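(* Let $n\ge 1$ be an integer, $0<\alpha,\beta<\min\{2,n\}$, let $k,l\ge 0$ be integers, and let $a,b,p,q\ge 0$ be real numbers with $p,q\ge 1$ and $pq>1$. Then there exists a positive constant $M=M(k,l,\alpha,\beta,a,b,p,q,n)$ such that every non-negative solution $(u,v)$ of the system $$(-\Delta)^{k+\frac{\alpha}{2}}u(x)=|x|^a v^p(x),\qquad (-\Delta)^{l+\frac{\beta}{2}}v(x)=|x|^b u^q(x),\qquad u(x)\ge 0,\ v(x)\ge 0,\qquad x\in\mathbb{R}^n,$$ (solution in the sense specified in the context) satisfies, for every $R>0$, $$\int_{R}^{+\infty}\frac{R^{\alpha}}{r(r^{2}-R^{2})^{\frac{\alpha}{2}}}\,\overline{u}(r)\,dr\leq M R^{-\frac{2k+\alpha+a+p(2l+\beta+b)}{pq-1}},\qquad \int_{R}^{+\infty}\frac{R^{\beta}}{r(r^{2}-R^{2})^{\frac{\beta}{2}}}\,\overline{v}(r)\,dr\leq M R^{-\frac{2l+\beta+b+q(2k+\alpha+a)}{pq-1}}.$$ Furthermore, if $k,l\ge 1$, then the following local estimates hold: $$\overline{u}(R)\leq M R^{-\frac{2k+\alpha+a+p(2l+\beta+b)}{pq-1}},\qquad \overline{v}(R)\leq M R^{-\frac{2l+\beta+b+q(2k+\alpha+a)}{pq-1}},\qquad \forall\, R>0.$$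
   Context: For $t\in\mathbb{R}$, $[t]$ is the integer part of $t$ and $\{t\}:=t-[t]$. For $0<\alpha<2$, $\mathcal{L}_\alpha(\mathbb{R}^n):=\{u:\mathbb{R}^n\to\mathbb{R} \mid \int_{\mathbb{R}^n}\frac{|u(x)|}{1+|x|^{n+\alpha}}\,dx<\infty\}$. For $u\in C^{[\alpha],\{\alpha\}+\epsilon}_{loc}(\mathbb{R}^n)\cap\mathcal{L}_\alpha(\mathbb{R}^n)$ with some (arbitrarily small) $\epsilon>0$, the fractional Laplacian is defined pointwise by $$(-\Delta)^{\frac{\alpha}{2}}u(x)=C_{n,\alpha}\lim_{\varepsilon\to 0}\int_{|y-x|\ge\varepsilon}\frac{u(x)-u(y)}{|x-y|^{n+\alpha}}\,dy,$$ where $C_{n,\alpha}>0$ is the usual normalization constant. For an integer $m\ge 0$ and $f\in C^{2m+[\alpha],\{\alpha\}+\epsilon}_{loc}(\mathbb{R}^n)\cap\mathcal{L}_\alpha(\mathbb{R}^n)$, $(-\Delta)^{m+\frac{\alpha}{2}}f:=(-\Delta)^m(-\Delta)^{\frac{\alpha}{2}}f$ (under this regularity $(-\Delta)^{\frac{\alpha}{2}}f\in C^{2m}(\mathbb{R}^n)$). A solution $(u,v)$ of the system is a pair of functions with $u\in C^{2k+[\alpha],\{\alpha\}+\epsilon}_{loc}(\mathbb{R}^n)\cap\mathcal{L}_\alpha(\mathbb{R}^n)$ and $v\in C^{2l+[\beta],\{\beta\}+\epsilon}_{loc}(\mathbb{R}^n)\cap\mathcal{L}_\beta(\mathbb{R}^n)$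 for some arbitrarily small $\epsilon>0$, satisfying the equations and sign conditions pointwise in all of $\mathbb{R}^n$. $\overline{f}(r):=\frac{1}{|\partial B_r(0)|}\int_{\partial B_r(0)}f\,d\sigma$ denotes the spherical average of $f$ over the sphere of radius $r$ centered at $0$. *)

(* Defs.v *)
From HB Require Import structures.
From mathcomp Require Import all_boot all_order all_algebra.
From mathcomp Require Import all_classical all_reals all_analysis.
From mathcomp Require Import measurable_realfun.

Set Implicit Arguments.
Unset Strict Implicit.
Unset Printing Implicit Defensive.

Import Order.TTheory GRing.Theory Num.Theory.
Import numFieldTopology.Exports numFieldNormedType.Exports.

Local Open Scope classical_set_scope.
Local Open Scope ring_scope.

(* The product sigma-algebra on T^n; for T = R it is the Borel one. *)
Section measurable_rV.
Context {d} {T : measurableType d} (n : nat).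

Let coord (i : 'I_n) (x : 'rV[T]_n) : T := x ord0 i.

Let rV_set0 : g_sigma_preimage coord set0.
Proof. exact: sigma_algebra0. Qed.

Let rV_setC A : g_sigma_preimage coord A -> g_sigma_preimage coord (~` A).
Proof. exact: sigma_algebraC. Qed.

Let rV_bigcup (F : (set 'rV[T]_n)^nat) :
  (forall i, g_sigma_preimage coord (F i)) ->
  g_sigma_preimage coord (\bigcup_i F i).
Proof. exact: sigma_algebra_bigcup. Qed.

HB.instance Definition _ := @isMeasurable.Build (measure_tuple_display d)
  'rV[T]_n (g_sigma_preimage coord) rV_set0 rV_setC rV_bigcup.

Lemma measurable_coord_rV (i : 'I_n) :
  measurable_fun [set: 'rV[T]_n] (fun x => x ord0 i).
Proof.
move=> _ Y mY; rewrite setTI; apply: sub_sigma_algebra => /=.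
rewrite -bigcup_seq/=; exists i => /=; first by rewrite mem_index_enum.
by exists Y => //; rewrite setTI.
Qed.

Lemma measurable_fun_rV {d1} {T1 : measurableType d1} (f : T1 -> 'rV[T]_n) :
  (forall i, measurable_fun setT (fun t => f t ord0 i)) ->
  measurable_fun setT f.
Proof.
move=> mf.
suff : g_sigma_preimage (fun i => coord i \o f) `<=` measurable.
  rewrite g_sigma_preimage_comp => + _ A mA; apply.
  by exists A.
apply: smallest_sub; first exact: sigma_algebra_measurable.
rewrite -bigcup_seq; apply: bigcup_sub => i _.
by move=> A [B mB <-]; exact: mf.
Qed.

End measurable_rV.

Section lebesgue_measure_rV.
Context {R : realType}.

Definition cons_rV n (p : R * 'rV[R]_n) : 'rV[R]_n.+1 :=
  row_mx (const_mx p.1 : 'rV_1) p.2.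

Lemma measurable_cons_rV n : measurable_fun setT (@cons_rV n).
Proof.
apply: measurable_fun_rV => i; rewrite /cons_rV.
under eq_fun do rewrite mxE.
case: fintype.split => j.
- by under eq_fun do rewrite mxE; exact: measurable_fst.
- apply: (@measurableT_comp _ _ _ _ _ _ (fun x : 'rV[R]_n => x ord0 j)) => //.
  exact: measurable_coord_rV.
Qed.

Lemma measurable_tail_rV n :
  measurable_fun setT (rsubmx : 'rV[R]_(1 + n) -> 'rV[R]_n).
Proof.
apply: measurable_fun_rV => i.
under eq_fun do rewrite mxE.
exact: (@measurable_coord_rV _ _ n.+1).
Qed.

Section cons_measure.
Context n (mu : {sigma_finite_measure set 'rV[R]_n -> \bar R}).

Definition cons_measure :=
  pushforward ((@lebesgue_measure R) \x mu)%E (@cons_rV n).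

Let mE (A : set 'rV[R]_n.+1) :
  measurable A -> measurable (@cons_rV n @^-1` A).
Proof.
by move=> mA; rewrite -[X in measurable X]setTI; exact: measurable_cons_rV.
Qed.

Let cons_measure0 : cons_measure set0 = 0%E.
Proof. by rewrite /cons_measure /pushforward preimage_set0 measure0. Qed.

Let cons_measure_ge0 A : (0 <= cons_measure A)%E.
Proof. by rewrite /cons_measure /pushforward; exact: measure_ge0. Qed.

Let cons_measure_sigma_additive : semi_sigma_additive cons_measure.
Proof.
move=> F mF tF mUF; rewrite /cons_measure /pushforward preimage_bigcup.
apply: measure_semi_sigma_additive.
- by move=> k; exact: mE.
- apply/trivIsetP => /= i j _ _ ij; rewrite -preimage_setI.
  by move/trivIsetP : tF => /(_ _ _ _ _ ij) ->//; rewrite preimage_set0.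
- by rewrite -preimage_bigcup; exact: mE.
Qed.

HB.instance Definition _ := isMeasure.Build _ _ _ cons_measure
  cons_measure0 cons_measure_ge0 cons_measure_sigma_additive.

Let cons_measure_sigma_finite : sigma_finite setT cons_measure.
Proof.
have /sigma_finiteP[F [UF ndF mF]] := @sigma_finiteT _ _ _ (@lebesgue_measure R).
have /sigma_finiteP[G [UG ndG mG]] := @sigma_finiteT _ _ _ mu.
pose hd (x : 'rV[R]_n.+1) : R := x ord0 ord0.
pose tl (x : 'rV[R]_(1 + n)) : 'rV[R]_n := rsubmx x.
exists (fun k => hd @^-1` F k `&` tl @^-1` G k).
  apply/esym; rewrite -subTset => x _.
  have : (\bigcup_i F i) (hd x) by rewrite -UF.
  have : (\bigcup_i G i) (tl x) by rewrite -UG.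
  move=> [i _ Gi] [j _ Fj]; exists (maxn i j) => //; split.
  - by have /subsetPset := ndF _ _ (leq_maxr i j); apply.
  - by have /subsetPset := ndG _ _ (leq_maxl i j); apply.
move=> k; split.
  apply: measurableI.
  - rewrite -[X in measurable X]setTI.
    by apply: measurable_coord_rV => //; exact: (mF k).1.
  - rewrite -[X in measurable X]setTI.
    by apply: measurable_tail_rV => //; exact: (mG k).1.
rewrite /cons_measure /pushforward.
rewrite (_ : _ @^-1` _ = F k `*` G k); last first.
  have hdE p : hd (@cons_rV n p) = p.1.
    rewrite /hd /cons_rV mxE; case: fintype.splitP => j; first by rewrite mxE.
    by case: j.
  have tlE p : tl (@cons_rV n p) = p.2 by rewrite /tl /cons_rV row_mxKr.
  rewrite (_ : F k `*` G k = [set p | F k p.1 /\ G k p.2])//.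
  by apply/funext => p; rewrite /preimage /setI /mkset hdE tlE.
have -> := product_measure1E _ mu (mF k).1 (mG k).1.
apply: lte_mul_pinfty => //; last exact: (mG k).2.
by rewrite ge0_fin_numE//; exact: (mF k).2.
Qed.

HB.instance Definition _ := Measure_isSigmaFinite.Build _ _ _ cons_measure
  cons_measure_sigma_finite.

End cons_measure.

(* Lebesgue measure on R^n (on Borel sets) as the n-fold product. *)
Fixpoint lebesgue_rV n : {sigma_finite_measure set 'rV[R]_n -> \bar R} :=
  match n with
  | 0 => dirac (0 : 'rV[R]_0)
  | m.+1 => cons_measure (lebesgue_rV m)
  end.

End lebesgue_measure_rV.
Arguments lebesgue_rV R n : clear implicits.

Section spherical_average.
Context {R : realType} {n : nat}.
Implicit Types (x : 'rV[R]_n) (r : R) (f : 'rV[R]_n -> R).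

(* The canonical norm on 'rV[R]_n is the sup norm. *)
Definition enorm x : R := Num.sqrt (\sum_(i < n) x ord0 i ^+ 2).

Lemma measurable_enorm : measurable_fun setT enorm.
Proof.
apply: measurableT_comp.
  by apply: continuous_measurable_fun; exact: sqrt_continuous.
apply: measurable_sum => i; apply: measurable_realfun.measurable_funX.
exact: measurable_coord_rV.
Qed.

Definition sphere r : set 'rV[R]_n := [set x | enorm x = r].

Definition punctured_ball r : set 'rV[R]_n := [set x | 0 < enorm x <= r].

Lemma measurable_punctured_ball r : measurable (punctured_ball r).
Proof.
rewrite (_ : punctured_ball r = enorm @^-1` `]0, r]%classic); last first.
  by apply/seteqP; split => x /=; rewrite in_itv.
by rewrite -[X in measurable X]setTI; exact: measurable_enorm.
Qed.

Definition radial_proj r x := (r / enorm x) *: x.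

Lemma measurable_radial_proj r : measurable_fun setT (radial_proj r).
Proof.
apply: measurable_fun_rV => i; rewrite /radial_proj.
under eq_fun do rewrite mxE.
apply: measurable_funM; last exact: measurable_coord_rV.
under eq_fun do rewrite -(powR_inv1 (sqrtr_ge0 _)).
apply: measurable_funM => //.
exact: (measurableT_comp (measurable_powR _) measurable_enorm).
Qed.

(* Surface measure on the sphere of radius r > 0, extended by zero to Borel
   subsets of R^n, given by the measure of cones:
   sigma_r(A) = (n / r) * lebesgue {x | 0 < |x| <= r, r x / |x| \in A}.
   For n = 1 this is the counting measure on {-r, r}. *)
Definition surface_measure r : set 'rV[R]_n -> \bar R := fun A =>
  ((n%:R / `|r|)%:E *
   lebesgue_rV R n (radial_proj r @^-1` A `&` punctured_ball r))%E.

Let surface_measure0 r : surface_measure r set0 = 0%E.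
Proof. by rewrite /surface_measure preimage_set0 set0I measure0 mule0. Qed.

Let surface_measure_ge0 r A : (0 <= surface_measure r A)%E.
Proof. by rewrite /surface_measure mule_ge0// lee_fin divr_ge0. Qed.

Let surface_measure_sigma_additive r : semi_sigma_additive (surface_measure r).
Proof.
pose c : {nonneg R} := NngNum (divr_ge0 (ler0n R n) (normr_ge0 r)).
pose m : {measure set 'rV[R]_n -> \bar R} :=
  mscale c (mrestr (lebesgue_rV R n) (measurable_punctured_ball r)).
have mE A : measurable A -> measurable (radial_proj r @^-1` A).
  by move=> mA; rewrite -[X in measurable X]setTI; exact: measurable_radial_proj.
move=> F mF tF mUF.
rewrite (_ : surface_measure r = m \o preimage (radial_proj r))//=.
rewrite preimage_bigcup.
apply: (@measure_semi_sigma_additive _ _ _ m).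
- by move=> k; exact: mE.
- apply/trivIsetP => /= i j _ _ ij; rewrite -preimage_setI.
  by move/trivIsetP : tF => /(_ _ _ _ _ ij) ->//; rewrite preimage_set0.
- by rewrite -preimage_bigcup; exact: mE.
Qed.

HB.instance Definition _ r := isMeasure.Build _ _ _ (surface_measure r)
  (surface_measure0 r) (@surface_measure_ge0 r)
  (@surface_measure_sigma_additive r).

Definition spherical_average f r : R :=
  (fine (surface_measure r (sphere r)))^-1 *
  \int[surface_measure r]_(x in sphere r) f x.

End spherical_average.

Section function_spaces.
Context {R : realType} {n : nat}.
Implicit Types (f : 'rV[R]_n -> R) (m : nat).

Definition partial (i : 'I_n) f : 'rV[R]_n -> R :=
  fun x => 'D_(delta_mx ord0 i) f x.

Definition partials (s : seq 'I_n) f : 'rV[R]_n -> R := foldr partial f s.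

Definition Cm m f : Prop :=
  (forall (s : seq 'I_n) (i : 'I_n) x, (size s < m)%N ->
     derivable (partials s f) x (delta_mx ord0 i)) /\
  (forall s : seq 'I_n, (size s <= m)%N -> continuous (partials s f)).

Definition locally_hoelder (theta : R) f : Prop :=
  forall K : set 'rV[R]_n, compact K ->
    exists C : R, forall x y, K x -> K y ->
      `|f x - f y| <= C * enorm (x - y) `^ theta.

Definition Cm_hoelder_loc m (theta : R) f : Prop :=
  Cm m f /\
  forall s : seq 'I_n, size s = m -> locally_hoelder theta (partials s f).

(* [t] for t >= 0, the only case needed. *)
Definition int_part (t : R) : nat := Num.truncn t.

Definition frac_part (t : R) : R := t - (int_part t)%:R.

(* f lies in the space C_loc^(2m+[alpha], {alpha}+eps) for some eps > 0. These
   spaces increase as eps decreases, and {alpha} + eps < 1 makes the second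
   index a genuine Hoelder exponent. *)
Definition regular m (alpha : R) f : Prop :=
  exists eps : R, [/\ 0 < eps, frac_part alpha + eps < 1 &
    Cm_hoelder_loc (m.*2 + int_part alpha) (frac_part alpha + eps) f].

(* The space L_alpha(R^n). *)
Definition weighted_L (alpha : R) f : Prop :=
  measurable_fun setT f /\
  (\int[lebesgue_rV R n]_x
     (`|f x| / (1 + enorm x `^ (n%:R + alpha)))%:E < +oo)%E.

End function_spaces.

Section fractional_laplacian.
Context {R : realType} {n : nat}.
Implicit Types (u f : 'rV[R]_n -> R) (alpha : R) (m : nat).

Definition laplacian f : 'rV[R]_n -> R :=
  fun x => \sum_(i < n) partial i (partial i f) x.

(* The first coordinate of x (n > 0). *)
Definition first_coord (x : 'rV[R]_n) : R :=
  if insub 0%N is Some i then x ord0 i else 0.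

(* C_(n,alpha), normalised so that (-Delta)^(alpha/2) has Fourier symbol
   |xi|^alpha. *)
Definition frac_laplacian_const alpha : R :=
  (\int[lebesgue_rV R n]_z
     ((1 - cos (first_coord z)) / enorm z `^ (n%:R + alpha)))^-1.

Definition frac_laplacian alpha u : 'rV[R]_n -> R := fun x =>
  frac_laplacian_const alpha *
  lim ((\int[lebesgue_rV R n]_(y in [set y | eps <= enorm (y - x)%R])
          ((u x - u y) / enorm (x - y) `^ (n%:R + alpha)))
       @[eps --> 0^'+]).

(* (-Delta)^(m + alpha/2) *)
Definition poly_frac_laplacian m alpha f : 'rV[R]_n -> R :=
  iter m (fun g x => - laplacian g x) (frac_laplacian alpha f).

Definition nonneg_solution (k l : nat) (alpha beta a b p q : R) u v : Prop :=
  [/\ regular k alpha u /\ weighted_L alpha u,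
      regular l beta v /\ weighted_L beta v,
      forall x, 0 <= u x /\ 0 <= v x,
      forall x, poly_frac_laplacian k alpha u x = enorm x `^ a * v x `^ p &
      forall x, poly_frac_laplacian l beta v x = enorm x `^ b * u x `^ q].

End fractional_laplacian.

(* Main.v *)
(** The operator (-Delta)^(alpha/2) only enters through pairs (u, w) in which w
    is the locally uniform limit of the truncated operators L_eps u; testing w
    against a bounded compactly supported function T is then a matter of
    Tonelli's theorem and of pointwise bounds on L_eps T.

    All the functions w_i = (-Delta)^i (-Delta)^(alpha/2) u, i <= k, are
    nonnegative: otherwise the means of some w_i, hence by descent those of w_0,
    against the weights (1 - |x - x0|^2 / r^2)_+^N stay away from 0 as r grows,
    whereas duality shows that those of w_0 tend to 0.

    Let X_u(R) be the mean of u at scale R against a bump phi on the annulus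
    R < |x| < 2 R. As L_eps phi <= C phi - c (1 + |x|)^(-n - alpha), X_u controls
    the integral of u against the weight (1 + |x|)^(-n - alpha) and, integrating
    the derivatives of the means of the w_i, also
    R^(2 k + alpha) times the mean of |x|^a v^p. By Jensen's inequality
    R^(2 k + alpha + a) X_v^p <= C X_u; together with the symmetric inequality
    and p q > 1 this bounds X_u and X_v by the claimed powers of R.

    The first estimate tests w_0 >= 0 against T = (1 - |x|^2)_+^(alpha/2). Inside
    the ball L_eps T <= C: along each chord T is a product of two powers x_+^s,
    s = alpha/2, for which the half-line inequality is an explicit integral.
    Outside, - L_eps T >= c |x|^(-n) (|x|^2 - 1)^(-alpha/2).

    If k >= 1 then w_0 is superharmonic, so its spherical means decrease and are
    controlled at scale R. The spherical mean U of u and that of w_0 form again a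
    pair, and a bound for U(x1), |x1| = 3/2, follows by looking at a maximum
    point of (1 - |y|^2)^n U(x1 + y/2) on the unit ball. *)

From HB Require Import structures.
Require Import Defs.
From mathcomp Require Import all_boot all_order all_algebra.
From mathcomp Require Import all_classical all_reals all_analysis.
From mathcomp Require Import measurable_realfun.
From mathcomp Require Import ring lra.

Set Implicit Arguments.
Unset Strict Implicit.
Unset Printing Implicit Defensive.

Import Order.TTheory GRing.Theory Num.Theory.
Import numFieldTopology.Exports numFieldNormedType.Exports.

Local Open Scope classical_set_scope.
Local Open Scope ring_scope.

(** * Integration on R^n *)

(** Non-negativity shapes the proof: u, v, the kernels and the test functions are non-negative, so
    every duality step is an instance of Tonelli's theorem. The two halves of the truncated
    operator, a mass times u and a convolution, are therefore integrated separately, and only finite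
    quantities are cancelled.

    Means are taken against (1 - |x|^2)_+^N rather than over spheres because the radial derivative
    of such a mean is a multiple of the mean of the Laplacian with N + 1 in place of N, without
    boundary terms. Monotonicity of true spherical means is recovered at the end from weights that
    concentrate on thin shells.

    The bump phi is a square g^2: for the operator L, L(g^2) is 2 g L g minus the integral of the
    kernel against (g(x) - g(y))^2, and this last term supplies the gain - c (1 + |x|)^(-n - alpha)
    even where phi vanishes.

    Estimates are proved at unit scale and transported by u(c x), whose operator is c^alpha w(c
    x). *)

Section lebesgue_substitution.
Context {R : realType}.
Local Notation leb := (@lebesgue_measure R).

Lemma lebesgue_ge0_shift (a : R) (f : R -> \bar R) :
  measurable_fun setT f -> (forall x, (0 <= f x)%E) ->
  (\int[leb]_x f (x + a)%R = \int[leb]_x f x)%E.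
Proof.
move=> mf f0.
pose T : measurableTypeR R -> measurableTypeR R := fun x : R => x + a.
have mT : measurable_fun setT T by exact: measurable_funD.
have E (A : set (measurableTypeR R)) : measurable A -> pushforward leb T A = leb A.
  move=> mA; apply/esym/lebesgue_measure_unique => //= _ [[b c]] _ <-.
  rewrite /pushforward (_ : T @^-1` _ = `]b - a, c - a]%classic); last first.
    by apply/seteqP; split => x /=; rewrite /T !in_itv/= ltrBlDr lerBrDr.
  rewrite !lebesgue_measure_itv/= !lte_fin ltrD2r; case: ifPn => // _.
  by congr EFin; ring.
rewrite [LHS](_ : _ = \int[leb]_(x in T @^-1` setT) (f \o T) x)%E; last first.
  by rewrite preimage_setT.
rewrite -(ge0_integral_pushforward mT) //.
by apply: eq_measure_integral => A mA _; exact: E.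
Qed.

Lemma lebesgue_ge0_scale (c : R) (f : R -> \bar R) : 0 < c ->
  measurable_fun setT f -> (forall x, (0 <= f x)%E) ->
  (\int[leb]_x f (c * x)%R = (c^-1)%:E * \int[leb]_x f x)%E.
Proof.
move=> c0 mf f0.
pose T : measurableTypeR R -> measurableTypeR R := fun x : R => c * x.
have mT : measurable_fun setT T by exact: measurable_funM.
pose cn : {nonneg R} := NngNum (ltW c0).
have E (A : set (measurableTypeR R)) : measurable A ->
    leb A = mscale cn (pushforward leb T) A.
  move=> mA; apply: (@lebesgue_measure_unique R (mscale cn (pushforward leb T))) => //= _ [[b d]] _ <-.
  rewrite /mscale/= /pushforward (_ : T @^-1` _ = `]b / c, d / c]%classic); last first.
    by apply/seteqP; split => x /=; rewrite /T !in_itv/= ltr_pdivrMr// ler_pdivlMr// ![x * c]mulrC.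
  rewrite !lebesgue_measure_itv/= !lte_fin ltr_pM2r ?invr_gt0//; case: ifPn => [bd|_]; last by rewrite mule0.
  by rewrite -EFinM; congr EFin; field; rewrite gt_eqF.
rewrite [LHS](_ : _ = \int[leb]_(x in T @^-1` setT) (f \o T) x)%E; last first.
  by rewrite preimage_setT.
rewrite -(ge0_integral_pushforward mT) //.
rewrite [in RHS](eq_measure_integral (mscale cn (pushforward leb T))); last by move=> A mA _; exact: E.
rewrite ge0_integral_mscale//= muleA -EFinM mulVf ?mul1e ?gt_eqF//.
Qed.
End lebesgue_substitution.

(** * The product measure on R^n: translations, dilations, cubes *)

Section rV_measure.
Context {R : realType}.
Local Notation leb := (@lebesgue_measure R).
Local Notation mu n := (lebesgue_rV R n).

Lemma integral_cons_rV n (f : 'rV[R]_n.+1 -> \bar R) :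
  measurable_fun setT f -> (forall x, (0 <= f x)%E) ->
  (\int[mu n.+1]_x f x = \int[leb]_x \int[mu n]_y f (cons_rV (x, y)))%E.
Proof.
move=> mf f0.
have mfc : measurable_fun setT (f \o @cons_rV R n).
  exact: (measurableT_comp mf (@measurable_cons_rV R n)).
transitivity (\int[leb \x mu n]_z (f \o @cons_rV R n) z)%E; last first.
  by apply: fubini_tonelli1; [exact: mfc|move=> z; exact: f0].
have H : (\int[pushforward (leb \x mu n) (@cons_rV R n)]_(y in setT) f y =
    \int[leb \x mu n]_(x in @cons_rV R n @^-1` setT) (f \o @cons_rV R n) x)%E.
  by apply: ge0_integral_pushforward => //; exact: measurable_cons_rV.
by move: H; rewrite preimage_setT => <-.
Qed.

Lemma cons_rV0 n (p : R * 'rV[R]_n) : cons_rV p ord0 ord0 = p.1.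
Proof.
rewrite /cons_rV mxE; case: fintype.splitP => j; first by rewrite mxE.
by case: j.
Qed.

Lemma cons_rV_lift n (p : R * 'rV[R]_n) (j : 'I_n) :
  cons_rV p ord0 (lift ord0 j) = p.2 ord0 j.
Proof.
rewrite /cons_rV mxE; case: fintype.splitP => i; first by case: i => -[].
by rewrite /= => /eqP; rewrite eqSS => /eqP ij; congr (p.2 _ _); apply/val_inj.
Qed.

Lemma measurable_fun_cons_section n (f : 'rV[R]_n.+1 -> \bar R) (x : R) :
  measurable_fun setT f -> measurable_fun setT (fun y => f (cons_rV (x, y))).
Proof.
move=> mf; apply: (measurableT_comp mf).
exact: (measurableT_comp (@measurable_cons_rV R n) (pair1_measurable x)).
Qed.

Lemma measurable_addr_rV n (a : 'rV[R]_n) : measurable_fun setT (fun x : 'rV[R]_n => x + a).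
Proof.
apply: measurable_fun_rV => i; under eq_fun do rewrite mxE.
by apply: measurable_funD => //; exact: measurable_coord_rV.
Qed.

Lemma measurable_scale_rV n (c : R) : measurable_fun setT (fun x : 'rV[R]_n => c *: x).
Proof.
apply: measurable_fun_rV => i; under eq_fun do rewrite mxE.
by apply: measurable_funM => //; exact: measurable_coord_rV.
Qed.

Lemma ge0_integral_shift n (a : 'rV[R]_n) (f : 'rV[R]_n -> \bar R) :
  measurable_fun setT f -> (forall x, (0 <= f x)%E) ->
  (\int[mu n]_x f (x + a)%R = \int[mu n]_x f x)%E.
Proof.
elim: n a f => [a f mf f0|n IH a f mf f0].
  by apply: eq_integral => x _; congr f; apply/rowP => -[].
have mfa : measurable_fun setT (fun x : 'rV[R]_n.+1 => f (x + a)).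
  exact: (measurableT_comp mf (measurable_addr_rV a)).
rewrite (integral_cons_rV mfa) ?(integral_cons_rV mf f0); last by move=> x; exact: f0.
pose a' := \row_(j < n) a ord0 (lift ord0 j).
pose g x := (\int[mu n]_y f (cons_rV (x, y)))%E.
rewrite -(lebesgue_ge0_shift (a ord0 ord0) (f := g)); last 2 first.
- apply: (@measurable_fun_fubini_tonelli_F _ _ _ _ _ (mu n) (f \o @cons_rV R n)).
    exact: (measurableT_comp mf (@measurable_cons_rV R n)).
  by move=> p; exact: f0.
- by move=> x; rewrite /g; apply: integral_ge0 => y _; exact: f0.
apply: eq_integral => x _; rewrite /g.
rewrite -(IH a' (fun y => f (cons_rV (x + a ord0 ord0, y)))) //.
- apply: eq_integral => y _; congr f; apply/rowP => i; rewrite mxE.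
  have [j ->|->] := unliftP ord0 i; first by rewrite !cons_rV_lift !mxE.
  by rewrite !cons_rV0.
- exact: measurable_fun_cons_section.
Qed.

Lemma ge0_integral_scale n (c : R) (f : 'rV[R]_n -> \bar R) : 0 < c ->
  measurable_fun setT f -> (forall x, (0 <= f x)%E) ->
  (\int[mu n]_x f (c *: x)%R = (c ^- n)%:E * \int[mu n]_x f x)%E.
Proof.
move=> c0; elim: n f => [f mf f0|n IH f mf f0].
  rewrite expr0 invr1 mul1e.
  by apply: eq_integral => x _; congr f; apply/rowP => -[].
have mfa : measurable_fun setT (fun x : 'rV[R]_n.+1 => f (c *: x)).
  exact: (measurableT_comp mf (@measurable_scale_rV _ c)).
rewrite (integral_cons_rV mfa) ?(integral_cons_rV mf f0); last by move=> x; exact: f0.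
pose g x := (\int[mu n]_y f (cons_rV (x, y)))%E.
have mg : measurable_fun setT g.
  apply: (@measurable_fun_fubini_tonelli_F _ _ _ _ _ (mu n) (f \o @cons_rV R n)).
    exact: (measurableT_comp mf (@measurable_cons_rV R n)).
  by move=> p; exact: f0.
have g0 x : (0 <= g x)%E by rewrite /g; apply: integral_ge0 => y _; exact: f0.
have H := lebesgue_ge0_scale c0 mg g0.
rewrite exprS invfM mulrC EFinM -muleA -H -ge0_integralZl//; last 2 first.
- exact: (measurableT_comp mg (measurable_funM (@measurable_cst _ _ _ _ _ c) (@measurable_id _ _ _))).
- by rewrite lee_fin invr_ge0 exprn_ge0// ltW.
apply: eq_integral => x _; rewrite /g.
rewrite -(IH (fun y => f (cons_rV (c * x, y)))) //.
- apply: eq_integral => y _; congr f; apply/rowP => i; rewrite mxE.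
  have [j ->|->] := unliftP ord0 i; first by rewrite !cons_rV_lift !mxE.
  by rewrite !cons_rV0.
- exact: measurable_fun_cons_section.
Qed.

Definition cube n (r : R) : set 'rV[R]_n := [set x | forall i, `|x ord0 i| <= r].

Lemma measurable_cube n r : measurable (@cube n r).
Proof.
pose F (i : 'I_n) := (fun x : 'rV[R]_n => x ord0 i) @^-1` `[-r, r]%classic.
rewrite (_ : cube r = \bigcap_(i in [set: 'I_n]) F i); last first.
  apply/seteqP; split => x /= H i; first by rewrite /F /= in_itv/= -ler_norml => _; exact: H.
  by have := H i I; rewrite /F /= in_itv/= -ler_norml.
apply: fin_bigcap_measurable => // i _.
by rewrite -[X in measurable X]setTI; exact: measurable_coord_rV.
Qed.

Lemma lebesgue_cube n (r : R) : 0 <= r -> mu n (cube r) = ((2 * r) ^+ n)%:E.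
Proof.
move=> r0; elim: n => [|n IH].
  by rewrite /= diracE mem_set// => -[].
rewrite [LHS]/= /cons_measure /pushforward.
rewrite (_ : _ @^-1` _ = `[-r, r]%classic `*` cube r); last first.
  apply/seteqP; split => -[x y] /=.
    move=> H; split; first by have := H ord0; rewrite cons_rV0 in_itv/= -ler_norml.
    by move=> i; have := H (lift ord0 i); rewrite cons_rV_lift.
  rewrite in_itv/= -ler_norml => -[H1 H2] i.
  by have [j ->|->] := unliftP ord0 i; rewrite ?cons_rV_lift ?cons_rV0.
transitivity (leb `[(- r)%R, r]%classic * mu n (cube r))%E.
  by apply: product_measure1E => //; exact: measurable_cube.
rewrite IH lebesgue_measure_itv/= lte_fin exprS.
case: ifPn => [_|]; first by rewrite -EFinM; congr EFin; congr (_ * _); lra.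
rewrite -leNgt => H; have r00 : r = 0 by lra.
by rewrite mul0e r00 mulr0 mul0r.
Qed.

End rV_measure.

(** * The Euclidean norm and hyperplane reflections *)

Section enorm_theory.
Context {R : realType} {n : nat}.
Implicit Types (x y z : 'rV[R]_n) (c : R).

Definition edot x y : R := \sum_(i < n) x ord0 i * y ord0 i.

Lemma enorm_ge0 x : 0 <= enorm x.
Proof. exact: sqrtr_ge0. Qed.

Lemma enorm_sqr x : enorm x ^+ 2 = \sum_(i < n) x ord0 i ^+ 2.
Proof. by rewrite /enorm sqr_sqrtr// sumr_ge0// => i _; rewrite sqr_ge0. Qed.

Lemma enorm_sqr_edot x : enorm x ^+ 2 = edot x x.
Proof. by rewrite enorm_sqr; apply: eq_bigr => i _; rewrite expr2. Qed.

Lemma edotC x y : edot x y = edot y x.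
Proof. by apply: eq_bigr => i _; rewrite mulrC. Qed.

Lemma edotDl x y z : edot (x + y) z = edot x z + edot y z.
Proof. by rewrite /edot -big_split/=; apply: eq_bigr => i _; rewrite mxE mulrDl. Qed.

Lemma edotZl c x y : edot (c *: x) y = c * edot x y.
Proof. by rewrite /edot mulr_sumr; apply: eq_bigr => i _; rewrite mxE mulrA. Qed.

Lemma edotNl x y : edot (- x) y = - edot x y.
Proof. by rewrite -scaleN1r edotZl mulN1r. Qed.

Lemma edotDr x y z : edot z (x + y) = edot z x + edot z y.
Proof. by rewrite edotC edotDl !(edotC z). Qed.

Lemma edotZr c x y : edot x (c *: y) = c * edot x y.
Proof. by rewrite edotC edotZl edotC. Qed.

Lemma edotNr x y : edot x (- y) = - edot x y.
Proof. by rewrite edotC edotNl edotC. Qed.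

Lemma enorm_sqrD x y : enorm (x + y) ^+ 2 = enorm x ^+ 2 + 2 * edot x y + enorm y ^+ 2.
Proof. by rewrite !enorm_sqr_edot !(edotDl, edotDr) (edotC y x); ring. Qed.

Lemma enorm0 : enorm (0 : 'rV[R]_n) = 0.
Proof. by rewrite /enorm big1 ?sqrtr0// => i _; rewrite mxE expr0n. Qed.

Lemma enorm_eq0 x : (enorm x == 0) = (x == 0).
Proof.
apply/idP/eqP => [/eqP x0|->]; last by rewrite enorm0.
have /eqP : enorm x ^+ 2 = 0 by rewrite x0 expr0n.
rewrite enorm_sqr psumr_eq0 => [/allP H|i _]; last exact: sqr_ge0.
by apply/rowP => i; rewrite mxE; apply/eqP; rewrite -sqrf_eq0; apply: H; rewrite mem_index_enum.
Qed.

Lemma enorm_gt0 x : (0 < enorm x) = (x != 0).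
Proof. by rewrite lt0r enorm_eq0 enorm_ge0 andbT. Qed.

Lemma enormZ c x : enorm (c *: x) = `|c| * enorm x.
Proof.
apply/eqP; rewrite -(@eqrXn2 _ 2)// ?mulr_ge0 ?enorm_ge0//.
by rewrite exprMn !enorm_sqr_edot edotZl edotZr real_normK ?num_real// mulrA expr2.
Qed.

Lemma enormN x : enorm (- x) = enorm x.
Proof. by rewrite -scaleN1r enormZ normrN1 mul1r. Qed.

Lemma enorm_distC x y : enorm (x - y) = enorm (y - x).
Proof. by rewrite -opprB enormN. Qed.

Lemma edot_le x y : edot x y <= enorm x * enorm y.
Proof.
have [->|x0] := eqVneq x 0; first by rewrite enorm0 mul0r -(scale0r 0) edotZl mul0r.
have [->|y0] := eqVneq y 0; first by rewrite enorm0 mulr0 -(scale0r 0) edotZr mul0r.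
have := sqr_ge0 (enorm (enorm y *: x + (- enorm x) *: y)).
rewrite enorm_sqrD !enormZ edotZl edotZr normrN !ger0_norm ?enorm_ge0//.
rewrite (_ : _ + _ = 2 * (enorm x * enorm y) * (enorm x * enorm y - edot x y)); last by ring.
by rewrite pmulr_rge0 ?subr_ge0// !mulr_gt0 ?enorm_gt0.
Qed.

Lemma edot_abs_le x y : `|edot x y| <= enorm x * enorm y.
Proof.
by rewrite ler_norml edot_le lerNl -edotNr (le_trans (edot_le _ _))// enormN.
Qed.

Lemma enormD x y : enorm (x + y) <= enorm x + enorm y.
Proof.
rewrite -(@ler_pXn2r _ 2)// ?nnegrE ?addr_ge0 ?enorm_ge0//.
by rewrite enorm_sqrD sqrrD; have := edot_le x y; lra.
Qed.

Lemma enormB x y : enorm (x - y) <= enorm x + enorm y.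
Proof. by rewrite -(enormN y) enormD. Qed.

Lemma enorm_leB x y : enorm x - enorm y <= enorm (x - y).
Proof. by rewrite lerBlDr -{1}(subrK y x) enormD. Qed.

Lemma enorm_leD x y : enorm x - enorm y <= enorm (x + y).
Proof. by rewrite -(enormN y) -{2}(opprK y) enorm_leB. Qed.

Lemma enorm_dist_le x y : `|enorm x - enorm y| <= enorm (x - y).
Proof. by rewrite ler_norml enorm_leB lerNl opprB enorm_distC enorm_leB. Qed.

Lemma coord_le_enorm x i : `|x ord0 i| <= enorm x.
Proof.
rewrite -(@ler_pXn2r _ 2)// ?nnegrE ?enorm_ge0// real_normK ?num_real//.
by rewrite enorm_sqr (bigD1 i)//= lerDl sumr_ge0// => j _; rewrite sqr_ge0.
Qed.

Lemma enorm_le_norm x : enorm x <= n%:R * `|x|.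
Proof.
rewrite -(@ler_pXn2r _ 2)// ?nnegrE ?enorm_ge0 ?mulr_ge0//.
have H i : x ord0 i ^+ 2 <= `|x| ^+ 2.
  rewrite -[leLHS]real_normK ?num_real// ler_pXn2r// ?nnegrE//.
  have /mapP[j Hj ->] : `|x ord0 i| \in [seq `|x x0.1 x0.2| | x0 : 'I_1 * 'I_n].
    by apply/mapP; exists (ord0, i) => //=; rewrite mem_enum.
  by rewrite [leRHS]/Num.norm /= mx_normrE; apply/bigmax_geP; right => /=; exists j.
rewrite enorm_sqr (le_trans (ler_sum _ (fun i _ => H i)))//.
rewrite sumr_const card_ord exprMn -[leLHS]mulr_natl; apply: ler_wpM2r; first exact: sqr_ge0.
by rewrite -natrX ler_nat; case: n => // m; rewrite leq_pmulr.
Qed.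

Lemma norm_le_enorm x : `|x| <= enorm x.
Proof.
rewrite [leLHS]/Num.norm /= mx_normrE; apply/bigmax_leP; split; first exact: enorm_ge0.
by move=> [i j] _ /=; rewrite ord1 coord_le_enorm.
Qed.

Lemma continuous_enorm : continuous (@enorm R n).
Proof.
move=> x; have FF : Filter (nbhs x) := nbhs_filter x.
apply/(@cvgrPdist_le _ _ _ _ FF) => /= e e0.
have d0 : 0 < e / (n%:R + 1) by rewrite divr_gt0// ltr_wpDl.
apply/nbhs_ballP; exists (e / (n%:R + 1)) => //= y; rewrite -ball_normE /= => /ltW.
rewrite ler_pdivlMr ?ltr_wpDl// => H.
rewrite (le_trans (enorm_dist_le _ _))// (le_trans (enorm_le_norm _))// (le_trans _ H)//.
by rewrite mulrC ler_wpM2l// lerDl.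
Qed.

(** Reflections stand in for the whole rotation group: rotational invariance is only ever used to
    exchange two points of equal norm, which the reflection along their difference does. For e = 0
    the quotient is 0 and the map is the identity. *)
Definition reflect_rV (e x : 'rV[R]_n) := x - (2 * edot x e / enorm e ^+ 2) *: e.

Lemma reflect_rVD e x y : reflect_rV e (x + y) = reflect_rV e x + reflect_rV e y.
Proof. by rewrite /reflect_rV edotDl mulrDr mulrDl scalerDl opprD addrACA. Qed.

Lemma reflect_rVK e x : reflect_rV e (reflect_rV e x) = x.
Proof.
rewrite /reflect_rV; have [->|e0] := eqVneq e 0; first by rewrite !scaler0 !subr0.
rewrite -addrA -opprD -scalerDl edotDl edotNl edotZl -enorm_sqr_edot.
rewrite [X in X *: _](_ : _ = 0) ?scale0r ?subr0//.
by field; rewrite enorm_eq0.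
Qed.

Lemma enorm_reflect_rV e x : enorm (reflect_rV e x) = enorm x.
Proof.
rewrite /reflect_rV; have [->|e0] := eqVneq e 0; first by rewrite !scaler0 !subr0.
apply/eqP; rewrite -(@eqrXn2 _ 2)// ?enorm_ge0//; apply/eqP.
rewrite enorm_sqrD enormN enormZ exprMn real_normK ?num_real// edotNr edotZr.
by field; rewrite enorm_eq0.
Qed.

(** When |x| = |y|, |x - y|^2 = 2 x.(x - y), so the coefficient of e = x - y in the reflection of x
    is 1. *)
Lemma reflect_rV_swap x y : enorm x = enorm y -> reflect_rV (x - y) x = y.
Proof.
move=> xy; have [->|e0] := eqVneq x y; first by rewrite /reflect_rV subrr scaler0 subr0.
rewrite /reflect_rV [X in X *: _](_ : _ = 1) ?scale1r ?subKr//.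
have E : enorm (x - y) ^+ 2 = 2 * edot x (x - y).
  rewrite enorm_sqrD enormN -xy edotNr edotDr edotNr -enorm_sqr_edot; ring.
by rewrite E divff// -E sqrf_eq0 enorm_eq0 subr_eq0.
Qed.

End enorm_theory.

(** * Measurability, and Tonelli's theorem for real-valued integrands *)

Section measurability_rV.
Context {d} {T : measurableType d} {R : realType} {n : nat}.

Lemma measurable_funD_rV (f g : T -> 'rV[R]_n) :
  measurable_fun setT f -> measurable_fun setT g ->
  measurable_fun setT (fun x => f x + g x).
Proof.
move=> mf mg; apply: measurable_fun_rV => i; under eq_fun do rewrite mxE.
by apply: measurable_funD; apply: (measurableT_comp (@measurable_coord_rV _ _ n i)).
Qed.

Lemma measurable_funZ_rV (f : T -> R) (g : T -> 'rV[R]_n) :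
  measurable_fun setT f -> measurable_fun setT g ->
  measurable_fun setT (fun x => f x *: g x).
Proof.
move=> mf mg; apply: measurable_fun_rV => i; under eq_fun do rewrite mxE.
by apply: measurable_funM => //; apply: (measurableT_comp (@measurable_coord_rV _ _ n i)).
Qed.

Lemma measurable_funN_rV (f : T -> 'rV[R]_n) :
  measurable_fun setT f -> measurable_fun setT (fun x => - f x).
Proof.
move=> mf; under eq_fun do rewrite -scaleN1r.
by apply: measurable_funZ_rV.
Qed.

Lemma measurable_fun_enorm (f : T -> 'rV[R]_n) :
  measurable_fun setT f -> measurable_fun setT (fun x => enorm (f x)).
Proof. by move=> mf; apply: (measurableT_comp (@measurable_enorm R n)). Qed.

Lemma measurable_fun_edot (f g : T -> 'rV[R]_n) :
  measurable_fun setT f -> measurable_fun setT g ->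
  measurable_fun setT (fun x => edot (f x) (g x)).
Proof.
move=> mf mg; apply: measurable_sum => i.
by apply: measurable_funM; apply: (measurableT_comp (@measurable_coord_rV _ _ n i)).
Qed.

Lemma measurable_fun_b2r (b : T -> bool) :
  measurable_fun setT b -> measurable_fun setT (fun x => (b x)%:R : R).
Proof.
move=> mb; have -> : (fun x => (b x)%:R : R) = (fun x => if b x then 1 else 0).
  by apply/funext => x; case: (b x).
by apply: measurable_fun_ifT.
Qed.

Lemma measurable_fun_powR_comp (f : T -> R) (c : R) :
  measurable_fun setT f -> measurable_fun setT (fun x => f x `^ c).
Proof. by move=> mf; apply: (measurableT_comp (measurable_powR _)). Qed.

Lemma measurable_fun_inv_comp (f : T -> R) :
  measurable_fun setT f -> measurable_fun setT (fun x => (f x)^-1).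
Proof.
move=> mf; have mi : measurable_fun setT (fun x : R => x^-1).
  rewrite (_ : setT = [set 0] `|` ~` [set 0]); last by rewrite setUv.
  apply/measurable_funU => //; first exact: measurableC.
  split; first exact: measurable_fun_set1.
  apply: open_continuous_measurable_fun.
    by apply: closed_openC; apply: accessible_closed_set1; apply: hausdorff_accessible; exact: norm_hausdorff.
  by move=> x; rewrite inE/= => /eqP x0; exact: inv_continuous.
exact: (measurableT_comp mi).
Qed.

End measurability_rV.

Ltac meas :=
  repeat first
    [ assumption
    | exact: measurable_cst | exact: measurable_id
    | exact: measurable_fst | exact: measurable_snd
    | exact: measurable_coord_rV
    | apply: measurable_fun_b2r
    | apply: measurable_and
    | apply: measurable_fun_ler | apply: measurable_fun_ltr
    | apply: measurable_fun_enorm | apply: measurable_fun_edot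
    | apply: measurable_fun_inv_comp
    | apply: measurable_fun_powR_comp
    | apply: measurable_funZ_rV | apply: measurable_funD_rV | apply: measurable_funN_rV
    | apply: measurable_funX
    | apply: measurable_funD | apply: measurable_funB | apply: measurable_funM
    | apply: measurable_funN ].

Section tonelli.
Context {R : realType} {d1 d2} {T1 : measurableType d1} {T2 : measurableType d2}.
Variables (m1 : {sigma_finite_measure set T1 -> \bar R})
          (m2 : {sigma_finite_measure set T2 -> \bar R}).
Variable f : T1 -> T2 -> R.
Hypothesis mf : measurable_fun setT (fun p : T1 * T2 => f p.1 p.2).
Hypothesis f0 : forall x y, 0 <= f x y.

Let mfE : measurable_fun setT (fun p : T1 * T2 => (f p.1 p.2)%:E).
Proof. exact/measurable_EFinP. Qed.

Let f0E (p : T1 * T2) : (0 <= (f p.1 p.2)%:E)%E.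
Proof. by rewrite lee_fin. Qed.

Lemma integral_swap :
  (\int[m1]_x \int[m2]_y (f x y)%:E = \int[m2]_y \int[m1]_x (f x y)%:E)%E.
Proof. exact: (@fubini_tonelli _ _ _ _ _ m1 m2 _ mfE f0E). Qed.

Lemma measurable_integral1 :
  measurable_fun setT (fun x => (\int[m2]_y (f x y)%:E)%E).
Proof. exact: (@measurable_fun_fubini_tonelli_F _ _ _ _ _ m2 _ mfE f0E). Qed.

Lemma measurable_section1 x : measurable_fun setT (f x).
Proof. exact: (measurableT_comp mf (pair1_measurable x)). Qed.

Lemma measurable_section2 y : measurable_fun setT (f ^~ y).
Proof. exact: (measurableT_comp mf (pair2_measurable y)). Qed.

End tonelli.

Section ge0_integral_extra.
Context {R : realType} {d} {T : measurableType d}.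
Variable (m : {measure set T -> \bar R}).

(** Restrictions of the domain are written as factors [(P x)%:R], so that all integrals run over the
    whole space and translation invariance and Tonelli apply without side conditions on domains. *)
Lemma ge0_integral_cond (P : T -> bool) (f : T -> R) :
  (\int[m]_(x in [set x | P x]) (f x)%:E = \int[m]_x ((P x)%:R * f x)%:E)%E.
Proof.
rewrite integral_mkcond; apply: eq_integral => x _; rewrite patchE.
case: ifPn => [|]; first by rewrite inE/= => ->; rewrite mul1r.
by rewrite notin_setE/= => /negP/negbTE ->; rewrite mul0r.
Qed.

Lemma ge0_le_integral_fin (f g : T -> R) :
  measurable_fun setT f -> measurable_fun setT g ->
  (forall x, 0 <= f x) -> (forall x, f x <= g x) ->
  (\int[m]_x (f x)%:E <= \int[m]_x (g x)%:E)%E.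
Proof.
move=> mf mg f0 fg; apply: ge0_le_integral => //.
- by move=> x _; rewrite lee_fin.
- exact/measurable_EFinP.
- exact/measurable_EFinP.
- by move=> x _; rewrite lee_fin.
Qed.

Lemma ge0_integralZ_fin (c : R) (f : T -> R) : 0 <= c ->
  measurable_fun setT f -> (forall x, 0 <= f x) ->
  (\int[m]_x (c * f x)%:E = c%:E * \int[m]_x (f x)%:E)%E.
Proof.
move=> c0 mf f0; under eq_integral do rewrite EFinM.
rewrite ge0_integralZl//; first exact/measurable_EFinP.
by move=> x _; rewrite lee_fin.
Qed.

Lemma ge0_integralD_fin (f g : T -> R) :
  measurable_fun setT f -> measurable_fun setT g ->
  (forall x, 0 <= f x) -> (forall x, 0 <= g x) ->
  (\int[m]_x (f x + g x)%:E = \int[m]_x (f x)%:E + \int[m]_x (g x)%:E)%E.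
Proof.
move=> mf mg f0 g0; under eq_integral do rewrite EFinD.
rewrite ge0_integralD//; try exact/measurable_EFinP.
- by move=> x _; rewrite lee_fin.
- by move=> x _; rewrite lee_fin.
Qed.

Lemma integral_fin_ge0 (f : T -> R) : (forall x, 0 <= f x) ->
  (0 <= \int[m]_x (f x)%:E)%E.
Proof. by move=> f0; apply: integral_ge0 => x _; rewrite lee_fin. Qed.

End ge0_integral_extra.

(** * Volumes of balls and invariance under isometric involutions *)

Section ball_isometry.
Context {R : realType} {n : nat}.
Local Notation mu := (lebesgue_rV R n).
Implicit Types (x y : 'rV[R]_n).

Definition eball r : set 'rV[R]_n := [set x | enorm x <= r].

Lemma measurable_eball r : measurable (eball r).
Proof.
rewrite (_ : eball r = (@enorm R n) @^-1` `]-oo, r]%classic); last first.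
  by apply/seteqP; split => x /=; rewrite in_itv.
by rewrite -[X in measurable X]setTI; exact: measurable_enorm.
Qed.

Lemma integral_eball r : (\int[mu]_x ((enorm x <= r)%R%:R)%:E = mu (eball r))%E.
Proof.
rewrite -[RHS]mul1e -integral_cst//; last exact: measurable_eball.
rewrite (ge0_integral_cond mu (fun x => enorm x <= r) (cst 1)).
by apply: eq_integral => x _; rewrite /= mulr1.
Qed.

Lemma lebesgue_eball_fin (r : R) : (mu (eball r) < +oo)%E.
Proof.
have [r0|r0] := leP 0 r; last first.
  rewrite (_ : eball r = set0) ?measure0//.
  apply/seteqP; split => x //=; rewrite /eball /= => H.
  by have := enorm_ge0 x; lra.
apply: (@le_lt_trans _ _ (mu (cube r))); last by rewrite lebesgue_cube// ltry.
apply: le_measure; rewrite ?inE; [exact: measurable_eball|exact: measurable_cube|].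
by move=> x xr i; rewrite (le_trans (coord_le_enorm _ _)).
Qed.

Lemma lebesgue_eball_gt0 (r : R) : 0 < r -> (0 < mu (eball r))%E.
Proof.
(* A cube inscribed in the ball, from |x| <= n times the sup norm; n + 1 keeps the side positive and
   finite when n = 0. *)
move=> r0; have s0 : 0 < r / (n%:R + 1) by rewrite divr_gt0// ltr_wpDl.
apply: (@lt_le_trans _ _ (mu (cube (r / (n%:R + 1))))).
  by rewrite lebesgue_cube ?ltW// lte_fin exprn_gt0// mulr_gt0.
apply: le_measure; rewrite ?inE; [exact: measurable_cube|exact: measurable_eball|].
move=> x xr; rewrite /eball /= (le_trans (enorm_le_norm _))//.
rewrite (@le_trans _ _ (n%:R * (r / (n%:R + 1))))//.
  rewrite ler_wpM2l// [leLHS]/Num.norm /= mx_normrE; apply/bigmax_leP; split.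
    exact: ltW.
  by move=> [i j] _ /=; rewrite ord1; exact: xr.
by rewrite mulrA ler_pdivrMr ?ltr_wpDl// mulrDr mulr1 mulrC lerDl ltW.
Qed.

(* Both iterated integrals of [f (T x + y) b x], for [b] the indicator of the
   unit ball, are computed by translation invariance alone. *)
Lemma ge0_integral_isometry (T : 'rV[R]_n -> 'rV[R]_n) (f : 'rV[R]_n -> R) :
  measurable_fun setT T -> (forall x y, T (x + y) = T x + T y) ->
  (forall x, T (T x) = x) -> (forall x, enorm (T x) = enorm x) ->
  measurable_fun setT f -> (forall x, 0 <= f x) ->
  (\int[mu]_x (f (T x))%:E = \int[mu]_x (f x)%:E)%E.
Proof.
move=> mT TD TK Tn mf f0.
pose b x : R := (enorm x <= 1)%R%:R.
have mb : measurable_fun setT b by rewrite /b; meas.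
have b0 x : 0 <= b x by rewrite /b.
have mfT : measurable_fun setT (f \o T) by exact: measurableT_comp.
have TN x : T (- x) = - T x.
  by apply/(addIr (T x)); rewrite -TD addNr addNr; apply: (addIr (T 0)); rewrite -TD !add0r.
suff H : (mu (eball 1%R) * \int[mu]_x (f (T x))%:E = mu (eball 1%R) * \int[mu]_x (f x)%:E)%E.
  have B0 := lebesgue_eball_gt0 (@ltr01 R); have B1 := lebesgue_eball_fin 1.
  move: H B0 B1; case: (mu (eball 1)) => // r H; rewrite lte_fin => r0 _.
  have := congr1 (mule (r^-1)%:E) H.
  by rewrite !muleA -!EFinM mulVf ?gt_eqF// !mul1e.
rewrite -integral_eball.
have mfTb : measurable_fun setT (fun p : 'rV[R]_n * 'rV[R]_n => f (T p.1) * b (p.2 - T p.1)).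
  apply: measurable_funM; first by apply: (measurableT_comp mfT); exact: measurable_fst.
  apply: (measurableT_comp mb); apply: measurable_funD_rV; first exact: measurable_snd.
  by apply: measurable_funN_rV; apply: (measurableT_comp mT); exact: measurable_fst.
have mfTb' : measurable_fun setT (fun p : 'rV[R]_n * 'rV[R]_n => f (T p.2 + p.1) * b (- T p.2)).
  have mT2 : measurable_fun setT (fun p : 'rV[R]_n * 'rV[R]_n => T p.2).
    by apply: (measurableT_comp mT); exact: measurable_snd.
  apply: measurable_funM; first apply: (measurableT_comp mf).
    by apply: measurable_funD_rV => //; exact: measurable_fst.
  by apply: (measurableT_comp mb); exact: measurable_funN_rV.
transitivity (\int[mu]_x \int[mu]_y (f (T x) * b (y - T x))%:E)%E.
  rewrite muleC -ge0_integralZr//; last 3 first.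
  - exact/measurable_EFinP.
  - by move=> x _; rewrite lee_fin.
  - by apply: integral_ge0 => x _; rewrite lee_fin.
  apply: eq_integral => x _; rewrite ge0_integralZ_fin//; last first.
    by apply: (measurableT_comp mb); exact: measurable_addr_rV.
  congr (_ * _)%E; rewrite (ge0_integral_shift (- T x) (f := EFin \o b))//.
  exact/measurable_EFinP.
rewrite (integral_swap mu mu mfTb); last by move=> x y; rewrite mulr_ge0.
transitivity (\int[mu]_y \int[mu]_x (f (T x + y) * b (- T x))%:E)%E.
  apply: eq_integral => y _.
  rewrite -[LHS](ge0_integral_shift (T y)); last 2 first.
  - apply/measurable_EFinP; apply: measurable_funM => //.
    apply: (measurableT_comp mb); apply: measurable_funD_rV => //.
    exact: measurable_funN_rV.
  - by move=> x; rewrite lee_fin mulr_ge0.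
  by apply: eq_integral => x _; rewrite TD TK opprD [y + _]addrC -addrA addNr addr0.
rewrite (integral_swap mu mu mfTb'); last by move=> x y; rewrite mulr_ge0.
rewrite -ge0_integralZr//; last 2 first.
- exact/measurable_EFinP.
- by apply: integral_ge0 => x _; rewrite lee_fin.
apply: eq_integral => x _.
rewrite (_ : (enorm x <= 1)%R%:R = b (- T x)); last by rewrite /b enormN Tn.
under eq_integral do rewrite mulrC.
rewrite ge0_integralZ_fin//; last first.
  apply: (measurableT_comp mf); apply: measurable_funD_rV => //; exact: measurable_cst.
congr (_ * _)%E; rewrite -[RHS](ge0_integral_shift (T x))//; last exact/measurable_EFinP.
by apply: eq_integral => y _; rewrite addrC.
Qed.

Lemma ge0_integral_opp (f : 'rV[R]_n -> R) :
  measurable_fun setT f -> (forall x, 0 <= f x) ->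
  (\int[mu]_x (f (- x))%:E = \int[mu]_x (f x)%:E)%E.
Proof.
move=> mf f0; apply: (ge0_integral_isometry (T := -%R)) => //.
- exact: measurable_funN_rV.
- exact: opprD.
- exact: opprK.
- exact: enormN.
Qed.

Lemma ge0_integral_reflect e (f : 'rV[R]_n -> R) :
  measurable_fun setT f -> (forall x, 0 <= f x) ->
  (\int[mu]_x (f (reflect_rV e x))%:E = \int[mu]_x (f x)%:E)%E.
Proof.
move=> mf f0; apply: ge0_integral_isometry => //.
- rewrite /reflect_rV; meas.
- exact: reflect_rVD.
- exact: reflect_rVK.
- exact: enorm_reflect_rV.
Qed.

Lemma ge0_integral_shift_fin (a : 'rV[R]_n) (f : 'rV[R]_n -> R) :
  measurable_fun setT f -> (forall x, 0 <= f x) ->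
  (\int[mu]_x (f (x + a)%R)%:E = \int[mu]_x (f x)%:E)%E.
Proof.
move=> mf f0; apply: (ge0_integral_shift a (f := EFin \o f)).
- exact/measurable_EFinP.
- by move=> x; rewrite lee_fin.
Qed.

Lemma ge0_integral_scale_fin (c : R) (f : 'rV[R]_n -> R) : 0 < c ->
  measurable_fun setT f -> (forall x, 0 <= f x) ->
  (\int[mu]_x (f (c *: x)%R)%:E = (c ^- n)%:E * \int[mu]_x (f x)%:E)%E.
Proof.
move=> c0 mf f0; apply: (ge0_integral_scale c0 (f := EFin \o f)).
- exact/measurable_EFinP.
- by move=> x; rewrite lee_fin.
Qed.

End ball_isometry.

(** * Exhaustion of domains and integrals of powers *)

Section exhaustion.
Context {R : realType} {d} {T : measurableType d}.
Variable (m : {measure set T -> \bar R}).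

(** Monotone convergence. At each point the truncated integrands are eventually constant, since
    [P k] holds from some rank on or never, so a bound uniform in k passes to the union of the
    exhausting sets. *)
Lemma ge0_integral_exhaustion (P : nat -> T -> bool) (Q : T -> bool) (f : T -> R) (M : \bar R) :
  (forall k, measurable_fun setT (P k)) -> measurable_fun setT f ->
  (forall x, 0 <= f x) ->
  (forall k l x, (k <= l)%N -> P k x -> P l x) ->
  (forall x, Q x -> exists k, P k x) -> (forall k x, P k x -> Q x) ->
  (forall k, \int[m]_x ((P k x)%:R * f x)%:E <= M)%E ->
  (\int[m]_x ((Q x)%:R * f x)%:E <= M)%E.
Proof.
move=> mP mf f0 Pmon PQ QP PM.
pose g k x := ((P k x)%:R * f x)%:E.
have mg k : measurable_fun setT (g k).
  by apply/measurable_EFinP; apply: measurable_funM => //; exact: measurable_fun_b2r.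
have g0 k x : (0 <= g k x)%E by rewrite lee_fin mulr_ge0.
have ndg x : {homo g ^~ x : k l / (k <= l)%N >-> (k <= l)%E}.
  move=> k l kl; rewrite lee_fin ler_wpM2r// ler_nat.
  by case: (P k x) (@Pmon k l x kl) => // ->.
have glim x : ((Q x)%:R * f x)%:E = limn (g ^~ x).
  case Qx : (Q x); last first.
    apply/esym/cvg_lim => //; rewrite mul0r; apply: cvg_near_cst; apply: nearW => k.
    by rewrite /g; case Pk : (P k x); rewrite ?mul0r//; rewrite (QP _ _ Pk) in Qx.
  have [k Pk] := PQ x Qx.
  apply/esym/cvg_lim => //; apply: cvg_near_cst; exists k => // l /= kl.
  by rewrite /g (Pmon _ _ _ kl Pk).
rewrite (eq_integral (fun x => limn (g ^~ x))); last by move=> x _; exact: glim.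
rewrite monotone_convergence//.
apply: lime_le; last by apply: nearW => k; exact: PM.
apply: ereal_nondecreasing_is_cvgn => k l kl.
by apply: ge0_le_integral => // x _; exact: ndg.
Qed.

End exhaustion.

Section power_integrals.
Context {R : realType}.
Local Notation leb := (@lebesgue_measure R).

Lemma is_derive1_continuous (f : R -> R) (x d : R) :
  is_derive x 1 f d -> f y @[y --> x] --> f x.
Proof.
by move=> [D _]; apply: (differentiable_continuous (f := f)); exact/derivable1_diffP.
Qed.

Lemma powR_cvgy0 (c : R) : 0 < c -> t `^ (- c) @[t --> +oo] --> 0.
Proof.
move=> c0; apply/cvgr0Pnorm_le => e e0; near=> t.
have e1 : 0 < e `^ (- c^-1) by rewrite powR_gt0.
have te : e `^ (- c^-1) <= t by near: t; exact: nbhs_pinfty_ge.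
rewrite ger0_norm ?powR_ge0// powRN.
have t0 : 0 < t by exact: lt_le_trans te.
rewrite -[leRHS]invrK lef_pV2 ?posrE ?invr_gt0 ?powR_gt0//.
have -> : e^-1 = (e `^ (- c^-1)) `^ c.
  by rewrite -powRrM mulNr mulVf ?gt_eqF// powR_inv1// ltW.
by rewrite ge0_ler_powR ?nnegrE ?ltW.
Unshelve. all: by end_near. Qed.

Lemma integral_powR_infty (a c : R) : 0 < a -> 0 < c ->
  (\int[leb]_t ((a <= t)%R%:R * t `^ (- 1 - c))%:E = (a `^ (- c) / c)%:E)%E.
Proof.
move=> a0 c0.
rewrite -(ge0_integral_cond leb (fun t => a <= t)).
rewrite (_ : [set x | a <= x] = `[a, +oo[%classic); last first.
  by apply/seteqP; split => x /=; rewrite in_itv/= andbT.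
have H (x : R) : 0 < x -> is_derive x 1 (fun t => - c^-1 * t `^ (- c)) (x `^ (- 1 - c)).
  move=> x0; have D := is_derive1_powR (- c) x0.
  apply: is_derive_eq.
  by rewrite /GRing.scale/= mulrA mulrNN mulVf ?gt_eqF// mul1r addrC.
rewrite (ge0_continuous_FTC2y (F := fun t => - c^-1 * t `^ (- c)) (l := 0)).
- by rewrite sub0e -EFinN mulNr opprK mulrC.
- by move=> x _; rewrite powR_ge0.
- apply: derivable_within_continuous => x; rewrite in_itv/= andbT => ax.
  by have [] := is_derive1_powR (- 1 - c) (lt_le_trans a0 ax).
- rewrite -(mulr0 (- c^-1)); apply: cvgMr.
  exact: powR_cvgy0.
- by move=> x ax; have [] := H x (lt_trans a0 ax).
- apply: cvg_at_right_filter.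
  exact: is_derive1_continuous (H a a0).
- move=> x; rewrite in_itv/= andbT => ax.
  by rewrite derive1E; have [_ ->] := H x (lt_trans a0 ax).
Qed.

Lemma integral_powR_itv (a b c : R) : 0 < a -> 0 < c ->
  (\int[leb]_t ((a <= t <= b)%R%:R * t `^ (c - 1))%:E <= (b `^ c / c)%:E)%E.
Proof.
move=> a0 c0.
have [ab|ba] := ltP a b; last first.
  rewrite (_ : \int[leb]_t _ = 0)%E ?lee_fin ?divr_ge0 ?powR_ge0 ?ltW//.
  have Z : lebesgue_measure [set a] = 0%E by exact: lebesgue_measure_set1.
  rewrite -(ge0_integral_cond leb (fun t => a <= t <= b)).
  apply: (@integral_Sset1 _ _ _ a) => t /= /andP[? ?].
  by apply/eqP; rewrite eq_le; apply/andP; split => //; apply: le_trans ba.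
rewrite -(ge0_integral_cond leb (fun t => a <= t <= b)).
rewrite (_ : [set x | _] = `[a, b]%classic); last first.
  by apply/seteqP; split => x /=; rewrite in_itv/=.
have H (x : R) : 0 < x -> is_derive x 1 (fun t => c^-1 * t `^ c) (x `^ (c - 1)).
  move=> x0; have D := is_derive1_powR c x0.
  apply: is_derive_eq.
  by rewrite /GRing.scale/= mulrA mulVf ?gt_eqF// mul1r.
have C (x : R) : 0 < x -> c^-1 * y `^ c @[y --> x] --> c^-1 * x `^ c.
  by move=> x0; exact: is_derive1_continuous (H x x0).
rewrite (continuous_FTC2 (F := fun t => c^-1 * t `^ c))//.
- by rewrite -EFinB lee_fin mulrC gerBl mulr_ge0 ?powR_ge0// invr_ge0 ltW.
- apply: derivable_within_continuous => x; rewrite in_itv/= => /andP[ax _].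
  by have [] := is_derive1_powR (c - 1) (lt_le_trans a0 ax).
- split.
  + by move=> x; rewrite in_itv/= => /andP[ax _]; have [] := H x (lt_trans a0 ax).
  + by apply: cvg_at_right_filter; exact: C.
  + by apply: cvg_at_left_filter; apply: C; exact: lt_trans ab.
- move=> x; rewrite in_itv/= => /andP[ax _].
  by rewrite derive1E; have [_ ->] := H x (lt_trans a0 ax).
Qed.

(** The integrand may be unbounded at 0, so the fundamental theorem of calculus is applied on
    [1/(k+1), b] and the bound, which does not see the left end point, survives the exhaustion. *)
Lemma integral_powR_0 (b c : R) : 0 < c ->
  (\int[leb]_t ((0 < t <= b)%R%:R * t `^ (c - 1))%:E <= (b `^ c / c)%:E)%E.
Proof.
move=> c0; apply: (@ge0_integral_exhaustion R _ _ leb (fun k (t : R) => k.+1%:R^-1 <= t <= b) (fun t : R => 0 < t <= b) (fun t : R => t `^ (c - 1))).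
- move=> k; meas.
- by meas.
- by move=> t; rewrite powR_ge0.
- move=> k l t kl /andP[kt ->]; rewrite andbT; apply: le_trans kt.
  by rewrite lef_pV2 ?posrE// ler_nat.
- move=> t /andP[t0 ->]; exists (Num.truncn t^-1).
  rewrite andbT -[leRHS]invrK lef_pV2 ?posrE ?invr_gt0// ltW//.
  by rewrite -truncn_lt_nat// ?invr_ge0 ltW.
- by move=> k t /andP[kt ->]; rewrite andbT (lt_le_trans _ kt).
- by move=> k; apply: integral_powR_itv => //; rewrite invr_gt0.
Qed.

End power_integrals.

(** * Polar coordinates *)

Section polar_coordinates.
Context {R : realType} {m : nat}.
Local Notation n := m.+1.
Local Notation leb := (@lebesgue_measure R).
Local Notation mu := (lebesgue_rV R n).
Implicit Types (x y : 'rV[R]_n).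

Lemma integral_natpow_infty (a : R) : 0 < a ->
  (\int[leb]_t ((a <= t)%R%:R * t ^- n.+1)%:E = (a ^- n / n%:R)%:E)%E.
Proof.
move=> a0; rewrite -(powR_invn _ (ltW a0)) -integral_powR_infty//.
apply: eq_integral => t _; congr EFin.
case: (leP a t) => [at_|]; last by rewrite !mul0r.
rewrite -(powR_invn _ (le_trans (ltW a0) at_)).
by congr (_ * _ `^ _); rewrite -natr1; ring.
Qed.

Lemma ae_neq0_rV : mu [set 0] = 0%E.
Proof.
have E0 : [set 0] = @cube R n 0.
  apply/seteqP; split => x /=; first by move=> -> i; rewrite mxE normr0.
  by move=> H; apply/rowP => i; rewrite mxE; apply/eqP; rewrite -normr_le0; exact: H.
have H (r : R) : 0 < r -> (mu [set 0%R] <= ((2 * r) ^+ n)%:E)%E.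
  move=> r0; rewrite E0 -(lebesgue_cube _ (ltW r0)).
  apply: le_measure; rewrite ?inE; [exact: measurable_cube|exact: measurable_cube|].
  by move=> x xr i; rewrite (le_trans (xr i))// ltW.
apply/eqP; rewrite eq_le measure_ge0 andbT; apply/lee_addgt0Pr => e e0; rewrite add0e.
have H' (r : R) : 0 < r -> r <= e -> r <= 1 -> (mu [set 0%R] <= e%:E)%E.
  move=> r0 re r1; have := H (r / 2); rewrite (_ : 2 * (r / 2) = r); last by lra.
  rewrite divr_gt0// => /(_ isT)/le_trans; apply.
  by rewrite lee_fin exprS (le_trans _ re)// ler_piMr ?(ltW r0)// exprn_ile1 ?(ltW r0).
have [e1|e1] := leP e 1; first exact: (H' e).
by apply: (H' 1) => //; exact: ltW.
Qed.

Lemma ge0_integral_neq0 (f : 'rV[R]_n -> R) : measurable_fun setT f ->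
  (forall x, 0 <= f x) ->
  (\int[mu]_x ((0 < enorm x)%R%:R * f x)%:E = \int[mu]_x (f x)%:E)%E.
Proof.
move=> mf f0; apply: ge0_ae_eq_integral => //.
- by apply/measurable_EFinP; meas.
- exact/measurable_EFinP.
- by move=> x _; rewrite lee_fin mulr_ge0.
- by move=> x _; rewrite lee_fin.
exists [set 0]; split; [| exact: ae_neq0_rV|].
- rewrite (_ : [set 0] = cube 0); first exact: measurable_cube.
  apply/seteqP; split => x /=; first by move=> -> i; rewrite mxE normr0.
  by move=> H; apply/rowP => i; rewrite mxE; apply/eqP; rewrite -normr_le0; exact: H.
- move=> x /= H; apply/eqP/negPn/negP => x0; apply: H => _.
  by rewrite enorm_gt0 x0 mul1r.
Qed.

(** No surface measure is used: the direction is y/|y| for y in the punctured unit ball, in keeping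
    with the cones that define [surface_measure]. The proof inserts 1 = n |x|^n times the integral
    of s^(-n-1) over s >= |x|, exchanges the integrals, substitutes x = s y for fixed s, and finally
    t = |y| s for fixed y. *)
Lemma ge0_integral_polar (F : 'rV[R]_n -> R) : measurable_fun setT F ->
  (forall x, 0 <= F x) ->
  (\int[mu]_x (F x)%:E = n%:R%:E *
   \int[mu]_y \int[leb]_t ((0 < enorm y <= 1)%R%:R *
     ((0 < t)%R%:R * (t ^+ m * F ((t / enorm y) *: y))))%:E)%E.
Proof.
move=> mF F0.
pose h y (s : R) := (0 < enorm y <= 1)%R%:R *
   ((0 < s)%R%:R * (enorm y ^+ n * s ^+ m * F (s *: y))).
have mFZ : measurable_fun setT (fun p : 'rV[R]_n * R => F (p.2 *: p.1)).
  by apply: (measurableT_comp mF); meas.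
have mh : measurable_fun setT (fun p : 'rV[R]_n * R => h p.1 p.2).
  by rewrite /h; meas.
have h0 y s : 0 <= h y s.
  rewrite /h; case: (ltP 0 s) => [s0|]; last by rewrite mul0r mulr0.
  by rewrite !mulr_ge0// ?exprn_ge0 ?enorm_ge0// ltW.
(* The integrand after insertion of the factor 1, and [h] above is what it becomes under x = s y. *)
pose k x (s : R) := ((0 < enorm x)%R%:R * (enorm x ^+ n * F x)) *
   ((0 < s)%R%:R * ((enorm x <= s)%R%:R * s ^- n.+1)).
have mk : measurable_fun setT (fun p : 'rV[R]_n * R => k p.1 p.2).
  rewrite /k; apply: measurable_funM; last by meas.
  apply: measurable_funM; first by meas.
  by apply: measurable_funM; [meas|apply: (measurableT_comp mF); exact: measurable_fst].
have k0 x s : 0 <= k x s.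
  rewrite /k; case: (ltP 0 s) => [s0|]; last by rewrite mul0r mulr0.
  by rewrite !mulr_ge0// ?invr_ge0 ?exprn_ge0 ?enorm_ge0// ltW.
transitivity (n%:R%:E * \int[mu]_y \int[leb]_s (h y s)%:E)%E; last first.
  apply: congr1; apply: eq_integral => y _.
  case yP : (0 < enorm y <= 1); last first.
    by rewrite /h yP; apply: eq_integral => s _; rewrite !mul0r.
  have /andP[y0 _] := yP.
  have mG : measurable_fun setT (fun t : R => (0 < t)%R%:R * (t ^+ m * F ((t / enorm y) *: y))).
    apply: measurable_funM; first by meas.
    by apply: measurable_funM; [meas|apply: (measurableT_comp mF); meas].
  have G0 t : 0 <= (0 < t)%R%:R * (t ^+ m * F ((t / enorm y) *: y)).
    case: (ltP 0 t) => [t0|]; last by rewrite mul0r.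
    by rewrite !mulr_ge0// exprn_ge0// ltW.
  under [RHS]eq_integral do rewrite mul1r.
  have := @lebesgue_ge0_scale R (enorm y) (fun t => ((0 < t)%R%:R * (t ^+ m * F ((t / enorm y) *: y)))%:E) y0.
  move=> /(_ _ _)/(congr1 (mule (enorm y)%:E)).
  rewrite muleA -EFinM divff ?gt_eqF// mul1e => <-; last 2 first.
  - exact/measurable_EFinP.
  - by move=> t; rewrite lee_fin.
  rewrite -ge0_integralZ_fin ?enorm_ge0//; last first.
    apply: (measurableT_comp mG); exact: measurable_funM.
  apply: eq_integral => s _; congr EFin; rewrite /h yP mul1r pmulr_rgt0//.
  rewrite (_ : enorm y * s / enorm y = s); last by field; rewrite gt_eqF.
  by rewrite exprMn exprS; ring.
rewrite (integral_swap mu leb mh h0).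
transitivity (n%:R%:E * \int[leb]_s \int[mu]_x (k x s)%:E)%E; last first.
  apply: congr1; apply: eq_integral => s _.
  case: (ltP 0 s) => [s0|s0]; last first.
    have s0' : (0 < s) = false by apply/negbTE; rewrite -leNgt.
    rewrite [LHS]integral0_eq ?[RHS]integral0_eq// => x _.
      by rewrite /h s0' mul0r mulr0.
    by rewrite /k s0' mul0r mulr0.
  pose H x := (0 < enorm x <= s)%R%:R * (enorm x ^+ n * s ^- n * s ^+ m * F x).
  have mH : measurable_fun setT H by rewrite /H; meas.
  have H0 x : 0 <= H x.
    by rewrite /H !mulr_ge0// ?invr_ge0 ?exprn_ge0 ?enorm_ge0// ltW.
  transitivity (\int[mu]_y (H (s *: y))%:E)%E; last first.
    apply: eq_integral => y _; congr EFin; rewrite /H /h enormZ (gtr0_norm s0) s0 mul1r.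
    rewrite pmulr_rgt0// ger_pMr// exprMn; congr (_ * (_ * _ * _)).
    by rewrite mulrC mulrA mulVf ?mul1r// expf_neq0// gt_eqF.
  rewrite ge0_integral_scale_fin// -ge0_integralZ_fin ?invr_ge0 ?exprn_ge0 ?ltW//.
  apply: eq_integral => x _; congr EFin; rewrite /k /H s0 mul1r.
  case: (ltP 0 (enorm x)) => [x0|]; last by rewrite !mul0r mulr0.
  case: (leP (enorm x) s) => [xs|]; last by rewrite !mul0r !mulr0.
  rewrite /= !mul1r !exprS; field.
  by rewrite expf_eq0 !gt_eqF// andbF.
rewrite -(integral_swap mu leb mk k0) -ge0_integralZl//; last 2 first.
- exact: (measurable_integral1 leb mk k0).
- by move=> x _; apply: integral_ge0 => s _; rewrite lee_fin.
rewrite -ge0_integral_neq0//; apply: eq_integral => x _.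
rewrite /k; case: (ltP 0 (enorm x)) => [x0|]; last first.
  by rewrite mul0r integral0_eq ?mule0// => s _; rewrite !mul0r.
rewrite !mul1r ge0_integralZ_fin ?(mulr_ge0 (exprn_ge0 _ (enorm_ge0 x)) (F0 x))//; last 2 first.
- by meas.
- move=> s; case: (ltP 0 s) => [s0|]; last by rewrite mul0r.
  by rewrite !mulr_ge0// invr_ge0 exprn_ge0// ltW.
have E : (\int[leb]_s ((0 < s)%R%:R * ((enorm x <= s)%R%:R * s ^- n.+1))%:E =
    (enorm x ^- n / n%:R)%:E)%E.
  rewrite -integral_natpow_infty//; apply: eq_integral => s _.
  case: (ltP 0 s) => [s0|s0]; first by rewrite mul1r.
  by rewrite mul0r leNgt (le_lt_trans s0 x0) mul0r.
rewrite E -!EFinM; congr EFin; field.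
by rewrite expf_neq0 ?gt_eqF// andbT gt_eqF// ltr_wpDr.
Qed.

End polar_coordinates.

Section mrestr_integral.
Context {R : realType} {d} {T : measurableType d}.

Lemma ge0_integral_mrestr (mu : {measure set T -> \bar R}) (D : set T)
  (mD : measurable D) (g : T -> \bar R) :
  measurable_fun setT g -> (forall x, (0 <= g x)%E) ->
  (\int[mrestr mu mD]_x g x = \int[mu]_(x in D) g x)%E.
Proof.
move=> mg g0; rewrite -[in LHS](setUv D) ge0_integral_setU//; last 3 first.
- exact: measurableC.
- by rewrite setUv.
- by apply/disj_setPS; rewrite setICr.
rewrite [X in (_ + X)%E](_ : _ = 0%E); last first.
  rewrite (ge0_negligible_integral (N := ~` D))//.
  - by rewrite setDv integral_set0.
  - exact: measurableC.
  - exact: measurableC.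
  - exact: measurable_funTS.
  - by rewrite /= /mrestr setICl measure0.
rewrite adde0; apply: eq_measure_integral => A mA AD.
by rewrite /= /mrestr setIidl.
Qed.

End mrestr_integral.

(** * Continuous functions are measurable for the product sigma-algebra *)

Section continuous_measurable_rV.
Context {R : realType} {n : nat}.

Lemma floor_approx (k : nat) (x : R) :
  `|x - (Num.floor (k.+1%:R * x))%:~R / k.+1%:R| <= k.+1%:R^-1.
Proof.
have k0 : 0 < k.+1%:R :> R by [].
have /andP[h1 h2] := floor_itv (k.+1%:R * x).
rewrite intrD in h2.
have E : x - (Num.floor (k.+1%:R * x))%:~R / k.+1%:R =
   (k.+1%:R * x - (Num.floor (k.+1%:R * x))%:~R) / k.+1%:R by field; rewrite gt_eqF.
rewrite E ger0_norm; last by rewrite divr_ge0// subr_ge0.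
by rewrite ler_pdivrMr// mulVf ?gt_eqF// lerBlDl ltW.
Qed.

(** The sigma-algebra is generated by the coordinates, not by the open sets. The function is a
    pointwise limit of its values at grid points: [q k] rounds down to the grid of mesh 1/(k+1) and
    takes countably many values, each on a measurable half-open cube. *)
Lemma continuous_measurable_rV (f : 'rV[R]_n -> R) :
  continuous f -> measurable_fun setT f.
Proof.
move=> cf.
pose q (k : nat) (x : 'rV[R]_n) : 'rV[int]_n := \row_i Num.floor (k.+1%:R * x ord0 i).
pose e (k : nat) (z : 'rV[int]_n) : 'rV[R]_n := \row_i ((z ord0 i)%:~R / k.+1%:R).
apply: (@measurable_fun_cvg _ _ _ _ (fun k x => f (e k (q k x)))).
  move=> k _ Y mY; rewrite setTI.
  rewrite (_ : _ @^-1` Y = \bigcup_(z in [set: 'rV[int]_n])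
      ((if `[< Y (f (e k z)) >] then setT else set0) `&`
       \bigcap_(i in [set: 'I_n]) ((fun x : 'rV[R]_n => Num.floor (k.+1%:R * x ord0 i)) @^-1` [set z ord0 i]))); last first.
    apply/seteqP; split => x /=.
      move=> Yx; exists (q k x) => //; split; first by rewrite asboolT.
      by move=> i _ /=; rewrite mxE.
    move=> [z _ []]; case: ifPn => [/asboolP Yz _ H|_ []//].
    have -> // : q k x = z.
    by apply/rowP => i; rewrite mxE; exact: (H i I).
  apply: countable_bigcupT_measurable; first exact: countableP.
  move=> z; apply: measurableI; first by case: ifPn.
  apply: fin_bigcap_measurable => // i _.
  rewrite (_ : _ @^-1` _ = (fun x : 'rV[R]_n => k.+1%:R * x ord0 i) @^-1`
      `[(z ord0 i)%:~R, (z ord0 i + 1)%:~R[%classic); last first.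
    apply/seteqP; split => x /=; rewrite in_itv/=.
      by move=> <-; exact: floor_itv.
    by move=> /floor_def.
  rewrite -[X in measurable X]setTI.
  have : measurable_fun setT (fun x : 'rV[R]_n => k.+1%:R * x ord0 i) by meas.
  exact.
move=> x _; apply: (@continuous_cvg _ _ _ _ _ _ f); first exact: cf.
have FF : Filter (nbhs (\oo : set_system nat)) by exact: filter_filter.
apply/cvg_ballP => eps eps0.
exists (Num.truncn (eps^-1)) => // k /= kk.
rewrite -ball_normE/=; apply: (@le_lt_trans _ _ k.+1%:R^-1).
  rewrite [leLHS]/Num.norm /= mx_normrE; apply/bigmax_leP; split; first by [].
  by move=> [i j] _ /=; rewrite ord1 !mxE floor_approx.
rewrite -[ltRHS]invrK ltf_pV2 ?posrE ?invr_gt0//.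
rewrite -truncn_lt_nat ?invr_ge0 ?ltW//.
Qed.

End continuous_measurable_rV.

(** * Integrals over balls, shells and spheres *)

Section radial_integrals.
Context {R : realType} {m : nat}.
Local Notation n := m.+1.
Local Notation leb := (@lebesgue_measure R).
Local Notation mu := (lebesgue_rV R n).
Implicit Types (x y z : 'rV[R]_n) (f : 'rV[R]_n -> R).

Definition ball_vol : R := fine (mu (eball 1)).

Lemma ball_volE : mu (eball 1) = ball_vol%:E.
Proof. by rewrite fineK// ge0_fin_numE// lebesgue_eball_fin. Qed.

Lemma ball_vol_gt0 : 0 < ball_vol.
Proof. by rewrite -lte_fin -ball_volE lebesgue_eball_gt0. Qed.

Lemma measurable_eball_fun (r : R) : measurable_fun setT (fun x => (enorm x <= r)%R%:R : R).
Proof. by meas. Qed.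

Lemma lebesgue_eball (r : R) : 0 < r -> mu (eball r) = (r ^+ n * ball_vol)%:E.
Proof.
move=> r0; rewrite -integral_eball EFinM -ball_volE -integral_eball.
have := ge0_integral_scale_fin (f := fun x => (enorm x <= r)%R%:R : R) r0
  (measurable_eball_fun r) (fun x => ler0n _ _).
move=> /(congr1 (mule (r ^+ n)%:E)).
rewrite muleA -EFinM divff ?expf_neq0 ?gt_eqF// mul1e => <-.
congr (_ * _)%E; apply: eq_integral => x _.
by rewrite enormZ gtr0_norm// ger_pMr.
Qed.

Lemma integral_punctured_ball :
  (\int[mu]_y ((0 < enorm y <= 1)%R%:R)%:E = ball_vol%:E)%E.
Proof.
rewrite -ball_volE -integral_eball -[RHS]ge0_integral_neq0//; last exact: measurable_eball_fun.
by apply: eq_integral => y _; case: (ltP 0 (enorm y)) => _; rewrite ?mul1r ?mul0r.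
Qed.

Lemma ge0_integral_radial (f : R -> R) : measurable_fun setT f -> (forall t, 0 <= f t) ->
  (\int[mu]_x (f (enorm x))%:E =
   (n%:R * ball_vol)%:E * \int[leb]_t ((0 < t)%R%:R * (t ^+ m * f t))%:E)%E.
Proof.
move=> mf f0; rewrite ge0_integral_polar//; last first.
  by apply: (measurableT_comp mf); meas.
rewrite EFinM -muleA; apply: congr1.
rewrite -integral_punctured_ball -ge0_integralZr//; last 2 first.
- by apply/measurable_EFinP; meas.
- apply: integral_ge0 => t _; rewrite lee_fin.
  by case: (ltP 0 t) => [t0|]; rewrite ?mul0r// mulr_ge0// mulr_ge0// exprn_ge0// ltW.
apply: eq_integral => y _.
case yP : (0 < enorm y <= 1); last first.
  by rewrite mul0e integral0_eq// => t _; rewrite mul0r.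
rewrite mul1e; apply: eq_integral => t _; rewrite mul1r.
case: (ltP 0 t) => [t0|]; last by rewrite !mul0r.
have /andP[y0 _] := yP.
by rewrite enormZ ger0_norm ?divr_ge0 ?enorm_ge0 ?ltW// divfK// gt_eqF.
Qed.

Lemma integral_enorm_infty (a c : R) : 0 < a -> 0 < c ->
  (\int[mu]_z ((a <= enorm z)%R%:R * enorm z `^ (- (n%:R + c)))%:E =
   (n%:R * ball_vol * (a `^ (- c) / c))%:E)%E.
Proof.
move=> a0 c0.
rewrite (ge0_integral_radial (f := fun t => (a <= t)%R%:R * t `^ (- (n%:R + c)))); last 2 first.
- by meas.
- by move=> t; rewrite mulr_ge0// powR_ge0.
rewrite [RHS]EFinM -integral_powR_infty//; apply: congr1; apply: eq_integral => t _.
congr EFin; case: (leP a t) => [at_|ta]; last by rewrite !mul0r !mulr0.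
have t0 := lt_le_trans a0 at_.
rewrite t0 !mul1r -powR_mulrn ?ltW// -powRD ?(gt_eqF t0) ?implybT//.
by congr (_ `^ _); rewrite -natr1; ring.
Qed.

Lemma integral_enorm_0 (b c : R) : 0 < c ->
  (\int[mu]_z ((enorm z <= b)%R%:R * enorm z `^ (c - n%:R))%:E <=
   (n%:R * ball_vol * (b `^ c / c))%:E)%E.
Proof.
move=> c0.
rewrite (ge0_integral_radial (f := fun t => (t <= b)%R%:R * t `^ (c - n%:R))); last 2 first.
- by meas.
- by move=> t; rewrite mulr_ge0// powR_ge0.
rewrite [leRHS]EFinM lee_pmul2l//; last first.
  by rewrite lte_fin mulr_gt0// ball_vol_gt0.
apply: le_trans (integral_powR_0 b c0); apply: ge0_le_integral_fin.
- by meas.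
- by meas.
- move=> t; case: (ltP 0 t) => t0; rewrite ?mul0r//.
  by rewrite !mulr_ge0 ?exprn_ge0 ?powR_ge0// ltW.
move=> t; case: (ltP 0 t) => t0; rewrite ?mul0r// !mul1r.
case: (leP t b) => tb; rewrite ?mul0r ?mulr0// !mul1r.
rewrite -powR_mulrn ?(ltW t0)// -powRD ?(gt_eqF t0) ?implybT//.
by rewrite (_ : m%:R + (c - n%:R) = c - 1)//; rewrite -natr1; ring.
Qed.

(* [sphere_int f r] is the integral of [f] over the sphere of radius [r],
   normalised so that the constant 1 has integral [ball_vol]. *)
Definition sphere_int (f : 'rV[R]_n -> R) (r : R) : \bar R :=
  (\int[mu]_y ((0 < enorm y <= 1)%R%:R * f ((r / enorm y) *: y))%:E)%E.

Lemma sphere_int_ge0 f r : (forall x, 0 <= f x) -> (0 <= sphere_int f r)%E.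
Proof. by move=> f0; apply: integral_ge0 => y _; rewrite lee_fin mulr_ge0. Qed.

Lemma measurable_sphere_int f : measurable_fun setT f -> (forall x, 0 <= f x) ->
  measurable_fun setT (sphere_int f).
Proof.
move=> mf f0.
pose F (r : R) (y : 'rV[R]_n) := (0 < enorm y <= 1)%R%:R * f ((r / enorm y) *: y).
have mF : measurable_fun setT (fun p : R * 'rV[R]_n => F p.1 p.2).
  apply: measurable_funM; first by meas.
  by apply: (measurableT_comp mf); meas.
have F0 r y : 0 <= F r y by rewrite mulr_ge0.
exact: (measurable_integral1 mu mF F0).
Qed.

Lemma ge0_integral_shells (h : R -> R) (f : 'rV[R]_n -> R) :
  measurable_fun setT h -> (forall t, 0 <= h t) ->
  measurable_fun setT f -> (forall x, 0 <= f x) ->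
  (\int[mu]_x (h (enorm x) * f x)%:E =
   n%:R%:E * \int[leb]_t (((0 < t)%R%:R * (t ^+ m * h t))%:E * sphere_int f t))%E.
Proof.
move=> mh h0 mf f0; rewrite ge0_integral_polar//; last 2 first.
- by apply: measurable_funM => //; apply: (measurableT_comp mh); meas.
- by move=> x; rewrite mulr_ge0.
apply: congr1.
rewrite (integral_swap mu leb (f := fun y t => (0 < enorm y <= 1)%R%:R *
     ((0 < t)%R%:R * (t ^+ m * (h (enorm ((t / enorm y) *: y)) * f ((t / enorm y) *: y)))))); last 2 first.
- apply: measurable_funM; first by meas.
  apply: measurable_funM; first by meas.
  apply: measurable_funM; first by meas.
  apply: measurable_funM; first by apply: (measurableT_comp mh); meas.
  by apply: (measurableT_comp mf); meas.
- move=> y t; case: (ltP 0 t) => t0; rewrite ?mul0r ?mulr0//.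
  by rewrite !mulr_ge0// exprn_ge0// ltW.
apply: eq_integral => t _; rewrite /sphere_int.
rewrite -ge0_integralZ_fin; last 3 first.
- by case: (ltP 0 t) => t0; rewrite ?mul0r// !mulr_ge0// exprn_ge0// ltW.
- apply: measurable_funM; first by meas.
  by apply: (measurableT_comp mf); meas.
- by move=> y; rewrite mulr_ge0.
apply: eq_integral => y _; congr EFin.
case: (ltP 0 t) => t0; rewrite ?mul0r ?mulr0//.
case yP : (0 < enorm y <= 1); rewrite ?mul0r ?mulr0// !mul1r.
have /andP[y0 _] := yP.
by rewrite enormZ ger0_norm ?divr_ge0 ?enorm_ge0 ?ltW// divfK ?gt_eqF// mulrA.
Qed.

(** The surface measure is the push-forward of a multiple of Lebesgue measure on the punctured ball,
    so numerator and denominator are both integrals over the ball, and their common factor (n / r)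
    r^n cancels. *)
Lemma spherical_averageE f (r : R) : 0 < r -> measurable_fun setT f -> (forall x, 0 <= f x) ->
  spherical_average f r = ball_vol^-1 * fine (sphere_int f r).
Proof.
move=> r0 mf f0.
pose c : {nonneg R} := NngNum (divr_ge0 (ler0n R n) (normr_ge0 r)).
pose mr : {measure set 'rV[R]_n -> \bar R} := mscale c (mrestr mu (measurable_punctured_ball (n := n) r)).
have mproj := @measurable_radial_proj R n r.
have mS : measurable (@sphere R n r).
  rewrite (_ : sphere r = (@enorm R n) @^-1` [set r]) //.
  by rewrite -[X in measurable X]setTI; exact: measurable_enorm.
have c0 : 0 < n%:R / `|r| by rewrite divr_gt0// normr_gt0 gt_eqF.
have rn0 : (r ^- n)%R != 0 by rewrite invr_eq0 expf_neq0// gt_eqF.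
have E (g : 'rV[R]_n -> R) : measurable_fun setT g -> (forall x, 0 <= g x) ->
    (\int[surface_measure r]_(x in sphere r) (g x)%:E =
      (n%:R / `|r| * r ^+ n)%:E * sphere_int g r)%E.
  move=> mg g0.
  transitivity (\int[pushforward mr (@radial_proj R n r)]_(x in sphere r) (g x)%:E)%E.
    by apply: eq_measure_integral.
  rewrite ge0_integral_pushforward//; last 2 first.
  - by apply: measurable_funTS; exact/measurable_EFinP.
  - by move=> x _; rewrite lee_fin.
  rewrite integral_mkcond.
  have mpre : measurable (@radial_proj R n r @^-1` sphere r).
    by rewrite -[X in measurable X]setTI; exact: mproj.
  have mgp : measurable_fun setT ((fun x => (g x)%:E) \o @radial_proj R n r).
    by apply/measurable_EFinP; apply: measurableT_comp.
  set G := (_ \_ _).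
  have mG : measurable_fun setT G by apply/(measurable_restrictT _ mpre); exact: measurable_funTS.
  have G0 x : (0 <= G x)%E by rewrite /G patchE; case: ifP => //; rewrite lee_fin.
  transitivity ((n%:R / `|r|)%:E * \int[mrestr mu (measurable_punctured_ball (n := n) r)]_x G x)%E.
    exact: (@ge0_integral_mscale _ _ _ (mrestr mu (measurable_punctured_ball (n := n) r)) _ measurableT c).
  rewrite ge0_integral_mrestr// (EFinM (n%:R / `|r|)) -muleA; apply: congr1.
  pose H y := (0 < enorm y <= r)%R%:R * g ((r / enorm y) *: y).
  have mH : measurable_fun setT H.
    by rewrite /H; apply: measurable_funM; [meas|apply: (measurableT_comp mg); meas].
  transitivity (\int[mu]_y (H y)%:E)%E.
    rewrite -(ge0_integral_cond mu (fun y => 0 < enorm y <= r)).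
    apply: eq_integral => y; rewrite inE/= => /andP[y0 yr].
    rewrite /G patchE mem_set// /preimage/= /sphere/= /radial_proj enormZ.
    by rewrite ger0_norm ?divr_ge0 ?enorm_ge0 ?ltW// divfK// gt_eqF.
  have := ge0_integral_scale_fin r0 mH (fun y => mulr_ge0 (ler0n _ _) (g0 _)).
  move=> /(congr1 (mule (r ^+ n)%:E)).
  rewrite muleA -EFinM divff ?expf_neq0 ?gt_eqF// mul1e => <-.
  apply: congr1; apply: eq_integral => y _; rewrite /H enormZ gtr0_norm// pmulr_rgt0// ger_pMr//.
  case: (ltP 0 (enorm y)) => y0; rewrite ?mul0r//.
  by congr EFin; congr (_ * g _); rewrite scalerA; congr (_ *: _); field; rewrite !gt_eqF.
have S1 : surface_measure r (@sphere R n r) = (n%:R / `|r| * r ^+ n * ball_vol)%:E.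
  transitivity (\int[surface_measure r]_(x in @sphere R n r) (cst 1%E x))%E.
    by rewrite (integral_cst _ mS) mul1e.
  rewrite (E (fun=> 1)) ?[in RHS]EFinM//; apply: congr1.
  by rewrite -integral_punctured_ball; apply: eq_integral => y _; rewrite mulr1.
rewrite /spherical_average S1 /= /Rintegral E//.
have vv := ball_vol_gt0.
have K0 : 0 < n%:R / `|r| * r ^+ n by rewrite mulr_gt0// exprn_gt0.
have := sphere_int_ge0 r f0; case: (sphere_int f r) => [s| |] //= s0.
  by field; rewrite (gt_eqF vv) expf_neq0 ?gt_eqF//= ?normr_gt0 ?gt_eqF// ?andbT ltr_wpDr.
(* For an infinite sphere integral both sides are 0, as [fine] sends infinity to 0. *)
by rewrite mulr0 gt0_muley// ?lte_fin//= mulr0.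
Qed.

End radial_integrals.
Arguments ball_vol R m : clear implicits.

(** * The truncated operator and its test functions *)

Section truncated_operator.
Context {R : realType} {m : nat}.
Local Notation n := m.+1.
Local Notation mu := (lebesgue_rV R n).
Implicit Types (x y z : 'rV[R]_n) (u v phi : 'rV[R]_n -> R) (alpha eps : R).

Definition rker alpha z : R := enorm z `^ (- (n%:R + alpha)).

Definition tker alpha eps z : R := (eps <= enorm z)%R%:R * rker alpha z.

Definition tmass alpha eps : R := n%:R * ball_vol R m * (eps `^ (- alpha) / alpha).

(** The truncated operator is L_eps u = [tmass] u - [tconv] u. For u >= 0 both halves are
    non-negative, and the convolution is finite as soon as u has a finite integral against
    [weight]. *)
Definition tconv alpha eps u x : R := fine (\int[mu]_z (tker alpha eps z * u (x + z))%:E).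

Definition weight alpha x : R := (1 + enorm x) `^ (- (n%:R + alpha)).

Lemma rker_ge0 alpha z : 0 <= rker alpha z.
Proof. exact: powR_ge0. Qed.

Lemma tker_ge0 alpha eps z : 0 <= tker alpha eps z.
Proof. by rewrite mulr_ge0// rker_ge0. Qed.

Lemma tker_even alpha eps z : tker alpha eps (- z) = tker alpha eps z.
Proof. by rewrite /tker /rker enormN. Qed.

Lemma measurable_rker alpha : measurable_fun setT (rker alpha).
Proof. by rewrite /rker; meas. Qed.

Lemma measurable_tker alpha eps : measurable_fun setT (tker alpha eps).
Proof. by rewrite /tker; apply: measurable_funM; [meas|exact: measurable_rker]. Qed.

Lemma weight_gt0 alpha x : 0 < weight alpha x.
Proof. by rewrite powR_gt0// ltr_wpDr// enorm_ge0. Qed.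

Lemma measurable_weight alpha : measurable_fun setT (weight alpha).
Proof. by rewrite /weight; meas. Qed.

Lemma tmass_gt0 alpha eps : 0 < alpha -> 0 < eps -> 0 < tmass alpha eps.
Proof. by move=> a0 e0; rewrite !mulr_gt0// ?ball_vol_gt0 ?powR_gt0 ?invr_gt0. Qed.

Lemma integral_tker alpha eps : 0 < alpha -> 0 < eps ->
  (\int[mu]_z (tker alpha eps z)%:E = (tmass alpha eps)%:E)%E.
Proof. by move=> a0 e0; exact: integral_enorm_infty. Qed.

Lemma powRN_le (a b g : R) : 0 < a -> a <= b -> 0 <= g -> b `^ (- g) <= a `^ (- g).
Proof.
move=> a0 ab g0; rewrite !powRN lef_pV2 ?posrE ?powR_gt0//; last exact: lt_le_trans ab.
by rewrite ge0_ler_powR// nnegrE ltW// (lt_le_trans a0).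
Qed.

(** For |x| <= rho and |z| >= eps one has 1 + |x + z| <= 1 + rho + |z| <= (1 + (1 + rho)/eps)
    |z|. *)
Lemma tker_le_weight alpha eps (rho : R) x z : 0 <= alpha -> 0 < eps -> enorm x <= rho ->
  tker alpha eps z <= (1 + (1 + rho) / eps) `^ (n%:R + alpha) * weight alpha (x + z).
Proof.
move=> a0 e0 xr; have rho0 : 0 <= rho by rewrite (le_trans (enorm_ge0 x)).
have c0 : 0 < 1 + (1 + rho) / eps by rewrite addr_gt0// divr_gt0// ltr_wpDr.
have W0 := weight_gt0 alpha (x + z).
rewrite /tker; case: (leP eps (enorm z)) => [ez|_]; last first.
  by rewrite mul0r mulr_ge0 ?powR_ge0// ltW.
have z0 : 0 < enorm z by exact: lt_le_trans ez.
rewrite mul1r /rker /weight.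
have -> : enorm z `^ (- (n%:R + alpha)) = (1 + (1 + rho) / eps) `^ (n%:R + alpha) *
    ((1 + (1 + rho) / eps) * enorm z) `^ (- (n%:R + alpha)).
  rewrite powRM ?ltW// mulrA -powRD ?(gt_eqF c0) ?implybT// ?subrr ?powRr0 ?mul1r//.
rewrite ler_pM2l ?powR_gt0// powRN_le ?addr_ge0//.
  by rewrite ltr_wpDr// enorm_ge0.
rewrite (le_trans (y := 1 + rho + enorm z))//.
  by rewrite -addrA lerD2l (le_trans (enormD _ _))// lerD2r.
rewrite mulrDl mul1r addrC lerD2l mulrAC ler_pdivlMr// ler_wpM2l// addr_ge0//.
Qed.

Lemma measurable_shift u x : measurable_fun setT u -> measurable_fun setT (fun z => u (x + z)).
Proof. by move=> mu'; apply: (measurableT_comp mu'); meas. Qed.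

Lemma measurable_tconv_int alpha eps u x : measurable_fun setT u ->
  measurable_fun setT (fun z => tker alpha eps z * u (x + z)).
Proof.
by move=> mu'; apply: measurable_funM; [exact: measurable_tker|exact: measurable_shift].
Qed.

Lemma measurable_tconv2 alpha eps u : measurable_fun setT u ->
  measurable_fun setT (fun p : 'rV[R]_n * 'rV[R]_n => tker alpha eps p.2 * u (p.1 + p.2)).
Proof.
move=> mu'; apply: measurable_funM.
  by apply: (measurableT_comp (measurable_tker alpha eps)); exact: measurable_snd.
by apply: (measurableT_comp mu'); meas.
Qed.

Lemma integral_shift_addl x u : measurable_fun setT u -> (forall y, 0 <= u y) ->
  (\int[mu]_z (u (x + z))%:E = \int[mu]_z (u z)%:E)%E.
Proof.
move=> mu' u0; rewrite -[RHS](ge0_integral_shift_fin x)//.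
by apply: eq_integral => z _; rewrite addrC.
Qed.

Definition weighted_fin alpha u : Prop :=
  [/\ measurable_fun setT u, forall x, 0 <= u x &
     (\int[mu]_x (u x * weight alpha x)%:E < +oo)%E].

Lemma tconvE alpha eps u x : 0 <= alpha -> 0 < eps -> weighted_fin alpha u ->
  (\int[mu]_z (tker alpha eps z * u (x + z))%:E = (tconv alpha eps u x)%:E)%E.
Proof.
move=> a0 e0 [mu' u0 ufin]; rewrite /tconv fineK// ge0_fin_numE; last first.
  by apply: integral_ge0 => z _; rewrite lee_fin mulr_ge0 ?tker_ge0.
pose C := (1 + (1 + enorm x) / eps) `^ (n%:R + alpha).
apply: (@le_lt_trans _ _ (\int[mu]_z (C * (u (x + z) * weight alpha (x + z)))%:E)%E).
  apply: ge0_le_integral_fin.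
  - exact: measurable_tconv_int.
  - apply: measurable_funM => //; apply: measurable_funM; first exact: measurable_shift.
    by apply: measurable_shift; exact: measurable_weight.
  - by move=> z; rewrite mulr_ge0 ?tker_ge0.
  - move=> z; rewrite mulrCA mulrC ler_wpM2l//.
    exact: tker_le_weight.
have mw := measurable_weight alpha.
rewrite ge0_integralZ_fin ?powR_ge0//; last 2 first.
- by apply: measurable_funM; exact: measurable_shift.
- by move=> z; rewrite mulr_ge0// ltW// weight_gt0.
rewrite (integral_shift_addl x (u := fun z => u z * weight alpha z)).
- by rewrite lte_mul_pinfty// ?lee_fin ?powR_ge0.
- by apply: measurable_funM.
- by move=> z; rewrite mulr_ge0// ltW// weight_gt0.
Qed.

Lemma tconv_ge0 alpha eps u x : (forall x, 0 <= u x) -> 0 <= tconv alpha eps u x.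
Proof.
by move=> u0; apply: fine_ge0; apply: integral_ge0 => z _; rewrite lee_fin mulr_ge0 ?tker_ge0.
Qed.

Lemma measurable_tconv alpha eps u : measurable_fun setT u -> (forall x, 0 <= u x) ->
  measurable_fun setT (tconv alpha eps u).
Proof.
move=> mu' u0; rewrite /tconv; apply: (measurableT_comp (fine_measurable _)) => //.
exact: (measurable_integral1 mu (measurable_tconv2 alpha eps mu')
  (fun x z => mulr_ge0 (tker_ge0 alpha eps z) (u0 _))).
Qed.

(** Self-adjointness of the truncated operator: the kernel is even, and Tonelli gives the equality
    even if both sides are infinite. *)
Lemma tconv_sym alpha eps u phi : 0 <= alpha -> 0 < eps ->
  weighted_fin alpha u -> weighted_fin alpha phi ->
  (\int[mu]_x (phi x * tconv alpha eps u x)%:E =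
   \int[mu]_x (u x * tconv alpha eps phi x)%:E)%E.
Proof.
move=> a0 e0 wu wphi; have [mu' u0 _] := wu; have [mphi phi0 _] := wphi.
have mk := measurable_tker alpha eps.
pose F x y := phi x * (u y * tker alpha eps (y - x)).
have mF : measurable_fun setT (fun p : 'rV[R]_n * 'rV[R]_n => F p.1 p.2).
  apply: measurable_funM; first by apply: (measurableT_comp mphi); exact: measurable_fst.
  apply: measurable_funM; first by apply: (measurableT_comp mu'); exact: measurable_snd.
  by apply: (measurableT_comp mk); meas.
have F0 x y : 0 <= F x y by rewrite /F mulr_ge0// mulr_ge0// tker_ge0.
transitivity (\int[mu]_x \int[mu]_y (F x y)%:E)%E.
  apply: eq_integral => x _; rewrite EFinM -tconvE// -ge0_integralZ_fin//; last 2 first.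
  - exact: measurable_tconv_int.
  - by move=> z; rewrite mulr_ge0 ?tker_ge0.
  rewrite -[RHS](integral_shift_addl x); last 2 first.
  - exact: (measurable_section1 mF).
  - by move=> y.
  apply: eq_integral => z _; rewrite /F addrAC subrr add0r.
  by rewrite [tker _ _ _ * _]mulrC.
rewrite (integral_swap mu mu mF F0); apply: eq_integral => y _.
rewrite EFinM -tconvE// -ge0_integralZ_fin//; last 2 first.
- exact: measurable_tconv_int.
- by move=> z; rewrite mulr_ge0 ?tker_ge0.
rewrite -[LHS](integral_shift_addl y); last 2 first.
- exact: (measurable_section2 mF).
- by move=> x.
apply: eq_integral => z _; rewrite /F opprD addNKr tker_even; congr EFin; ring.
Qed.

Lemma tconv_bound alpha eps u x (rho : R) : 0 <= alpha -> 0 < eps ->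
  weighted_fin alpha u -> enorm x <= rho ->
  tconv alpha eps u x <= (1 + (1 + rho) / eps) `^ (n%:R + alpha) *
    fine (\int[mu]_x (u x * weight alpha x)%:E).
Proof.
move=> a0 e0 wu xr; have [mu' u0 ufin] := wu; have mw := measurable_weight alpha.
have I0 : (0 <= \int[mu]_x (u x * weight alpha x)%:E)%E.
  by apply: integral_ge0 => y _; rewrite lee_fin mulr_ge0// ltW// weight_gt0.
rewrite -lee_fin -tconvE// EFinM fineK ?ge0_fin_numE//.
rewrite -(integral_shift_addl x (u := fun z => u z * weight alpha z)); last 2 first.
- by apply: measurable_funM.
- by move=> z; rewrite mulr_ge0// ltW// weight_gt0.
rewrite -ge0_integralZ_fin ?powR_ge0//; last 2 first.
- by apply: measurable_funM; exact: measurable_shift.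
- by move=> z; rewrite mulr_ge0// ltW// weight_gt0.
apply: ge0_le_integral_fin.
- exact: measurable_tconv_int.
- by apply: measurable_funM => //; apply: measurable_funM; exact: measurable_shift.
- by move=> z; rewrite mulr_ge0 ?tker_ge0.
- by move=> z; rewrite mulrCA mulrC ler_wpM2l//; exact: tker_le_weight.
Qed.

(** Just what makes pairings with locally bounded functions finite. The regularity of a test
    function enters only through the pointwise bounds on its truncated operators that each
    application supplies. *)
Definition test_fun (rho : R) phi : Prop :=
  [/\ measurable_fun setT phi, forall x, 0 <= phi x,
      forall x, rho < enorm x -> phi x = 0 &
      exists M, forall x, phi x <= M].

Lemma test_fun_fin rho phi (g : 'rV[R]_n -> R) : test_fun rho phi ->
  measurable_fun setT g -> (forall x, 0 <= g x) ->
  (exists M, forall x, enorm x <= rho -> g x <= M) ->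
  (\int[mu]_x (phi x * g x)%:E < +oo)%E.
Proof.
move=> [mphi phi0 phis [M phiM]] mg g0 [N gN].
have H x : phi x * g x <= `|M| * `|N| * (enorm x <= rho)%R%:R.
  case: (leP (enorm x) rho) => [xr|xr]; last by rewrite phis// mul0r mulr0.
  rewrite mulr1; apply: ler_pM => //; first by rewrite (le_trans (phiM x))// ler_norm.
  by rewrite (le_trans (gN x xr))// ler_norm.
apply: (@le_lt_trans _ _ (\int[mu]_x (`|M| * `|N| * (enorm x <= rho)%R%:R)%:E)%E).
  apply: ge0_le_integral_fin => //; [exact: measurable_funM|meas|].
  by move=> x; rewrite mulr_ge0.
rewrite ge0_integralZ_fin ?mulr_ge0//; last by meas.
by rewrite integral_eball lte_mul_pinfty// ?lee_fin ?mulr_ge0// lebesgue_eball_fin.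
Qed.

Lemma test_fun_weighted alpha rho phi : 0 <= alpha -> test_fun rho phi -> weighted_fin alpha phi.
Proof.
move=> a0 tphi; have [mphi phi0 _ _] := tphi; split => //.
apply: (test_fun_fin tphi); first exact: measurable_weight.
- by move=> x; rewrite ltW// weight_gt0.
- exists 1 => x _; rewrite /weight powRN invf_le1 ?powR_gt0 ?ltr_wpDr ?enorm_ge0//.
  have H : 1 `^ (n%:R + alpha) <= (1 + enorm x) `^ (n%:R + alpha).
    by rewrite ge0_ler_powR ?nnegrE ?addr_ge0 ?enorm_ge0// lerDl enorm_ge0.
  by rewrite powR1 in H.
Qed.

End truncated_operator.
Arguments tmass {R} m alpha eps.

Section integral_DD.
Context {R : realType} {d} {T : measurableType d} (mu : {measure set T -> \bar R}).

(** Differences of integrals could be of the form infinity minus infinity, so pointwise inequalities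
    between differences are integrated in additive form. *)
Lemma ge0_le_integralDD (f1 f2 g1 g2 : T -> R) :
  measurable_fun setT f1 -> measurable_fun setT f2 ->
  measurable_fun setT g1 -> measurable_fun setT g2 ->
  (forall x, 0 <= f1 x) -> (forall x, 0 <= f2 x) ->
  (forall x, 0 <= g1 x) -> (forall x, 0 <= g2 x) ->
  (forall x, f1 x + f2 x <= g1 x + g2 x) ->
  (\int[mu]_x (f1 x)%:E + \int[mu]_x (f2 x)%:E <=
   \int[mu]_x (g1 x)%:E + \int[mu]_x (g2 x)%:E)%E.
Proof.
move=> mf1 mf2 mg1 mg2 f10 f20 g10 g20 H.
rewrite -!ge0_integralD_fin//; apply: ge0_le_integral_fin => //.
- exact: measurable_funD.
- exact: measurable_funD.
- by move=> x; rewrite addr_ge0.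
Qed.

End integral_DD.

(** Adds two inequalities and cancels S + P. Only S and P are known to be finite: in the
    applications they are the two halves of the pairing of phi with L_eps u, while the other
    integrals may diverge. *)
Lemma ereal_cancel {R : realType} (A B C D S P : \bar R) :
  (0 <= A)%E -> (0 <= B)%E -> (0 <= C)%E -> (0 <= D)%E ->
  S \is a fin_num -> P \is a fin_num ->
  (A + S <= P + D)%E -> (P + B <= S + C)%E -> (A + B <= C + D)%E.
Proof.
case: S => // s; case: P => // p; case: C => [c| |] //; case: D => [d| |] //;
case: A => [a| |] //; case: B => [b| |] // _ _ _ _ _ _.
by rewrite -!EFinD !lee_fin; lra.
all: by move=> _ _; rewrite ?addey ?addye ?leey.
Qed.

(** * Duality for the truncated operators and the limit eps to 0 *)

Section test_inequalities.
Context {R : realType} {m : nat}.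
Local Notation n := m.+1.
Local Notation mu := (lebesgue_rV R n).
Implicit Types (x y z : 'rV[R]_n) (u w phi a b g : 'rV[R]_n -> R) (alpha eps c rho : R).

Section fixed_eps.
Variables (alpha eps rho c : R) (u phi g a b : 'rV[R]_n -> R).
Hypotheses (a0 : 0 < alpha) (e0 : 0 < eps) (c0 : 0 <= c).
Hypotheses (wu : weighted_fin alpha u) (tphi : test_fun rho phi).
Hypotheses (mg : measurable_fun setT g) (g0 : forall x, enorm x <= rho -> 0 <= g x).
Hypotheses (ma : measurable_fun setT a) (pa : forall x, 0 <= a x).
Hypotheses (mb : measurable_fun setT b) (pb : forall x, 0 <= b x).
Hypothesis ubnd : exists M, forall x, enorm x <= rho -> u x <= M.

Let mu' : measurable_fun setT u. Proof. by have [] := wu. Qed.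
Let u0 x : 0 <= u x. Proof. by have [] := wu. Qed.
Let mphi : measurable_fun setT phi. Proof. by have [] := tphi. Qed.
Let phi0 x : 0 <= phi x. Proof. by have [] := tphi. Qed.
Let phis x : rho < enorm x -> phi x = 0. Proof. by have [_ _ + _] := tphi; apply. Qed.
Let wphi : weighted_fin alpha phi.
Proof. exact: test_fun_weighted (ltW a0) tphi. Qed.
Let phig0 x : 0 <= phi x * g x.
Proof.
have [xr|/phis ->] := leP (enorm x) rho; last by rewrite mul0r.
by rewrite mulr_ge0// g0.
Qed.

Let mTu := measurable_tconv alpha eps mu' u0.
Let mTphi := measurable_tconv alpha eps mphi phi0.
Let Tu0 x : 0 <= tconv alpha eps u x := tconv_ge0 alpha eps x u0.
Let Tphi0 x : 0 <= tconv alpha eps phi x := tconv_ge0 alpha eps x phi0.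
Let S := (\int[mu]_x (phi x * tconv alpha eps u x)%:E)%E.
Let P := (\int[mu]_x (phi x * u x)%:E)%E.
Let k0 : 0 <= tmass m alpha eps := ltW (tmass_gt0 a0 e0).

Let Sfin : S \is a fin_num.
Proof.
rewrite ge0_fin_numE; last by apply: integral_fin_ge0 => x; rewrite mulr_ge0.
apply: (test_fun_fin tphi) => //; eexists => x xr; exact: (tconv_bound (ltW a0) e0 wu xr).
Qed.

Let Pfin : P \is a fin_num.
Proof.
rewrite ge0_fin_numE; last by apply: integral_fin_ge0 => x; rewrite mulr_ge0.
exact: (test_fun_fin tphi).
Qed.

Let P0 : (0 <= P)%E.
Proof. by apply: integral_fin_ge0 => x; rewrite mulr_ge0. Qed.

Let SE : S = (\int[mu]_x (u x * tconv alpha eps phi x)%:E)%E.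
Proof. exact: tconv_sym (ltW a0) e0 wu wphi. Qed.

Let kphiu0 x : 0 <= tmass m alpha eps * (phi x * u x).
Proof. exact: mulr_ge0 k0 (mulr_ge0 (phi0 x) (u0 x)). Qed.
Let mkphiu : measurable_fun setT (fun x => tmass m alpha eps * (phi x * u x)).
Proof. by apply: measurable_funM => //; exact: measurable_funM. Qed.
Let phiT0 x : 0 <= phi x * tconv alpha eps u x := mulr_ge0 (phi0 x) (Tu0 x).
Let uT0 x : 0 <= u x * tconv alpha eps phi x := mulr_ge0 (u0 x) (Tphi0 x).
Let mphiT : measurable_fun setT (fun x => phi x * tconv alpha eps u x) := measurable_funM mphi mTu.
Let muT : measurable_fun setT (fun x => u x * tconv alpha eps phi x) := measurable_funM mu' mTphi.
Let mphig : measurable_fun setT (fun x => phi x * g x) := measurable_funM mphi mg.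
Let mua : measurable_fun setT (fun x => u x * a x) := measurable_funM mu' ma.
Let mub : measurable_fun setT (fun x => u x * b x) := measurable_funM mu' mb.
Let ua0 x : 0 <= u x * a x := mulr_ge0 (u0 x) (pa x).
Let ub0 x : 0 <= u x * b x := mulr_ge0 (u0 x) (pb x).
Let cphi0 x : 0 <= c * phi x := mulr_ge0 c0 (phi0 x).
Let mcphi : measurable_fun setT (fun x => c * phi x).
Proof. exact: measurable_funM. Qed.
Let mphiu : measurable_fun setT (fun x => phi x * u x) := measurable_funM mphi mu'.
Let phiu0 x : 0 <= phi x * u x := mulr_ge0 (phi0 x) (u0 x).
Let KE : (\int[mu]_x (tmass m alpha eps * (phi x * u x))%:E = (tmass m alpha eps)%:E * P)%E.
Proof. exact: ge0_integralZ_fin k0 mphiu phiu0. Qed.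
Let Kfin : ((tmass m alpha eps)%:E * P)%E \is a fin_num.
Proof. by rewrite fin_numM. Qed.

(** In terms of L_eps the hypotheses read g <= L_eps u + c on the ball and L_eps phi + b <= a
    everywhere. The first is multiplied by phi, the second by u; after integration the two pairings
    of L_eps agree by [tconv_sym] and drop out. *)
Lemma trunc_test_le :
  (forall x, enorm x <= rho -> g x + tconv alpha eps u x <= tmass m alpha eps * u x + c) ->
  (forall x, tmass m alpha eps * phi x + b x <= tconv alpha eps phi x + a x) ->
  (\int[mu]_x (phi x * g x)%:E + \int[mu]_x (u x * b x)%:E <=
   \int[mu]_x (u x * a x)%:E + c%:E * \int[mu]_x (phi x)%:E)%E.
Proof.
move=> H1 H2; rewrite -(ge0_integralZ_fin _ c0 mphi phi0).
have I1 := ge0_le_integralDD mu mphig mphiT mkphiu mcphi phig0 phiT0 kphiu0 cphi0.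
have I2 := ge0_le_integralDD mu mkphiu mub muT mua kphiu0 ub0 uT0 ua0.
have {}I1 : (\int[mu]_x (phi x * g x)%:E + S <=
    (tmass m alpha eps)%:E * P + \int[mu]_x (c * phi x)%:E)%E.
  rewrite -KE; apply: I1 => x; have [xr|/phis ->] := leP (enorm x) rho; last by rewrite !(mul0r, mulr0).
  by rewrite mulrCA (mulrC c) -!mulrDr ler_wpM2l// H1.
have {}I2 : ((tmass m alpha eps)%:E * P + \int[mu]_x (u x * b x)%:E <=
    S + \int[mu]_x (u x * a x)%:E)%E.
  rewrite -KE SE; apply: I2 => x.
  by rewrite mulrA (mulrC (_ * phi x)) -!mulrDr ler_wpM2l// H2.
exact: ereal_cancel (integral_fin_ge0 mu phig0) (integral_fin_ge0 mu ub0)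
  (integral_fin_ge0 mu ua0) (integral_fin_ge0 mu cphi0) Sfin Kfin I1 I2.
Qed.

(** The same argument for - L_eps; together with [trunc_test_le] it gives two-sided bounds. *)
Lemma trunc_test_ge :
  (forall x, enorm x <= rho -> g x + tmass m alpha eps * u x <= tconv alpha eps u x + c) ->
  (forall x, tconv alpha eps phi x <= tmass m alpha eps * phi x + a x) ->
  (\int[mu]_x (phi x * g x)%:E <=
   \int[mu]_x (u x * a x)%:E + c%:E * \int[mu]_x (phi x)%:E)%E.
Proof.
move=> H1 H2; rewrite -(ge0_integralZ_fin _ c0 mphi phi0).
have I1 := ge0_le_integralDD mu mphig mkphiu mphiT mcphi phig0 kphiu0 phiT0 cphi0.
have I2 := ge0_le_integralDD mu muT (@measurable_cst _ _ _ _ setT (0 : R)) mkphiu mua uT0 (fun=> lexx 0) kphiu0 ua0.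
have {}I1 : (\int[mu]_x (phi x * g x)%:E + (tmass m alpha eps)%:E * P <=
    S + \int[mu]_x (c * phi x)%:E)%E.
  rewrite -KE; apply: I1 => x; have [xr|/phis ->] := leP (enorm x) rho; last by rewrite !(mul0r, mulr0).
  by rewrite mulrCA (mulrC c) -!mulrDr ler_wpM2l// H1.
have {}I2 : (S <= (tmass m alpha eps)%:E * P + \int[mu]_x (u x * a x)%:E)%E.
  rewrite -KE SE -[leLHS]adde0 -(@integral0 _ _ _ mu setT); apply: I2 => x.
  by rewrite addr0 mulrA (mulrC (_ * phi x)) -!mulrDr ler_wpM2l// H2.
rewrite -[leLHS]adde0; apply: (ereal_cancel (integral_fin_ge0 mu phig0) _
  (integral_fin_ge0 mu ua0) (integral_fin_ge0 mu cphi0) Kfin Sfin) => //.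
by rewrite adde0.
Qed.

End fixed_eps.

(* [w] is the operator [(-Delta)^(alpha/2)] of [u], up to the normalising
   constant, as a locally uniform limit of truncated singular integrals. *)
Definition frac_pair alpha u w : Prop :=
  [/\ weighted_fin alpha u, continuous u, continuous w &
    forall rho (e : R), 0 < rho -> 0 < e -> exists d : R, 0 < d /\
      forall eps x, 0 < eps -> eps < d -> enorm x <= rho ->
        `|tmass m alpha eps * u x - tconv alpha eps u x - w x| <= e].

Lemma compact_eball (rho : R) : compact (@eball R n rho).
Proof.
apply: bounded_closed_compact.
  exists rho; split; first exact: num_real.
  by move=> M rM x xr; apply: le_trans (norm_le_enorm x) (le_trans xr (ltW rM)).
rewrite (_ : eball rho = (@enorm R n) @^-1` [set x | x <= rho]) //.
by apply: closed_comp; [move=> x _; exact: continuous_enorm|exact: closed_le].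
Qed.

Lemma continuous_bounded_eball (f : 'rV[R]_n -> R) (rho : R) : continuous f ->
  exists2 M : R, 0 <= M & forall x, enorm x <= rho -> `|f x| <= M.
Proof.
move=> cf; have cB := @compact_eball rho.
have cfB : compact (f @` eball rho).
  by apply: continuous_compact => //; apply: continuous_subspaceT.
have [M [Mr HM]] := compact_bounded cfB.
exists (`|M| + 1); first by rewrite addr_ge0.
move=> x xr; apply: (HM (`|M| + 1)); last by exists x.
by rewrite (le_lt_trans (ler_norm M))// ltrDl.
Qed.

Lemma test_fun_integral_fin rho phi : test_fun rho phi ->
  (\int[mu]_x (phi x)%:E < +oo)%E.
Proof.
move=> tphi; have := test_fun_fin (g := fun=> 1) tphi.
under eq_integral do rewrite mulr1.
by apply => //; exists 1.
Qed.

(** The convergence of L_eps u to w is uniform on the ball that carries phi, so for small eps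
    [trunc_test_le] applies with g = w and a constant c whose total contribution is below any
    prescribed e. *)
Lemma frac_pair_test alpha u w phi rho a b (d0 : R) : 0 < alpha -> 0 < rho -> 0 < d0 ->
  frac_pair alpha u w -> test_fun rho phi ->
  (forall x, enorm x <= rho -> 0 <= w x) ->
  measurable_fun setT a -> (forall x, 0 <= a x) ->
  measurable_fun setT b -> (forall x, 0 <= b x) ->
  (forall eps x, 0 < eps -> eps < d0 ->
     tmass m alpha eps * phi x + b x <= tconv alpha eps phi x + a x) ->
  (\int[mu]_x (phi x * w x)%:E + \int[mu]_x (u x * b x)%:E <= \int[mu]_x (u x * a x)%:E)%E.
Proof.
move=> a0 rho0 d00 [wu cu cw Luw] tphi w0 ma pa mb pb H.
have mw := continuous_measurable_rV cw.
have [Mu Mu0 HMu] := continuous_bounded_eball rho cu.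
have [mphi phi0 phis [N phiN]] := tphi.
have phifin := test_fun_integral_fin tphi.
have I0 := integral_fin_ge0 mu phi0.
apply/lee_addgt0Pr => e e0.
pose J := fine (\int[mu]_x (phi x)%:E).
have JE : (\int[mu]_x (phi x)%:E = J%:E)%E by rewrite fineK// ge0_fin_numE.
have J0 : 0 <= J by rewrite -lee_fin -JE.
(* The error is spread over the mass J of phi; J + 1 avoids a division by 0. *)
have c0 : 0 < e / (J + 1) by rewrite divr_gt0// ltr_wpDl.
have [d [d0' Hd]] := Luw _ _ rho0 c0.
pose eps := Num.min d d0 / 2.
have eps0 : 0 < eps by rewrite divr_gt0// lt_min d0'.
have epsm : eps < Num.min d d0 by rewrite /eps ltr_pdivrMr// mulr_natr mulr2n ltrDl lt_min d0'.
move: epsm; rewrite lt_min => /andP[ed ed0].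
have := @trunc_test_le alpha eps rho (e / (J + 1)) u phi w a b a0 eps0 (ltW c0) wu tphi mw w0 ma pa mb pb.
move=> /(_ _ _ _)/le_trans; apply => //.
- by exists Mu => x xr; rewrite (le_trans (ler_norm _))// HMu.
- move=> x xr; have := Hd eps x eps0 ed xr; rewrite ler_norml => /andP[]; lra.
- by move=> x; exact: H.
- rewrite JE leeD2l// -EFinM lee_fin mulrAC ler_pdivrMr ?ltr_wpDl//.
  by rewrite ler_wpM2l ?(ltW e0)// lerDl.
Qed.

Lemma test_fun_integrable rho phi w : test_fun rho phi -> continuous w ->
  mu.-integrable setT (EFin \o (fun x => phi x * w x)).
Proof.
move=> tphi cw; have [mphi phi0 phis [N phiN]] := tphi.
have mw := continuous_measurable_rV cw.
have [M M0 HM] := continuous_bounded_eball rho cw.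
apply/integrableP; split; first by apply/measurable_EFinP; exact: measurable_funM.
under eq_integral do rewrite /= normrM (ger0_norm (phi0 _)).
apply: (test_fun_fin tphi (g := fun x => `|w x|)) => //.
- by apply: measurableT_comp.
- by exists M.
Qed.

(** Here w may change sign. With W a bound of |w| on the ball, w + W and W - w are non-negative
    there and can be tested; the terms W J that this adds appear on both sides and are finite. *)
Lemma frac_pair_test_abs alpha u w phi rho a (d0 : R) : 0 < alpha -> 0 < rho -> 0 < d0 ->
  frac_pair alpha u w -> test_fun rho phi ->
  measurable_fun setT a -> (forall x, 0 <= a x) ->
  (forall eps x, 0 < eps -> eps < d0 ->
     `|tmass m alpha eps * phi x - tconv alpha eps phi x| <= a x) ->
  (`|\int[mu]_x (phi x * w x)|%:E <= \int[mu]_x (u x * a x)%:E)%E.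
Proof.
move=> a0 rho0 d00 pr tphi ma pa H; have [wu cu cw Luw] := pr.
have mw := continuous_measurable_rV cw.
have [Mu Mu0 HMu] := continuous_bounded_eball rho cu.
have [W W0 HW] := continuous_bounded_eball rho cw.
have [mphi phi0 phis [N phiN]] := tphi.
have phifin := test_fun_integral_fin tphi.
have I0 := integral_fin_ge0 mu phi0.
pose J := fine (\int[mu]_x (phi x)%:E).
have JE : (\int[mu]_x (phi x)%:E = J%:E)%E by rewrite fineK// ge0_fin_numE.
have J0 : 0 <= J by rewrite -lee_fin -JE.
have [_ u0 _] := wu.
have A0 : (0 <= \int[mu]_x (u x * a x)%:E)%E by apply: integral_fin_ge0 => x; rewrite mulr_ge0.
apply/lee_addgt0Pr => e e0.
have c0 : 0 < e / (J + 1) by rewrite divr_gt0// ltr_wpDl.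
have [d [d0' Hd]] := Luw _ _ rho0 c0.
pose eps := Num.min d d0 / 2.
have eps0 : 0 < eps by rewrite divr_gt0// lt_min d0'.
have epsm : eps < Num.min d d0 by rewrite /eps ltr_pdivrMr// mulr_natr mulr2n ltrDl lt_min d0'.
move: epsm; rewrite lt_min => /andP[ed ed0].
have iw := test_fun_integrable tphi cw.
have iW : mu.-integrable setT (EFin \o (fun x => phi x * W)).
  by apply: (test_fun_integrable tphi (w := cst W)) => x; exact: cst_continuous.
have RW : \int[mu]_x (phi x * W) = J * W.
  by rewrite /Rintegral; under eq_integral do rewrite mulrC; rewrite ge0_integralZ_fin// JE /= mulrC.
have ub : exists M, forall x, enorm x <= rho -> u x <= M.
  by exists Mu => x xr; rewrite (le_trans (ler_norm _))// HMu.
have cW0 : 0 <= e / (J + 1) + W by rewrite addr_ge0// ltW.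
have eJ : e / (J + 1) * J <= e.
  by rewrite mulrAC ler_pdivrMr ?ltr_wpDl// ler_wpM2l ?(ltW e0)// lerDl.
have toR (g : 'rV[R]_n -> R) (r : R) : mu.-integrable setT (EFin \o g) -> \int[mu]_x g x = r ->
    (\int[mu]_x (g x)%:E = r%:E)%E.
  by move=> ig <-; rewrite /Rintegral fineK//; apply: integrable_fin_num.
have [L1 L2] : ((\int[mu]_x (phi x * w x))%:E <= \int[mu]_x (u x * a x)%:E + e%:E)%E /\
    ((- \int[mu]_x (phi x * w x))%:E <= \int[mu]_x (u x * a x)%:E + e%:E)%E.
  split.
  - have := @trunc_test_le alpha eps rho (e / (J + 1) + W) u phi (fun x => w x + W) a (cst 0)
      a0 eps0 cW0 wu tphi (measurable_funD mw (measurable_cst _)).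
    move=> /(_ _ ma pa (measurable_cst _) (fun=> lexx _) ub _ _).
    under [X in (_ + X <= _)%E]eq_integral do rewrite /= mulr0.
    rewrite integral0 adde0 JE.
    rewrite (toR _ (\int[mu]_x (phi x * w x) + J * W)); last 2 first.
    - by under eq_fun do rewrite mulrDr; exact: (integrableD _ iw iW).
    - by rewrite -RW -RintegralD//; apply: eq_Rintegral => x _; rewrite mulrDr.
    move=> HH; have {HH} : ((\int[mu]_x (phi x * w x) + J * W)%:E <= \int[mu]_x (u x * a x)%:E + (e / (J + 1) + W)%:E * J%:E)%E.
      apply: HH.
      - by move=> x /HW; rewrite ler_norml => /andP[]; lra.
      - move=> x xr; have := Hd eps x eps0 ed xr; rewrite ler_norml => /andP[]; lra.
      - by move=> x; have := H eps x eps0 ed0; rewrite ler_norml addr0 => /andP[]; lra.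
    case: (\int[mu]_x (u x * a x)%:E)%E A0 => [r| |] // A0; last by move=> _; rewrite addye// leey.
    by rewrite -EFinM -!EFinD !lee_fin mulrDl; lra.
  - have := @trunc_test_ge alpha eps rho (e / (J + 1) + W) u phi (fun x => W - w x) a
      a0 eps0 cW0 wu tphi (measurable_funB (measurable_cst _) mw).
    move=> /(_ _ ma pa ub _ _); rewrite JE.
    rewrite (toR _ (J * W - \int[mu]_x (phi x * w x))); last 2 first.
    - by under eq_fun do rewrite mulrBr; exact: (integrableB _ iW iw).
    - by rewrite -RW -RintegralB//; apply: eq_Rintegral => x _; rewrite mulrBr.
    move=> HH; have {HH} : ((J * W - \int[mu]_x (phi x * w x))%:E <= \int[mu]_x (u x * a x)%:E + (e / (J + 1) + W)%:E * J%:E)%E.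
      apply: HH.
      - by move=> x /HW; rewrite ler_norml => /andP[]; lra.
      - move=> x xr; have := Hd eps x eps0 ed xr; rewrite ler_norml => /andP[]; lra.
      - by move=> x; have := H eps x eps0 ed0; rewrite ler_norml => /andP[]; lra.
    case: (\int[mu]_x (u x * a x)%:E)%E A0 => [r| |] // A0; last by move=> _; rewrite addye// leey.
    by rewrite -EFinM -!EFinD !lee_fin mulrDl; lra.
by have [] := ger0P (\int[mu]_x (phi x * w x)).
Qed.

End test_inequalities.

(** * Bounds on the truncated operator from second differences *)

Section second_difference.
Context {R : realType} {m : nat}.
Local Notation n := m.+1.
Local Notation mu := (lebesgue_rV R n).
Implicit Types (x y z : 'rV[R]_n) (f : 'rV[R]_n -> R) (alpha eps c rho : R).

(** The integral of |z|^(-n-alpha) against min(|z|^2, 1): the unit ball contributes the term with 2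
    - alpha, its complement the term with alpha. *)
Definition sd_const alpha : R := n%:R * ball_vol R m * ((2 - alpha)^-1 + alpha^-1).

Lemma sd_const_gt0 alpha : 0 < alpha -> alpha < 2 -> 0 < sd_const alpha.
Proof.
move=> a0 a2; rewrite !mulr_gt0// ?ball_vol_gt0// addr_gt0// invr_gt0//; lra.
Qed.

Lemma measurable_min_sqr : measurable_fun setT (fun z : 'rV[R]_n => Num.min (enorm z ^+ 2) 1).
Proof. by apply: measurable_minr => //; meas. Qed.

Lemma min_sqr_ge0 z : 0 <= Num.min (enorm z ^+ 2) 1.
Proof. by rewrite le_min ler01 exprn_ge0// enorm_ge0. Qed.

Lemma integral_tker_min alpha eps : 0 < alpha -> alpha < 2 -> 0 < eps ->
  (\int[mu]_z (tker alpha eps z * Num.min (enorm z ^+ 2) 1)%:E <= (sd_const alpha)%:E)%E.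
Proof.
move=> a0 a2 e0.
pose A z : R := (enorm z <= 1)%R%:R * enorm z `^ ((2 - alpha) - n%:R).
pose B z : R := (1 <= enorm z)%R%:R * enorm z `^ (- (n%:R + alpha)).
have mA : measurable_fun setT A by rewrite /A; meas.
have mB : measurable_fun setT B by rewrite /B; meas.
have A0 z : 0 <= A z by rewrite /A mulr_ge0// powR_ge0.
have B0 z : 0 <= B z by rewrite /B mulr_ge0// powR_ge0.
apply: (@le_trans _ _ (\int[mu]_z (A z + B z)%:E)%E).
  apply: ge0_le_integral_fin.
  - by apply: measurable_funM; [exact: measurable_tker|exact: measurable_min_sqr].
  - exact: measurable_funD.
  - by move=> z; rewrite mulr_ge0 ?tker_ge0 ?min_sqr_ge0.
  move=> z; rewrite /tker; case: (leP eps (enorm z)) => [ez|_]; last by rewrite !mul0r addr_ge0.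
  have z0 : 0 < enorm z := lt_le_trans e0 ez.
  rewrite mul1r; case: (leP (enorm z) 1) => [z1|z1].
    have /min_idPl -> : enorm z ^+ 2 <= 1 by rewrite expr_le1 ?enorm_ge0.
    rewrite (le_trans (y := A z)) ?lerDl//.
    rewrite /A z1 mul1r /rker -(powR_mulrn 2 (enorm_ge0 z)) -powRD ?(gt_eqF z0) ?implybT//.
    by rewrite (_ : - (n%:R + alpha) + 2 = 2 - alpha - n%:R) //; ring.
  have /min_idPr -> : 1 <= enorm z ^+ 2 by rewrite expr_ge1 ?enorm_ge0// ltW.
  by rewrite mulr1 (le_trans (y := B z)) ?lerDr// /B (ltW z1) mul1r.
rewrite ge0_integralD_fin// /sd_const mulrDr EFinD leeD//.
  have := @integral_enorm_0 R m 1 (2 - alpha); rewrite powR1 div1r; apply; lra.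
by rewrite (@integral_enorm_infty R m 1 alpha)// powR1 div1r.
Qed.

Lemma measurable_shiftN f x : measurable_fun setT f -> measurable_fun setT (fun z => f (x - z)).
Proof. by move=> mf; apply: (measurableT_comp mf); meas. Qed.

Lemma tconv_opp alpha eps f x : measurable_fun setT f -> (forall x, 0 <= f x) ->
  (\int[mu]_z (tker alpha eps z * f (x - z))%:E =
   \int[mu]_z (tker alpha eps z * f (x + z))%:E)%E.
Proof.
move=> mf f0; rewrite -[RHS]ge0_integral_opp.
- by apply: eq_integral => z _; rewrite tker_even.
- exact: measurable_tconv_int.
- by move=> z; rewrite mulr_ge0 ?tker_ge0.
Qed.

Section sd_fixed.
Variables (alpha eps c : R) (f : 'rV[R]_n -> R) (x : 'rV[R]_n).
Hypotheses (a0 : 0 < alpha) (a2 : alpha < 2) (e0 : 0 < eps) (c0 : 0 <= c).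
Hypothesis wf : weighted_fin alpha f.

Let mf : measurable_fun setT f. Proof. by have [] := wf. Qed.
Let f0 y : 0 <= f y. Proof. by have [] := wf. Qed.
Let tk0 z : 0 <= tker alpha eps z := tker_ge0 alpha eps z.
Let mtk := @measurable_tker R m alpha eps.

Let mS : measurable_fun setT (fun z => tker alpha eps z * (f (x + z) + f (x - z))).
Proof.
apply: measurable_funM => //; apply: measurable_funD; [exact: measurable_shift|exact: measurable_shiftN].
Qed.
Let S0 z : 0 <= tker alpha eps z * (f (x + z) + f (x - z)).
Proof. by rewrite mulr_ge0// addr_ge0. Qed.
Let mC : measurable_fun setT (fun z => c * (tker alpha eps z * Num.min (enorm z ^+ 2) 1)).
Proof. by apply: measurable_funM => //; apply: measurable_funM => //; exact: measurable_min_sqr. Qed.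
Let tm0 z : 0 <= tker alpha eps z * Num.min (enorm z ^+ 2) 1.
Proof. by rewrite mulr_ge0// min_sqr_ge0. Qed.
Let C0 z : 0 <= c * (tker alpha eps z * Num.min (enorm z ^+ 2) 1) := mulr_ge0 c0 (tm0 z).

Let SE : (\int[mu]_z (tker alpha eps z * (f (x + z) + f (x - z)))%:E =
  (2 * tconv alpha eps f x)%:E)%E.
Proof.
under eq_integral do rewrite mulrDr.
rewrite ge0_integralD_fin//; last 4 first.
- exact: measurable_tconv_int.
- by apply: measurable_funM => //; exact: measurable_shiftN.
- by move=> z; rewrite mulr_ge0.
- by move=> z; rewrite mulr_ge0.
rewrite (tconv_opp _ _ _ mf f0) (tconvE x (ltW a0) e0 wf) -EFinD.
by rewrite mulrC mulr_natr mulr2n.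
Qed.

Let f2E : (\int[mu]_z (2 * f x * tker alpha eps z)%:E = (2 * f x * tmass m alpha eps)%:E)%E.
Proof. by rewrite ge0_integralZ_fin ?mulr_ge0// integral_tker// EFinM. Qed.

Let CE : (\int[mu]_z (c * (tker alpha eps z * Num.min (enorm z ^+ 2) 1))%:E <=
  (c * sd_const alpha)%:E)%E.
Proof.
rewrite ge0_integralZ_fin//; last by apply: measurable_funM => //; exact: measurable_min_sqr.
by rewrite EFinM lee_wpmul2l ?lee_fin// integral_tker_min.
Qed.

(** Averaging z and - z removes the first-order term; what is left is paid by min(|z|^2, 1), whose
    integral against the kernel is bounded by [sd_const] uniformly in eps. *)
Lemma second_diff_le :
  (forall z, 2 * f x <= f (x + z) + f (x - z) + c * Num.min (enorm z ^+ 2) 1) ->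
  tmass m alpha eps * f x <= tconv alpha eps f x + c * sd_const alpha.
Proof.
move=> H.
have : (\int[mu]_z (2 * f x * tker alpha eps z)%:E <=
   \int[mu]_z (tker alpha eps z * (f (x + z) + f (x - z)) +
      c * (tker alpha eps z * Num.min (enorm z ^+ 2) 1))%:E)%E.
  apply: ge0_le_integral_fin => //.
  - exact: measurable_funM.
  - exact: measurable_funD.
  - by move=> z; rewrite mulr_ge0// mulr_ge0.
  move=> z; rewrite (mulrCA c) -mulrDr [leLHS]mulrC ler_wpM2l//.
rewrite f2E ge0_integralD_fin// SE => /le_trans/(_ (leeD (lexx _) CE)).
rewrite -EFinD lee_fin => H1.
have : 0 <= c * sd_const alpha by rewrite mulr_ge0// ltW// sd_const_gt0.
lra.
Qed.

Lemma second_diff_ge :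
  (forall z, f (x + z) + f (x - z) <= 2 * f x + c * Num.min (enorm z ^+ 2) 1) ->
  tconv alpha eps f x <= tmass m alpha eps * f x + c * sd_const alpha.
Proof.
move=> H.
have : (\int[mu]_z (tker alpha eps z * (f (x + z) + f (x - z)))%:E <=
   \int[mu]_z (2 * f x * tker alpha eps z +
      c * (tker alpha eps z * Num.min (enorm z ^+ 2) 1))%:E)%E.
  apply: ge0_le_integral_fin => //.
  - by apply: measurable_funD => //; exact: measurable_funM.
  move=> z; rewrite (mulrCA c) (mulrC (2 * f x)) -mulrDr ler_wpM2l//.
rewrite SE ge0_integralD_fin//; last 2 first.
- exact: measurable_funM.
- by move=> z; rewrite mulr_ge0// mulr_ge0.
rewrite f2E => /le_trans/(_ (leeD (lexx _) CE)).
rewrite -EFinD lee_fin => H1.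
have : 0 <= c * sd_const alpha by rewrite mulr_ge0// ltW// sd_const_gt0.
lra.
Qed.

End sd_fixed.
End second_difference.

(** * The annular bump and the sharp bound on its operator *)

Section annular_bump.
Context {R : realType} {m : nat}.
Local Notation n := m.+1.
Local Notation mu := (lebesgue_rV R n).
Implicit Types (x y z : 'rV[R]_n) (alpha eps c rho : R).

Definition annulus_poly x : R := (enorm x ^+ 2 - 1) * (4 - enorm x ^+ 2).
(** The square root g of the bump is itself the square of a positive part, hence of class C^(1,1).
    That [abump] is a square is what [abump_operator_le] exploits. *)
Definition abump_root x : R := Num.max (annulus_poly x) 0 ^+ 2.
Definition abump x : R := abump_root x ^+ 2.

Lemma annulus_poly_le x : annulus_poly x <= 9 / 4.
Proof. by rewrite /annulus_poly; have := sqr_ge0 (enorm x ^+ 2 - 5 / 2); lra. Qed.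

Lemma pos_part_le x : Num.max (annulus_poly x) 0 <= 9 / 4.
Proof. by rewrite ge_max annulus_poly_le; lra. Qed.

Lemma pos_part_ge0 x : 0 <= Num.max (annulus_poly x) 0.
Proof. by rewrite le_max lexx orbT. Qed.

Lemma abump_root_ge0 x : 0 <= abump_root x. Proof. exact: sqr_ge0. Qed.
Lemma abump_ge0 x : 0 <= abump x. Proof. exact: sqr_ge0. Qed.

Lemma abump_root_le x : abump_root x <= 6.
Proof.
rewrite /abump_root; have := pos_part_le x; have := pos_part_ge0 x.
set p := Num.max _ _ => p0 p1; nra.
Qed.

Lemma abump_le x : abump x <= 36.
Proof. by rewrite /abump; have := abump_root_le x; have := abump_root_ge0 x; nra. Qed.

Lemma measurable_abump_root : measurable_fun setT abump_root.
Proof.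
rewrite /abump_root; apply: measurable_funX; apply: measurable_maxr => //.
by rewrite /annulus_poly; meas.
Qed.

Lemma measurable_abump : measurable_fun setT abump.
Proof. by apply: measurable_funX; exact: measurable_abump_root. Qed.

Lemma abump_root_out x : 2 <= enorm x -> abump_root x = 0.
Proof.
move=> x2; rewrite /abump_root (_ : Num.max _ _ = 0) ?expr0n//.
apply/max_idPr; rewrite /annulus_poly; have : 4 <= enorm x ^+ 2 by nra.
by nra.
Qed.

Lemma abump_root_in x : enorm x <= 1 -> abump_root x = 0.
Proof.
move=> x1; rewrite /abump_root (_ : Num.max _ _ = 0) ?expr0n//.
apply/max_idPr; rewrite /annulus_poly.
have : enorm x ^+ 2 <= 1 by rewrite expr_le1 ?enorm_ge0.
by nra.
Qed.

Lemma abump_test : test_fun 2 abump.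
Proof.
split; [exact: measurable_abump|exact: abump_ge0| |by exists 36; exact: abump_le].
by move=> x x2; rewrite /abump abump_root_out ?expr0n// ltW.
Qed.

Lemma abump_root_test : test_fun 2 abump_root.
Proof.
split; [exact: measurable_abump_root|exact: abump_root_ge0| |by exists 6; exact: abump_root_le].
by move=> x x2; rewrite abump_root_out// ltW.
Qed.

(** The function t_+^2 is convex with second derivative at most 2: it lies above its tangent and, by
    the next lemma, below the tangent plus (b - a)^2. *)
Lemma pos_sqr_ge (a b : R) : Num.max b 0 ^+ 2 >= Num.max a 0 ^+ 2 + 2 * Num.max a 0 * (b - a).
Proof. by have := sqr_ge0 (a - b); case: (leP a 0) => a0; case: (leP b 0) => b0 h; rewrite ?expr0n /=; nra. Qed.

Lemma pos_sqr_le (a b : R) :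
  Num.max b 0 ^+ 2 <= Num.max a 0 ^+ 2 + 2 * Num.max a 0 * (b - a) + (b - a) ^+ 2.
Proof. by have := sqr_ge0 (a - b); case: (leP a 0) => a0; case: (leP b 0) => b0 h; rewrite ?expr0n /=; nra. Qed.

Lemma annulus_poly_diff x z : enorm x <= 4 -> enorm z <= 1 ->
  `|annulus_poly (x + z) - annulus_poly x| <= 500 * enorm z.
Proof.
move=> x4 z1; rewrite /annulus_poly enorm_sqrD.
have z0 := enorm_ge0 z; have x0 := enorm_ge0 x.
have : `|edot x z| <= 4 * enorm z by rewrite (le_trans (edot_abs_le _ _))// ler_wpM2r.
set d := edot x z; set a := enorm z in z1 z0 *; set b := enorm x in x4 x0 *.
rewrite ler_norml => /andP[d1 d2].
rewrite (_ : _ - _ = (2 * d + a ^+ 2) * (5 - 2 * b ^+ 2 - 2 * d - a ^+ 2)); last by ring.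
have h1 : `|2 * d + a ^+ 2| <= 9 * a by rewrite ler_norml; apply/andP; split; nra.
have h2 : `|5 - 2 * b ^+ 2 - 2 * d - a ^+ 2| <= 50.
  have : b ^+ 2 <= 16 by nra.
  by rewrite ler_norml => ?; apply/andP; split; nra.
rewrite normrM (le_trans (ler_pM _ _ h1 h2))//; nra.
Qed.

Lemma annulus_poly_diff2 x z : enorm x <= 4 -> enorm z <= 1 ->
  `|annulus_poly (x + z) + annulus_poly (x - z) - 2 * annulus_poly x| <= 300 * enorm z ^+ 2.
Proof.
move=> x4 z1; rewrite /annulus_poly !enorm_sqrD enormN edotNr.
have z0 := enorm_ge0 z; have x0 := enorm_ge0 x.
have : `|edot x z| <= 4 * enorm z by rewrite (le_trans (edot_abs_le _ _))// ler_wpM2r.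
set d := edot x z; set a := enorm z in z1 z0 *; set b := enorm x in x4 x0 *.
rewrite -(@ler_pXn2r _ 2)// ?nnegrE ?mulr_ge0// exprMn real_normK ?num_real// => d2.
have b2 : b ^+ 2 <= 16 by nra.
have b20 : 0 <= b ^+ 2 by exact: sqr_ge0.
have a2 : a ^+ 2 <= 1 by nra.
have a20 : 0 <= a ^+ 2 by exact: sqr_ge0.
rewrite (_ : _ - _ = 10 * a ^+ 2 - 2 * (2 * (b ^+ 2 * a ^+ 2) + a ^+ 2 * a ^+ 2 + 4 * d ^+ 2)); last by ring.
have d20 := sqr_ge0 d.
by rewrite ler_norml; apply/andP; split; nra.
Qed.

Lemma annulus_poly_bounds : exists2 L : R, 0 <= L & forall x z, enorm x <= 4 -> enorm z <= 1 ->
  `|annulus_poly (x + z) - annulus_poly x| <= L * enorm z /\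
  `|annulus_poly (x + z) + annulus_poly (x - z) - 2 * annulus_poly x| <= L * enorm z ^+ 2.
Proof.
exists 500 => [|x z x4 z1]; first by lra.
split; first exact: annulus_poly_diff.
apply: le_trans (annulus_poly_diff2 x4 z1) _; apply: ler_wpM2r; first exact: sqr_ge0.
by lra.
Qed.

Section abump_algebra.
Variables (L t a b c p g gp gm : R).
Hypotheses (L0 : 0 <= L) (t0 : 0 <= t) (t1 : t <= 1) (p0 : 0 <= p) (p3 : p <= 3).
Hypotheses (bL : `|b - a| <= L * t) (cL : `|c - a| <= L * t).
Hypothesis bcL : `|b + c - 2 * a| <= L * t ^+ 2.
Hypotheses (gp1 : g + 2 * p * (b - a) <= gp) (gm1 : g + 2 * p * (c - a) <= gm).
Hypotheses (gp2 : gp <= g + 2 * p * (b - a) + (b - a) ^+ 2)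
           (gm2 : gm <= g + 2 * p * (c - a) + (c - a) ^+ 2).

Let t2 : 0 <= t ^+ 2. Proof. exact: sqr_ge0. Qed.
Let pbc : `|p * (b + c - 2 * a)| <= 3 * (L * t ^+ 2).
Proof. by rewrite normrM (ger0_norm p0); apply: ler_pM. Qed.

Lemma abump_algebra1 : 2 * g <= gp + gm + 6 * L * t ^+ 2.
Proof. by move: pbc gp1 gm1; rewrite ler_norml => /andP[h _] h1 h2; lra. Qed.

End abump_algebra.

Lemma abump_root_diff2_ge : exists2 K : R, 0 <= K & forall x z,
  2 * abump_root x <= abump_root (x + z) + abump_root (x - z) + K * Num.min (enorm z ^+ 2) 1.
Proof.
have [L L0 HL] := annulus_poly_bounds.
(* The part 12 is twice the bound 6 on [abump_root] and serves |z| >= 1; the part 6 L comes from the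
   tangent slope 2 p with p <= 3 and serves |z| < 1. *)
exists (12 + 6 * L) => [|x z]; first by lra.
have B1 := abump_root_ge0 (x + z); have B2 := abump_root_ge0 (x - z).
have M0 := min_sqr_ge0 z.
have [x2|x2] := leP 2 (enorm x).
  rewrite (abump_root_out x2); have : 0 <= (12 + 6 * L) * Num.min (enorm z ^+ 2) 1 by apply: mulr_ge0 => //; lra.
  by lra.
have [z1|z1] := leP 1 (enorm z).
  have /min_idPr -> : 1 <= enorm z ^+ 2 by rewrite expr_ge1 ?enorm_ge0.
  by have := abump_root_le x; lra.
have /min_idPl -> : enorm z ^+ 2 <= 1 by rewrite expr_le1 ?enorm_ge0// ltW.
have x4 : enorm x <= 4 by lra.
have [_ H] := HL x z x4 (ltW z1).
have p3 : Num.max (annulus_poly x) 0 <= 3 by have := pos_part_le x; lra.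
have := abump_algebra1 (pos_part_ge0 x) p3 H (pos_sqr_ge _ _) (pos_sqr_ge _ _).
rewrite -!/(abump_root _); have : 0 <= enorm z ^+ 2 by exact: sqr_ge0.
by lra.
Qed.

End annular_bump.

Lemma powRN_scale {R : realType} (a c g : R) : 0 <= a -> 0 < c ->
  a `^ (- g) = c `^ g * (c * a) `^ (- g).
Proof.
move=> a0 c0; rewrite powRM ?(ltW c0)// mulrA -powRD ?(gt_eqF c0) ?implybT//.
by rewrite subrr powRr0 mul1r.
Qed.

Section abump_inequalities.
Context {R : realType} {m : nat}.
Local Notation n := m.+1.
Local Notation mu := (lebesgue_rV R n).
Implicit Types (x y z : 'rV[R]_n) (alpha eps c rho : R).
Local Notation abump := (@abump R m).
Local Notation abump_root := (@abump_root R m).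

Definition abump_int : R := fine (\int[mu]_x (abump x)%:E).

Lemma abump_intE : (\int[mu]_x (abump x)%:E = abump_int%:E)%E.
Proof.
rewrite fineK// ge0_fin_numE; first exact: test_fun_integral_fin abump_test.
exact: integral_fin_ge0 abump_ge0.
Qed.

Lemma abump_int_gt0 : 0 < abump_int.
Proof.
(* On this shell the bump is at least 1/16, and the shell has positive measure because the balls of
   radii 7/4 and 5/4 have different volumes. *)
pose A x : R := (5 / 4 <= enorm x <= 7 / 4)%R%:R.
have mA : measurable_fun setT A by rewrite /A; meas.
have A0 x : 0 <= A x by rewrite /A.
have H1 : (\int[mu]_x (16^-1 * A x)%:E <= abump_int%:E)%E.
  rewrite -abump_intE; apply: ge0_le_integral_fin.
  - exact: measurable_funM.
  - exact: measurable_abump.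
  - by move=> x; rewrite mulr_ge0.
  move=> x; rewrite /A; case: andP => [[x1 x2]|_]; last by rewrite mulr0 abump_ge0.
  have N1 : 25 / 16 <= enorm x ^+ 2 by nra.
  have N2 : enorm x ^+ 2 <= 49 / 16 by nra.
  have P1 : 1 / 2 <= annulus_poly x by rewrite /annulus_poly; nra.
  have P2 : 1 / 2 <= Num.max (annulus_poly x) 0 by rewrite le_max P1.
  have P3 : 1 / 4 <= abump_root x by rewrite /abump_root; nra.
  by rewrite /abump /=; nra.
have H2 : (mu (eball (7 / 4)%R) <= \int[mu]_x (A x)%:E + mu (eball (5 / 4)%R))%E.
  rewrite -!integral_eball -ge0_integralD_fin//; last by meas.
  apply: ge0_le_integral_fin => //; [meas|by apply: measurable_funD => //; meas|].
  move=> x; rewrite /A; case: (leP (enorm x) (7 / 4)) => h1; last by rewrite addr_ge0.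
  case: (leP (5 / 4) (enorm x)) => h2 /=; first by rewrite lerDl.
  by rewrite (ltW h2) add0r.
rewrite !lebesgue_eball in H2; try lra.
have v0 := ball_vol_gt0 (R := R) (m := m).
have A1 : (0 < \int[mu]_x (A x)%:E)%E.
  have lt1 : (((5 / 4) ^+ n * ball_vol R m)%:E < ((7 / 4) ^+ n * ball_vol R m)%:E)%E.
    by rewrite lte_fin ltr_pM2r// ltrXn2r//; lra.
  rewrite ltNge; apply/negP => A1; have := lt_le_trans lt1 H2.
  by rewrite -[ltLHS]add0e => /(lt_le_trans)/(_ (leeD2r _ A1)); rewrite ltxx.
rewrite ge0_integralZ_fin ?invr_ge0// in H1.
rewrite -lte_fin; apply: lt_le_trans H1.
by rewrite mule_gt0// lte_fin invr_gt0.
Qed.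

Section abump_operator.
Variable alpha : R.
Hypotheses (a0 : 0 < alpha) (a2 : alpha < 2).

Let wb : weighted_fin alpha abump := test_fun_weighted (ltW a0) abump_test.
Let wb2 : weighted_fin alpha abump_root := test_fun_weighted (ltW a0) abump_root_test.

(** By the second hypothesis a ball of radius d holds at most half of the mass of the bump, since
    [abump] <= 36. The rest lies at distance at least d from x and at most 2 + |x| <= 2 (1 + |x|),
    where the kernel is at least a multiple of [weight]. *)
Lemma abump_tconv_far (d : R) x : 0 < d ->
  36 * (d ^+ n * ball_vol R m) <= abump_int / 2 ->
  2 `^ (- (n%:R + alpha)) * (abump_int / 2) * weight alpha x <= tconv alpha d abump x.
Proof.
move=> d0 dI.
pose B z : R := (d <= enorm z)%R%:R * abump (x + z).
have mbx : measurable_fun setT (fun z => abump (x + z)) by apply: measurable_shift; exact: measurable_abump.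
have mB : measurable_fun setT B by apply: measurable_funM => //; meas.
have B0 z : 0 <= B z by rewrite mulr_ge0// abump_ge0.
have H1 : ((abump_int / 2)%:E <= \int[mu]_z (B z)%:E)%E.
  have : (abump_int%:E <= \int[mu]_z (B z)%:E + (36 * (d ^+ n * ball_vol R m))%:E)%E.
    rewrite -abump_intE -(integral_shift_addl x measurable_abump abump_ge0).
    rewrite (EFinM 36) -(lebesgue_eball d0) -integral_eball -ge0_integralZ_fin//; last by meas.
    rewrite -ge0_integralD_fin//; last by apply: measurable_funM => //; meas.
    apply: ge0_le_integral_fin => //.
    - by apply: measurable_funD => //; apply: measurable_funM => //; meas.
    - by move=> z; exact: abump_ge0.
    move=> z; rewrite /B; case: (leP d (enorm z)) => h.
      by rewrite mul1r lerDl mulr_ge0.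
    by rewrite mul0r add0r (ltW h) mulr1 abump_le.
  case: (\int[mu]_z (B z)%:E)%E => [r| |] //; last by move=> _; rewrite leey.
  by rewrite -EFinD !lee_fin; lra.
have w0 := weight_gt0 alpha x.
have c0 : 0 <= 2 `^ (- (n%:R + alpha)) * weight alpha x by rewrite mulr_ge0 ?powR_ge0// ltW.
rewrite -lee_fin -(tconvE x (ltW a0) d0 wb) mulrAC EFinM.
apply: (@le_trans _ _ (\int[mu]_z (2 `^ (- (n%:R + alpha)) * weight alpha x * B z)%:E)%E).
  by rewrite ge0_integralZ_fin// lee_wpmul2l// lee_fin.
apply: ge0_le_integral_fin.
- exact: measurable_funM.
- by apply: measurable_tconv_int; exact: measurable_abump.
- by move=> z; rewrite mulr_ge0.
move=> z; rewrite /B /tker; case: (leP d (enorm z)) => dz; last by rewrite !mul0r mulr0.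
rewrite !mul1r; have [xz2|xz2] := leP 2 (enorm (x + z)).
  by rewrite /abump (abump_root_out xz2) expr0n/= !mulr0.
apply: ler_wpM2r; first exact: abump_ge0.
have z0 : 0 < enorm z by exact: lt_le_trans dz.
have x0 := enorm_ge0 x.
rewrite /weight -powRM//; last by rewrite addr_ge0.
apply: powRN_le => //; last by rewrite addr_ge0// ltW.
have : enorm z <= enorm (x + z) + enorm x.
  by rewrite -(enormN x) (le_trans _ (enormD _ _))// addrAC subrr add0r.
by lra.
Qed.

(** With phi = g^2, L_eps phi = 2 g L_eps g minus the integral of the kernel against (g(x + z) -
    g(x))^2. The first term is at most a multiple of g. Of the second only |z| >= d is kept, where
    (g(x + z) - g(x))^2 >= phi(x + z) - 12 g(x), so it yields - c0 [weight] up to another multiple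
    of g. It remains to absorb A g into half of c0 [weight] and C g^2. *)
Lemma abump_operator_le : exists c C d : R, [/\ 0 < c, 0 <= C, 0 < d &
  forall eps x, 0 < eps -> eps < d ->
    tmass m alpha eps * abump x + c * weight alpha x <= tconv alpha eps abump x + C * abump x].
Proof.
have [K K0 HK] := @abump_root_diff2_ge R m.
have v0 := ball_vol_gt0 (R := R) (m := m); have I0 := abump_int_gt0.
(* For d <= 1 one has d^n <= d, so this choice ensures the mass condition of [abump_tconv_far]. *)
pose d : R := Num.min 1 (abump_int / (72 * ball_vol R m)).
have d0 : 0 < d by rewrite lt_min ltr01 divr_gt0// mulr_gt0.
have d1 : d <= 1 by rewrite ge_min lexx.
have dI : 36 * (d ^+ n * ball_vol R m) <= abump_int / 2.
  have : d * (72 * ball_vol R m) <= abump_int.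
    by rewrite -ler_pdivlMr ?mulr_gt0// ge_min lexx orbT.
  have : d ^+ n * ball_vol R m <= d * ball_vol R m.
    by rewrite ler_wpM2r ?(ltW v0)// exprS ler_piMr ?(ltW d0)// exprn_ile1// ltW.
  by lra.
pose c0 := 2 `^ (- (n%:R + alpha)) * (abump_int / 2).
have c00 : 0 < c0 by rewrite mulr_gt0 ?powR_gt0// divr_gt0.
pose A := 2 * (K * sd_const (m := m) alpha) + 12 * tmass m alpha d.
have A0 : 0 <= A.
  rewrite addr_ge0// mulr_ge0//; last by rewrite ltW// tmass_gt0.
  by rewrite mulr_ge0// ltW// sd_const_gt0.
pose C := A ^+ 2 * 3 `^ (n%:R + alpha) / (2 * c0).
exists (c0 / 2), C, d; split => //.
- by rewrite divr_gt0.
- by rewrite /C divr_ge0 ?mulr_ge0 ?sqr_ge0 ?powR_ge0// ltW.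
move=> eps x e0 ed.
have T1 : tmass m alpha eps * abump_root x <= tconv alpha eps abump_root x + K * sd_const (m := m) alpha.
  by apply: second_diff_le.
have far := abump_tconv_far x d0 dI; rewrite -/c0 in far.
(* The integrated identity for g^2, arranged so that every term is non-negative. The constant 12 is
   2 g(x + z) <= 2 * 6. *)
have T2 : tmass m alpha eps * abump x + tconv alpha d abump x + 2 * abump_root x * tconv alpha eps abump_root x <=
    tconv alpha eps abump x + 2 * abump x * tmass m alpha eps + 12 * abump_root x * tmass m alpha d.
  have tk0 e z : 0 <= tker alpha e z := tker_ge0 alpha e z.
  have mtk e := @measurable_tker R m alpha e.
  have g0 y := abump_root_ge0 y; have f0 y := abump_ge0 y.
  have mg := @measurable_abump_root R m; have mf := @measurable_abump R m.
  have mI1 : measurable_fun setT (fun z => abump x * tker alpha eps z) by exact: measurable_funM.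
  have mI2 := measurable_tconv_int alpha d x mf.
  have mI3 : measurable_fun setT (fun z => 2 * abump_root x * (tker alpha eps z * abump_root (x + z))).
    by apply: measurable_funM => //; exact: measurable_tconv_int.
  have mI4 := measurable_tconv_int alpha eps x mf.
  have mI5 : measurable_fun setT (fun z => 2 * abump x * tker alpha eps z) by exact: measurable_funM.
  have mI6 : measurable_fun setT (fun z => 12 * abump_root x * tker alpha d z) by exact: measurable_funM.
  have p1 z : 0 <= abump x * tker alpha eps z := mulr_ge0 (f0 x) (tk0 eps z).
  have p2 z : 0 <= tker alpha d z * abump (x + z) := mulr_ge0 (tk0 d z) (f0 _).
  have p3 z : 0 <= 2 * abump_root x * (tker alpha eps z * abump_root (x + z)).
    by apply: mulr_ge0; apply: mulr_ge0.
  have p4 z : 0 <= tker alpha eps z * abump (x + z) := mulr_ge0 (tk0 eps z) (f0 _).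
  have p5 z : 0 <= 2 * abump x * tker alpha eps z by apply: mulr_ge0 => //; apply: mulr_ge0.
  have p6 z : 0 <= 12 * abump_root x * tker alpha d z by apply: mulr_ge0 => //; apply: mulr_ge0.
  have : (\int[mu]_z (abump x * tker alpha eps z + tker alpha d z * abump (x + z) +
            2 * abump_root x * (tker alpha eps z * abump_root (x + z)))%:E <=
          \int[mu]_z (tker alpha eps z * abump (x + z) + 2 * abump x * tker alpha eps z +
            12 * abump_root x * tker alpha d z)%:E)%E.
    apply: ge0_le_integral_fin.
    - by apply: measurable_funD => //; apply: measurable_funD.
    - by apply: measurable_funD => //; apply: measurable_funD.
    - by move=> z; apply: addr_ge0 => //; apply: addr_ge0.
    move=> z; have H : tker alpha d z <= tker alpha eps z.
      rewrite /tker ler_wpM2r ?rker_ge0// ler_nat.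
      by case: (leP d (enorm z)) => // /(le_trans (ltW ed)) ->.
    have kd := tk0 d z; have := g0 x; have := g0 (x + z); have := abump_root_le (x + z).
    rewrite /abump; move: (tker alpha d z) (tker alpha eps z) (abump_root x) (abump_root (x + z)) H kd.
    move=> kd ke g h kde kd0 h6 h0 gg0.
    have : kd * (g - h) ^+ 2 <= ke * (g - h) ^+ 2 by rewrite ler_wpM2r// sqr_ge0.
    have : (kd * g) * h <= (kd * g) * 6 by rewrite ler_wpM2l// mulr_ge0.
    have : 0 <= kd * g ^+ 2 by rewrite mulr_ge0// sqr_ge0.
    by lra.
  rewrite !ge0_integralD_fin//; try by [apply: measurable_funD|move=> z; apply: addr_ge0].
  rewrite ge0_integralZ_fin// integral_tker// !(tconvE _ (ltW a0))//.
  rewrite !ge0_integralZ_fin//; try by [apply: mulr_ge0|exact: measurable_tconv_int|move=> z; apply: mulr_ge0].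
  rewrite !integral_tker// (tconvE _ (ltW a0))// -!EFinM -!EFinD lee_fin.
  by lra.
have g0 := abump_root_ge0 x.
(* The inequality of arithmetic and geometric means: C is such that the product of the two terms on
   the right is at least (A g)^2 / 4, because [weight] >= 3^(-n-alpha) on |x| < 2; further out g =
   0. *)
have AG : A * abump_root x <= c0 / 2 * weight alpha x + C * abump x.
  have [x2|x2] := leP 2 (enorm x).
    rewrite (abump_root_out x2) /abump (abump_root_out x2) expr0n/= !mulr0 addr0.
    by rewrite mulr_ge0 ?divr_ge0 ?ltW ?weight_gt0.
  have w0 := weight_gt0 alpha x.
  have w3 : 1 <= 3 `^ (n%:R + alpha) * weight alpha x.
    have x0 := enorm_ge0 x.
    rewrite /weight powRN ler_pdivlMr ?powR_gt0 ?ltr_wpDr// mul1r.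
    by rewrite ge0_ler_powR ?nnegrE ?addr_ge0 ?(ltW a0)//; lra.
  rewrite /C /abump; move: w3 w0; set T := 3 `^ _; set w := weight _ _; set g := abump_root x => w3 w0.
  have Ag2 : 0 <= (A * g) ^+ 2 by exact: sqr_ge0.
  have E : c0 / 2 * w * (A ^+ 2 * T / (2 * c0) * g ^+ 2) = (A * g) ^+ 2 / 4 * (T * w).
    by field; rewrite gt_eqF.
  have : (A * g) ^+ 2 / 4 <= c0 / 2 * w * (A ^+ 2 * T / (2 * c0) * g ^+ 2).
    by rewrite E ler_peMr// divr_ge0.
  set p := c0 / 2 * w; set q := A ^+ 2 * T / (2 * c0) * g ^+ 2 => pq.
  have p0 : 0 <= p by rewrite /p mulr_ge0 ?divr_ge0 ?ltW.
  have q0 : 0 <= q.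
    apply: mulr_ge0; last exact: sqr_ge0.
    apply: divr_ge0; first by apply: mulr_ge0; [exact: sqr_ge0|exact: powR_ge0].
    by apply: mulr_ge0 => //; exact: ltW.
  have : (A * g) ^+ 2 <= (p + q) ^+ 2 by have := sqr_ge0 (p - q); lra.
  by rewrite ler_pXn2r// nnegrE ?addr_ge0// mulr_ge0.
have G : 2 * abump_root x * (tmass m alpha eps * abump_root x) <=
    2 * abump_root x * (tconv alpha eps abump_root x + K * sd_const (m := m) alpha).
  by apply: ler_wpM2l => //; apply: mulr_ge0.
have E : abump x = abump_root x ^+ 2 by [].
rewrite E in T2 AG *; rewrite /A in AG; lra.
Qed.

End abump_operator.

(** For |x| <= 2 rho the second-difference bound applies and [weight] is bounded below. For |x| > 2
    rho, phi(x) = 0 and the convolution is about |x|^(-n-alpha) times the integral of phi. *)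
Lemma test_fun_operator_abs alpha (phi : 'rV[R]_n -> R) rho (K : R) : 0 < alpha -> alpha < 2 ->
  0 < rho -> 0 <= K -> test_fun rho phi ->
  (forall x z, `|phi (x + z) + phi (x - z) - 2 * phi x| <= K * Num.min (enorm z ^+ 2) 1) ->
  exists2 C : R, 0 <= C & forall eps x, 0 < eps ->
    `|tmass m alpha eps * phi x - tconv alpha eps phi x| <= C * weight alpha x.
Proof.
move=> a0 a2 r0 K0 tphi HK; have [mphi phi0 phis _] := tphi.
have wphi := test_fun_weighted (ltW a0) tphi.
have [J J0 JE] : exists2 J : R, 0 <= J & (\int[mu]_x (phi x)%:E = J%:E)%E.
  have I0 := integral_fin_ge0 mu phi0.
  have If : (\int[mu]_x (phi x)%:E \is a fin_num)%E by rewrite ge0_fin_numE//; exact: test_fun_integral_fin tphi.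
  by exists (fine (\int[mu]_x (phi x)%:E)%E); [exact: fine_ge0|rewrite fineK].
have s0 := sd_const_gt0 (R := R) (m := m) a0 a2.
pose T1 := K * sd_const (m := m) alpha * (1 + 2 * rho) `^ (n%:R + alpha).
(* If |x + z| <= rho and |x| > 2 rho, then |z| > rho, so 1 + |x| <= 1 + rho + |z| <= c1 |z|. *)
pose c1 := 2 + rho^-1.
have r1 : 0 < rho^-1 by rewrite invr_gt0.
have c10 : 0 < c1 by rewrite /c1; lra.
pose T2 := c1 `^ (n%:R + alpha) * J.
have T10 : 0 <= T1 by rewrite /T1 mulr_ge0 ?powR_ge0// mulr_ge0// ltW.
have T20 : 0 <= T2 by rewrite /T2 mulr_ge0// powR_ge0.
exists (T1 + T2); first exact: addr_ge0.
move=> eps x e0; have w0 := ltW (weight_gt0 alpha x); have x0 := enorm_ge0 x.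
have W1 : 0 <= T1 * weight alpha x by rewrite mulr_ge0.
have W2 : 0 <= T2 * weight alpha x by rewrite mulr_ge0.
have [x2|x2] := leP (enorm x) (2 * rho).
  have h1 : tconv alpha eps phi x <= tmass m alpha eps * phi x + K * sd_const (m := m) alpha.
    by apply: second_diff_ge => // z; have := HK x z; rewrite ler_norml => /andP[_]; lra.
  have h3 : tmass m alpha eps * phi x <= tconv alpha eps phi x + K * sd_const (m := m) alpha.
    by apply: second_diff_le => // z; have := HK x z; rewrite ler_norml => /andP[+ _]; lra.
  have h2 : K * sd_const (m := m) alpha <= T1 * weight alpha x.
    have s1 : 0 <= K * sd_const (m := m) alpha by apply: mulr_ge0 => //; rewrite ltW.
    rewrite /T1 -mulrA; apply: ler_peMr => //.
    rewrite /weight powRN ler_pdivlMr ?powR_gt0 ?ltr_wpDr// mul1r.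
    by rewrite ge0_ler_powR ?nnegrE ?addr_ge0 ?(ltW a0)//; lra.
  by rewrite ler_norml; apply/andP; split; lra.
have -> : phi x = 0 by apply: phis; lra.
have t0 : 0 <= tconv alpha eps phi x by apply: tconv_ge0.
rewrite mulr0 sub0r normrN ger0_norm//.
suff : tconv alpha eps phi x <= T2 * weight alpha x by lra.
rewrite -lee_fin -tconvE// ?(ltW a0)// /T2 mulrAC EFinM -JE.
rewrite -(integral_shift_addl x mphi phi0).
have c40 : 0 <= c1 `^ (n%:R + alpha) * weight alpha x by rewrite mulr_ge0 ?powR_ge0.
have mbx : measurable_fun setT (fun z => phi (x + z)) by exact: measurable_shift.
rewrite -ge0_integralZ_fin//.
apply: ge0_le_integral_fin.
- exact: measurable_tconv_int.
- exact: measurable_funM.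
- by move=> z; rewrite mulr_ge0 ?tker_ge0.
move=> z; have [xz2|xz2] := ltP rho (enorm (x + z)).
  by rewrite (phis _ xz2) !mulr0.
apply: ler_wpM2r => //.
have h : enorm x <= enorm (x + z) + enorm z.
  by rewrite -(enormN z) (le_trans _ (enormD _ _))// addrK.
have z0 : 0 < enorm z by lra.
rewrite /tker; case: (leP eps (enorm z)) => ez; last by rewrite mul0r mulr_ge0 ?powR_ge0.
rewrite mul1r /rker (powRN_scale (c := c1)) ?(ltW z0)// ler_wpM2l ?powR_ge0//.
apply: powRN_le; [by rewrite ltr_wpDr| |by rewrite addr_ge0// ltW].
have hr : 1 <= rho^-1 * enorm z.
  have rz : rho <= enorm z by lra.
  by rewrite mulrC ler_pdivlMr// mul1r.
by rewrite /c1; lra.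
Qed.

End abump_inequalities.
Arguments abump_int R m : clear implicits.

(** * Translates and dilates of a pair *)

Section pair_transformations.
Context {R : realType} {m : nat}.
Local Notation n := m.+1.
Local Notation mu := (lebesgue_rV R n).
Implicit Types (x y z : 'rV[R]_n) (u w : 'rV[R]_n -> R) (alpha eps c rho : R).

Lemma continuous_shift_rV u x0 : continuous u -> continuous (fun x => u (x0 + x)).
Proof.
move=> cu x; apply: (@continuous_comp _ _ _ (fun x => x0 + x) u); last exact: cu.
have FF : Filter (nbhs x) := nbhs_filter x.
exact: (@cvgD _ _ _ (nbhs x) FF _ _ _ _ (@cvg_cst _ _ _ _ FF) (@cvg_id _ (nbhs x))).
Qed.

Lemma continuous_scale_rV u c : continuous u -> continuous (fun x => u (c *: x)).
Proof.
move=> cu x; apply: (@continuous_comp _ _ _ (fun x => c *: x) u); last exact: cu.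
exact: scaler_continuous.
Qed.

Lemma continuous_funM u w : continuous u -> continuous w -> continuous (fun x => u x * w x).
Proof. by move=> cu cw x; exact: (continuousM (cu x) (cw x)). Qed.

Lemma continuous_funD u w : continuous u -> continuous w -> continuous (fun x => u x + w x).
Proof. by move=> cu cw x; exact: (continuousD (cu x) (cw x)). Qed.

Lemma continuous_funZ u c : continuous u -> continuous (fun x => c * u x).
Proof. by apply: continuous_funM => x; exact: cst_continuous. Qed.

Lemma weight_shift_le alpha x0 x : 0 <= alpha ->
  weight alpha x <= (1 + enorm x0) `^ (n%:R + alpha) * weight alpha (x0 + x).
Proof.
move=> a0; have h0 := enorm_ge0 x0; have h := enorm_ge0 x; have hy := enorm_ge0 (x0 + x).
rewrite /weight (powRN_scale (c := 1 + enorm x0)) ?addr_ge0//; last by rewrite ltr_wpDr.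
rewrite ler_wpM2l ?powR_ge0// powRN_le ?addr_ge0//; first by rewrite ltr_wpDr.
have : enorm (x0 + x) <= enorm x0 + enorm x by exact: enormD.
have : 0 <= enorm x0 * enorm x by rewrite mulr_ge0.
by lra.
Qed.

Lemma weight_scale_le alpha c x : 0 <= alpha -> 0 < c ->
  weight alpha x <= (1 + c) `^ (n%:R + alpha) * weight alpha (c *: x).
Proof.
move=> a0 c0; have h := enorm_ge0 x.
rewrite /weight enormZ gtr0_norm// (powRN_scale (c := 1 + c)) ?addr_ge0//; last by rewrite addr_gt0.
rewrite ler_wpM2l ?powR_ge0// powRN_le ?addr_ge0//; first by rewrite ltr_wpDr// mulr_ge0// ltW.
have : 0 <= c * enorm x by rewrite mulr_ge0// ltW.
by lra.
Qed.

Lemma ge0_integral_lt_pinfty (f g : 'rV[R]_n -> R) (C : R) : 0 <= C ->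
  measurable_fun setT f -> measurable_fun setT g ->
  (forall x, 0 <= f x) -> (forall x, 0 <= g x) -> (forall x, f x <= C * g x) ->
  (\int[mu]_x (g x)%:E < +oo)%E -> (\int[mu]_x (f x)%:E < +oo)%E.
Proof.
move=> C0 mf mg f0 g0 fg gfin.
apply: (@le_lt_trans _ _ (\int[mu]_x (C * g x)%:E)%E).
  by apply: ge0_le_integral_fin => //; exact: measurable_funM.
by rewrite ge0_integralZ_fin// lte_mul_pinfty// lee_fin.
Qed.

Lemma weighted_fin_shift alpha u x0 : 0 <= alpha -> weighted_fin alpha u ->
  weighted_fin alpha (fun x => u (x0 + x)).
Proof.
move=> a0 [mu' u0 ufin]; have mw := @measurable_weight R m alpha.
have w0 x := ltW (weight_gt0 alpha x).
have muw : measurable_fun setT (fun y => u y * weight alpha y) by exact: measurable_funM.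
split; [exact: measurable_shift|by []|].
apply: (@ge0_integral_lt_pinfty _ (fun x => u (x0 + x) * weight alpha (x0 + x)) ((1 + enorm x0) `^ (n%:R + alpha))).
- exact: powR_ge0.
- by apply: measurable_funM => //; exact: measurable_shift.
- exact: (measurable_shift x0 muw).
- by move=> x; rewrite mulr_ge0.
- by move=> x; rewrite mulr_ge0.
- by move=> x; rewrite mulrCA; apply: ler_wpM2l => //; exact: weight_shift_le.
by rewrite (integral_shift_addl x0 muw)// => y; rewrite mulr_ge0.
Qed.

Lemma measurable_scale_fun u c : measurable_fun setT u -> measurable_fun setT (fun x => u (c *: x)).
Proof. by move=> mu'; apply: (measurableT_comp mu'); exact: measurable_scale_rV. Qed.

Lemma weighted_fin_scale alpha u c : 0 <= alpha -> 0 < c -> weighted_fin alpha u ->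
  weighted_fin alpha (fun x => u (c *: x)).
Proof.
move=> a0 c0 [mu' u0 ufin]; have mw := @measurable_weight R m alpha.
have w0 x := ltW (weight_gt0 alpha x).
have muw : measurable_fun setT (fun y => u y * weight alpha y) by exact: measurable_funM.
split; [exact: measurable_scale_fun|by []|].
apply: (@ge0_integral_lt_pinfty _ (fun x => u (c *: x) * weight alpha (c *: x)) ((1 + c) `^ (n%:R + alpha))).
- exact: powR_ge0.
- by apply: measurable_funM => //; exact: measurable_scale_fun.
- exact: (measurable_scale_fun c muw).
- by move=> x; rewrite mulr_ge0.
- by move=> x; rewrite mulr_ge0.
- by move=> x; rewrite mulrCA; apply: ler_wpM2l => //; exact: weight_scale_le.
rewrite (ge0_integral_scale_fin c0 muw); last by move=> y; rewrite mulr_ge0.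
by rewrite lte_mul_pinfty// lee_fin invr_ge0 exprn_ge0// ltW.
Qed.

Lemma frac_pair_shift alpha u w x0 : 0 <= alpha -> frac_pair alpha u w ->
  frac_pair alpha (fun x => u (x0 + x)) (fun x => w (x0 + x)).
Proof.
move=> a0 [wu cu cw Luw]; split.
- exact: weighted_fin_shift.
- exact: continuous_shift_rV.
- exact: continuous_shift_rV.
move=> rho e rho0 e0.
have r0 : 0 < enorm x0 + rho by rewrite ltr_wpDl// enorm_ge0.
have [d [d0 Hd]] := Luw (enorm x0 + rho) e r0 e0; exists d; split => // eps x eps0 epsd xr.
rewrite (_ : tconv alpha eps _ x = tconv alpha eps u (x0 + x)).
  by apply: Hd => //; rewrite (le_trans (enormD _ _))// lerD2l.
by rewrite /tconv; congr fine; apply: eq_integral => z _; rewrite addrA.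
Qed.

Lemma tmass_scale alpha eps c : 0 < eps -> 0 < c ->
  tmass m alpha eps = c `^ alpha * tmass m alpha (c * eps).
Proof.
move=> e0 c0; rewrite /tmass (powRN_scale (c := c)) ?(ltW e0)//; ring.
Qed.

Lemma tconv_scale alpha eps u x c : 0 < eps -> 0 < c -> measurable_fun setT u ->
  (forall y, 0 <= u y) ->
  tconv alpha eps (fun x => u (c *: x)) x = c `^ alpha * tconv alpha (c * eps) u (c *: x).
Proof.
move=> e0 c0 mu' u0.
have mI := measurable_tconv_int alpha (c * eps) (c *: x) mu'.
have p0 y : 0 <= tker alpha (c * eps) y * u (c *: x + y) by rewrite mulr_ge0 ?tker_ge0.
have H := ge0_integral_scale_fin c0 mI p0.
rewrite /tconv.
have E : (\int[mu]_z (tker alpha eps z * u (c *: (x + z)))%:E =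
   (c `^ alpha)%:E * \int[mu]_z (tker alpha (c * eps) z * u (c *: x + z))%:E)%E.
  transitivity (((c `^ alpha) * c ^+ n)%:E *
     \int[mu]_z (tker alpha (c * eps) (c *: z) * u (c *: x + c *: z))%:E)%E.
    rewrite -ge0_integralZ_fin ?mulr_ge0 ?powR_ge0 ?exprn_ge0 ?(ltW c0)//; last exact: (measurable_scale_fun c mI).
    apply: eq_integral => z _; congr EFin; rewrite scalerDr mulrA; congr (_ * _).
    rewrite /tker enormZ gtr0_norm// ler_pM2l//.
    rewrite mulrCA; congr (_ * _); rewrite /rker enormZ gtr0_norm//.
    by rewrite [LHS](powRN_scale _ (enorm_ge0 z) c0) powRD ?(gt_eqF c0) ?implybT// powR_mulrn ?(ltW c0)// [c `^ alpha * _]mulrC.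
  rewrite H muleA -EFinM mulrAC -mulrA -[_ * c ^+ n]mulrC mulfV ?mulr1// expf_neq0// gt_eqF//.
rewrite E; have : (0 <= \int[mu]_z (tker alpha (c * eps) z * u (c *: x + z))%:E)%E by exact: integral_fin_ge0.
case: (\int[mu]_z _)%E => [r| |] //= _.
by rewrite gt0_muley ?lte_fin ?powR_gt0//= mulr0.
Qed.

(** Homogeneity of degree alpha: truncation at eps for u(c x) corresponds to truncation at c eps for
    u. All later estimates at scale r come from this. *)
Lemma frac_pair_scale alpha u w c : 0 <= alpha -> 0 < c -> frac_pair alpha u w ->
  frac_pair alpha (fun x => u (c *: x)) (fun x => c `^ alpha * w (c *: x)).
Proof.
move=> a0 c0 [wu cu cw Luw]; have [mu' u0 _] := wu; split.
- exact: weighted_fin_scale.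
- exact: continuous_scale_rV.
- by apply: continuous_funZ; exact: continuous_scale_rV.
move=> rho e rho0 e0.
have ca := powR_gt0 alpha c0.
have [d [d0 Hd]] := Luw (c * rho) (e / c `^ alpha) (mulr_gt0 c0 rho0) (divr_gt0 e0 ca).
exists (d / c); split; first by rewrite divr_gt0.
move=> eps x eps0; rewrite ltr_pdivlMr// mulrC => epsd xr.
rewrite tconv_scale// (tmass_scale _ eps0 c0) -mulrA -!mulrBr normrM gtr0_norm//.
rewrite mulrC -ler_pdivlMr//; apply: Hd => //; first by rewrite mulr_gt0.
by rewrite enormZ gtr0_norm// ler_pM2l.
Qed.

End pair_transformations.

(** * Pairs tested against the bump and against rescaled test functions *)

Section abump_pair.
Context {R : realType} {m : nat}.
Local Notation n := m.+1.
Local Notation mu := (lebesgue_rV R n).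
Implicit Types (x y z : 'rV[R]_n) (u w : 'rV[R]_n -> R) (eps c rho : R).
Variable alpha : R.
Hypotheses (a0 : 0 < alpha) (a2 : alpha < 2).

(** Both terms on the left are non-negative, so the mean of u over a single annulus controls the
    integral of u over all of R^n against [weight], and the mean of w over the annulus as well. *)
Lemma abump_pair_le : exists c C : R, [/\ 0 < c, 0 <= C &
  forall u w, frac_pair alpha u w -> (forall x, enorm x <= 2 -> 0 <= w x) ->
  (\int[mu]_x (abump x * w x)%:E + c%:E * \int[mu]_x (u x * weight alpha x)%:E <=
   C%:E * \int[mu]_x (abump x * u x)%:E)%E].
Proof.
have [c [C [d [c0 C0 d0 H]]]] := @abump_operator_le R m alpha a0 a2.
exists c, C; split => // u w pr w0; have [[mu' u0 _] cu cw _] := pr.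
have mb := @measurable_abump R m; have b0 x := @abump_ge0 R m x.
have mw := @measurable_weight R m alpha.
have w0' x := ltW (weight_gt0 alpha x : 0 < weight alpha (x : 'rV[R]_n)).
have two0 : 0 < 2 :> R by [].
have := @frac_pair_test R m alpha u w (@abump R m) 2 (fun x => C * abump x) (fun x => c * weight alpha x) d
  a0 two0 d0 pr abump_test w0.
move=> /(_ _ _ _ _ H).
rewrite (_ : (\int[mu]_x (u x * (c * weight alpha x))%:E = c%:E * \int[mu]_x (u x * weight alpha x)%:E)%E); last first.
  rewrite -ge0_integralZ_fin ?(ltW c0)//; [|exact: measurable_funM|by move=> x; rewrite mulr_ge0].
  by apply: eq_integral => x _; rewrite mulrCA.
rewrite (_ : (\int[mu]_x (u x * (C * abump x))%:E = C%:E * \int[mu]_x (abump x * u x)%:E)%E); last first.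
  rewrite -ge0_integralZ_fin//; [|exact: measurable_funM|by move=> x; rewrite mulr_ge0].
  by apply: eq_integral => x _; rewrite mulrCA [u x * _]mulrC.
apply.
- exact: measurable_funM.
- by move=> x; rewrite mulr_ge0.
- exact: measurable_funM.
- by move=> x; rewrite mulr_ge0// ltW.
Qed.

Section test_fun_pair.
Variables (phi : 'rV[R]_n -> R) (rho K : R).
Hypotheses (r0 : 0 < rho) (K0 : 0 <= K) (tphi : test_fun rho phi).
Hypothesis HK : forall x z, `|phi (x + z) + phi (x - z) - 2 * phi x| <= K * Num.min (enorm z ^+ 2) 1.

Lemma test_fun_pair_abs : exists2 C : R, 0 <= C &
  forall u w, frac_pair alpha u w ->
  (`|\int[mu]_x (phi x * w x)|%:E <= C%:E * \int[mu]_x (u x * weight alpha x)%:E)%E.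
Proof.
have [C C0 H] := test_fun_operator_abs a0 a2 r0 K0 tphi HK.
exists C => // u w pr; have [[mu' u0 _] cu cw _] := pr.
have mw := @measurable_weight R m alpha.
have w0' x := ltW (weight_gt0 alpha x : 0 < weight alpha (x : 'rV[R]_n)).
have := @frac_pair_test_abs R m alpha u w phi rho (fun x => C * weight alpha x) 1
  a0 r0 ltr01 pr tphi.
rewrite (_ : (\int[mu]_x (u x * (C * weight alpha x))%:E = C%:E * \int[mu]_x (u x * weight alpha x)%:E)%E); last first.
  rewrite -ge0_integralZ_fin//; [|exact: measurable_funM|by move=> x; rewrite mulr_ge0].
  by apply: eq_integral => x _; rewrite mulrCA.
apply => //; first exact: measurable_funM.
  by move=> x; rewrite mulr_ge0.
by move=> eps x e0 _; exact: H.
Qed.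

(** Dominated convergence: (r + |y|)^(-n-alpha) decreases to 0 as r grows and is below [weight] for
    r >= 1. *)
Lemma weighted_tail_cvg0 u : weighted_fin alpha u ->
  forall e : R, 0 < e -> exists r0 : R, 0 < r0 /\ forall r, r0 <= r ->
   (\int[mu]_y (u y * (r + enorm y) `^ (- (n%:R + alpha)))%:E <= e%:E)%E.
Proof.
move=> [mu' u0 ufin] e e0.
pose f (k : nat) y : \bar R := (u y * (k.+1%:R + enorm y) `^ (- (n%:R + alpha)))%:E.
pose g y : \bar R := (u y * weight alpha y)%:E.
have mf (r : R) : measurable_fun setT (fun y => u y * (r + enorm y) `^ (- (n%:R + alpha))) by meas.
have mw := @measurable_weight R m alpha.
have g0 y : 0 <= u y * weight alpha y by rewrite mulr_ge0// ltW// weight_gt0.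
have na : 0 < n%:R + alpha by rewrite addr_gt0.
have ig : mu.-integrable setT g.
  apply/integrableP; split; first by apply/measurable_EFinP; exact: measurable_funM.
  by under eq_integral do rewrite /g abse_EFin ger0_norm//.
have cf y : f ^~ y @ \oo --> 0%E.
  rewrite /f; apply: cvg_EFin; first exact: nearW.
  rewrite /comp /= -(mulr0 (u y)); apply: cvgM; first exact: cvg_cst.
  apply/cvgrPdist_le => /= d d0; have := powR_cvgy0 na.
  move/cvgrPdist_le => /(_ d d0)[M [Mr HM]].
  exists (Num.truncn `|M|).+1 => // k /= kM.
  apply: HM; apply: (@lt_le_trans _ _ k.+1%:R); last by rewrite lerDl enorm_ge0.
  apply: (le_lt_trans (ler_norm M)); apply: lt_le_trans (truncnS_gt _) _.
  by rewrite ler_nat (leq_trans kM).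
have dom k y : setT y -> (`|f k y| <= g y)%E.
  move=> _; rewrite /f /g abse_EFin lee_fin ger0_norm ?mulr_ge0 ?powR_ge0//.
  rewrite ler_wpM2l// /weight powRN_le ?(ltW na)//; first by rewrite ltr_wpDr// enorm_ge0.
  by rewrite lerD2r ler1n.
have [_ _] := @dominated_convergence _ _ _ mu setT measurableT f (cst 0%E) g
  (fun k => (measurable_EFinP _ _).2 (mf _)) (measurable_cst _) (aeW _ (fun y _ => cf y)) ig
  (aeW _ (fun y k => dom k y)).
rewrite integral0 => /fine_cvgP[_ /cvgrPdist_le/(_ e e0)[k _ Hk]].
exists k.+1%:R; split => // r rk.
apply: (@le_trans _ _ (\int[mu]_y f k y)%E).
  apply: ge0_le_integral_fin => //.
  - by move=> y; rewrite mulr_ge0// powR_ge0.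
  - move=> y; rewrite ler_wpM2l// powRN_le ?(ltW na)//; first by rewrite ltr_wpDr// enorm_ge0.
    by rewrite lerD2r.
have := Hk k (leqnn k); rewrite /= sub0r normrN.
have F0 : (0 <= \int[mu]_y f k y)%E by apply: integral_ge0 => y _; rewrite lee_fin mulr_ge0// powR_ge0.
have Ffin : (\int[mu]_y f k y < +oo)%E.
  suff H : (\int[mu]_y f k y <= \int[mu]_x (u x * weight alpha x)%:E)%E by exact: le_lt_trans H ufin.
  rewrite /f; apply: ge0_le_integral_fin.
  - exact: mf.
  - exact: measurable_funM.
  - by move=> y; rewrite mulr_ge0// powR_ge0.
  - by move=> y; have := dom k y I; rewrite /f /g abse_EFin lee_fin; apply: le_trans; exact: ler_norm.
move: F0 Ffin; case: (\int[mu]_y f k y)%E => [s| |] //= s0 _.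
by rewrite lee_fin; apply: le_trans; exact: ler_norm.
Qed.

(** Apply [test_fun_pair_abs] to the pair dilated by r. A factor r^alpha comes out on both sides and
    cancels, which leaves the integral of u(y) (r + |y|)^(-n-alpha), which tends to 0. *)
Lemma test_fun_pair_cvg0 u w : frac_pair alpha u w ->
  forall e : R, 0 < e -> exists r0 : R, 0 < r0 /\ forall r, r0 <= r ->
    `|\int[mu]_x (phi x * w (r *: x))| <= e.
Proof.
move=> pr e e0; have [C C0 HC] := test_fun_pair_abs.
have [wu cu cw _] := pr; have [mu' u0 _] := wu.
have [q0 [q00 Hr]] := weighted_tail_cvg0 wu (divr_gt0 e0 (ltr_wpDl C0 ltr01)).
exists q0; split => // r rr0; have r_gt0 : 0 < r by exact: lt_le_trans rr0.
have := HC _ _ (frac_pair_scale (ltW a0) r_gt0 pr).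
have ra := powR_gt0 alpha r_gt0.
have mw := @measurable_weight R m alpha.
pose I := (\int[mu]_y (u y * (r + enorm y) `^ (- (n%:R + alpha)))%:E)%E.
have E : (\int[mu]_x (u (r *: x) * weight alpha x)%:E = (r `^ alpha)%:E * I)%E.
  have mI : measurable_fun setT (fun y => u y * (r + enorm y) `^ (- (n%:R + alpha))) by meas.
  have H := ge0_integral_scale_fin r_gt0 mI (fun y => mulr_ge0 (u0 y) (powR_ge0 _ _)).
  transitivity (((r `^ alpha) * r ^+ n)%:E *
     \int[mu]_x (u (r *: x) * (r + enorm (r *: x)) `^ (- (n%:R + alpha)))%:E)%E.
    rewrite -ge0_integralZ_fin; last 3 first.
    - by apply: mulr_ge0; [exact: powR_ge0|exact: exprn_ge0 (ltW r_gt0)].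
    - exact: (measurable_scale_fun r mI).
    - by move=> x; apply: mulr_ge0 => //; exact: powR_ge0.
    apply: eq_integral => x _; congr EFin; rewrite mulrCA; congr (_ * _).
    rewrite /weight (powRN_scale (c := r)) ?addr_ge0 ?enorm_ge0//.
    rewrite powRD ?(gt_eqF r_gt0) ?implybT// powR_mulrn ?(ltW r_gt0)// [r `^ alpha * _]mulrC.
    by rewrite mulrDr mulr1 enormZ gtr0_norm.
  rewrite H muleA -EFinM mulrAC -mulrA -[_ * r ^+ n]mulrC mulfV ?mulr1// expf_neq0// gt_eqF//.
rewrite E.
have -> : \int[mu]_x (phi x * (r `^ alpha * w (r *: x))) = r `^ alpha * \int[mu]_x (phi x * w (r *: x)).
  have iw := test_fun_integrable tphi (@continuous_scale_rV R m w r cw).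
  rewrite -(RintegralZl _ measurableT iw).
  by apply: eq_Rintegral => x _; rewrite mulrCA.
rewrite normrM (gtr0_norm ra) muleCA EFinM lee_pmul2l ?lte_fin//.
move=> /le_trans/(_ (lee_wpmul2l _ (Hr r rr0))).
rewrite lee_fin => /(_ C0); rewrite -EFinM lee_fin => /le_trans; apply.
by rewrite mulrCA ler_piMr ?(ltW e0)// ler_pdivrMr ?ltr_wpDl// mul1r lerDl.
Qed.

End test_fun_pair.

End abump_pair.

(** * Regularity of the fractional Laplacian *)

Section slices.
Context {R : realType} {m : nat}.
Local Notation n := m.+1.
Local Notation e_ i := (delta_mx ord0 i : 'rV[R]_n).
Implicit Types (x y z v : 'rV[R]_n) (f g : 'rV[R]_n -> R).

Lemma quotient_slice f x v t : (fun h => h^-1 *: ((f \o shift (x + t *: v)) (h *: v) - f (x + t *: v))) =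
  (fun h : R => h^-1 *: (((fun s => f (x + s *: v)) \o shift t) (h *: (1 : R)) - f (x + t *: v))).
Proof.
apply/funext => h; congr (_ *: (_ - _)).
by rewrite /= [h *: 1]mulr1 scalerDl addrCA; congr f; rewrite addrC [in RHS]addrC.
Qed.

Lemma is_derive_slice f x v t d : is_derive (x + t *: v) v f d <->
  is_derive (t : R) 1 (fun s => f (x + s *: v)) d.
Proof.
split=> [[H1 H2]|[H1 H2]]; split.
- by move: H1; rewrite /derivable quotient_slice.
- by move: H2; rewrite /derive quotient_slice.
- by rewrite /derivable quotient_slice.
- by rewrite /derive quotient_slice.
Qed.

Lemma is_derive_slice0 f x v d : is_derive x v f d <->
  is_derive (0 : R) 1 (fun s => f (x + s *: v)) d.
Proof. by rewrite -is_derive_slice scale0r addr0. Qed.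

Lemma is_derive_partial f i x : derivable f x (e_ i) -> is_derive x (e_ i) f (partial i f x).
Proof. by move=> df; apply: derivableP. Qed.

Lemma partialE f i x d : is_derive x (e_ i) f d -> partial i f x = d.
Proof. by case. Qed.

Lemma slice_mvt f i x (t : R) : (forall y, derivable f y (e_ i)) ->
  exists c : R, `|c| <= `|t| /\ f (x + t *: e_ i) - f x = t * partial i f (x + c *: e_ i).
Proof.
move=> df; pose g s := f (x + s *: e_ i).
have dg (s : R) : is_derive s 1 g (partial i f (x + s *: e_ i)).
  by apply/is_derive_slice; exact: is_derive_partial.
have cg : continuous g by move=> s; exact: is_derive1_continuous (dg s).
have g0 : g 0 = f x by rewrite /g scale0r addr0.
have [t0|t0] := leP 0 t.
  have [c] := MVT_segment t0 (fun s _ => dg s) (continuous_subspaceT cg).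
  rewrite in_itv/= => /andP[c0 ct]; rewrite g0 subr0 mulrC => E.
  by exists c; split => //; rewrite !ger0_norm.
have [c] := MVT_segment (ltW t0) (fun s _ => dg s) (continuous_subspaceT cg).
rewrite in_itv/= => /andP[tc c0]; rewrite g0 sub0r mulrN mulrC => E.
exists c; split; first by rewrite !ler0_norm ?(ltW t0)// lerN2.
by rewrite -[LHS]opprB -/(g t) E opprK.
Qed.

Lemma enorm_delta i : enorm (e_ i) = 1.
Proof.
rewrite /enorm (bigD1 i)//= !mxE !eqxx/= big1 ?addr0 ?expr1n ?sqrtr1// => j ji.
by rewrite !mxE (negPf ji) andbF expr0n.
Qed.

(** The increment z is travelled one coordinate at a time, with the mean value theorem on each
    segment. The second conclusion keeps the intermediate points inside the region where the partial
    derivatives are close to c. *)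
Lemma linear_approx_seq f x z (c : 'I_n -> R) (M B : R) (s : seq 'I_n) :
  (forall i y, derivable f y (e_ i)) ->
  (forall i y, enorm (y - x) <= B -> `|partial i f y - c i| <= M) ->
  \sum_(i <- s) `|z ord0 i| <= B ->
  `|f (x + \sum_(i <- s) z ord0 i *: e_ i) - f x - \sum_(i <- s) c i * z ord0 i|
     <= M * \sum_(i <- s) `|z ord0 i| /\
  enorm (\sum_(i <- s) z ord0 i *: e_ i) <= \sum_(i <- s) `|z ord0 i|.
Proof.
move=> df H; elim: s => [_|i s IH].
  by rewrite !big_nil addr0 subrr subr0 normr0 mulr0 enorm0.
rewrite !big_cons => sB.
have s0 : 0 <= \sum_(j <- s) `|z ord0 j| by rewrite sumr_ge0.
have zi : 0 <= `|z ord0 i| by [].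
have [I1 I2] := IH ltac:(lra).
set S := \sum_(j <- s) z ord0 j *: _ in I1 I2 *; set T := \sum_(j <- s) `|_| in s0 sB I1 I2 *.
have [t [tz E]] := slice_mvt (x + S) (z ord0 i) (df i).
split; last first.
  by rewrite (le_trans (enormD _ _))// enormZ enorm_delta mulr1 lerD2l.
rewrite (addrC (z ord0 i *: _) S) addrA.
have -> : f (x + S + z ord0 i *: e_ i) - f x - (c i * z ord0 i + \sum_(j <- s) c j * z ord0 j) =
   (f (x + S) - f x - \sum_(j <- s) c j * z ord0 j) + z ord0 i * (partial i f (x + S + t *: e_ i) - c i).
  by rewrite mulrBr -E; ring.
have -> : M * (`|z ord0 i| + T) = M * T + M * `|z ord0 i| by ring.
apply: (le_trans (ler_normD _ _)); apply: lerD => //.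
rewrite normrM mulrC; apply: ler_wpM2r => //.
apply: H; rewrite -(addrA x S) [x + _]addrC addrK.
apply: le_trans (enormD _ _) _; rewrite enormZ enorm_delta mulr1; lra.
Qed.

Lemma linear_approx f x z (c : 'I_n -> R) (M : R) : 0 <= M ->
  (forall i y, derivable f y (e_ i)) ->
  (forall i y, enorm (y - x) <= n%:R * enorm z -> `|partial i f y - c i| <= M) ->
  `|f (x + z) - f x - \sum_i c i * z ord0 i| <= M * (n%:R * enorm z).
Proof.
move=> M0 df H.
have sB : \sum_i `|z ord0 i| <= n%:R * enorm z.
  apply: (@le_trans _ _ (\sum_(i < n) enorm z)).
    by apply: ler_sum => i _; exact: coord_le_enorm.
  by rewrite sumr_const card_ord mulr_natl.
have [+ _] := linear_approx_seq df H sB.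
rewrite -row_sum_delta => /le_trans; apply; exact: ler_wpM2l.
Qed.

End slices.

(** * Classes of differentiable functions and local Hoelder bounds *)

Section smooth_functions.
Context {R : realType} {m : nat}.
Local Notation n := m.+1.
Local Notation e_ i := (delta_mx ord0 i : 'rV[R]_n).
Implicit Types (x y z v : 'rV[R]_n) (f g : 'rV[R]_n -> R).

(** The class C^k unfolded from the first derivative taken, which suits induction on k, whereas [Cm]
    quantifies over lists of derivatives. *)
Fixpoint smooth (k : nat) f : Prop :=
  continuous f /\
  match k with
  | 0 => True
  | k'.+1 => forall i, (forall x, derivable f x (e_ i)) /\ smooth k' (partial i f)
  end.

Lemma smooth_continuous k f : smooth k f -> continuous f.
Proof. by case: k => [|k] []. Qed.

Lemma smooth_le k j f : (j <= k)%N -> smooth k f -> smooth j f.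
Proof.
elim: j k f => [|j IH] [|k] f //= jk [cf H]; split => // i.
by have [df sf] := H i; split => //; exact: IH sf.
Qed.

Lemma smooth_ext k f g : f =1 g -> smooth k f -> smooth k g.
Proof. by move=> /funext ->. Qed.

Lemma partialD f g i : (forall x, derivable f x (e_ i)) -> (forall x, derivable g x (e_ i)) ->
  (forall x, derivable (fun x => f x + g x) x (e_ i)) /\
  partial i (fun x => f x + g x) = (fun x => partial i f x + partial i g x).
Proof.
move=> df dg; split; first by move=> x; apply: derivableD.
by apply/funext => x; rewrite /partial -deriveD.
Qed.

Lemma partialM f g i : (forall x, derivable f x (e_ i)) -> (forall x, derivable g x (e_ i)) ->
  (forall x, derivable (fun x => f x * g x) x (e_ i)) /\
  partial i (fun x => f x * g x) = (fun x => f x * partial i g x + g x * partial i f x).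
Proof.
move=> df dg; split; first by move=> x; apply: derivableM.
by apply/funext => x; rewrite /partial -deriveM.
Qed.

Lemma partialZ f c i : (forall x, derivable f x (e_ i)) ->
  (forall x, derivable (fun x => c * f x) x (e_ i)) /\
  partial i (fun x => c * f x) = (fun x => c * partial i f x).
Proof.
move=> df; split; first by move=> x; apply: derivableZ.
by apply/funext => x; exact: (deriveZ c (df x)).
Qed.

Lemma smoothD k f g : smooth k f -> smooth k g -> smooth k (fun x => f x + g x).
Proof.
elim: k f g => [|k IH] f g /= [cf Hf] [cg Hg]; (split; first exact: continuous_funD) => // i.
have [df sf] := Hf i; have [dg sg] := Hg i; have [D E] := partialD df dg.
by split => //; rewrite E; exact: IH.
Qed.

Lemma smoothZ k f c : smooth k f -> smooth k (fun x => c * f x).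
Proof.
elim: k f => [|k IH] f /= [cf Hf]; (split; first exact: continuous_funZ) => // i.
have [df sf] := Hf i; have [D E] := partialZ c df.
by split => //; rewrite E; exact: IH.
Qed.

Lemma Cm_smooth k f : Cm k f -> smooth k f.
Proof.
elim: k f => [|k IH] f [D C] /=; (split; first exact: (C [::])) => // i.
split; first by move=> x; exact: (D [::]).
apply: IH; split => [s j x sk|s sk].
  by have := D (rcons s i) j x; rewrite /partials foldr_rcons size_rcons; apply.
by have := C (rcons s i); rewrite /partials foldr_rcons size_rcons; apply.
Qed.

Lemma smooth_partials k s f : (size s <= k)%N -> smooth k f -> smooth (k - size s) (partials s f).
Proof.
move=> + sf; elim: s => [_|i s IH sk] /=; first by rewrite subn0.
have := IH (ltnW sk); rewrite -subSS subSn//.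
by case=> _ /(_ i)[].
Qed.

End smooth_functions.

Section local_bounds.
Context {R : realType} {m : nat}.
Local Notation n := m.+1.
Local Notation e_ i := (delta_mx ord0 i : 'rV[R]_n).
Implicit Types (x y z v : 'rV[R]_n) (f g : 'rV[R]_n -> R) (rho theta : R).

Definition lhold theta f := forall rho, 0 < rho -> exists2 C : R, 0 <= C &
  forall x y, enorm x <= rho -> enorm y <= rho -> `|f x - f y| <= C * enorm (x - y) `^ theta.

(* [s] plays the role of alpha + epsilon. *)
Definition ldiff2 (s : R) f := forall rho, 0 < rho -> exists2 C : R, 0 <= C &
  forall x z, enorm x <= rho -> enorm z <= 1 ->
    `|2 * f x - f (x + z) - f (x - z)| <= C * enorm z `^ s.

Lemma ler_sum_ord (F : 'I_n -> R) i : (forall j, 0 <= F j) -> F i <= \sum_j F j.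
Proof. by move=> F0; rewrite (bigD1 i isT) /= lerDl sumr_ge0. Qed.

Lemma smooth_bounded_partials f rho : smooth 1 f -> exists2 M : R, 0 <= M &
  forall i x, enorm x <= rho -> `|partial i f x| <= M.
Proof.
move=> [_ H].
have B i : {M : R | 0 <= M /\ forall x, enorm x <= rho -> `|partial i f x| <= M}.
  apply: cid; have [_ [c _]] := H i.
  by have [M M0 HM] := continuous_bounded_eball rho c; exists M.
exists (\sum_i sval (B i)) => [|i x xr].
  by apply: sumr_ge0 => i _; have [] := svalP (B i).
have [_ /(_ x xr) h] := svalP (B i); apply: (le_trans h).
apply: (@ler_sum_ord (fun i => sval (B i))) => j; by have [] := svalP (B j).
Qed.

Lemma smooth1_lhold theta f : 0 < theta -> theta <= 1 -> smooth 1 f -> lhold theta f.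
Proof.
move=> t0 t1 sf rho r0; have [_ H] := sf.
have [M M0 HM] := smooth_bounded_partials (rho + n%:R * (2 * rho)) sf.
exists (M * (n%:R * (2 * rho) `^ (1 - theta))).
  by rewrite mulr_ge0// mulr_ge0 ?powR_ge0.
move=> x y xr yr; have h0 := enorm_ge0 (x - y).
have h : enorm (x - y) <= 2 * rho by rewrite (le_trans (enormB _ _))//; lra.
have h1 : enorm (x - y) <= (2 * rho) `^ (1 - theta) * enorm (x - y) `^ theta.
  have [->|xy] := eqVneq (enorm (x - y)) 0; first by rewrite mulr_ge0// powR_ge0.
  have xy0 : 0 < enorm (x - y) by rewrite lt_neqAle eq_sym xy.
  rewrite -[leLHS]powRr1// -{1}(subrK theta 1) powRD ?xy ?implybT//.
  by rewrite ler_wpM2r ?powR_ge0// ge0_ler_powR ?nnegrE ?subr_ge0// mulr_ge0// ltW.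
have := @linear_approx R m f y (x - y) (fun=> 0) M M0 (fun i => (H i).1).
rewrite big1 ?subr0 => [|i _]; last by rewrite mul0r.
rewrite [y + _]addrC subrK => A; apply: (le_trans (A _)).
  move=> i w wy; rewrite subr0; apply: HM.
  rewrite -(subrK y w) (le_trans (enormD _ _))// addrC lerD// (le_trans wy)// ler_wpM2l//.
by rewrite -!mulrA ler_wpM2l// ler_wpM2l.
Qed.

Lemma lhold_ldiff2 theta f : lhold theta f -> ldiff2 theta f.
Proof.
move=> H rho r0; have [C C0 HC] := H (rho + 1) (addr_gt0 r0 ltr01).
exists (2 * C) => [|x z xr z1]; first by rewrite mulr_ge0.
have h1 : enorm (x + z) <= rho + 1 by rewrite (le_trans (enormD _ _))// lerD.
have h2 : enorm (x - z) <= rho + 1 by rewrite (le_trans (enormB _ _))// lerD.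
have h3 : enorm x <= rho + 1 by lra.
have := HC _ _ h3 h1; have := HC _ _ h3 h2.
rewrite subKr (_ : x - (x + z) = - z) ?enormN; last by rewrite opprD addrA subrr add0r.
move=> A B.
have -> : 2 * f x - f (x + z) - f (x - z) = (f x - f (x + z)) + (f x - f (x - z)) by ring.
by rewrite (le_trans (ler_normD _ _))//; lra.
Qed.

(** The linear terms at z and - z cancel in the second difference; each Taylor remainder is of order
    |z|^(1 + theta) because the gradient is Hoelder continuous. *)
Lemma smooth1_ldiff2 theta f : 0 < theta -> smooth 1 f -> (forall i, lhold theta (partial i f)) ->
  ldiff2 (1 + theta) f.
Proof.
move=> t0 [_ H] Hh rho r0.
pose rho' := rho + n%:R; have r0' : 0 < rho' by rewrite /rho' ltr_wpDr.
have B i : {C : R | 0 <= C /\ forall x y, enorm x <= rho' -> enorm y <= rho' ->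
   `|partial i f x - partial i f y| <= C * enorm (x - y) `^ theta}.
  by apply: cid; have [C C0 HC] := Hh i _ r0'; exists C.
pose C := \sum_i sval (B i).
have C0 : 0 <= C by apply: sumr_ge0 => i _; have [] := svalP (B i).
have BC i : sval (B i) <= C.
  apply: (@ler_sum_ord (fun i => sval (B i))) => j; by have [] := svalP (B j).
pose K := C * n%:R `^ theta * n%:R.
exists (2 * K); first by rewrite mulr_ge0// mulr_ge0// mulr_ge0// powR_ge0.
have A x z : enorm x <= rho -> enorm z <= 1 ->
   `|f (x + z) - f x - \sum_i partial i f x * z ord0 i| <= K * enorm z `^ (1 + theta).
  move=> xr z1; have z0 := enorm_ge0 z.
  have Mz : 0 <= C * (n%:R * enorm z) `^ theta by rewrite mulr_ge0// powR_ge0.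
  apply: (le_trans (linear_approx Mz (fun i => (H i).1) _)).
    move=> i y yx; have [_ HB] := svalP (B i).
    have nz : n%:R * enorm z <= n%:R by rewrite ler_piMr.
    apply: (@le_trans _ _ (sval (B i) * enorm (y - x) `^ theta)).
      apply: HB; last by rewrite /rho' (le_trans xr)// lerDl.
      by rewrite -(subrK x y) (le_trans (enormD _ _))// addrC /rho' lerD// (le_trans yx).
    apply: ler_pM => //; rewrite ?powR_ge0//; first by have [] := svalP (B i).
    by rewrite ge0_ler_powR ?nnegrE ?enorm_ge0 ?(ltW t0)// mulr_ge0.
  rewrite powRM// /K.
  have [->|zn] := eqVneq (enorm z) 0; first by rewrite !powR0 ?gt_eqF ?addr_gt0// !mulr0.
  by rewrite powRD ?zn ?implybT// powRr1// le_eqVlt; apply/orP; left; apply/eqP; ring.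
move=> x z xr z1.
have A1 := A x z xr z1; have := A x (- z) xr; rewrite enormN => /(_ z1) A2.
have E : \sum_i partial i f x * (- z) ord0 i = - \sum_i partial i f x * z ord0 i.
  by rewrite -sumrN; apply: eq_bigr => i _; rewrite mxE mulrN.
rewrite E in A2; move: A1 A2; set S := \sum_i _ => A1 A2.
have -> : 2 * f x - f (x + z) - f (x - z) =
   - (f (x + z) - f x - S) - (f (x - z) - f x - - S) by ring.
by rewrite (le_trans (ler_normB _ _))// normrN; lra.
Qed.

End local_bounds.

(** * Continuity and differentiation of parametric integrals *)

Section parametric_integrals.
Context {R : realType} {m : nat}.
Local Notation n := m.+1.
Local Notation mu := (lebesgue_rV R n).
Local Notation e_ i := (delta_mx ord0 i : 'rV[R]_n).
Implicit Types (x y z v : 'rV[R]_n) (f g : 'rV[R]_n -> R) (G : 'rV[R]_n -> 'rV[R]_n -> R).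

Definition dominated G : Prop :=
  (forall x, measurable_fun setT (G x)) /\
  forall rho : R, 0 < rho -> exists g, [/\ mu.-integrable setT (EFin \o g), forall z, 0 <= g z &
    forall x z, enorm x <= rho -> `|G x z| <= g z].

Fixpoint dsmooth (k : nat) G : Prop :=
  [/\ dominated G, forall z, continuous (G ^~ z) &
  match k with
  | 0 => True
  | k'.+1 => forall i, (forall z x, derivable (G ^~ z) x (e_ i)) /\
      dsmooth k' (fun x z => partial i (G ^~ z) x)
  end].

Lemma dominated_integrable G x : dominated G -> mu.-integrable setT (EFin \o G x).
Proof.
move=> [mG H]; have r0 : 0 < enorm x + 1 by rewrite ltr_wpDl ?enorm_ge0.
have [g [ig g0 Hg]] := H _ r0.
apply: (le_integrable measurableT) ig; first exact/measurable_EFinP.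
move=> z _; rewrite /= lee_fin (ger0_norm (g0 z)); apply: Hg; lra.
Qed.

Lemma near_enorm x (e : R) : 0 < e -> \forall y \near x, enorm (y - x) <= e.
Proof.
move=> e0; have c := @continuous_enorm R n; have FF : Filter (nbhs x) := nbhs_filter x.
have cx : enorm (y - x) @[y --> x] --> (0 : R).
  have <- : enorm (x - x) = 0 by rewrite subrr enorm0.
  apply: (continuous_comp (f := fun y => y - x) (g := enorm)); last exact: c.
  exact: (@cvgD _ _ _ (nbhs x) FF _ _ _ _ (@cvg_id _ (nbhs x)) (@cvg_cst _ _ _ _ FF)).
move/(@cvgrPdist_le _ _ _ _ FF)/(_ e e0) : cx; apply: filterS => y.
by rewrite sub0r normrN ger0_norm ?enorm_ge0.
Qed.

(** Dominated convergence concerns sequences, so continuity is proved by contradiction: a failure at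
    x yields points [y k] within 1/(k+1) of x at which the integral stays e away from its value at
    x. *)
Lemma continuous_dominated G : dominated G -> (forall z, continuous (G ^~ z)) ->
  continuous (fun x => \int[mu]_z G x z).
Proof.
move=> dG cG x; have FF : Filter (nbhs x) := nbhs_filter x.
apply/(@cvgrPdist_le _ _ _ _ FF) => e e0; apply: contrapT => H.
have [mG dom] := dG.
have r0 : 0 < enorm x + 1 by rewrite ltr_wpDl ?enorm_ge0.
have [g [ig g0 Hg]] := dom _ r0.
have K k : {y | enorm (y - x) <= k.+1%:R^-1 /\ e < `|\int[mu]_z G x z - \int[mu]_z G y z|}.
  apply: cid; apply: contrapT => N; apply: H.
  have k0 : 0 < k.+1%:R^-1 :> R by rewrite invr_gt0.
  apply: filterS (near_enorm x k0) => y yk; rewrite leNgt; apply/negP => ey.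
  by apply: N; exists y.
pose y k := sval (K k).
have yx k : enorm (y k - x) <= k.+1%:R^-1 by have [] := svalP (K k).
have yr k : enorm (y k) <= enorm x + 1.
  rewrite -(subrK x (y k)) (le_trans (enormD _ _))// addrC lerD2l (le_trans (yx k))//.
  by rewrite invf_le1// ler1n.
have cy : y k @[k --> \oo] --> x.
  apply/cvgrPdist_le => /= d d0; exists (Num.truncn d^-1).+1 => // k /= kd.
  rewrite distrC (le_trans (norm_le_enorm _))// (le_trans (yx k))//.
  rewrite -[leRHS]invrK lef_pV2 ?posrE ?invr_gt0//.
  apply: ltW; apply: (lt_le_trans (truncnS_gt _)); rewrite ler_nat; exact: leq_trans kd _.
have := @dominated_convergence _ _ _ mu setT measurableT (fun k z => (G (y k) z)%:E)
  (fun z => (G x z)%:E) (EFin \o g).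
move=> /(_ _ _ _ ig)[].
- by move=> k; apply/measurable_EFinP.
- exact/measurable_EFinP.
- by apply: aeW => z _; apply: cvg_EFin; [exact: nearW|exact: (cvg_comp _ _ cy (cG z x))].
- by apply: aeW => z k _; rewrite /= lee_fin; exact: Hg.
move=> iG _ C.
have C1 : \int[mu]_z G (y k) z @[k --> \oo] --> \int[mu]_z G x z.
  apply: fine_cvg; rewrite fineK//; first exact: integrable_fin_num.
move/cvgrPdist_le/(_ e e0) : C1 => [k _ /(_ k (leqnn k))] /=.
by have [_] := svalP (K k); rewrite ltNge => /negP.
Qed.

Lemma is_derive_dominated G i x : dominated G ->
  (forall z x, derivable (G ^~ z) x (e_ i)) ->
  dominated (fun x z => partial i (G ^~ z) x) ->
  is_derive x (e_ i) (fun x => \int[mu]_z G x z) (\int[mu]_z partial i (G ^~ z) x).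
Proof.
move=> dG D dG'; apply/is_derive_slice0.
have [_ dom'] := dG'.
have r0 : 0 < enorm x + 1 by rewrite ltr_wpDl ?enorm_ge0.
have [g [ig g0 Hg]] := dom' _ r0.
pose f (s : R) z := G (x + s *: e_ i) z.
have df (s : R) z : is_derive s (1 : R) (f ^~ z) (partial i (G ^~ z) (x + s *: e_ i)).
  by apply/(is_derive_slice (G ^~ z)); exact: is_derive_partial.
have I0 : `]-1, 1[%classic (0 : R) by rewrite /= in_itv/= ltrN10 ltr01.
have H1 s : `]-1, 1[%classic s -> mu.-integrable setT (EFin \o f s).
  by move=> _; exact: dominated_integrable.
have H2 s z : `]-1, 1[%classic s -> setT z -> derivable (f ^~ z) s 1.
  by move=> _ _; have [] := df s z.
have H3 s z : `]-1, 1[%classic s -> setT z -> `|partial1of2 f s z| <= g z.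
  rewrite /= in_itv/= => /andP[s1 s2] _; rewrite partial1of2E; have [_ ->] := df s z.
  apply: Hg; rewrite (le_trans (enormD _ _))// enormZ enorm_delta mulr1 lerD2l.
  by rewrite ler_norml !ltW.
have E := differentiation_under_integral measurableT I0 H1 H2 g0 ig H3.
have V := derivable_under_integral measurableT I0 H1 H2 g0 ig H3.
split; first exact: V.
rewrite -derive1E E; apply: eq_Rintegral => z _.
by rewrite partial1of2E; have [_ ->] := df 0 z; rewrite scale0r addr0.
Qed.

Lemma smooth_dominated k G : dsmooth k G -> smooth k (fun x => \int[mu]_z G x z).
Proof.
elim: k G => [|k IH] G [dG cG H] /=; (split; first exact: continuous_dominated) => // i.
have [D S] := H i.
have dG' : dominated (fun x z => partial i (G ^~ z) x) by case: (k) S => [|?] [].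
have E x := is_derive_dominated x dG D dG'.
split; first by move=> x; have [] := E x.
apply: smooth_ext (IH _ S) => x; by have [_] := E x.
Qed.

End parametric_integrals.

(** * Derivatives of the truncated powers (1 - |z|^2)_+^N *)

Section positive_part_calculus.
Context {R : realType} {m : nat}.
Local Notation n := m.+1.
Local Notation e_ i := (delta_mx ord0 i : 'rV[R]_n).
Implicit Types (x y z v : 'rV[R]_n) (f g : 'rV[R]_n -> R).

Lemma is_derive_quadratic (f : R -> R) (x d C : R) : (forall h : R, `|f (x + h) - f x - h * d| <= C * h ^+ 2) ->
  is_derive x (1 : R) f d.
Proof.
move=> H; suff L : (fun h : R => h^-1 *: ((f \o shift x) (h *: (1 : R)) - f x)) @ 0^' --> d.
  by split; [apply/cvg_ex; exists d|exact: cvg_lim L].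
apply/cvgrPdist_le => e e0; near=> h.
have h0 : h != 0 by near: h; exact: nbhs_dnbhs_neq.
rewrite /= [h *: 1]mulr1 [h + x]addrC.
have -> : d - h^-1 *: (f (x + h) - f x) = - (h^-1 * (f (x + h) - f x - h * d)).
  by rewrite /GRing.scale/=; field.
rewrite normrN normrM normfV mulrC ler_pdivrMr ?normr_gt0//.
apply: (le_trans (H h)); rewrite -real_normK ?num_real// expr2 mulrA ler_wpM2r//.
apply: (@le_trans _ _ (`|C| * `|h|)); first by rewrite ler_wpM2r// ler_norm.
have C1 : 0 < `|C| + 1 by rewrite ltr_wpDl.
have hh : `|h| <= e / (`|C| + 1).
  near: h; apply: dnbhs0_le; by rewrite divr_gt0.
apply: le_trans (ler_wpM2l (normr_ge0 C) hh) _.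
by rewrite mulrCA ler_piMr ?(ltW e0)// ler_pdivrMr// mul1r lerDl.
Unshelve. all: by end_near.
Qed.

(** The square is squeezed between its tangent and a quadratic error by [pos_sqr_ge] and
    [pos_sqr_le], which also covers the kink at 0; higher powers follow from t_+^(N+3) = t t_+^(N+2)
    and the product rule. *)
Lemma is_derive_pospart (N : nat) (t : R) :
  is_derive t (1 : R) (fun t => Num.max t 0 ^+ N.+2) (N.+2%:R * Num.max t 0 ^+ N.+1).
Proof.
elim: N t => [|N IH] t.
  apply: (@is_derive_quadratic _ _ _ 1) => h; rewrite ler_norml.
  have := @pos_sqr_ge R t (t + h); have := @pos_sqr_le R t (t + h).
  rewrite [t + h]addrC addrK expr1; have := sqr_ge0 h; move=> *; apply/andP; split; lra.
have E : (fun t => Num.max t 0 ^+ N.+3) = (fun t : R => t) * (fun t => Num.max t 0 ^+ N.+2).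
  apply/funext => s; rewrite [LHS]exprS; change (Num.max s 0 * Num.max s 0 ^+ N.+2 = s * Num.max s 0 ^+ N.+2).
  by case: (leP s 0) => // _; rewrite expr0n /= !mulr0.
rewrite E; have := is_deriveM (is_derive_id t (1 : R)) (IH t).
move=> D; apply: is_derive_eq.
case: (leP t 0) => [t0|t0]; first by rewrite !expr0n/= !mulr0 !scaler0 scale0r addr0.
rewrite /GRing.scale/= mulr1 [X in _ = _ * X]exprS.
by rewrite mulrCA -exprS -[N.+3%:R]natr1; ring.
Qed.

(** For N = 0 this is the constant 1, even outside the ball, so statements about its support use
    exponents of the form [N.+1]. *)
Definition ppart (N : nat) z : R := Num.max (1 - enorm z ^+ 2) 0 ^+ N.

Lemma ppart_ge0 N z : 0 <= ppart N z.
Proof. by rewrite exprn_ge0// le_max lexx orbT. Qed.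

Lemma ppart_le1 N z : ppart N z <= 1.
Proof.
rewrite exprn_ile1// ?le_max ?lexx ?orbT// ge_max ler01 andbT gerBl.
exact: sqr_ge0.
Qed.

Lemma ppart_out N z : 1 <= enorm z -> ppart N.+1 z = 0.
Proof.
move=> z1; rewrite /ppart (_ : Num.max _ _ = 0) ?expr0n//; apply/max_idPr.
by rewrite subr_le0 expr_ge1// enorm_ge0.
Qed.

Lemma continuous_sqr_enorm : continuous (fun z => enorm z ^+ 2).
Proof. by have c := @continuous_enorm R n; exact: (continuous_funM c c). Qed.

Lemma continuous_ppart N : continuous (ppart N).
Proof.
have c : continuous (fun z : 'rV[R]_n => Num.max (1 - enorm z ^+ 2) 0).
  have c1 : continuous (fun _ : 'rV[R]_n => 1 : R) by move=> y; exact: cst_continuous.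
  have c2 := continuous_funD c1 (continuous_funZ (c := -1) continuous_sqr_enorm).
  under eq_fun do rewrite -mulN1r.
  move=> z; apply: (@continuous_comp _ _ _ (fun z => 1 + -1 * enorm z ^+ 2) (fun t => Num.max t 0)).
    exact: c2.
  by apply: continuous_max; [exact: cvg_id|exact: cst_continuous].
elim: N => [|N IH]; first by move=> z; exact: cst_continuous.
have -> : ppart N.+1 = (fun z => Num.max (1 - enorm z ^+ 2) 0 * ppart N z).
  by apply/funext => z; rewrite /ppart exprS.
exact: continuous_funM.
Qed.

Lemma is_derive_sqr_enorm i z : is_derive z (e_ i) (fun z => enorm z ^+ 2) (2 * z ord0 i).
Proof.
apply/is_derive_slice0; apply: (@is_derive_quadratic _ _ _ 1) => h.
have ed : edot z (e_ i) = z ord0 i.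
  rewrite /edot (bigD1 i)//= !mxE !eqxx mulr1 big1 ?addr0// => j ji.
  by rewrite !mxE (negPf ji) andbF mulr0.
rewrite add0r scale0r addr0 enorm_sqrD edotZr ed enormZ enorm_delta mulr1 real_normK ?num_real//.
rewrite (_ : _ - _ = h ^+ 2); first by rewrite mul1r ger0_norm ?sqr_ge0.
ring.
Qed.

Lemma is_derive_comp1 i z f (h : R -> R) d d' : is_derive z (e_ i) f d -> is_derive (f z) (1 : R) h d' ->
  is_derive z (e_ i) (h \o f) (d' * d).
Proof.
move=> /is_derive_slice0 D1 D2; apply/is_derive_slice0.
have D2' : is_derive ((fun s : R => f (z + s *: e_ i)) 0) (1 : R) h d' by rewrite scale0r addr0.
have := is_derive1_comp (f := h) (g := fun s : R => f (z + s *: e_ i)).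
by move=> /(_ _ _ _ D2' D1).
Qed.

Lemma is_derive_ppart (N : nat) i z :
  is_derive z (e_ i) (ppart N.+2) (- (2 * N.+2%:R) * (z ord0 i * ppart N.+1 z)).
Proof.
have D1 : is_derive z (e_ i) (fun z => 1 - enorm z ^+ 2) (0 - 2 * z ord0 i).
  exact: (is_deriveB (is_derive_cst (1 : R) z (e_ i)) (is_derive_sqr_enorm i z)).
have := is_derive_comp1 D1 (is_derive_pospart N (1 - enorm z ^+ 2)).
by rewrite sub0r (_ : _ * - _ = - (2 * N.+2%:R) * (z ord0 i * ppart N.+1 z))// /ppart; ring.
Qed.

End positive_part_calculus.

(** * Functions with decaying derivatives and the regularised kernel *)

Section decay_classes.
Context {R : realType} {m : nat}.
Local Notation n := m.+1.
Local Notation e_ i := (delta_mx ord0 i : 'rV[R]_n).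
Implicit Types (x y z v : 'rV[R]_n) (f g : 'rV[R]_n -> R) (d : R).

(** All derivatives up to order k obey the same rate d. A negative rate allows growth: the
    coordinates have rate -1, so that products of kernels and coordinates stay within these
    classes. *)
Fixpoint decay (k : nat) d g : Prop :=
  [/\ continuous g, exists2 C : R, 0 <= C & forall z, `|g z| <= C * (1 + enorm z) `^ (- d) &
  match k with
  | 0 => True
  | k'.+1 => forall i, (forall z, derivable g z (e_ i)) /\ decay k' d (partial i g)
  end].

Lemma decay_bound k d g : decay k d g ->
  exists2 C : R, 0 <= C & forall z, `|g z| <= C * (1 + enorm z) `^ (- d).
Proof. by case: k => [|k] []. Qed.

Lemma decay_ext k d f g : f =1 g -> decay k d f -> decay k d g.
Proof. by move=> /funext ->. Qed.

Lemma decay_pred k d g : decay k.+1 d g -> decay k d g.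
Proof.
elim: k g => [|k IH] g [cg bg H]; first by [].
by split => // i; have [D S] := H i; split => //; exact: IH.
Qed.

Let base_gt0 z : 0 < 1 + enorm z. Proof. by rewrite ltr_wpDr// enorm_ge0. Qed.

Lemma decay_le k d d' g : d' <= d -> decay k d g -> decay k d' g.
Proof.
move=> dd; elim: k g => [|k IH] g [cg [C C0 HC] H]; split => //.
- exists C => // z; apply: (le_trans (HC z)); rewrite ler_wpM2l// ler_powR ?lerN2//.
  by rewrite lerDl enorm_ge0.
- exists C => // z; apply: (le_trans (HC z)); rewrite ler_wpM2l// ler_powR ?lerN2//.
  by rewrite lerDl enorm_ge0.
- by move=> i; have [D S] := H i; split => //; exact: IH.
Qed.

Lemma decayD k d f g : decay k d f -> decay k d g -> decay k d (fun z => f z + g z).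
Proof.
have B (f' g' : 'rV[R]_n -> R) :
   (exists2 C : R, 0 <= C & forall z, `|f' z| <= C * (1 + enorm z) `^ (- d)) ->
   (exists2 C : R, 0 <= C & forall z, `|g' z| <= C * (1 + enorm z) `^ (- d)) ->
   exists2 C : R, 0 <= C & forall z, `|f' z + g' z| <= C * (1 + enorm z) `^ (- d).
  move=> [C C0 HC] [D D0 HD]; exists (C + D) => [|z]; first exact: addr_ge0.
  by rewrite (le_trans (ler_normD _ _))// mulrDl lerD.
elim: k f g => [|k IH] f g [cf bf Hf] [cg bg Hg]; split => //; try exact: continuous_funD; try exact: B.
move=> i; have [df sf] := Hf i; have [dg sg] := Hg i; have [D E] := partialD df dg.
by split => //; rewrite E; exact: IH.
Qed.

Lemma decayM k d d' f g : decay k d f -> decay k d' g -> decay k (d + d') (fun z => f z * g z).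
Proof.
have B d1 d2 (f' g' : 'rV[R]_n -> R) :
   (exists2 C : R, 0 <= C & forall z, `|f' z| <= C * (1 + enorm z) `^ (- d1)) ->
   (exists2 C : R, 0 <= C & forall z, `|g' z| <= C * (1 + enorm z) `^ (- d2)) ->
   exists2 C : R, 0 <= C & forall z, `|f' z * g' z| <= C * (1 + enorm z) `^ (- (d1 + d2)).
  move=> [C C0 HC] [D D0 HD]; exists (C * D) => [|z]; first exact: mulr_ge0.
  rewrite normrM opprD powRD ?(gt_eqF (base_gt0 z)) ?implybT// mulrACA.
  exact: ler_pM.
elim: k d d' f g => [|k IH] d d' f g Sf Sg; have [cf bf Hf] := Sf; have [cg bg Hg] := Sg.
  by split => //; [exact: continuous_funM|exact: B].
split; [exact: continuous_funM|exact: B|].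
move=> i; have [df sf] := Hf i; have [dg sg] := Hg i; have [D E] := partialM df dg.
split => //; rewrite E; apply: decayD; first by apply: IH => //; exact: decay_pred.
by rewrite (addrC d d'); apply: IH => //; exact: decay_pred.
Qed.

Lemma decayZ k d c g : decay k d g -> decay k d (fun z => c * g z).
Proof.
have B (g' : 'rV[R]_n -> R) :
   (exists2 C : R, 0 <= C & forall z, `|g' z| <= C * (1 + enorm z) `^ (- d)) ->
   exists2 C : R, 0 <= C & forall z, `|c * g' z| <= C * (1 + enorm z) `^ (- d).
  move=> [C C0 HC]; exists (`|c| * C) => [|z]; first exact: mulr_ge0.
  by rewrite normrM -mulrA ler_wpM2l.
elim: k g => [|k IH] g [cg bg Hg]; split => //; try exact: continuous_funZ; try exact: B.
move=> i; have [dg sg] := Hg i; have [D E] := partialZ c dg.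
by split => //; rewrite E; exact: IH.
Qed.

Lemma decay_cst k (c : R) : decay k 0 (fun _ : 'rV[R]_n => c).
Proof.
elim: k c => [|k IH] c; split => //; try by move=> z; exact: cst_continuous.
- by exists `|c| => // z; rewrite oppr0 powRr0 mulr1.
- by exists `|c| => // z; rewrite oppr0 powRr0 mulr1.
move=> i; split => //.
apply: (@decay_ext _ _ (fun=> 0)) (IH 0) => z.
by apply/esym/partialE; exact: is_derive_cst.
Qed.

Lemma is_derive_coord i j z : is_derive z (e_ i) (fun z => z ord0 j) ((i == j)%:R).
Proof.
apply/is_derive_slice0; apply: (@is_derive_quadratic _ _ _ _ 0) => h.
rewrite add0r scale0r addr0 !mxE eqxx/= [j == i]eq_sym.
by rewrite addrAC addrK subrr normr0 mul0r.
Qed.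

Lemma continuous_coord j : continuous (fun z : 'rV[R]_n => z ord0 j).
Proof. exact: coord_continuous. Qed.

Lemma decay_coord k j : decay k (-1) (fun z : 'rV[R]_n => z ord0 j).
Proof.
have B : exists2 C : R, 0 <= C & forall z : 'rV[R]_n, `|z ord0 j| <= C * (1 + enorm z) `^ (- (-1)).
  exists 1 => // z; rewrite mul1r opprK powRr1 ?(ltW (base_gt0 z))//.
  by rewrite (le_trans (coord_le_enorm _ _))// lerDr.
case: k => [|k]; split => //; try exact: continuous_coord.
move=> i; have D z := is_derive_coord i j z; split; first by move=> z; have [] := D z.
apply: (@decay_le _ 0); first by rewrite lerN10.
apply: (@decay_ext _ _ (fun=> (i == j)%:R)) (decay_cst k _) => z.
exact/esym/partialE.
Qed.

(** Compact support gives every rate d. Each derivative lowers the exponent by one, hence the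
    exponent k + N + 1. *)
Lemma decay_ppart k (N : nat) d : decay k d (@ppart R m (k + N).+1).
Proof.
have B k' d' : exists2 C : R, 0 <= C & forall z, `|@ppart R m k'.+1 z| <= C * (1 + enorm z) `^ (- d').
  exists (2 `^ `|d'|) => [|z]; first exact: powR_ge0.
  rewrite ger0_norm ?ppart_ge0//.
  have [z1|z1] := leP 1 (enorm z); first by rewrite ppart_out// mulr_ge0// powR_ge0.
  apply: (le_trans (ppart_le1 _ _)).
  rewrite powRN -ler_pdivrMr ?invr_gt0 ?powR_gt0// invrK mul1r.
  apply: (@le_trans _ _ ((1 + enorm z) `^ `|d'|)).
    by rewrite ler_powR ?ler_norm// lerDl enorm_ge0.
  by rewrite ge0_ler_powR ?nnegrE ?(ltW (base_gt0 z))//; lra.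
elim: k N d => [|k IH] N d; split => //; try exact: continuous_ppart.
move=> i; have D z := is_derive_ppart (k + N) i z; split; first by move=> z; have [] := D z.
have E : partial i (ppart (k + N).+2) = (fun z => - (2 * (k + N).+2%:R) * (z ord0 i * ppart (k + N).+1 z)).
  by apply/funext => z; exact: partialE.
rewrite addSn E; apply: decayZ.
have := decayM (decay_coord k i) (IH N (d + 1)).
by rewrite addrCA addNr addr0.
Qed.

(** A positive function of finite smoothness that equals |z|^2 outside the unit ball; its negative
    powers [reg_ker] regularise the singular kernel at 0 without touching its tail. *)
Definition quad_reg (N : nat) z : R := enorm z ^+ 2 + ppart N z.

(** With t = |z|^2 < 1, Bernoulli's inequality bounds (1 - t)^(N+1) below by 1 - (N+1) t, which
    settles t < 1/(N+1); larger t suffice by themselves. *)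
Lemma quad_reg_ge N z : (N.+1%:R)^-1 <= quad_reg N.+1 z.
Proof.
have t0 := sqr_ge0 (enorm z); rewrite /quad_reg /ppart; set t := enorm z ^+ 2 in t0 *.
have N0 : 0 < N.+1%:R :> R by [].
have N1 : (N.+1%:R)^-1 <= 1 :> R by rewrite invf_le1// ler1n.
have [t1|t1] := leP 1 t.
  rewrite (_ : Num.max _ _ = 0) ?expr0n /= ?addr0; first exact: le_trans t1.
  by apply/max_idPr; rewrite subr_le0.
rewrite (_ : Num.max _ _ = 1 - t); last by apply/max_idPl; rewrite subr_ge0 ltW.
have B (k : nat) : 1 - k%:R * t <= (1 - t) ^+ k.
  elim: k => [|k IH]; first by rewrite mul0r subr0 expr0.
  rewrite exprS; apply: (@le_trans _ _ ((1 - t) * (1 - k%:R * t))).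
    have -> : k.+1%:R = k%:R + 1 :> R by rewrite natr1.
    have : 0 <= k%:R * t * t by apply: mulr_ge0 => //; exact: mulr_ge0.
    by move: (k%:R : R) => c; lra.
  by apply: ler_wpM2l => //; lra.
have := B N.+1; have : 0 <= (1 - t) ^+ N.+1 by rewrite exprn_ge0// subr_ge0 ltW.
set p := (1 - t) ^+ _ => p0 pB.
have [tN|tN] := leP (N.+1%:R)^-1 t; first by rewrite (le_trans tN)// lerDl.
have : N.+1%:R * t + (N.+1%:R^-1 - t) <= 1.
  have h : N.+1%:R * (N.+1%:R^-1 - t) = 1 - N.+1%:R * t by rewrite mulrBr mulfV ?gt_eqF.
  have : 0 <= N%:R * (N.+1%:R^-1 - t) by rewrite mulr_ge0// subr_ge0 ltW.
  by move: h; move: (N.+1%:R^-1) => v; rewrite -(natr1 N); move: (N%:R : R) => c; lra.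
by move=> H; rewrite addrC; apply: (le_trans _ (lerD pB (lexx t))); rewrite -lerBlDr lerBrDl.
Qed.

Lemma quad_reg_gt0 N z : 0 < quad_reg N.+1 z.
Proof. by apply: lt_le_trans (quad_reg_ge N z); rewrite invr_gt0. Qed.

Lemma quad_reg_out N z : 1 <= enorm z -> quad_reg N.+1 z = enorm z ^+ 2.
Proof. by move=> z1; rewrite /quad_reg ppart_out// addr0. Qed.

Lemma le_quad_reg N z : enorm z ^+ 2 <= quad_reg N z.
Proof. by rewrite lerDl ppart_ge0. Qed.

Lemma base_le_quad_reg N z : (1 + enorm z) ^+ 2 <= (2 * N.+1%:R + 2) * quad_reg N.+1 z.
Proof.
have h1 := quad_reg_ge N z; have h2 := le_quad_reg N.+1 z; have h0 := enorm_ge0 z.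
have h3 := sqr_ge0 (enorm z - 1).
have h4 : 1 <= N.+1%:R * quad_reg N.+1 z.
  by rewrite -(@ler_pM2l _ N.+1%:R^-1) ?invr_gt0// mulr1 mulKf ?gt_eqF.
by lra.
Qed.

Definition reg_ker (N : nat) (c : R) z : R := quad_reg N z `^ (- c).

Lemma continuous_reg_ker N (g : R) : continuous (reg_ker N.+1 g).
Proof.
have cq : continuous (quad_reg N.+1) by apply: continuous_funD; [exact: continuous_sqr_enorm|exact: continuous_ppart].
move=> z; apply: (@continuous_comp _ _ _ (quad_reg N.+1) (fun t => t `^ (- g))); first exact: cq.
have q0 := quad_reg_gt0 N z.
have D : is_derive (quad_reg N.+1 z) (1 : R) (fun t => t `^ (- g)) (- g * quad_reg N.+1 z `^ (- g - 1)).
  exact: is_derive1_powR.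
exact: is_derive1_continuous D.
Qed.

Lemma is_derive_reg_ker N (g : R) i z : is_derive z (e_ i) (reg_ker N.+2 g)
  (- g * (reg_ker N.+2 (g + 1) z * (z ord0 i * (2 - (2 * N.+2%:R) * ppart N.+1 z)))).
Proof.
have D1 : is_derive z (e_ i) (quad_reg N.+2) (2 * z ord0 i + - (2 * N.+2%:R) * (z ord0 i * ppart N.+1 z)).
  exact: (is_deriveD (is_derive_sqr_enorm i z) (is_derive_ppart N i z)).
have q0 := quad_reg_gt0 N.+1 z.
have D2 : is_derive (quad_reg N.+2 z) (1 : R) (fun t => t `^ (- g)) (- g * quad_reg N.+2 z `^ (- g - 1)).
  exact: is_derive1_powR.
have D := is_derive_comp1 D1 D2.
rewrite (_ : - g * (reg_ker _ _ _ * _) = - g * quad_reg N.+2 z `^ (- g - 1) *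
  (2 * z ord0 i + - (2 * N.+2%:R) * (z ord0 i * ppart N.+1 z))); first exact: D.
by rewrite /reg_ker opprD; ring.
Qed.

(** A derivative raises g to g + 1, that is the rate by 2, and brings out a coordinate of rate -1.
    The surplus 1 is discarded so that one rate serves all orders. *)
Lemma decay_reg_ker k N (g : R) : 0 <= g -> decay k (2 * g) (reg_ker (k + N).+2 g).
Proof.
have B k' (g' : R) : 0 <= g' -> exists2 C : R, 0 <= C & forall z, `|reg_ker k'.+1 g' z| <= C * (1 + enorm z) `^ (- (2 * g')).
  move=> g0; pose K : R := 2 * k'.+1%:R + 2; have K0 : 0 < K by rewrite /K ltr_wpDl// mulr_ge0.
  exists (K `^ g') => [|z]; first exact: powR_ge0.
  rewrite ger0_norm ?powR_ge0// /reg_ker (powRN_scale (c := K)) ?(ltW (quad_reg_gt0 _ _))//.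
  rewrite ler_wpM2l ?powR_ge0// -mulrN powRrM powR_mulrn ?(ltW (base_gt0 z))//.
  by apply: powRN_le => //; [rewrite exprn_gt0|exact: base_le_quad_reg].
elim: k N g => [|k IH] N g g0; (split; [exact: continuous_reg_ker|exact: B|]) => // i.
have D z := is_derive_reg_ker (k + N).+1 g i z; split; first by move=> z; have [] := D z.
rewrite addSn (_ : partial i _ = (fun z => - g *
   (reg_ker (k + N).+3 (g + 1) z * (z ord0 i * (2 - (2 * (k + N).+3%:R) * ppart (k + N).+2 z))))); last first.
  by apply/funext => z; exact: partialE.
apply: decayZ.
have I1 : decay k (2 * (g + 1)) (reg_ker (k + N).+3 (g + 1)).
  by rewrite -addnS; apply: IH; rewrite addr_ge0.
have I2 : decay k 0 (fun z => 2 + (- (2 * (k + N).+3%:R)) * ppart (k + N).+2 z).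
  apply: decayD; first exact: decay_cst.
  by apply: decayZ; rewrite -addnS; exact: decay_ppart.
have := decayM I1 (decayM (decay_coord k i) I2).
rewrite addr0 (_ : 2 * (g + 1) - 1 = 2 * g + 1); last by ring.
move=> /(@decay_le _ _ (2 * g)) H; apply: decay_ext (H _); last by rewrite lerDl.
by move=> z; rewrite mulNr.
Qed.

End decay_classes.

(** * Splitting the singular kernel into a compact and a regular part *)

Section fractional_regularity.
Context {R : realType} {m : nat}.
Local Notation n := m.+1.
Local Notation mu := (lebesgue_rV R n).
Local Notation e_ i := (delta_mx ord0 i : 'rV[R]_n).
Implicit Types (x y z v : 'rV[R]_n) (f g u : 'rV[R]_n -> R) (rho theta : R).

Definition diff2 f x z : R := 2 * f x - f (x + z) - f (x - z).

Lemma is_derive_shift_rV f x y v d : is_derive (x + y) v f d -> is_derive x v (fun x => f (x + y)) d.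
Proof.
move=> /is_derive_slice0 D; apply/is_derive_slice0.
by under eq_fun do rewrite addrAC.
Qed.

Lemma continuous_shiftr f y : continuous f -> continuous (fun x => f (x + y)).
Proof. by move=> cf; under eq_fun do rewrite addrC; exact: continuous_shift_rV. Qed.

(** The form in which the regularity of u is used: derivatives up to order k whose second
    differences are of order |z|^s, with s > alpha in the applications. *)
Fixpoint smooth_diff2 (s : R) (k : nat) f : Prop :=
  [/\ continuous f, ldiff2 s f &
  match k with
  | 0 => True
  | k'.+1 => forall i, (forall x, derivable f x (e_ i)) /\ smooth_diff2 s k' (partial i f)
  end].

Lemma smooth_diff2_smooth s k f : smooth_diff2 s k f -> smooth k f.
Proof.
elim: k f => [|k IH] f [cf _ H]; split => // i.
by have [D S] := H i; split => //; exact: IH.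
Qed.

Lemma smooth_diff2_continuous s k f : smooth_diff2 s k f -> continuous f.
Proof. by case: k => [|k] []. Qed.

Lemma smooth_diff2_ldiff2 s k f : smooth_diff2 s k f -> ldiff2 s f.
Proof. by case: k => [|k] []. Qed.

Section kernels.
Variable alpha : R.
Hypotheses (a0 : 0 < alpha) (a2 : alpha < 2).
Local Notation gam := ((n%:R + alpha) / 2).

Let gam2 : 2 * gam = n%:R + alpha. Proof. by field. Qed.
Let na0 : 0 < n%:R + alpha. Proof. by rewrite addr_gt0. Qed.

Lemma integrable_weight : mu.-integrable setT (EFin \o @weight R m alpha).
Proof.
have mw := @measurable_weight R m alpha.
have mb : measurable_fun setT (fun z : 'rV[R]_n => (enorm z <= 1)%R%:R : R) by meas.
apply/integrableP; split; first exact/measurable_EFinP.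
under eq_integral do rewrite /= ger0_norm ?(ltW (weight_gt0 _ _))//.
apply: (@le_lt_trans _ _ (\int[mu]_z ((enorm z <= 1)%R%:R + tker alpha 1 z)%:E)%E).
  apply: ge0_le_integral_fin => //.
  - by apply: measurable_funD => //; exact: measurable_tker.
  - by move=> z; rewrite ltW// weight_gt0.
  move=> z; have z0 := enorm_ge0 z; rewrite /weight /tker /rker.
  case: (leP (enorm z) 1) => z1.
    rewrite (@le_trans _ _ 1)//; last by rewrite lerDl mulr_ge0// powR_ge0.
    have h : (1 + enorm z) `^ (- (n%:R + alpha)) <= 1 `^ (- (n%:R + alpha)).
      by apply: powRN_le; [lra|lra|exact: ltW].
    by rewrite powR1 in h.
  rewrite (ltW z1) mul1r add0r; apply: powRN_le; [lra|lra|exact: ltW].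
rewrite ge0_integralD_fin//; [|exact: measurable_tker|by move=> z; exact: tker_ge0].
by rewrite integral_tker// integral_eball lte_add_pinfty ?ltry// lebesgue_eball_fin.
Qed.

Definition weight_kernel (kap : 'rV[R]_n -> R) : Prop :=
  [/\ measurable_fun setT kap, forall z, 0 <= kap z, forall z, kap (- z) = kap z &
    exists2 C : R, 0 <= C & forall z, kap z <= C * weight alpha z].

Lemma weight_kernel_integrable kap : weight_kernel kap -> mu.-integrable setT (EFin \o kap).
Proof.
move=> [mk k0 _ [C C0 HC]].
apply: (le_integrable measurableT (g := fun z => (C%:E * (weight alpha z)%:E)%E)).
- exact/measurable_EFinP.
- move=> z _; rewrite /= lee_fin ger0_norm// (le_trans (HC z))// ger0_norm//.
  by rewrite mulr_ge0// ltW// weight_gt0.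
- by apply: integrableZl => //; exact: integrable_weight.
Qed.

Lemma weight_kernel_conv kap u x : weight_kernel kap -> weighted_fin alpha u ->
  mu.-integrable setT (EFin \o (fun z => kap z * u (x + z))).
Proof.
move=> [mk k0 _ [C C0 HC]] wu.
have [mu' u0 ufin] := weighted_fin_shift x (ltW a0) wu.
apply/integrableP; split; first by apply/measurable_EFinP; exact: measurable_funM.
under eq_integral do rewrite /= ger0_norm ?mulr_ge0//.
apply: ge0_integral_lt_pinfty C0 _ _ _ _ _ ufin.
- exact: measurable_funM.
- by apply: measurable_funM => //; exact: measurable_weight.
- by move=> z; rewrite mulr_ge0.
- by move=> z; rewrite mulr_ge0// ltW// weight_gt0.
by move=> z; rewrite mulrC mulrCA ler_wpM2l.
Qed.

Lemma weight_kernel_opp kap u x : weight_kernel kap -> weighted_fin alpha u ->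
  (\int[mu]_z (kap z * u (x - z))%:E = \int[mu]_z (kap z * u (x + z))%:E)%E.
Proof.
move=> [mk k0 ke _] [mu' u0 _].
rewrite -(@ge0_integral_opp _ _ (fun z => kap z * u (x + z))).
- by apply: eq_integral => z _; rewrite ke.
- by apply: measurable_funM => //; exact: measurable_shift.
- by move=> z; rewrite mulr_ge0.
Qed.

Lemma weight_kernel_diff2 kap u x : weight_kernel kap -> weighted_fin alpha u ->
  mu.-integrable setT (EFin \o (fun z => diff2 u x z * kap z)) /\
  \int[mu]_z (diff2 u x z * kap z) =
    2 * (u x * \int[mu]_z kap z - \int[mu]_z (kap z * u (x + z))).
Proof.
move=> wk wu; have [mk k0 ke _] := wk; have [mu' u0 _] := wu.
have i1 : mu.-integrable setT (EFin \o (fun z => 2 * u x * kap z)).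
  have := integrableZl (mu := mu) measurableT (2 * u x) (weight_kernel_integrable wk).
  by apply: eq_integrable.
have i2 := weight_kernel_conv x wk wu.
have i3 : mu.-integrable setT (EFin \o (fun z => kap z * u (x - z))).
  have := i2 => /integrableP[_ f2].
  apply/integrableP; split.
    by apply/measurable_EFinP; apply: measurable_funM => //; exact: measurable_shiftN.
  under eq_integral do rewrite /= ger0_norm ?mulr_ge0//.
  rewrite weight_kernel_opp//.
  by under eq_integral do rewrite -[X in X%:E]ger0_norm ?mulr_ge0//.
have i12 : mu.-integrable setT (EFin \o (fun z => 2 * u x * kap z - kap z * u (x + z))).
  have := integrableB measurableT i1 i2.
  by apply: eq_integrable.
have E : (fun z => diff2 u x z * kap z) = (fun z => 2 * u x * kap z - kap z * u (x + z) - kap z * u (x - z)).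
  by apply/funext => z; rewrite /diff2; ring.
rewrite E; split.
  have := integrableB measurableT i12 i3.
  by apply: eq_integrable.
rewrite (RintegralB _ i12 i3)// (RintegralB _ i1 i2)// RintegralZl//; last exact: weight_kernel_integrable.
rewrite (_ : \int[mu]_z (kap z * u (x - z)) = \int[mu]_z (kap z * u (x + z))); first by ring.
by rewrite /Rintegral weight_kernel_opp.
Qed.

Lemma tker_weight_kernel eps : 0 < eps -> weight_kernel (@tker R m alpha eps).
Proof.
move=> e0; split; [exact: measurable_tker|exact: tker_ge0|exact: tker_even|].
exists ((1 + (1 + 0) / eps) `^ (n%:R + alpha)) => [|z]; first exact: powR_ge0.
have := @tker_le_weight R m alpha eps 0 0 z (ltW a0) e0.
by rewrite enorm0 add0r; apply.
Qed.

Lemma reg_ker_weight_kernel N : weight_kernel (@reg_ker R m N.+2 gam).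
Proof.
split.
- by apply: continuous_measurable_rV; exact: continuous_reg_ker.
- by move=> z; exact: powR_ge0.
- by move=> z; rewrite /reg_ker /quad_reg /ppart enormN.
have g0 : 0 <= gam by rewrite divr_ge0 ?(ltW na0).
have [C C0 HC] := decay_bound (@decay_reg_ker R m 0 N gam g0).
exists C => // z; rewrite gam2 add0n in HC; exact: le_trans (ler_norm _) (HC z).
Qed.

(** The singular kernel minus its regularisation vanishes outside the unit ball. The first factor
    matters at z = 0 only, where the convention 0^(-c) = 0 for c > 0 would make the difference
    negative. *)
Definition near_ker N z : R := (0 < enorm z)%R%:R * (rker alpha z - reg_ker N gam z).

Lemma measurable_near_ker N : measurable_fun setT (near_ker N.+2).
Proof.
apply: measurable_funM; first by meas.
apply: measurable_funB; first exact: measurable_rker.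
by have [] := reg_ker_weight_kernel N.
Qed.

Lemma near_ker_bound N z : 0 <= near_ker N.+2 z <= (enorm z <= 1)%R%:R * rker alpha z.
Proof.
rewrite /near_ker; have r0 := rker_ge0 alpha z; have k0 : 0 <= reg_ker N.+2 gam z := powR_ge0 _ _.
have [z0|z0] := ltP 0 (enorm z); last by rewrite mul0r lexx mulr_ge0.
rewrite mul1r.
have E : rker alpha z = (enorm z ^+ 2) `^ (- gam).
  by rewrite -powR_mulrn ?(ltW z0)// -powRrM mulrN gam2.
have [z1|z1] := leP (enorm z) 1.
  rewrite mul1r gerBl k0 andbT subr_ge0 E; apply: powRN_le; [by rewrite exprn_gt0|exact: le_quad_reg|].
  by rewrite divr_ge0 ?(ltW na0).
by rewrite /reg_ker quad_reg_out ?(ltW z1)// -E subrr mul0r lexx.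
Qed.

(** The second difference is of order |z|^s and the kernel of order |z|^(-n-alpha), so the product
    is integrable near 0 since s > alpha, locally uniformly in x. Derivatives in x fall on f. *)
Lemma near_dominated s f N : alpha < s -> ldiff2 s f -> continuous f ->
  dominated (fun x z => diff2 f x z * near_ker N.+2 z).
Proof.
move=> as_ lf cf; have mf := continuous_measurable_rV cf; split => [x|rho r0].
  apply: measurable_funM; last exact: measurable_near_ker.
  by apply: measurable_funB; [apply: measurable_funB => //; exact: measurable_shift|exact: measurable_shiftN].
have [C C0 HC] := lf rho r0.
have h0 z : 0 <= (enorm z <= 1)%R%:R * enorm z `^ ((s - alpha) - n%:R) :> R by rewrite mulr_ge0// powR_ge0.
have mh : measurable_fun setT (fun z : 'rV[R]_n => (enorm z <= 1)%R%:R * enorm z `^ ((s - alpha) - n%:R) : R) by meas.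
exists (fun z => C * ((enorm z <= 1)%R%:R * enorm z `^ ((s - alpha) - n%:R))); split.
- have : mu.-integrable setT (EFin \o (fun z : 'rV[R]_n => (enorm z <= 1)%R%:R * enorm z `^ ((s - alpha) - n%:R) : R)).
    apply/integrableP; split; first exact/measurable_EFinP.
    under eq_integral do rewrite /= ger0_norm//.
    have sa : 0 < s - alpha by rewrite subr_gt0.
    by apply: le_lt_trans (integral_enorm_0 1 sa) _; rewrite ltry.
  move=> /(integrableZl (mu := mu) measurableT C); by apply: eq_integrable.
- by move=> z; rewrite mulr_ge0.
move=> x z xr; have /andP[k0 k1] := near_ker_bound N z.
rewrite normrM (ger0_norm k0).
have [z1|z1] := leP (enorm z) 1; last first.
  rewrite (lt_geF z1) mul0r in k1.
  have -> : near_ker N.+2 z = 0 by apply/le_anti; rewrite k1 k0.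
  by rewrite mulr0 mul0r mulr0.
rewrite z1 mul1r in k1; rewrite mul1r.
have [z0|z0] := eqVneq (enorm z) 0.
  by rewrite /near_ker z0 ltxx mul0r mulr0 mulr_ge0// powR_ge0.
rewrite (_ : s - alpha - n%:R = s + - (n%:R + alpha)); last by ring.
rewrite powRD ?z0 ?implybT// mulrA; apply: ler_pM => //.
exact: HC.
Qed.

Lemma near_dsmooth s k f N : alpha < s -> smooth_diff2 s k f ->
  dsmooth k (fun x z => diff2 f x z * near_ker N.+2 z).
Proof.
move=> as_; elim: k f => [|k IH] f [cf lf H].
  split => //; first exact: near_dominated as_ lf cf.
  move=> z; under eq_fun do rewrite mulrC; apply: continuous_funZ.
  have c1 := continuous_shiftr (y := z) cf; have c2 := continuous_shiftr (y := - z) cf.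
  have := continuous_funD (continuous_funD (continuous_funZ (c := 2) cf) (continuous_funZ (c := -1) c1)) (continuous_funZ (c := -1) c2).
  by under [X in continuous X -> _]eq_fun do rewrite !mulN1r.
split => //; first exact: near_dominated as_ lf cf.
  move=> z; under eq_fun do rewrite mulrC; apply: continuous_funZ.
  have c1 := continuous_shiftr (y := z) cf; have c2 := continuous_shiftr (y := - z) cf.
  have := continuous_funD (continuous_funD (continuous_funZ (c := 2) cf) (continuous_funZ (c := -1) c1)) (continuous_funZ (c := -1) c2).
  by under [X in continuous X -> _]eq_fun do rewrite !mulN1r.
move=> i; have [D S] := H i.
have E z x : is_derive x (e_ i) (fun x => diff2 f x z * near_ker N.+2 z) (diff2 (partial i f) x z * near_ker N.+2 z).
  have D0 := is_derive_partial (D x).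
  have D1 := is_derive_shift_rV (is_derive_partial (D (x + z))).
  have D2 := is_derive_shift_rV (is_derive_partial (D (x - z))).
  have := is_deriveZ (near_ker N.+2 z) (is_deriveB (is_deriveB (is_deriveZ 2 D0) D1) D2).
  rewrite (_ : _ *: _ = diff2 (partial i f) x z * near_ker N.+2 z); last by rewrite /GRing.scale/= mulrC.
  rewrite (_ : _ \*: _ = (fun x => diff2 f x z * near_ker N.+2 z))//.
  by apply/funext => y; rewrite /diff2 mulrC.
split; first by move=> z x; have [] := E z x.
rewrite (_ : (fun x z => partial i _ x) = (fun x z => diff2 (partial i f) x z * near_ker N.+2 z)); first exact: IH.
by apply/funext => x; apply/funext => z; exact: partialE.
Qed.

(** For the regular part the derivatives in x fall on the kernel; for x in a ball, shifting [weight]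
    by x costs only a constant, so u times [weight] is a common majorant. *)
Lemma far_dsmooth k u g : weighted_fin alpha u -> decay k (n%:R + alpha) g ->
  dsmooth k (fun x y => u y * g (x - y)).
Proof.
move=> wu; have [mu' u0 ufin] := wu.
have dom g' : continuous g' -> (exists2 C : R, 0 <= C & forall z, `|g' z| <= C * (1 + enorm z) `^ (- (n%:R + alpha))) ->
    dominated (fun x y => u y * g' (x - y)).
  move=> cg' [C C0 HC]; split => [x|rho r0].
    by apply: measurable_funM => //; apply: measurable_shiftN; exact: continuous_measurable_rV.
  have w0 y := ltW (weight_gt0 alpha (y : 'rV[R]_n)).
  exists (fun y => C * (1 + rho) `^ (n%:R + alpha) * (u y * weight alpha y)); split.
  - have : mu.-integrable setT (EFin \o (fun y => u y * weight alpha y)).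
      apply/integrableP; split; first by apply/measurable_EFinP; apply: measurable_funM => //; exact: measurable_weight.
      by under eq_integral do rewrite /= ger0_norm ?mulr_ge0//.
    move=> /(integrableZl (mu := mu) measurableT (C * (1 + rho) `^ (n%:R + alpha))); by apply: eq_integrable.
  - by move=> y; rewrite mulr_ge0 ?mulr_ge0// powR_ge0.
  move=> x y xr; rewrite normrM (ger0_norm (u0 y)) mulrCA ler_wpM2l//.
  apply: (le_trans (HC _)); rewrite -mulrA ler_wpM2l//.
  have := @weight_shift_le R m alpha (- x) (x - y) (ltW a0).
  rewrite addKr enormN {2}/weight enormN -/(weight alpha y) => /le_trans; apply.
  rewrite ler_wpM2r// ge0_ler_powR ?nnegrE ?(ltW na0) ?addr_ge0 ?enorm_ge0 ?(ltW r0)//.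
  by rewrite lerD2l.
elim: k g => [|k IH] g [cg bg H].
  by split => //; [exact: dom|move=> y; apply: continuous_funZ; exact: continuous_shiftr].
split; [exact: dom|by move=> y; apply: continuous_funZ; exact: continuous_shiftr|].
move=> i; have [D S] := H i.
have E y x : is_derive x (e_ i) (fun x => u y * g (x - y)) (u y * partial i g (x - y)).
  exact: (is_deriveZ (u y) (is_derive_shift_rV (is_derive_partial (D (x - y))))).
split; first by move=> y x; have [] := E y x.
rewrite (_ : (fun x z => partial i _ x) = (fun x y => u y * partial i g (x - y))); first exact: IH.
by apply/funext => x; apply/funext => z; exact: partialE.
Qed.

End kernels.
End fractional_regularity.

(** * Identification of the limit with the fractional Laplacian *)

Section frac_laplacian_link.
Context {R : realType} {m : nat}.
Local Notation n := m.+1.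
Local Notation mu := (lebesgue_rV R n).
Implicit Types (x y z v : 'rV[R]_n) (f g u w : 'rV[R]_n -> R) (rho theta : R).

Lemma normr_Rintegral_le f (B : R) : measurable_fun setT f ->
  (\int[mu]_z (`|f z|)%:E <= B%:E)%E -> `|\int[mu]_z f z| <= B.
Proof.
move=> mf fB; have mf' : measurable_fun setT (EFin \o f) by apply/measurable_EFinP.
have H := le_abse_integral mu measurableT mf'.
have {}H : (`|\int[mu]_z (f z)%:E| <= B%:E)%E by apply: (le_trans H); exact: fB.
by rewrite /Rintegral; move: H; case: (\int[mu]_z (f z)%:E)%E => [r| |].
Qed.

Lemma ge0_integrable_fin f : measurable_fun setT f -> (forall z, 0 <= f z) ->
  (\int[mu]_z (f z)%:E < +oo)%E -> mu.-integrable setT (EFin \o f).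
Proof.
move=> mf f0 ffin; apply/integrableP; split; first exact/measurable_EFinP.
rewrite (_ : (\int[mu]_z _)%E = \int[mu]_z (f z)%:E)%E//.
by apply: eq_integral => z _; rewrite /= ger0_norm.
Qed.

Variable alpha : R.
Hypotheses (a0 : 0 < alpha) (a2 : alpha < 2).
Local Notation gam := ((n%:R + alpha) / 2).

Lemma Rintegral_tker eps : 0 < eps -> \int[mu]_z tker alpha eps z = tmass m alpha eps.
Proof. by move=> e0; rewrite /Rintegral integral_tker. Qed.

Lemma tconv_diff2 u eps x : weighted_fin alpha u -> 0 < eps ->
  mu.-integrable setT (EFin \o (fun z => diff2 u x z * tker alpha eps z)) /\
  \int[mu]_z (diff2 u x z * tker alpha eps z) = 2 * (tmass m alpha eps * u x - tconv alpha eps u x).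
Proof.
move=> wu e0; have [I ->] := weight_kernel_diff2 a0 x (tker_weight_kernel a0 e0) wu.
by split => //; rewrite Rintegral_tker// mulrC [u x * _]mulrC mulrC.
Qed.

Lemma reg_ker_conv u k x : weighted_fin alpha u ->
  \int[mu]_z (@reg_ker R m k.+2 gam z * u (x + z)) = \int[mu]_y (u y * @reg_ker R m k.+2 gam (x - y)).
Proof.
move=> [mu' u0 _]; have [mk k0 ke _] := reg_ker_weight_kernel (R := R) (m := m) a0 k.
congr fine; rewrite -(@integral_shift_addl _ _ x (fun y => u y * @reg_ker R m k.+2 gam (x - y))).
- by apply: eq_integral => z _; rewrite opprD addrA subrr add0r ke mulrC.
- by apply: measurable_funM; [exact: mu'|exact: measurable_shiftN mk].
- by move=> y; apply: mulr_ge0; [exact: u0|exact: k0].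
Qed.

(** The operator without its normalising constant: half the integral of second differences against
    [near_ker], plus the operator with the integrable kernel [reg_ker], whose convolution is written
    with the variable x in the kernel so that it can be differentiated there. *)
Definition frac_op (k : nat) u x : R :=
  2^-1 * \int[mu]_z (diff2 u x z * near_ker alpha k.+2 z) +
  ((\int[mu]_z @reg_ker R m k.+2 gam z) * u x +
   -1 * \int[mu]_y (u y * @reg_ker R m k.+2 gam (x - y))).

Lemma smooth_frac_op (s : R) k u : alpha < s -> weighted_fin alpha u -> smooth_diff2 s k u ->
  smooth k (frac_op k u).
Proof.
move=> as_ wu su.
have s1 := smoothZ 2^-1 (smooth_dominated (near_dsmooth a0 k as_ su)).
have g0 : 0 <= gam by apply: divr_ge0 => //; exact: ltW (addr_gt0 _ a0).
have dk : decay k (n%:R + alpha) (@reg_ker R m k.+2 gam).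
  have := @decay_reg_ker R m k 0 gam g0; rewrite addn0.
  by have -> : 2 * gam = n%:R + alpha by field.
have s2 := smoothZ (-1) (smooth_dominated (far_dsmooth a0 wu dk)).
have s3 := smoothZ (\int[mu]_z @reg_ker R m k.+2 gam z) (smooth_diff2_smooth su).
exact: (smoothD s1 (smoothD s3 s2)).
Qed.

Lemma frac_op_diff2 u k x : weighted_fin alpha u ->
  2 * frac_op k u x = \int[mu]_z (diff2 u x z * near_ker alpha k.+2 z) +
    \int[mu]_z (diff2 u x z * @reg_ker R m k.+2 gam z).
Proof.
move=> wu; have [_ ->] := weight_kernel_diff2 a0 x (reg_ker_weight_kernel a0 k) wu.
by rewrite reg_ker_conv// /frac_op; field.
Qed.

(** In symmetrised form L_eps u and [frac_op] differ by the integral of the second difference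
    against the kernel over |z| < eps, which is of order eps^(s - alpha). *)
Lemma frac_op_rate (s : R) k u rho : alpha < s -> weighted_fin alpha u -> smooth_diff2 s k u ->
  0 < rho -> exists2 C : R, 0 <= C & forall eps x, 0 < eps -> eps <= 1 -> enorm x <= rho ->
    `|tmass m alpha eps * u x - tconv alpha eps u x - frac_op k u x| <= C * eps `^ (s - alpha).
Proof.
move=> as_ wu su r0; have [mu' u0 _] := wu.
have sa : 0 < s - alpha by rewrite subr_gt0.
have [C C0 HC] := smooth_diff2_ldiff2 su r0.
pose K := n%:R * ball_vol R m / (s - alpha).
have K0 : 0 <= K by rewrite divr_ge0 ?(ltW sa)// mulr_ge0// ltW// ball_vol_gt0.
exists (C * K) => [|eps x e0 e1 xr]; first exact: mulr_ge0.
have [i1 E1] := tconv_diff2 x wu e0.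
have [i2 _] := weight_kernel_diff2 a0 x (reg_ker_weight_kernel a0 k) wu.
have cu := smooth_diff2_continuous su.
have i3 := dominated_integrable x (near_dominated a0 k as_ (smooth_diff2_ldiff2 su) cu).
have i23 : mu.-integrable setT (EFin \o (fun z => diff2 u x z * near_ker alpha k.+2 z + diff2 u x z * @reg_ker R m k.+2 gam z)).
  have := integrableD measurableT i3 i2; by apply: eq_integrable.
have E2 := frac_op_diff2 k x wu; rewrite -RintegralD// in E2.
have E : 2 * (tmass m alpha eps * u x - tconv alpha eps u x - frac_op k u x) =
  \int[mu]_z (diff2 u x z * tker alpha eps z - (diff2 u x z * near_ker alpha k.+2 z + diff2 u x z * @reg_ker R m k.+2 gam z)).
  by rewrite RintegralB// E1 -E2; ring.
suff : `|2 * (tmass m alpha eps * u x - tconv alpha eps u x - frac_op k u x)| <= C * K * eps `^ (s - alpha).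
  rewrite normrM ger0_norm// => /(le_trans _); apply.
  by rewrite ler_peMl// ler1n.
have md : measurable_fun setT (fun z => diff2 u x z).
  apply: measurable_funB; last exact: measurable_shiftN.
  by apply: measurable_funB; [exact: measurable_cst|exact: measurable_shift].
have [mk _ _ _] := reg_ker_weight_kernel (R := R) (m := m) a0 k.
have mD : measurable_fun setT (fun z => diff2 u x z * tker alpha eps z -
    (diff2 u x z * near_ker alpha k.+2 z + diff2 u x z * @reg_ker R m k.+2 gam z)).
  apply: measurable_funB; first by apply: measurable_funM; [exact: md|exact: measurable_tker].
  apply: measurable_funD; apply: measurable_funM; [exact: md| |exact: md|exact: mk].
  exact: measurable_near_ker.
rewrite E; apply: normr_Rintegral_le; first exact: mD.
have mh : measurable_fun setT (fun z : 'rV[R]_n => (enorm z <= eps)%R%:R * enorm z `^ ((s - alpha) - n%:R) : R) by meas.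
have h0 z : 0 <= (enorm z <= eps)%R%:R * enorm z `^ ((s - alpha) - n%:R) :> R by rewrite mulr_ge0// powR_ge0.
apply: (@le_trans _ _ (\int[mu]_z (C * ((enorm z <= eps)%R%:R * enorm z `^ ((s - alpha) - n%:R)))%:E)%E).
  apply: ge0_le_integral_fin => //.
  - by apply: measurableT_comp; [exact: normr_measurable|exact: mD].
  - exact: measurable_funM.
  move=> z; rewrite -mulrDr -mulrBr normrM /tker /near_ker.
  have [z0|z0] := eqVneq (enorm z) 0.
    have -> : z = 0 by apply/eqP; rewrite -enorm_eq0 z0.
    have -> : diff2 u x 0 = 0 by rewrite /diff2 addr0 subr0; ring.
    by rewrite normr0 mul0r mulr_ge0.
  have zp : 0 < enorm z by rewrite lt_neqAle eq_sym z0 enorm_ge0.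
  rewrite zp mul1r subrK.
  have [ez|ez] := leP eps (enorm z).
    by rewrite mul1r subrr normr0 mulr0 mulr_ge0.
  rewrite mul0r sub0r normrN (ger0_norm (rker_ge0 _ _)) (ltW ez) mul1r.
  rewrite (_ : s - alpha - n%:R = s + - (n%:R + alpha)); last by ring.
  rewrite powRD ?z0 ?implybT// mulrA; apply: ler_wpM2r; first exact: powR_ge0.
  by apply: HC => //; exact: le_trans (ltW ez) e1.
rewrite ge0_integralZ_fin//.
apply: le_trans (lee_wpmul2l _ (integral_enorm_0 eps sa)) _; first by rewrite lee_fin.
by rewrite -EFinM lee_fin /K le_eqVlt; apply/orP; left; apply/eqP; ring.
Qed.

Lemma frac_pair_frac_op (s : R) k u : alpha < s -> weighted_fin alpha u -> smooth_diff2 s k u ->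
  frac_pair alpha u (frac_op k u).
Proof.
move=> as_ wu su; split => //.
- exact: smooth_diff2_continuous su.
- exact: smooth_continuous (smooth_frac_op as_ wu su).
move=> rho e r0 e0; have sa : 0 < s - alpha by rewrite subr_gt0.
have [C C0 HC] := frac_op_rate as_ wu su r0.
have C1 : 0 < C + 1 by rewrite ltr_wpDl.
pose d := Num.min 1 ((e / (C + 1)) `^ (s - alpha)^-1).
have q0 : 0 < e / (C + 1) by rewrite divr_gt0.
exists d; split; first by rewrite lt_min ltr01 powR_gt0.
move=> eps x eps0; rewrite lt_min => /andP[eps1 epsd] xr.
apply: (le_trans (HC eps x eps0 (ltW eps1) xr)).
have : eps `^ (s - alpha) <= e / (C + 1).
  move: q0 epsd; set q := e / (C + 1) => q0 epsd.
  rewrite -[leRHS]powRr1 ?(ltW q0)// -(mulVf (lt0r_neq0 sa)) powRrM.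
  by rewrite ge0_ler_powR ?nnegrE ?powR_ge0 ?(ltW sa) ?(ltW eps0)// ltW.
move=> /(ler_wpM2l C0) h; apply: (le_trans h).
by rewrite mulrCA ler_piMr ?(ltW e0)// ler_pdivrMr// mul1r lerDl.
Qed.

Lemma frac_laplacian_truncated u x eps : weighted_fin alpha u -> 0 < eps ->
  \int[mu]_(y in [set y | eps <= enorm (y - x)%R]) ((u x - u y) / enorm (x - y) `^ (n%:R + alpha)) =
  tmass m alpha eps * u x - tconv alpha eps u x.
Proof.
move=> wu e0; have [mu' u0 _] := wu.
rewrite Rintegral_mkcond.
have E : ((fun y => (u x - u y) / enorm (x - y) `^ (n%:R + alpha)) \_ [set y | eps <= enorm (y - x)%R]) =
   (fun y => u x * tker alpha eps (- x + y) - tker alpha eps (- x + y) * u y).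
  apply/funext => y; rewrite patchE; case: ifPn => [|].
    rewrite inE/= => xy; rewrite /tker [- x + y]addrC xy mul1r /rker powRN -enorm_distC; ring.
  by rewrite notin_setE/= /tker [- x + y]addrC => /negP/negbTE ->; rewrite !mul0r mulr0 subr0.
rewrite E.
have mt : measurable_fun setT (fun y => tker alpha eps (- x + y)).
  by apply: measurable_shift; exact: measurable_tker.
have E1 : (\int[mu]_y (u x * tker alpha eps (- x + y))%:E = (u x * tmass m alpha eps)%:E)%E.
  rewrite ge0_integralZ_fin//; last by move=> y; exact: tker_ge0.
  by rewrite (integral_shift_addl (- x) (@measurable_tker R m alpha eps) (tker_ge0 alpha eps)) integral_tker.
have E2 : (\int[mu]_y (tker alpha eps (- x + y) * u y)%:E = (tconv alpha eps u x)%:E)%E.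
  rewrite -(tconvE x (ltW a0) e0 wu) -(@integral_shift_addl _ _ x (fun y => tker alpha eps (- x + y) * u y)).
  - by apply: eq_integral => z _; rewrite addKr.
  - exact: measurable_funM.
  - by move=> y; rewrite mulr_ge0// tker_ge0.
have i1 : mu.-integrable setT (EFin \o (fun y => u x * tker alpha eps (- x + y))).
  apply: ge0_integrable_fin; last by rewrite E1 ltry.
    by apply: measurable_funM; [exact: measurable_cst|exact: mt].
  by move=> y; apply: mulr_ge0; [exact: u0|exact: tker_ge0].
have i2 : mu.-integrable setT (EFin \o (fun y => tker alpha eps (- x + y) * u y)).
  apply: ge0_integrable_fin; last by rewrite E2 ltry.
    by apply: measurable_funM; [exact: mt|exact: mu'].
  by move=> y; apply: mulr_ge0; [exact: tker_ge0|exact: u0].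
by rewrite RintegralB// /Rintegral E1 E2 /= mulrC.
Qed.

Lemma frac_laplacian_pair u w x : frac_pair alpha u w ->
  frac_laplacian alpha u x = @frac_laplacian_const R n alpha * w x.
Proof.
move=> [wu cu cw L]; congr (_ * _).
apply: cvg_lim => //; apply/cvgrPdist_le => e e0.
have r0 : 0 < enorm x + 1 by rewrite ltr_wpDl ?enorm_ge0.
have [d [d0 Hd]] := L _ e r0 e0.
near=> eps.
have eps0 : 0 < eps by near: eps; exact: nbhs_right_gt.
have epsd : eps < d by near: eps; exact: nbhs_right_lt.
by rewrite frac_laplacian_truncated// distrC; apply: Hd => //; rewrite lerDl.
Unshelve. all: by end_near.
Qed.

Lemma first_coordE z : first_coord z = z ord0 ord0.
Proof.
rewrite /first_coord; case: insubP => [i _ i0|//].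
by congr (z _ _); apply: val_inj.
Qed.

Lemma sin_abs_le (t : R) : `|sin t| <= `|t|.
Proof.
wlog t0 : t / 0 <= t.
  move=> H; have [|t0] := leP 0 t; first exact: H.
  by rewrite -normrN -sinN -(normrN t); apply: H; rewrite oppr_ge0 ltW.
have [c _] := MVT_segment t0 (fun s _ => is_derive_sin s) (continuous_subspaceT (@continuous_sin R)).
rewrite sin0 !subr0 => ->; rewrite normrM ler_piMl// ler_norml cos_geN1 cos_le1//.
Qed.

Lemma one_sub_cos_le (t : R) : 1 - cos t <= t ^+ 2.
Proof.
rewrite -[t in cos t](subrK (t / 2)) (_ : t - t / 2 = t / 2); last by field.
rewrite cosD -!expr2 cos2sin2.
have := sin_abs_le (t / 2); rewrite -(@ler_pXn2r _ 2)// ?nnegrE// !real_normK ?num_real//.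
rewrite exprMn; set q := sin _ ^+ 2; have := sqr_ge0 t; set p := t ^+ 2; lra.
Qed.

(** The real-valued integral of a divergent integrand would be 0, and so would its inverse; hence
    both finiteness and positivity of the integral are established. Near 0 one uses 1 - cos t <=
    t^2, at infinity 1 - cos t <= 2. *)
Lemma frac_laplacian_const_gt0 : 0 < @frac_laplacian_const R n alpha.
Proof.
rewrite /frac_laplacian_const invr_gt0 /Rintegral.
pose f (z : 'rV[R]_n) : R := (1 - cos (first_coord z)) / enorm z `^ (n%:R + alpha).
have f0 z : 0 <= f z by rewrite mulr_ge0 ?invr_ge0 ?powR_ge0// subr_ge0 cos_le1.
have fE z : f z = (1 - cos (z ord0 ord0)) * rker alpha z.
  by rewrite /f first_coordE /rker powRN.
have mf : measurable_fun setT f.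
  rewrite (_ : f = fun z => (1 - cos (z ord0 ord0)) * rker alpha z); last exact/funext.
  apply: measurable_funM; last exact: measurable_rker.
  apply: measurable_funB => //; apply: (@measurableT_comp _ _ _ _ _ _ (@cos R)).
    by apply: continuous_measurable_fun; exact: continuous_cos.
  exact: measurable_coord_rV.
have Ffin : (\int[mu]_z (f z)%:E < +oo)%E.
  have b0 : 0 < 2 - alpha by rewrite subr_gt0.
  pose A z : R := (enorm z <= 1)%R%:R * enorm (z : 'rV[R]_n) `^ ((2 - alpha) - n%:R).
  have mA : measurable_fun setT A by rewrite /A; meas.
  have A0 z : 0 <= A z by rewrite mulr_ge0// powR_ge0.
  apply: (@le_lt_trans _ _ (\int[mu]_z (A z + 2 * tker alpha 1 z)%:E)%E).
    apply: ge0_le_integral_fin => //.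
      by apply: measurable_funD => //; apply: measurable_funM => //; exact: measurable_tker.
    move=> z; rewrite fE /A /tker.
    have z0 := enorm_ge0 z; have r0 := rker_ge0 alpha z.
    have [z1|z1] := leP (enorm z) 1; last first.
      rewrite mul0r add0r (ltW z1) mul1r ler_wpM2r//.
      by have := cos_geN1 (z ord0 ord0); lra.
    have T0 : 0 <= 2 * ((1 <= enorm z)%R%:R * rker alpha z) by rewrite mulr_ge0// mulr_ge0.
    rewrite mul1r; apply: (@le_trans _ _ (enorm z `^ (2 - alpha - n%:R))); last by rewrite lerDl.
    have [->|zn] := eqVneq z 0.
      by rewrite mxE cos0 subrr mul0r powR_ge0.
    have zp : 0 < enorm z by rewrite enorm_gt0.
    rewrite (_ : 2 - alpha - n%:R = 2%:R + - (n%:R + alpha)); last by ring.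
    rewrite powRD ?(gt_eqF zp) ?implybT// powR_mulrn//; apply: ler_wpM2r => //.
    apply: (le_trans (one_sub_cos_le _)); rewrite -[leLHS]real_normK ?num_real// ler_pXn2r ?nnegrE//.
    exact: coord_le_enorm.
  rewrite ge0_integralD_fin//; last 2 first.
  - by apply: measurable_funM => //; exact: measurable_tker.
  - by move=> z; rewrite mulr_ge0// tker_ge0.
  rewrite ge0_integralZ_fin//; [|exact: measurable_tker|exact: tker_ge0].
  rewrite integral_tker// lte_add_pinfty ?ltry//.
  by apply: le_lt_trans (integral_enorm_0 1 b0) _; rewrite ltry.
have Fpos : (0 < \int[mu]_z (f z)%:E)%E.
  (* A lower bound of the integrand on the ball of radius 1/2 about the first basis vector: there
     the first coordinate lies in [1/2, 3/2], where cos is at most cos(1/2), and |z| <= 3/2. *)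
  pose c : R := (1 - cos (1 / 2)) * (3 / 2) `^ (- (n%:R + alpha)).
  have pi2 := @pi_ge2 R.
  have hI (t : R) : 0 <= t -> t <= 2 -> t \in `[0, pi].
    by move=> t0 t2; rewrite in_itv/= t0 (le_trans t2).
  have h1 : 0 < 1 / 2 :> R by lra.
  have cc : cos (1 / 2) < 1 :> R by rewrite -[X in _ < X]cos0 ltr_cos ?hI//; lra.
  have c0 : 0 < c by rewrite mulr_gt0 ?powR_gt0 ?subr_gt0//; lra.
  pose e : 'rV[R]_n := delta_mx ord0 ord0.
  have mB : measurable_fun setT (fun z : 'rV[R]_n => (enorm z <= 1 / 2)%R%:R : R) by meas.
  apply: (@lt_le_trans _ _ (\int[mu]_z (c * (enorm (- e + z) <= 1 / 2)%R%:R)%:E)%E).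
    rewrite ge0_integralZ_fin ?(ltW c0)//; last exact: (measurable_shift (- e) mB).
    rewrite (integral_shift_addl (- e) mB)// integral_eball mule_gt0//.
    by rewrite lebesgue_eball_gt0//; lra.
  apply: ge0_le_integral_fin => //.
  - by apply: measurable_funM => //; exact: (measurable_shift (- e) mB).
  - by move=> z; rewrite mulr_ge0// ltW.
  move=> z; have [ze|ze] := leP (enorm (- e + z)) (1 / 2); last by rewrite mulr0.
  rewrite mulr1 fE /c /rker.
  have z1 := le_trans (coord_le_enorm (- e + z) ord0) ze.
  rewrite !mxE !eqxx/= ler_norml in z1; move: z1 => /andP[z1 z2].
  have en : enorm z <= 3 / 2.
    rewrite -(addKr e z) [- e + _]addrC.
    rewrite (_ : e + z - e = e + (- e + z)); last by rewrite addrCA addrC.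
    rewrite (le_trans (enormD _ _))// /e enorm_delta; lra.
  have z0 : 0 < enorm z.
    rewrite enorm_gt0; apply: contraTneq ze => ->.
    by rewrite addr0 enormN enorm_delta -ltNge; lra.
  apply: ler_pM; rewrite ?powR_ge0 ?subr_ge0 ?cos_le1//.
    rewrite lerD2l lerN2; have [->//|/eqP zh] := eqVneq (z ord0 ord0) (1 / 2).
    have zl : 1 / 2 < z ord0 ord0 by rewrite lt_neqAle eq_sym; apply/andP; split; [exact/eqP|lra].
    by apply: ltW; rewrite ltr_cos ?hI//; lra.
  by apply: powRN_le => //; rewrite addr_ge0// ltW.
move: Ffin Fpos; rewrite -/f; by case: (\int[mu]_z (f z)%:E)%E => [r| |].
Qed.

End frac_laplacian_link.

(** * From the regularity class of the statement to pairs *)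

Section regular_functions.
Context {R : realType} {m : nat}.
Local Notation n := m.+1.
Local Notation mu := (lebesgue_rV R n).
Local Notation e_ i := (delta_mx ord0 i : 'rV[R]_n).
Implicit Types (x y z v : 'rV[R]_n) (f g u w : 'rV[R]_n -> R) (theta alpha : R).

Lemma Cm_hoelder_partial j theta f i :
  Cm_hoelder_loc j.+1 theta f -> Cm_hoelder_loc j theta (partial i f).
Proof.
move=> [[D C] H]; split; first split.
- by move=> s k x sk; have := D (rcons s i) k x; rewrite /partials foldr_rcons size_rcons; apply.
- by move=> s sk; have := C (rcons s i); rewrite /partials foldr_rcons size_rcons; apply.
by move=> s sk; have := H (rcons s i); rewrite /partials foldr_rcons size_rcons sk; apply.
Qed.

Lemma Cm_hoelder_lhold j theta f s : 0 < theta -> theta < 1 -> Cm_hoelder_loc j theta f ->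
  (size s <= j)%N -> lhold theta (partials s f).
Proof.
move=> t0 t1 [C H]; rewrite leq_eqVlt => /orP[/eqP sj|sj].
  move=> rho r0; have [c Hc] := H s sj _ (@compact_eball R m rho).
  exists `|c| => // x y xr yr; apply: (le_trans (Hc x y xr yr)).
  by rewrite ler_wpM2r ?powR_ge0// ler_norm.
apply: smooth1_lhold => //; first exact: ltW.
have := smooth_partials (ltnW sj) (Cm_smooth C).
by apply: smooth_le; rewrite subn_gt0.
Qed.

(** Here a is the integer part of alpha, so 0 or 1. For a = 0 Hoelder continuity bounds second
    differences directly; for a = 1 the gradient is Hoelder continuous and the linear terms
    cancel. *)
Lemma Cm_hoelder_smooth_diff2 a theta j f : (a <= 1)%N -> 0 < theta -> theta < 1 ->
  Cm_hoelder_loc (j + a) theta f -> smooth_diff2 (a%:R + theta) j f.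
Proof.
move=> a1 t0 t1; have D2 k g : Cm_hoelder_loc (k + a) theta g -> ldiff2 (a%:R + theta) g.
  move=> H; case: a a1 H => [|[|//]] _ H.
    by rewrite add0r; apply: lhold_ldiff2; exact: (Cm_hoelder_lhold (s := [::]) t0 t1 H).
  have [C _] := H; apply: smooth1_ldiff2 => //.
    by apply: smooth_le (Cm_smooth C); rewrite addn1.
  by move=> i; apply: (Cm_hoelder_lhold (s := [:: i]) t0 t1 H); rewrite addn1.
elim: j f => [|j IH] f H; (split; [by have [C _] := H; exact: smooth_continuous (Cm_smooth C)|exact: D2 H|]) => //.
move=> i; split; last by apply: IH; exact: Cm_hoelder_partial.
by move=> x; have [[D _] _] := H; exact: (D [::]).
Qed.

Lemma regular_smooth_diff2 k alpha u : 0 < alpha -> alpha < 2 -> regular k alpha u ->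
  exists2 s : R, alpha < s & smooth_diff2 s k.*2 u.
Proof.
move=> a0 a2 [eps [e0 e1 H]].
have /andP[h1 h2] := truncn_itv (ltW a0).
have i1 : (int_part alpha <= 1)%N.
  by rewrite -ltnS -(ltr_nat R); exact: le_lt_trans h1 a2.
have f0 : 0 <= frac_part alpha by rewrite /frac_part subr_ge0.
exists (alpha + eps); first by rewrite ltrDl.
have -> : alpha + eps = (int_part alpha)%:R + (frac_part alpha + eps).
  by rewrite /frac_part; ring.
by apply: Cm_hoelder_smooth_diff2 => //; exact: ltr_wpDl.
Qed.

Lemma weighted_L_fin alpha u : 0 < alpha -> weighted_L alpha u -> (forall x, 0 <= u x) ->
  weighted_fin alpha u.
Proof.
move=> a0 [mu' ufin] u0; split => //.
have g0 : 0 <= n%:R + alpha by rewrite addr_ge0 ?(ltW a0).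
have md : measurable_fun setT (fun x : 'rV[R]_n => u x / (1 + enorm x `^ (n%:R + alpha))).
  by apply: measurable_funM => //; apply: measurable_fun_inv_comp; meas.
have d0 x : 0 < 1 + enorm (x : 'rV[R]_n) `^ (n%:R + alpha) by rewrite ltr_wpDr ?powR_ge0.
apply: (@ge0_integral_lt_pinfty _ _ _ (fun x => u x / (1 + enorm x `^ (n%:R + alpha))) 2) => //.
- by apply: measurable_funM => //; exact: measurable_weight.
- by move=> x; rewrite mulr_ge0// ltW// weight_gt0.
- by move=> x; rewrite divr_ge0// ltW.
- move=> x; rewrite mulrCA ler_wpM2l// /weight powRN.
  have h0 := enorm_ge0 x; have p0 : 0 < 1 + enorm x by rewrite ltr_wpDr.
  rewrite ler_pdivlMr// mulrC ler_pdivrMr ?powR_gt0//.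
  have A : 1 `^ (n%:R + alpha) <= (1 + enorm x) `^ (n%:R + alpha).
    by rewrite ge0_ler_powR ?nnegrE ?(ltW p0)// lerDl.
  have B : enorm x `^ (n%:R + alpha) <= (1 + enorm x) `^ (n%:R + alpha).
    by rewrite ge0_ler_powR ?nnegrE ?(ltW p0)// lerDr.
  by rewrite powR1 in A; lra.
by move: ufin; congr (_ < _)%E; apply: eq_integral => x _; rewrite ger0_norm.
Qed.

Lemma decay_smooth k d g : decay k d g -> smooth k g.
Proof.
elim: k g => [|k IH] g [cg _ H]; split => // i.
by have [D S] := H i; split => //; exact: IH.
Qed.

Lemma smooth_cst k (c : R) : smooth k (fun _ : 'rV[R]_n => c).
Proof. exact: decay_smooth (decay_cst k c). Qed.

Lemma smooth_sum k (F : 'I_n -> 'rV[R]_n -> R) : (forall i, smooth k (F i)) ->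
  smooth k (fun x => \sum_i F i x).
Proof.
move=> H; elim: (index_enum _) => [|i s IH].
  by apply: smooth_ext (smooth_cst k 0) => x; rewrite big_nil.
by apply: smooth_ext (smoothD (H i) IH) => x; rewrite big_cons.
Qed.

Definition nlap g x : R := - laplacian g x.

Lemma smooth_nlap k g : smooth k.+2 g -> smooth k (nlap g).
Proof.
move=> [_ H]; apply: smooth_ext (fun x => mulN1r _) _; apply: smoothZ; apply: smooth_sum => i.
by have [_ [_ /(_ i)[_]]] := H i.
Qed.

Lemma nlapZ c g : smooth 2 g -> nlap (fun x => c * g x) = (fun x => c * nlap g x).
Proof.
move=> [_ H]; apply/funext => x; rewrite /nlap /laplacian mulrN mulr_sumr; congr (- _).
apply: eq_bigr => i _; have [d1 [_ /(_ i)[d2 _]]] := H i.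
by rewrite (partialZ c d1).2 (partialZ c d2).2.
Qed.

Lemma smooth_iter_nlap k i g : (i <= k)%N -> smooth k.*2 g -> smooth (k - i).*2 (iter i nlap g).
Proof.
move=> + sg; elim: i => [_|i IH ik]; first by rewrite subn0.
by apply: smooth_nlap; have := IH (ltnW ik); rewrite -subSS subSn.
Qed.

Lemma iter_nlapZ k c g : smooth k.*2 g ->
  iter k nlap (fun x => c * g x) = (fun x => c * iter k nlap g x).
Proof.
move=> sg; suff H i : (i <= k)%N -> iter i nlap (fun x => c * g x) = (fun x => c * iter i nlap g x).
  exact: H.
elim: i => [//|i IH] ik; rewrite !iterS (IH (ltnW ik)) nlapZ//.
have := smooth_iter_nlap (ltnW ik) sg; apply: smooth_le.
by rewrite -subSS subSn// doubleS.
Qed.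

(** The normalising constant is pulled out of the iterated Laplacian, so that all later sections
    deal with w = [frac_op], which has the 2k derivatives that the k Laplacians need. *)
Lemma regular_frac_pair k alpha u : 0 < alpha -> alpha < 2 -> regular k alpha u ->
  weighted_L alpha u -> (forall x, 0 <= u x) ->
  exists w, [/\ frac_pair alpha u w, smooth k.*2 w &
    forall x, poly_frac_laplacian k alpha u x = @frac_laplacian_const R n alpha * iter k nlap w x].
Proof.
move=> a0 a2 ru wL u0; have wu := weighted_L_fin a0 wL u0.
have [s as_ su] := regular_smooth_diff2 a0 a2 ru.
have pr := frac_pair_frac_op a0 as_ wu su; have sw := smooth_frac_op a0 as_ wu su.
exists (frac_op alpha k.*2 u); split => // x.
have <- := congr1 (fun f => f x) (iter_nlapZ (frac_laplacian_const alpha) sw).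
by congr (iter _ _ _ _); apply/funext => y; exact: frac_laplacian_pair.
Qed.

End regular_functions.

(** * Ball averages and superpolyharmonicity *)

Section ball_averages.
Context {R : realType} {m : nat}.
Local Notation n := m.+1.
Local Notation mu := (lebesgue_rV R n).
Local Notation e_ i := (delta_mx ord0 i : 'rV[R]_n).
Implicit Types (x y z v : 'rV[R]_n) (f g u w : 'rV[R]_n -> R).

Lemma is_derive_little (f : R -> R) (x d : R) :
  (forall e : R, 0 < e -> exists2 d' : R, 0 < d' & forall h : R, `|h| < d' ->
     `|f (x + h) - f x - h * d| <= e * `|h|) ->
  is_derive x (1 : R) f d.
Proof.
move=> H; suff L : (fun h : R => h^-1 *: ((f \o shift x) (h *: (1 : R)) - f x)) @ 0^' --> d.
  by split; [apply/cvg_ex; exists d|exact: cvg_lim L].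
apply/cvgrPdist_le => e e0; have [d' d0 Hd] := H e e0; near=> h.
have h0 : h != 0 by near: h; exact: nbhs_dnbhs_neq.
have hd : `|h| < d' by near: h; exact: dnbhs0_lt.
rewrite /= [h *: 1]mulr1 [h + x]addrC.
have -> : d - h^-1 *: (f (x + h) - f x) = - (h^-1 * (f (x + h) - f x - h * d)).
  by rewrite /GRing.scale/=; field.
by rewrite normrN normrM normfV mulrC ler_pdivrMr ?normr_gt0//; exact: Hd.
Unshelve. all: by end_near.
Qed.

Lemma Rintegral_shift f x : measurable_fun setT f ->
  \int[mu]_z f (x + z) = \int[mu]_z f z.
Proof.
move=> mf; congr fine; rewrite [LHS]integralE [RHS]integralE.
have P (g : 'rV[R]_n -> \bar R) : measurable_fun setT g -> (forall z, (0 <= g z)%E) ->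
    (\int[mu]_z g (x + z)%R = \int[mu]_z g z)%E.
  move=> mg g0; rewrite -[RHS](ge0_integral_shift x)//.
  by apply: eq_integral => z _; rewrite addrC.
have mf' : measurable_fun setT (EFin \o f) by apply/measurable_EFinP.
have P1 := P _ (measurable_funepos mf') (funepos_ge0 _).
have P2 := P _ (measurable_funeneg mf') (funeneg_ge0 _).
congr (_ - _)%E; [rewrite -[RHS]P1|rewrite -[RHS]P2]; apply: eq_integral => z _; by rewrite ?funeposE ?funenegE.
Qed.

Lemma compact_support_dominated rho f : continuous f -> (forall x, rho <= enorm x -> f x = 0) ->
  dominated (fun x z => f (x + z)).
Proof.
move=> cf f0; have mf := continuous_measurable_rV cf; split => [x|r r0]; first exact: measurable_shift.
have [M M0 HM] := continuous_bounded_eball rho cf.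
have mb : measurable_fun setT (fun z : 'rV[R]_n => (enorm z <= rho + r)%R%:R : R) by meas.
exists (fun z => M * (enorm z <= rho + r)%R%:R); split.
- apply: ge0_integrable_fin.
  + exact: measurable_funM.
  + by move=> z; rewrite mulr_ge0.
  rewrite ge0_integralZ_fin// integral_eball lte_mul_pinfty ?lee_fin//.
  exact: lebesgue_eball_fin.
- by move=> z; rewrite mulr_ge0.
move=> x z xr; have [xz|xz] := leP rho (enorm (x + z)).
  by rewrite f0// normr0 mulr_ge0.
have h : enorm z <= enorm (x + z) + enorm x.
  by rewrite -(enormN x) (le_trans _ (enormD _ _))// addrAC subrr add0r.
have -> : enorm z <= rho + r by lra.
by rewrite mulr1; apply: HM; exact: ltW.
Qed.

(** By translation invariance the integral of f(x + z) in z does not depend on x; differentiating it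
    under the integral sign gives the claim. *)
Lemma integral_partial rho f i : (forall x, derivable f x (e_ i)) -> continuous f ->
  continuous (partial i f) -> (forall x, rho <= enorm x -> f x = 0) ->
  \int[mu]_x partial i f x = 0.
Proof.
move=> df cf cp f0.
have rho' x : rho + 1 <= enorm x -> partial i f x = 0.
  move=> xr; have D := is_derive_partial (df x).
  apply: partialE; apply/is_derive_slice0; apply: is_derive_little => e e0.
  suff S s : `|s| < 1 -> f (x + s *: e_ i) = 0.
    by exists 1 => // h h1; rewrite add0r !S ?normr0// mulr0 !subr0 normr0 mulr_ge0// ltW.
  move=> s1; rewrite f0//.
  have h : enorm x <= enorm (x + s *: e_ i) + enorm (s *: e_ i).
    by rewrite -(enormN (s *: _)) (le_trans _ (enormD _ _))// addrK.
  by move: h; rewrite enormZ enorm_delta mulr1; lra.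
have dG := compact_support_dominated cf f0.
have E z x : is_derive x (e_ i) (fun x => f (x + z)) (partial i f (x + z)).
  have D1 := is_derive_partial (df (x + z)); have D2 := is_derive_shift_rV D1; exact: D2.
have E' : (fun x z => partial i ((fun x z => f (x + z)) ^~ z) x) = (fun x z => partial i f (x + z)).
  by apply/funext => x; apply/funext => z; exact: partialE.
have dG' : dominated (fun x z => partial i ((fun x z => f (x + z)) ^~ z) x).
  by rewrite E'; exact: compact_support_dominated cp rho'.
have Dz z x : derivable ((fun x z => f (x + z)) ^~ z) x (e_ i) by have [] := E z x.
have [_] := is_derive_dominated 0 dG Dz dG'.
rewrite (_ : (fun x => _) = (fun=> \int[mu]_z f z)); last first.
  by apply/funext => x; apply: Rintegral_shift; exact: continuous_measurable_rV.
rewrite derive_cst => H; rewrite [RHS]H.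
by apply: eq_Rintegral => z _; rewrite (partialE (E z 0)) add0r.
Qed.

Definition ballavg (N : nat) f (r : R) : R := \int[mu]_x (ppart N x * f (r *: x)).

Lemma is_derive_ray f x (s : R) : smooth 1 f ->
  is_derive s (1 : R) (fun s => f (s *: x)) (\sum_i partial i f (s *: x) * x ord0 i).
Proof.
move=> [_ H]; apply: is_derive_little => e e0.
pose K := n%:R * enorm x + 1; have K0 : 0 < K by rewrite ltr_wpDl// mulr_ge0// enorm_ge0.
have eK : 0 < e / K by rewrite divr_gt0.
have [d d0 Hd] : exists2 d : R, 0 < d & forall i y, enorm (y - s *: x) <= d ->
    `|partial i f y - partial i f (s *: x)| <= e / K.
  have B i : {d : R | 0 < d /\ forall y, enorm (y - s *: x) <= d ->
      `|partial i f y - partial i f (s *: x)| <= e / K}.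
    apply: cid; have [_ [ci _]] := H i; have := ci (s *: x).
    have FF : Filter (nbhs (s *: x)) := nbhs_filter (s *: x).
    move/(@cvgrPdist_le _ _ _ _ FF)/(_ _ eK); rewrite near_simpl => /nbhs_ballP[d /= d0 Hd].
    exists (d / 2); split => [|y yd]; first by rewrite divr_gt0.
    rewrite distrC; apply: Hd; rewrite -ball_normE /= distrC (le_lt_trans (norm_le_enorm _))//.
    by rewrite (le_lt_trans yd)// ltr_pdivrMr// mulr_natr mulr2n ltrDl.
  exists (\big[Num.min/1]_i sval (B i)) => [|i y yd].
    by elim/big_ind: _ => // [p q p0 q0|i _]; [rewrite lt_min p0|have [] := svalP (B i)].
  have [_] := svalP (B i); apply; apply: (le_trans yd).
  by rewrite (bigD1 i)//= ge_min lexx.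
exists (d / K) => [|h hd]; first by rewrite divr_gt0.
have Mle := @linear_approx R m f (s *: x) (h *: x) (fun i => partial i f (s *: x)) (e / K) (ltW eK) (fun i => (H i).1).
rewrite scalerDl.
have E : \sum_i partial i f (s *: x) * (h *: x) ord0 i = h * \sum_i partial i f (s *: x) * x ord0 i.
  by rewrite mulr_sumr; apply: eq_bigr => i _; rewrite mxE mulrCA.
rewrite E in Mle; apply: (le_trans (Mle _)).
  move=> i y yx; apply: Hd; apply: (le_trans yx); rewrite enormZ.
  apply: (@le_trans _ _ (`|h| * K)); last by rewrite -ler_pdivlMr// ltW.
  by rewrite mulrCA ler_wpM2l// lerDl.
rewrite enormZ; have -> : e / K * (n%:R * (`|h| * enorm x)) = e * `|h| * (n%:R * enorm x / K) by ring.
rewrite ler_piMr ?mulr_ge0 ?(ltW e0)//.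
by rewrite ler_pdivrMr// mul1r lerDl.
Qed.

Lemma is_derive_scale f i x (r : R) : (forall x, derivable f x (e_ i)) ->
  is_derive x (e_ i) (fun x => f (r *: x)) (r * partial i f (r *: x)).
Proof.
move=> df; apply/is_derive_slice0.
have D1 : is_derive (0 : R) (1 : R) (fun s : R => r * s) r.
  apply: (@is_derive_quadratic _ _ _ _ 0) => h.
  by rewrite add0r mulr0 subr0 [r * h]mulrC subrr normr0 mul0r.
have D2 : is_derive (r * 0) (1 : R) (fun s => f (r *: x + s *: e_ i)) (partial i f (r *: x)).
  by rewrite mulr0; apply/is_derive_slice0; exact: is_derive_partial.
have := is_derive1_comp (f := fun s => f (r *: x + s *: e_ i)) (g := fun s : R => r * s).
move=> /(_ _ _ _ D2 D1); rewrite mulrC /comp.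
by under eq_fun do rewrite -scalerA -scalerDr.
Qed.

Lemma ppart_integrable (N : nat) f : continuous f -> mu.-integrable setT (EFin \o (fun x => ppart N.+1 x * f x)).
Proof.
move=> cf; have := compact_support_dominated (rho := 1) (continuous_funM (@continuous_ppart R m N.+1) cf).
move=> /(_ _)/(dominated_integrable 0); under [X in EFin \o X]eq_fun do rewrite add0r; apply.
by move=> x x1; rewrite ppart_out// mul0r.
Qed.

Lemma Rintegral_sum (F : 'I_n -> 'rV[R]_n -> R) : (forall i, mu.-integrable setT (EFin \o F i)) ->
  \int[mu]_x (\sum_i F i x) = \sum_i \int[mu]_x F i x.
Proof.
move=> H; suff [] : \int[mu]_x (\sum_(i <- index_enum 'I_n) F i x) = \sum_(i <- index_enum 'I_n) \int[mu]_x F i x /\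
    mu.-integrable setT (EFin \o (fun x => \sum_(i <- index_enum 'I_n) F i x)) by [].
elim: (index_enum _) => [|i s [IH1 IH2]].
  rewrite big_nil; under eq_Rintegral do rewrite big_nil.
  split; first by rewrite /Rintegral integral0.
  by under [X in EFin \o X]eq_fun do rewrite big_nil; exact: integrable0.
rewrite big_cons -IH1 -RintegralD//; split; first by apply: eq_Rintegral => x _; rewrite big_cons.
under [X in EFin \o X]eq_fun do rewrite big_cons.
by have := integrableD measurableT (H i) IH2; apply: eq_integrable.
Qed.

(** Up to the factor -2 (N + 2), x_i [ppart N.+1] is the i-th partial derivative of [ppart N.+2], so
    this is an integration by parts with no boundary term. *)
Lemma ppart_ibp (N : nat) f i (r : R) : smooth 2 f ->
  \int[mu]_x (ppart N.+1 x * (partial i f (r *: x) * x ord0 i)) =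
  r / (2 * N.+2%:R) * \int[mu]_x (ppart N.+2 x * partial i (partial i f) (r *: x)).
Proof.
move=> [_ H]; have [df [cp /(_ i)[dp [cpp _]]]] := H i.
pose F x := ppart N.+2 x * partial i f (r *: x).
have N2 : (2 * N.+2%:R : R) != 0 by rewrite mulf_neq0.
pose P1 x := ppart N.+1 x * (partial i f (r *: x) * x ord0 i).
pose P2 x := ppart N.+2 x * partial i (partial i f) (r *: x).
have D x : is_derive x (e_ i) F (r * P2 x + - (2 * N.+2%:R) * P1 x).
  have := is_deriveM (is_derive_ppart N i x) (is_derive_scale x r dp).
  by rewrite /GRing.scale/= (_ : _ + _ = r * P2 x + - (2 * N.+2%:R) * P1 x)// /P1 /P2; ring.
have c1 : continuous (fun x => partial i f (r *: x)) by exact: continuous_scale_rV.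
have c2 : continuous (fun x => partial i (partial i f) (r *: x)) by exact: continuous_scale_rV.
have cP1 : continuous P1.
  apply: continuous_funM; first exact: continuous_ppart.
  by apply: continuous_funM => //; exact: continuous_coord.
have cP2 : continuous P2 by apply: continuous_funM => //; exact: continuous_ppart.
have E : partial i F = (fun x => r * P2 x + - (2 * N.+2%:R) * P1 x).
  by apply/funext => x; exact: partialE.
have i1 : mu.-integrable setT (EFin \o P1).
  by apply: ppart_integrable; apply: continuous_funM => //; exact: continuous_coord.
have i2 : mu.-integrable setT (EFin \o P2) by exact: ppart_integrable.
have : \int[mu]_x partial i F x = 0.
  apply: (@integral_partial 1).
  - by move=> x; have [] := D x.
  - by apply: continuous_funM => //; exact: continuous_ppart.
  - by rewrite E; apply: continuous_funD; exact: continuous_funZ.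
  - by move=> x x1; rewrite /F ppart_out// mul0r.
have j1 : mu.-integrable setT (EFin \o (fun x => - (2 * N.+2%:R) * P1 x)).
  by have := integrableZl measurableT (- (2 * N.+2%:R)) i1; apply: eq_integrable.
have j2 : mu.-integrable setT (EFin \o (fun x => r * P2 x)).
  by have := integrableZl measurableT r i2; apply: eq_integrable.
rewrite E RintegralD// RintegralZl// RintegralZl//.
rewrite -/(Rintegral mu setT P1) -/(Rintegral mu setT P2).
set a := Rintegral _ _ P2; set b := Rintegral _ _ P1 => h.
have -> : b = (r * a + - (2 * N.+2%:R) * b) * (- (2 * N.+2%:R)^-1) + r / (2 * N.+2%:R) * a by field.
by rewrite h mul0r add0r.
Qed.

(** Differentiation along rays gives x.grad f, and [ppart_ibp] turns it into a Laplacian at the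
    price of one more power in the weight. It replaces the classical formula for the derivative of
    spherical means. *)
Lemma is_derive_ballavg (N : nat) f (r : R) : smooth 2 f ->
  is_derive r (1 : R) (ballavg N.+1 f) (- (r / (2 * N.+2%:R)) * ballavg N.+2 (nlap f) r).
Proof.
move=> sf; have s1 : smooth 1 f by exact: smooth_le sf.
have [_ H] := sf.
pose G (s : R) x := ppart N.+1 x * f (s *: x).
pose G' (s : R) x := ppart N.+1 x * \sum_i partial i f (s *: x) * x ord0 i.
have D (s : R) x : is_derive s (1 : R) (G ^~ x) (G' s x).
  exact: (is_deriveZ (ppart N.+1 x) (is_derive_ray x s s1)).
have [M M0 HM] := smooth_bounded_partials (`|r| + 1) s1.
have mb : measurable_fun setT (fun z : 'rV[R]_n => (enorm z <= 1)%R%:R : R) by meas.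
have Ir : `]r - 1, r + 1[%classic r by rewrite /= in_itv/= ltrDl ltrBlDr ltrDl ltr01.
have H1 (s : R) : `]r - 1, r + 1[%classic s -> mu.-integrable setT (EFin \o G s).
  by move=> _; apply: ppart_integrable; apply: continuous_scale_rV; exact: smooth_continuous s1.
have H2 (s : R) x : `]r - 1, r + 1[%classic s -> setT x -> derivable (G ^~ x) s 1.
  by move=> _ _; have [] := D s x.
pose g (x : 'rV[R]_n) : R := n%:R * M * (enorm x <= 1)%R%:R.
have g0 x : 0 <= g x by rewrite !mulr_ge0.
have ig : mu.-integrable setT (EFin \o g).
  apply: ge0_integrable_fin => //; first exact: measurable_funM.
  rewrite ge0_integralZ_fin ?mulr_ge0// integral_eball lte_mul_pinfty ?lee_fin ?mulr_ge0//.
  exact: lebesgue_eball_fin.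
have H3 (s : R) x : `]r - 1, r + 1[%classic s -> setT x -> `|partial1of2 G s x| <= g x.
  rewrite /= in_itv/= => /andP[r1 r2] _; rewrite partial1of2E; have [_ ->] := D s x.
  rewrite /G' /g; have [x1|x1] := leP (enorm x) 1; last first.
    by rewrite ppart_out ?(ltW x1)// mul0r normr0 mulr0.
  rewrite mulr1 normrM (ger0_norm (ppart_ge0 _ _)).
  apply: (@le_trans _ _ `|\sum_i partial i f (s *: x) * x ord0 i|).
    by rewrite ler_piMl// ppart_le1.
  apply: (le_trans (ler_norm_sum _ _ _)); apply: (@le_trans _ _ (\sum_(i < n) M)); last first.
    by rewrite sumr_const card_ord mulr_natl.
  apply: ler_sum => i _; rewrite normrM -[leRHS]mulr1; apply: ler_pM => //.
    apply: HM; rewrite enormZ; apply: (@le_trans _ _ `|s|); first by rewrite ler_piMr.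
    rewrite -lerBlDl (le_trans (lerB_dist _ _))// ler_norml; apply/andP; split; lra.
  by rewrite (le_trans (coord_le_enorm _ _)).
have E := differentiation_under_integral measurableT Ir H1 H2 g0 ig H3.
have V := derivable_under_integral measurableT Ir H1 H2 g0 ig H3.
split; first exact: V.
rewrite -derive1E E.
have -> : \int[mu]_x partial1of2 G r x = \int[mu]_x G' r x.
  by apply: eq_Rintegral => x _; rewrite partial1of2E; have [_ ->] := D r x.
have -> : \int[mu]_x G' r x = \sum_i \int[mu]_x (ppart N.+1 x * (partial i f (r *: x) * x ord0 i)).
  rewrite -Rintegral_sum; first by apply: eq_Rintegral => x _; rewrite /G' mulr_sumr.
  move=> i; have [_ [cp _]] := H i; apply: ppart_integrable; apply: continuous_funM; last exact: continuous_coord.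
  exact: continuous_scale_rV.
under eq_bigr do rewrite ppart_ibp//.
rewrite -mulr_sumr -Rintegral_sum; last first.
  by move=> i; have [_ [_ /(_ i)[_ [cpp _]]]] := H i; apply: ppart_integrable; exact: continuous_scale_rV.
rewrite mulNr -mulrN; congr (_ * _); rewrite /ballavg.
have iL : mu.-integrable setT (EFin \o (fun x => ppart N.+2 x * nlap f (r *: x))).
  by apply: ppart_integrable; apply: continuous_scale_rV; apply: (@smooth_continuous _ _ 0); exact: smooth_nlap.
rewrite -mulN1r -RintegralZl//; apply: eq_Rintegral => x _.
by rewrite /nlap /laplacian mulN1r mulrN opprK mulr_sumr.
Qed.

End ball_averages.

(** * Non-negativity of all the iterated Laplacians *)

Section superpolyharmonic.
Context {R : realType} {m : nat}.
Local Notation n := m.+1.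
Local Notation mu := (lebesgue_rV R n).
Local Notation e_ i := (delta_mx ord0 i : 'rV[R]_n).
Implicit Types (x y z v : 'rV[R]_n) (f g u w : 'rV[R]_n -> R).

Lemma ppart2_test : test_fun 1 (@ppart R m 2).
Proof.
split.
- by apply: continuous_measurable_rV; exact: continuous_ppart.
- exact: ppart_ge0.
- by move=> x x1; rewrite ppart_out// ltW.
- by exists 1; exact: ppart_le1.
Qed.

(** The weight is the positive part of a quadratic, squared; the terms linear in z cancel and what
    remains is of order |z|^2. The constant 54 is a convenient upper bound. *)
Lemma ppart2_diff2 x z : `|ppart 2 (x + z) + ppart 2 (x - z) - 2 * ppart 2 x| <= 54 * Num.min (enorm z ^+ 2) 1.
Proof.
have z0 := enorm_ge0 z; have x0 := enorm_ge0 x.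
have b1 (y : 'rV[R]_n) : 0 <= ppart 2 y <= (1 : R) by rewrite ppart_ge0 ppart_le1.
have [z1|z1] := leP 1 (enorm z).
  have -> : Num.min (enorm z ^+ 2) 1 = 1 by apply/min_idPr; rewrite expr_ge1.
  have /andP[p1 p2] := b1 (x + z); have /andP[p3 p4] := b1 (x - z); have /andP[p5 p6] := b1 x.
  by rewrite ler_norml; apply/andP; split; lra.
have -> : Num.min (enorm z ^+ 2) 1 = enorm z ^+ 2 by apply/min_idPl; rewrite expr_le1// ltW.
have zz : 0 <= enorm z ^+ 2 by exact: sqr_ge0.
have [x2|x2] := leP 2 (enorm x).
  have h y : enorm x <= enorm (x + y) + enorm y.
    by rewrite -(enormN y) (le_trans _ (enormD _ _))// addrK.
  rewrite !ppart_out; last 3 first.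
  - lra.
  - by have := h (- z); rewrite enormN; lra.
  - by have := h z; lra.
  by rewrite mulr0 addr0 subr0 normr0; lra.
rewrite /ppart; set a := 1 - enorm x ^+ 2; set b := 1 - enorm (x + z) ^+ 2; set c := 1 - enorm (x - z) ^+ 2.
have B : b - a = - (2 * edot x z + enorm z ^+ 2) by rewrite /a /b enorm_sqrD; ring.
have C : c - a = 2 * edot x z - enorm z ^+ 2.
  by rewrite /a /c enorm_sqrD edotNr enormN; ring.
have g1 := pos_sqr_ge a b; have g2 := pos_sqr_ge a c.
have l1 := pos_sqr_le a b; have l2 := pos_sqr_le a c.
rewrite B in g1 l1; rewrite C in g2 l2.
have p0 : 0 <= Num.max a 0 by rewrite le_max lexx orbT.
have p1 : Num.max a 0 <= 1 by rewrite ge_max ler01 andbT gerBl sqr_ge0.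
have d2 : edot x z ^+ 2 <= 4 * enorm z ^+ 2.
  rewrite -[leLHS]real_normK ?num_real//.
  apply: (@le_trans _ _ ((2 * enorm z) ^+ 2)); last by rewrite exprMn; lra.
  rewrite ler_pXn2r ?nnegrE ?mulr_ge0// (le_trans (edot_abs_le _ _))// ler_wpM2r// ltW//.
have z4 : (enorm z ^+ 2) ^+ 2 <= enorm z ^+ 2.
  by rewrite -[leRHS]mulr1 [leLHS]expr2 ler_wpM2l// expr_le1// ltW.
have pz0 : 0 <= Num.max a 0 * enorm z ^+ 2 by rewrite mulr_ge0.
have pz1 : Num.max a 0 * enorm z ^+ 2 <= enorm z ^+ 2 by rewrite ler_piMl.
move: g1 g2 l1 l2 d2 z4 pz0 pz1; set P := Num.max a 0; set A := Num.max b 0 ^+ 2; set D := Num.max c 0 ^+ 2.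
move: (enorm z ^+ 2) zz (edot x z) => t tt d g1 g2 l1 l2 d2 z4 pz0 pz1.
rewrite ler_norml; apply/andP; split; lra.
Qed.

Lemma derive_ge_itv (F D : R -> R) (a b c : R) : a <= b ->
  (forall r : R, a <= r -> r <= b -> is_derive r (1 : R) F (D r)) ->
  (forall r, a <= r -> r <= b -> c <= D r) -> F a + c * (b - a) <= F b.
Proof.
move=> ab dF cD.
have cF : {within `[a, b], continuous F}.
  apply: derivable_within_continuous => s; rewrite in_itv/= => /andP[as_ sb].
  by have [] := dF s as_ sb.
have [s|s] := MVT_segment (df := D) ab _ cF.
  by rewrite in_itv/= => /andP[as_ sb]; exact: dF (ltW as_) (ltW sb).
rewrite in_itv/= => /andP[as_ sb] E.
by rewrite -lerBrDl E ler_wpM2r ?subr_ge0//; exact: cD.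
Qed.

Lemma derive_ge_growth (F D : R -> R) (a c : R) :
  (forall r : R, a <= r -> is_derive r (1 : R) F (D r)) -> (forall r, a <= r -> c <= D r) ->
  forall r, a <= r -> F a + c * (r - a) <= F r.
Proof. by move=> dF cD r ar; apply: derive_ge_itv => // s *; [exact: dF|exact: cD]. Qed.

Lemma derive_le_nonincreasing (F D : R -> R) (a : R) :
  (forall r : R, a <= r -> is_derive r (1 : R) F (D r)) -> (forall r, a <= r -> D r <= 0) ->
  forall r s, a <= r -> r <= s -> F s <= F r.
Proof.
move=> dF D0 r s ar rs.
have dN t : r <= t -> is_derive t (1 : R) (fun t => - F t) (- D t).
  by move=> rt; apply: is_deriveN; apply: dF; exact: le_trans rt.
have := derive_ge_growth (c := 0) dN _ rs.
rewrite mul0r addr0 lerN2; apply => t rt; rewrite oppr_ge0; apply: D0; exact: le_trans rt.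
Qed.

Lemma partial_shift f x0 i : (forall x, derivable f x (e_ i)) ->
  (forall x, derivable (fun x => f (x0 + x)) x (e_ i)) /\
  partial i (fun x => f (x0 + x)) = (fun x => partial i f (x0 + x)).
Proof.
move=> df; have E x : is_derive x (e_ i) (fun x => f (x0 + x)) (partial i f (x0 + x)).
  under eq_fun do rewrite addrC.
  rewrite [in partial i f _]addrC.
  have D := is_derive_partial (df (x + x0)); exact: (is_derive_shift_rV D).
by split=> [x|]; [have [] := E x|apply/funext => x; exact: partialE].
Qed.

Lemma smooth_shift k f x0 : smooth k f -> smooth k (fun x => f (x0 + x)).
Proof.
elim: k f => [|k IH] f [cf H]; (split; first exact: continuous_shift_rV) => // i.
have [df sf] := H i; have [D E] := partial_shift x0 df.
by split => //; rewrite E; exact: IH.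
Qed.

Lemma nlap_shift f x0 : smooth 2 f -> nlap (fun x => f (x0 + x)) = (fun x => nlap f (x0 + x)).
Proof.
move=> [_ H]; apply/funext => x; rewrite /nlap /laplacian; apply: (congr1 -%R); apply: eq_bigr => i _.
have [d1 [_ /(_ i)[d2 _]]] := H i.
have E1 := (partial_shift x0 d1).2; have E2 := (partial_shift x0 d2).2.
exact: (etrans (congr1 (fun g => partial i g x) E1) (congr1 (fun g => g x) E2)).
Qed.

Lemma ballavg_ge0 (N : nat) f r : (forall x, 0 <= f x) -> 0 <= ballavg N f r.
Proof. by move=> f0; apply: Rintegral_ge0 => x _; rewrite mulr_ge0// ppart_ge0. Qed.

Lemma ballavg0_lt0 (N : nat) f : f 0 < 0 -> ballavg N.+1 f 0 < 0.
Proof.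
move=> f0; rewrite /ballavg; under eq_Rintegral do rewrite scale0r mulrC.
have cc : continuous (fun _ : 'rV[R]_n => 1 : R) by move=> z; exact: cst_continuous.
have ip := ppart_integrable N cc.
have {}ip : mu.-integrable setT (EFin \o @ppart R m N.+1).
  by move: ip; apply: eq_integrable => // x _; rewrite /= mulr1.
rewrite RintegralZl// pmulr_llt0//.
have mB : measurable_fun setT (fun z : 'rV[R]_n => (enorm z <= 1 / 2)%R%:R : R) by meas.
have h : ((4^-1 ^+ N.+1)%:E * mu (@eball R n (1 / 2)%R) <= \int[mu]_x (ppart N.+1 x)%:E)%E.
  rewrite -integral_eball -ge0_integralZ_fin//.
  apply: ge0_le_integral_fin => //.
  - exact: measurable_funM.
  - by apply: continuous_measurable_rV; exact: continuous_ppart.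
  move=> x; have [x1|x1] := leP (enorm x) (1 / 2); last by rewrite mulr0 ppart_ge0.
  have x2 : enorm x ^+ 2 <= 4^-1.
    have := enorm_ge0 x; move: (enorm x) x1 => t t1 t0; nra.
  rewrite mulr1 /ppart lerXn2r ?nnegrE ?le_max ?lexx ?orbT//.
  by apply/orP; left; lra.
have p : (0 < (4^-1 ^+ N.+1)%:E * mu (@eball R n (1 / 2)%R))%E.
  by rewrite mule_gt0 ?lte_fin ?exprn_gt0// lebesgue_eball_gt0//; lra.
have := integrable_fin_num measurableT ip.
move: (lt_le_trans p h); rewrite /Rintegral /=; by case: (\int[mu]_x _)%E => [r| |].
Qed.

Section chain.
Variables (k : nat) (w : 'rV[R]_n -> R).
Hypothesis sw : smooth k.*2 w.
Local Notation W i := (iter i nlap w).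

Let sW2 i : (i < k)%N -> smooth 2 (W i).
Proof.
move=> ik; apply: smooth_le (smooth_iter_nlap (ltnW ik) sw).
by move: ik; rewrite -subn_gt0; case: (k - i)%N => // j _; rewrite doubleS.
Qed.

Lemma continuous_iter_nlap i : (i <= k)%N -> continuous (W i).
Proof. by move=> ik; apply: smooth_continuous (smooth_iter_nlap ik sw). Qed.

Lemma is_derive_ballavg_iter (N : nat) x0 i (r : R) : (i < k)%N ->
  is_derive r (1 : R) (ballavg N.+1 (fun x => W i (x0 + x)))
    (- (r / (2 * N.+2%:R)) * ballavg N.+2 (fun x => W i.+1 (x0 + x)) r).
Proof.
move=> ik; have := is_derive_ballavg N r (smooth_shift x0 (sW2 ik)).
by rewrite nlap_shift//; exact: sW2.
Qed.

Lemma ballavg_iter_nonincreasing (N : nat) x0 i : (i < k)%N -> (forall x, 0 <= W i.+1 x) ->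
  forall r s, 0 <= r -> r <= s ->
  ballavg N.+1 (fun x => W i (x0 + x)) s <= ballavg N.+1 (fun x => W i (x0 + x)) r.
Proof.
move=> ik W0; apply: derive_le_nonincreasing => [r _|r r0].
  exact: is_derive_ballavg_iter.
rewrite /= mulNr oppr_le0 mulr_ge0 ?divr_ge0 ?mulr_ge0//.
by apply: ballavg_ge0 => x; exact: W0.
Qed.

(** Induction from i = k downwards. If [W i] is negative at x0 while [W i.+1] >= 0, its means about
    x0 decrease in r and remain negative. Integrating the derivative formula down to index 0, the
    means keep a definite sign, opposite at each step, and stay away from 0, against the decay of
    the means of w. *)
Lemma superpolyharmonic_nonneg :
  (forall x0 (e : R), 0 < e -> exists r0 : R, 0 < r0 /\ forall r, r0 <= r ->
    `|ballavg 2 (fun x => w (x0 + x)) r| <= e) ->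
  (forall x, 0 <= W k x) -> forall i, (i <= k)%N -> forall x, 0 <= W i x.
Proof.
move=> small Wk i ik; rewrite -(subKn ik).
have : (k - i <= k)%N by exact: leq_subr.
elim: (k - i)%N => [|j IH] jk; first by rewrite subn0.
have i'k : (k - j.+1 < k)%N by rewrite ltn_subrL /= (leq_trans _ jk).
have E : (k - j = (k - j.+1).+1)%N by rewrite subnSK.
have {}IH x : 0 <= W (k - j.+1).+1 x by rewrite -E; exact: IH (ltnW jk) x.
move: (k - j.+1)%N i'k IH => {E jk ik}i {}ik IH x0; rewrite leNgt; apply/negP => Wx0.
(* The exponent grows with the index so that the derivative of [V l] is a multiple of [V l.+1]; for
   l = 0 it is the exponent 2 of the smallness hypothesis. *)
pose V l r := ballavg l.+2 (fun x => W l (x0 + x)) r.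
(* The boolean records the sign of the mean after d descents. *)
have Q d : (d <= i)%N -> exists (b : bool) (c r1 : R), [/\ 0 < c, 0 < r1 &
    forall r, r1 <= r -> c <= (-1) ^+ b * V (i - d)%N r].
  elim: d => [_|d IHd di].
    rewrite subn0; have V0 : V i 0 < 0 by apply: ballavg0_lt0; rewrite addr0.
    exists true, (- V i 0), 1; split => // [|r r1]; first by rewrite oppr_gt0.
    rewrite expr1 mulN1r lerN2; apply: ballavg_iter_nonincreasing => //.
    exact: le_trans r1.
  have [b [c [r1 [c0 r10 Hc]]]] := IHd (ltnW di).
  rewrite (_ : (i - d)%N = (i - d.+1).+1) in Hc; last by rewrite subnSK.
  have lk : (i - d.+1 < k)%N by rewrite (leq_ltn_trans (leq_subr _ _)).
  move: (i - d.+1)%N lk Hc => l lk Hc.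
  pose K : R := 2 * l.+3%:R; have K0 : 0 < K by rewrite mulr_gt0.
  pose c' := r1 / K * c; have c'0 : 0 < c' by rewrite mulr_gt0// divr_gt0.
  pose F r := (-1) ^+ (~~ b) * V l r.
  have sN : (-1) ^+ (~~ b) = - (-1) ^+ b :> R by case: (b); rewrite /= ?expr0 ?expr1 ?opprK.
  have dF (r : R) : r1 <= r -> is_derive r (1 : R) F (r / K * ((-1) ^+ b * V l.+1 r)).
    move=> _; have D := is_derive_ballavg_iter l.+1 x0 r lk.
    have := is_deriveZ ((-1) ^+ (~~ b)) D.
    rewrite (_ : _ *: _ = r / K * ((-1) ^+ b * V l.+1 r))//.
    by rewrite /GRing.scale/= sN /V /K; ring.
  have cF r : r1 <= r -> c' <= r / K * ((-1) ^+ b * V l.+1 r).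
    move=> r1r; apply: ler_pM; rewrite ?divr_ge0 ?(ltW r10) ?(ltW K0) ?(ltW c0)//; last exact: Hc.
    by rewrite ler_pM2r ?invr_gt0.
  have G := derive_ge_growth dF cF.
  (* The signed mean grows at least linearly with slope c' from r1 on, so it exceeds 1 after this
     radius. *)
  exists (~~ b), 1, (r1 + (1 + `|F r1|) / c'); split => //.
    by rewrite addr_gt0// divr_gt0// ltr_pwDl.
  move=> r rr; have q0 : 0 <= (1 + `|F r1|) / c' by rewrite divr_ge0 ?(ltW c'0)// addr_ge0.
  have r1r : r1 <= r by lra.
  apply: le_trans (G r r1r).
  have : 1 + `|F r1| <= c' * (r - r1) by rewrite mulrC -ler_pdivrMr//; lra.
  have := ler_norm (- F r1); rewrite normrN; lra.
have [b [c [r1 [c0 r10 Hc]]]] := Q i (leqnn i).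
rewrite subnn in Hc.
have [r0 [r00 Hr]] := small x0 (c / 2) ltac:(lra).
pose r := Num.max r0 r1.
have r0r : r0 <= r by rewrite le_max lexx.
have r1r : r1 <= r by rewrite le_max lexx orbT.
have h1 := Hr r r0r; have h2 := Hc r r1r.
have : c <= c / 2.
  apply: (le_trans h2); apply: le_trans h1; apply: (le_trans (ler_norm _)).
  by rewrite normrM normrX normrN1 expr1n mul1r.
lra.
Qed.

End chain.
End superpolyharmonic.

(** * Decay of the averages of a solution *)

Section energy_decay.
Context {R : realType} {m : nat}.
Local Notation n := m.+1.
Local Notation mu := (lebesgue_rV R n).
Implicit Types (x y z v : 'rV[R]_n) (f g u w : 'rV[R]_n -> R).

Definition bumpavg f (r : R) : R := \int[mu]_x (abump x * f (r *: x)).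

Definition weightavg (alpha : R) f (r : R) : R := \int[mu]_x (f (r *: x) * weight alpha x).

Lemma EFin_Rintegral f : mu.-integrable setT (EFin \o f) ->
  (\int[mu]_x (f x)%:E = (\int[mu]_x f x)%:E)%E.
Proof. by move=> If; rewrite fineK//; exact: integrable_fin_num. Qed.

Lemma bumpavg_integrable f (r : R) : continuous f ->
  mu.-integrable setT (EFin \o (fun x => abump x * f (r *: x))).
Proof. by move=> cf; apply: test_fun_integrable (@abump_test R m) _; exact: continuous_scale_rV. Qed.

Lemma weightavg_integrable alpha u (r : R) : 0 <= alpha -> 0 < r -> weighted_fin alpha u ->
  mu.-integrable setT (EFin \o (fun x => u (r *: x) * weight alpha x)).
Proof.
move=> a0 r0 wu; have [mu' u0 ufin] := weighted_fin_scale a0 r0 wu.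
apply: ge0_integrable_fin => //.
- by apply: measurable_funM => //; exact: measurable_weight.
- by move=> x; rewrite mulr_ge0// ltW// weight_gt0.
Qed.

Lemma weightavg_ge0 alpha u r : (forall x, 0 <= u x) -> 0 <= weightavg alpha u r.
Proof. by move=> u0; apply: Rintegral_ge0 => x _; rewrite mulr_ge0// ltW// weight_gt0. Qed.

Lemma bumpavg_ge0 u r : (forall x, 0 <= u x) -> 0 <= bumpavg u r.
Proof. by move=> u0; apply: Rintegral_ge0 => x _; rewrite mulr_ge0// abump_ge0. Qed.

Lemma Rintegral_scale f (c : R) : 0 < c -> measurable_fun setT f -> (forall x, 0 <= f x) ->
  \int[mu]_x f (c *: x) = (c ^+ n)^-1 * \int[mu]_x f x.
Proof.
move=> c0 mf f0; rewrite /Rintegral ge0_integral_scale_fin//.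
have := integral_fin_ge0 mu f0.
case: (\int[mu]_x (f x)%:E)%E => [s| |] //= _.
by rewrite gt0_muley ?lte_fin ?invr_gt0 ?exprn_gt0//= mulr0.
Qed.

Lemma weightavg_dilate alpha u (r c : R) : 0 <= alpha -> 0 < r -> 0 < c -> weighted_fin alpha u ->
  weightavg alpha u (c * r) <= (1 + c) `^ (n%:R + alpha) * (c ^+ n)^-1 * weightavg alpha u r.
Proof.
move=> a0 r0 c0 wu; have cr0 : 0 < c * r by rewrite mulr_gt0.
have [mu' u0 ufin] := wu; have mw := @measurable_weight R m alpha.
pose f x := u (r *: x) * weight alpha x.
have mf : measurable_fun setT f by apply: measurable_funM => //; exact: measurable_scale_fun.
have f0 x : 0 <= f x by rewrite mulr_ge0// ltW// weight_gt0.
have If : mu.-integrable setT (EFin \o f) := weightavg_integrable a0 r0 wu.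
rewrite /weightavg -mulrA -(Rintegral_scale c0 mf f0).
have Ic : mu.-integrable setT (EFin \o (fun x => f (c *: x))).
  apply: ge0_integrable_fin; [exact: measurable_scale_fun mf|by move=> x; exact: f0|].
  by rewrite (ge0_integral_scale_fin c0 mf f0) (EFin_Rintegral If) -EFinM ltry.
rewrite -(RintegralZl _ measurableT Ic); apply: le_Rintegral => //.
- exact: weightavg_integrable.
- by have := integrableZl measurableT ((1 + c) `^ (n%:R + alpha)) Ic; apply: eq_integrable.
move=> x _; rewrite /f mulrCA scalerA [r * c]mulrC ler_wpM2l//.
exact: weight_scale_le.
Qed.

Lemma ppart_mono (N : nat) x y : enorm y <= enorm x -> ppart N x <= ppart N y.
Proof.
move=> yx; have m0 z : 0 <= Num.max (1 - enorm z ^+ 2) 0 by rewrite le_max lexx orbT.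
rewrite /ppart lerXn2r ?nnegrE ?m0// ge_max m0 andbT le_max; apply/orP; left.
by rewrite lerD2l lerN2 lerXn2r ?nnegrE ?enorm_ge0.
Qed.

(** With c = s/r in [1, 2], the mean at s is c^(-n) times the integral of f(r x) against the weight
    dilated by c, which is at least the undilated weight. *)
Lemma ballavg_dilate_le (N : nat) f (r s : R) : continuous f -> (forall x, 0 <= f x) ->
  0 < r -> r <= s -> s <= 2 * r -> (2 ^+ n)^-1 * ballavg N.+1 f r <= ballavg N.+1 f s.
Proof.
move=> cf f0 r0 rs s2; have s0 : 0 < s by exact: lt_le_trans rs.
pose c := s / r; have c0 : 0 < c by rewrite divr_gt0.
have c1 : 1 <= c by rewrite ler_pdivlMr// mul1r.
have c2 : c <= 2 by rewrite ler_pdivrMr.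
pose g x := ppart N.+1 (c^-1 *: x) * f (r *: x).
have cg : continuous g.
  by apply: continuous_funM; apply: continuous_scale_rV => //; exact: continuous_ppart.
have mg := continuous_measurable_rV cg.
have g0 x : 0 <= g x by rewrite mulr_ge0// ppart_ge0.
have E : ballavg N.+1 f s = (c ^+ n)^-1 * \int[mu]_x g x.
  rewrite -(Rintegral_scale c0 mg g0); apply: eq_Rintegral => x _.
  rewrite /g !scalerA mulVf ?gt_eqF// scale1r; congr (_ * f (_ *: _)).
  by rewrite /c mulrC divfK// gt_eqF.
have gi : mu.-integrable setT (EFin \o g).
  have := compact_support_dominated (rho := c) cg => /(_ _)/(dominated_integrable 0).
  under [X in EFin \o X]eq_fun do rewrite add0r; apply => x xc.
  by rewrite /g ppart_out ?mul0r// enormZ gtr0_norm ?invr_gt0// mulrC ler_pdivlMr// mul1r.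
have L : ballavg N.+1 f r <= \int[mu]_x g x.
  apply: le_Rintegral => //; first by apply: ppart_integrable; exact: continuous_scale_rV.
  move=> x _; rewrite /g ler_wpM2r//; apply: ppart_mono.
  by rewrite enormZ gtr0_norm ?invr_gt0// ler_piMl ?enorm_ge0// invf_le1.
rewrite E; apply: ler_pM; [by rewrite invr_ge0 exprn_ge0|exact: ballavg_ge0| |exact: L].
by rewrite lef_pV2 ?posrE ?exprn_gt0// lerXn2r ?nnegrE ?(ltW c0).
Qed.

Lemma bumpavg_le_ballavg (N : nat) : exists2 C : R, 0 <= C & forall f (r : R), continuous f ->
  (forall x, 0 <= f x) -> 0 < r -> bumpavg f r <= C * ballavg N.+1 f (4 * r).
Proof.
(* On |x| <= 2 the bump is at most 36, while 1 - |x/4|^2 >= 3/4. *)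
pose K : R := 36 * ((3 / 4) ^+ N.+1)^-1.
have K0 : 0 <= K by rewrite mulr_ge0// invr_ge0 exprn_ge0.
exists (K * 4 ^+ n) => [|f r cf f0 r0]; first by rewrite mulr_ge0// exprn_ge0.
pose g x := ppart N.+1 (4^-1 *: x) * f (r *: x).
have cg : continuous g.
  by apply: continuous_funM; apply: continuous_scale_rV => //; exact: continuous_ppart.
have mg := continuous_measurable_rV cg.
have g0 x : 0 <= g x by rewrite mulr_ge0// ppart_ge0.
have four0 : 0 < 4 :> R by [].
have E : ballavg N.+1 f (4 * r) = (4 ^+ n)^-1 * \int[mu]_x g x.
  rewrite -(Rintegral_scale four0 mg g0); apply: eq_Rintegral => x _.
  by rewrite /g !scalerA mulVf// scale1r [r * 4]mulrC.
have gi : mu.-integrable setT (EFin \o g).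
  have := compact_support_dominated (rho := 4) cg => /(_ _)/(dominated_integrable 0).
  under [X in EFin \o X]eq_fun do rewrite add0r; apply => x xc.
  by rewrite /g ppart_out ?mul0r// enormZ gtr0_norm ?invr_gt0// mulrC ler_pdivlMr// mul1r.
rewrite E mulrA mulfK ?expf_neq0//.
suff : bumpavg f r <= \int[mu]_x (K * g x) by rewrite (RintegralZl K measurableT gi).
apply: le_Rintegral => //.
- exact: bumpavg_integrable.
- by have := integrableZl measurableT K gi; apply: eq_integrable.
move=> x _; rewrite /g mulrA ler_wpM2r//.
have [x2|x2] := leP 2 (enorm x).
  by rewrite /abump abump_root_out// expr0n/= mulr_ge0// ppart_ge0.
apply: (le_trans (abump_le x)); rewrite /K -mulrA ler_peMr// mulrC ler_pdivlMr ?exprn_gt0// mul1r.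
rewrite /ppart lerXn2r ?nnegrE ?le_max ?lexx ?orbT//; apply/orP; left.
rewrite enormZ gtr0_norm ?invr_gt0// exprMn.
have : enorm x ^+ 2 <= 4.
  by have := enorm_ge0 x; move: (enorm x) x2 => t t2 t0; nra.
by lra.
Qed.

(** The means of f decrease from r to 2r by at most their value at r. This decrease is the integral
    of a multiple of s times the mean of - Laplacian f at s, and by [ballavg_dilate_le] these means
    are comparable on [r, 2r]. *)
Lemma ballavg_chain_step (N : nat) f (r : R) : smooth 2 f -> (forall x, 0 <= f x) ->
  (forall x, 0 <= nlap f x) -> 0 < r ->
  r ^+ 2 * ballavg N.+2 (nlap f) r <= 2 * N.+2%:R * 2 ^+ n * ballavg N.+1 f r.
Proof.
move=> sf f0 g0 r0.
have cg : continuous (nlap f) by apply: (@smooth_continuous _ _ 0); exact: smooth_nlap.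
pose K : R := 2 * N.+2%:R; have K0 : 0 < K by rewrite mulr_gt0.
pose c := r / K * ((2 ^+ n)^-1 * ballavg N.+2 (nlap f) r).
have B0 s : 0 <= ballavg N.+2 (nlap f) s := ballavg_ge0 _ _ g0.
have dF (s : R) : r <= s -> s <= 2 * r ->
    is_derive s (1 : R) (fun s => - ballavg N.+1 f s) (s / K * ballavg N.+2 (nlap f) s).
  move=> _ _; have := is_deriveN (is_derive_ballavg N s sf).
  by rewrite mulNr opprK.
have cD (s : R) : r <= s -> s <= 2 * r -> c <= s / K * ballavg N.+2 (nlap f) s.
  move=> rs s2; apply: ler_pM; last exact: ballavg_dilate_le.
  - by rewrite divr_ge0 ?ltW.
  - by rewrite mulr_ge0// invr_ge0 exprn_ge0.
  by rewrite ler_pM2r ?invr_gt0.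
have r2 : r <= 2 * r by rewrite ler_peMl ?(ltW r0)// ler1n.
have G := derive_ge_itv r2 dF cD.
have h0 : 0 <= ballavg N.+1 f (2 * r) := ballavg_ge0 _ _ f0.
have h : c * r <= ballavg N.+1 f r by move: G; rewrite (_ : 2 * r - r = r); [lra|ring].
have T0 : 0 < 2 ^+ n :> R by rewrite exprn_gt0.
have E : r ^+ 2 * ballavg N.+2 (nlap f) r = K * 2 ^+ n * (c * r).
  by rewrite /c; field; rewrite !gt_eqF.
by rewrite E; apply: ler_wpM2l => //; rewrite mulr_ge0 ?ltW.
Qed.

Section pair.
Variable alpha : R.
Hypotheses (a0 : 0 < alpha) (a2 : alpha < 2).

Lemma superpolyharmonic_pair k u w : frac_pair alpha u w -> smooth k.*2 w ->
  (forall x, 0 <= iter k nlap w x) -> forall i, (i <= k)%N -> forall x, 0 <= iter i nlap w x.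
Proof.
move=> pr sw; apply: superpolyharmonic_nonneg => // x0 e e0.
have fifty4 : 0 <= 54 :> R by [].
exact: (test_fun_pair_cvg0 a0 a2 ltr01 fifty4 (@ppart2_test R m) (@ppart2_diff2 R m)
  (frac_pair_shift x0 (ltW a0) pr)).
Qed.

Lemma ballavg2_le_weightavg : exists2 C : R, 0 <= C & forall u w, frac_pair alpha u w ->
  forall r : R, 0 < r -> r `^ alpha * ballavg 2 w r <= C * weightavg alpha u r.
Proof.
have fifty4 : 0 <= 54 :> R by [].
have [C C0 HC] := test_fun_pair_abs a0 a2 ltr01 fifty4 (@ppart2_test R m) (@ppart2_diff2 R m).
exists C => // u w pr r r0; have [wu _ cw _] := pr.
have := HC _ _ (frac_pair_scale (ltW a0) r0 pr).
rewrite EFin_Rintegral; last exact: weightavg_integrable (ltW a0) r0 wu.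
rewrite -EFinM lee_fin; apply: le_trans; apply: le_trans (ler_norm _).
rewrite /ballavg -(RintegralZl _ measurableT (ppart_integrable 1 (@continuous_scale_rV _ _ w r cw))).
by rewrite le_eqVlt; apply/orP; left; apply/eqP; apply: eq_Rintegral => x _; rewrite mulrCA.
Qed.

Lemma weightavg_le_bumpavg : exists2 C : R, 0 <= C & forall u w, frac_pair alpha u w ->
  (forall x, 0 <= w x) -> forall r : R, 0 < r -> weightavg alpha u r <= C * bumpavg u r.
Proof.
have [c [C [c0 C0 H]]] := @abump_pair_le R m alpha a0 a2.
exists (c^-1 * C) => [|u w pr w0 r r0]; first by rewrite mulr_ge0// invr_ge0 ltW.
have [wu cu cw _] := pr; have [_ u0 _] := wu.
have := H _ _ (frac_pair_scale (ltW a0) r0 pr) (fun x _ => mulr_ge0 (powR_ge0 _ _) (w0 _)).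
rewrite [in X in (_ + X)%E]EFin_Rintegral; last exact: weightavg_integrable (ltW a0) r0 wu.
rewrite [in leRHS]EFin_Rintegral; last exact: bumpavg_integrable.
have I0 : (0 <= \int[mu]_x (abump x * (r `^ alpha * w (r *: x)))%:E)%E.
  by apply: integral_fin_ge0 => x; rewrite mulr_ge0 ?abump_ge0// mulr_ge0 ?powR_ge0.
move=> h; have {h} := le_trans (leeDr _ I0) h.
rewrite -!EFinM lee_fin -mulrA => h.
by rewrite mulrC ler_pdivlMr// mulrC.
Qed.

(** Up to constants, with W the k-th iterate: the bump mean of W is at most its weighted ball mean,
    hence at most r^(-2k) times the ball mean of w by k chain steps, hence r^(-2k-alpha) times the
    weighted integral of u by duality, hence r^(-2k-alpha) times the bump mean of u. *)
Lemma bumpavg_iter_le k : exists2 C : R, 0 <= C & forall u w, frac_pair alpha u w ->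
  smooth k.*2 w -> (forall x, 0 <= iter k nlap w x) -> forall r : R, 0 < r ->
  r ^+ (2 * k) * r `^ alpha * bumpavg (iter k nlap w) r <= C * bumpavg u r.
Proof.
have [A A0 HA] := ballavg2_le_weightavg.
have [B B0 HB] := weightavg_le_bumpavg.
have [D D0 HD] := bumpavg_le_ballavg k.+1.
pose K : R := \prod_(i < k) (2 * i.+3%:R * 2 ^+ n).
have K0 : 0 <= K by apply: prodr_ge0 => i _; rewrite !mulr_ge0// exprn_ge0.
pose T : R := (1 + 4) `^ (n%:R + alpha) * (4 ^+ n)^-1.
have T0 : 0 <= T by rewrite mulr_ge0 ?powR_ge0// invr_ge0 exprn_ge0.
exists (D * (K * (A * (T * B)))) => [|u w pr sw Wk r r0]; first by rewrite !mulr_ge0.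
have W0 := superpolyharmonic_pair pr sw Wk.
have [wu cu cw _] := pr; have [_ u0 _] := wu.
(* [bumpavg_le_ballavg] passes from scale r to scale 4r; [weightavg_dilate] leads back to r. *)
pose s := 4 * r; have s0 : 0 < s by rewrite mulr_gt0.
have chain i : (i <= k)%N -> s ^+ (2 * i) * ballavg i.+2 (iter i nlap w) s <=
    \prod_(j < i) (2 * j.+3%:R * 2 ^+ n) * ballavg 2 w s.
  elim: i => [_|i IH ik]; first by rewrite muln0 expr0 big_ord0.
  rewrite big_ord_recr/= mulnS exprD.
  have s2 : smooth 2 (iter i nlap w).
    apply: smooth_le (smooth_iter_nlap (ltnW ik) sw).
    by move: ik; rewrite -subn_gt0; case: (k - i)%N => // j _; rewrite doubleS.
  have st := @ballavg_chain_step i.+1 (iter i nlap w) s s2 (W0 i (ltnW ik)) (W0 i.+1 ik) s0.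
  rewrite mulrAC [s ^+ 2 * _]mulrC mulrC; apply: (@le_trans _ _ (s ^+ (2 * i) * (2 * i.+3%:R * 2 ^+ n * ballavg i.+2 (iter i nlap w) s))).
    rewrite [X in X <= _]mulrC; apply: ler_wpM2l; [exact: exprn_ge0 (ltW s0)|exact: st].
  rewrite mulrCA [X in _ <= X]mulrAC [X in _ <= X]mulrC; apply: ler_wpM2l (IH (ltnW ik)).
  by rewrite mulr_ge0 ?exprn_ge0// mulr_ge0.
have h1 : bumpavg (iter k nlap w) r <= D * ballavg k.+2 (iter k nlap w) s.
  have ck := continuous_iter_nlap sw (leqnn k); exact: (HD _ r ck Wk r0).
have h2 := chain k (leqnn k).
have h3 := HA u w pr s s0.
have h4 := weightavg_dilate (ltW a0) r0 (ltr0Sn R 3) wu.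
have h5 := HB u w pr (W0 0%N (leq0n k)) r r0.
have rs : r <= s by rewrite /s ler_peMl ?(ltW r0)// ler1n.
have b0 : 0 <= ballavg k.+2 (iter k nlap w) s by exact: ballavg_ge0.
have b2 : 0 <= ballavg 2 w s by apply: ballavg_ge0; exact: W0 0%N (leq0n k).
have p1 : r ^+ (2 * k) <= s ^+ (2 * k) by rewrite lerXn2r ?nnegrE ?(ltW r0) ?(ltW s0).
have p2 : r `^ alpha <= s `^ alpha by rewrite ge0_ler_powR ?nnegrE ?(ltW r0) ?(ltW s0) ?(ltW a0).
have q1 : 0 <= r ^+ (2 * k) by rewrite exprn_ge0// ltW.
have q2 : 0 <= r `^ alpha by exact: powR_ge0.
have z1 : r ^+ (2 * k) * r `^ alpha * bumpavg (iter k nlap w) r <=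
    D * (s `^ alpha * (s ^+ (2 * k) * ballavg k.+2 (iter k nlap w) s)).
  have -> : D * (s `^ alpha * (s ^+ (2 * k) * ballavg k.+2 (iter k nlap w) s)) =
     s ^+ (2 * k) * s `^ alpha * (D * ballavg k.+2 (iter k nlap w) s) by ring.
  by apply: ler_pM => //; [exact: mulr_ge0|exact: bumpavg_ge0|exact: ler_pM].
apply: (le_trans z1); rewrite -mulrA; apply: ler_wpM2l => //.
apply: (@le_trans _ _ (s `^ alpha * (K * ballavg 2 w s))).
  by apply: ler_wpM2l => //; exact: powR_ge0.
rewrite mulrCA -mulrA; apply: ler_wpM2l => //; apply: (le_trans h3).
rewrite -mulrA; apply: ler_wpM2l => //; apply: (le_trans h4).
by rewrite -[leRHS]mulrA; apply: ler_wpM2l.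
Qed.

End pair.
End energy_decay.

(** * Jensen's inequality and the closure of the system *)

Section nonlinear_decay.
Context {R : realType} {m : nat}.
Local Notation n := m.+1.
Local Notation mu := (lebesgue_rV R n).
Implicit Types (x y z : 'rV[R]_n) (f g u v w : 'rV[R]_n -> R).

(** The tangent inequality for t^p at s, obtained from Young's inequality for t and s^(p-1) with
    exponents p and p/(p-1); p = 1 is separate. *)
Lemma powR_tangent (p s t : R) : 1 <= p -> 0 <= s -> 0 <= t ->
  p * (t * s `^ (p - 1)) - (p - 1) * s `^ p <= t `^ p.
Proof.
move=> p1 s0 t0; have [<-|pn] := eqVneq 1 p.
  by rewrite subrr powRr0 mul0r subr0 mul1r mulr1 powRr1.
have pp : 0 < p - 1 by rewrite subr_gt0 lt_neqAle pn.
have p0 : 0 < p := lt_le_trans ltr01 p1.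
have q0 : 0 < p / (p - 1) by rewrite divr_gt0.
have pq : p^-1 + (p / (p - 1))^-1 = 1 by field; rewrite !gt_eqF.
have := conjugate_powR t0 (powR_ge0 s (p - 1)) p0 q0 pq.
rewrite -powRrM mulrCA mulfV ?gt_eqF// mulr1 => h.
have : p * (t * s `^ (p - 1)) <= p * (t `^ p / p + s `^ p / (p / (p - 1))) by rewrite ler_pM2l.
rewrite (_ : p * (_ + _) = t `^ p + (p - 1) * s `^ p); last by field; rewrite !gt_eqF.
lra.
Qed.

Lemma Rintegral_abump : \int[mu]_x abump x = abump_int R m.
Proof. by rewrite /Rintegral abump_intE. Qed.

Lemma continuous_powR_comp f (p : R) : 0 < p -> continuous f -> (forall x, 0 <= f x) ->
  continuous (fun x => f x `^ p).
Proof.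
move=> p0 cf f0 x; have FF : Filter (nbhs x) := nbhs_filter x.
have [fx|fx] := eqVneq (f x) 0; last first.
  have fp : 0 < f x by rewrite lt_neqAle eq_sym fx f0.
  apply: (@continuous_comp _ _ _ f (fun t => t `^ p)); first exact: cf.
  exact: is_derive1_continuous (is_derive1_powR p fp).
rewrite /continuous_at fx powR0 ?gt_eqF//.
apply/(@cvgrPdist_le _ _ _ _ FF) => e e0.
have e1 : 0 < e `^ p^-1 by rewrite powR_gt0.
have := cf x; move/(@cvgrPdist_le _ _ _ _ FF)/(_ _ e1); apply: filterS => y.
rewrite fx !sub0r !normrN !ger0_norm ?powR_ge0// => fy.
rewrite -[leRHS]powRr1 ?(ltW e0)// -(mulVf (lt0r_neq0 p0)) powRrM.
by rewrite ge0_ler_powR ?nnegrE ?powR_ge0 ?(ltW p0).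
Qed.

(** Jensen by integrating the tangent inequality at the mean s = X/J: the linear terms combine to J
    s^p. *)
Lemma bumpavg_jensen v (p r : R) : 1 <= p -> continuous v -> (forall x, 0 <= v x) ->
  abump_int R m * (bumpavg v r / abump_int R m) `^ p <= bumpavg (fun x => v x `^ p) r.
Proof.
move=> p1 cv v0; have J0 := @abump_int_gt0 R m; set J := abump_int R m in J0 *.
have X0 := bumpavg_ge0 r v0; set X := bumpavg v r in X0 *.
pose s := X / J; have s0 : 0 <= s by rewrite divr_ge0// ltW.
have p0 : 0 < p := lt_le_trans ltr01 p1.
have cvp := continuous_powR_comp p0 cv v0.
have i1 : mu.-integrable setT (EFin \o (fun x => abump x * v (r *: x))) by exact: bumpavg_integrable.
have i2 : mu.-integrable setT (EFin \o (fun x => abump x * v (r *: x) `^ p)).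
  exact: (bumpavg_integrable r cvp).
have i3 : mu.-integrable setT (EFin \o @abump R m).
  apply: ge0_integrable_fin; [exact: measurable_abump|exact: abump_ge0|].
  by rewrite abump_intE ltry.
pose c1 := p * s `^ (p - 1); pose c2 := (p - 1) * s `^ p.
have j1 : mu.-integrable setT (EFin \o (fun x => c1 * (abump x * v (r *: x)))).
  by have := integrableZl measurableT c1 i1; apply: eq_integrable.
have j3 : mu.-integrable setT (EFin \o (fun x => c2 * abump x)).
  by have := integrableZl measurableT c2 i3; apply: eq_integrable.
have j : mu.-integrable setT (EFin \o (fun x => c1 * (abump x * v (r *: x)) - c2 * abump x)).
  by have := integrableB measurableT j1 j3; apply: eq_integrable.
have E : \int[mu]_x (c1 * (abump x * v (r *: x)) - c2 * abump x) = J * s `^ p.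
  rewrite (RintegralB measurableT j1 j3) (RintegralZl _ measurableT i1) (RintegralZl _ measurableT i3).
  rewrite Rintegral_abump -/(bumpavg v r) -/X -/J /c1 /c2.
  have Xs : X = s * J by rewrite /s divfK// gt_eqF.
  have sp : s * s `^ (p - 1) = s `^ p.
    have [->|sn] := eqVneq s 0; first by rewrite mul0r powR0// gt_eqF.
    by rewrite -{1}[s]powRr1// -powRD ?sn ?implybT// addrC subrK.
  rewrite Xs (_ : p * s `^ (p - 1) * (s * J) = p * (s * s `^ (p - 1)) * J); last by ring.
  by rewrite sp; ring.
rewrite -E; apply: le_Rintegral => // x _.
have := powR_tangent p1 s0 (v0 (r *: x)).
move/(ler_wpM2l (abump_ge0 x)); apply: le_trans.
by rewrite /c1 /c2 le_eqVlt; apply/orP; left; apply/eqP; ring.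
Qed.

Lemma le_of_normalized (j jp xp t : R) : 0 < j -> 0 < jp -> j * (xp / jp) <= t -> xp <= jp / j * t.
Proof.
move=> j0 jp0; rewrite mulrAC ler_pdivlMr// -(ler_pM2l jp0).
by rewrite (_ : jp * (j * (xp / jp)) = xp * j)//; field; rewrite gt_eqF.
Qed.

(** The equation turns the bound on the bump mean of the k-th iterate into one on the bump mean of
    |x|^a v^p, and Jensen extracts the mean of v. *)
Lemma energy_step (alpha a p : R) k : 0 < alpha -> alpha < 2 -> 0 <= a -> 1 <= p ->
  exists2 A : R, 0 < A & forall u v w, frac_pair alpha u w -> smooth k.*2 w ->
    continuous v -> (forall x, 0 <= v x) ->
    (forall x, @frac_laplacian_const R n alpha * iter k nlap w x = enorm x `^ a * v x `^ p) ->
    forall r : R, 0 < r ->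
    bumpavg v r `^ p <= A * r `^ (- (2 * k%:R + alpha + a)) * bumpavg u r.
Proof.
move=> a0 a2 aa p1; have [C C0 HC] := @bumpavg_iter_le R m alpha a0 a2 k.
have K0 := frac_laplacian_const_gt0 (R := R) (m := m) a0 a2; set kap := frac_laplacian_const alpha in K0 *.
have J0 := @abump_int_gt0 R m; set J := abump_int R m in J0 *.
have p0 : 0 < p := lt_le_trans ltr01 p1.
exists (J `^ p / J * kap * (C + 1)).
  have C1 : 0 < C + 1 by rewrite ltr_wpDl.
  apply: mulr_gt0 => //; apply: mulr_gt0 => //; apply: divr_gt0 => //; exact: powR_gt0.
move=> u v w pr sw cv v0 eqn r r0.
have [[_ u0 _] _ _ _] := pr.
have Wk x : 0 <= iter k nlap w x.
  by rewrite -(pmulr_rge0 _ K0) eqn mulr_ge0// powR_ge0.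
have H := HC u w pr sw Wk r r0.
have ck := continuous_iter_nlap sw (leqnn k).
have cvp := continuous_powR_comp p0 cv v0.
have h1 : r `^ a * bumpavg (fun x => v x `^ p) r <= kap * bumpavg (iter k nlap w) r.
  have i1 := bumpavg_integrable r cvp; have i2 := bumpavg_integrable r ck.
  rewrite -(RintegralZl _ measurableT i1) -(RintegralZl _ measurableT i2).
  apply: le_Rintegral => //.
  - by have := integrableZl measurableT (r `^ a) i1; apply: eq_integrable.
  - by have := integrableZl measurableT kap i2; apply: eq_integrable.
  (* The bump vanishes on |x| <= 1, and for |x| > 1, |r x|^a >= r^a as a >= 0: this is why an
     annulus is used instead of a ball. *)
  move=> x _; rewrite [leRHS]mulrCA eqn mulrCA; have [x1|x1] := leP (enorm x) 1.
    by rewrite /abump abump_root_in// expr0n/= !mul0r.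
  apply: ler_wpM2l; first exact: abump_ge0.
  apply: ler_wpM2r; first exact: powR_ge0.
  rewrite ge0_ler_powR ?nnegrE ?enorm_ge0 ?(ltW r0)// enormZ gtr0_norm//.
  by rewrite ler_peMr ?(ltW r0)// ltW.
have h2 := bumpavg_jensen r p1 cv v0; rewrite -/J in h2.
have X0 := bumpavg_ge0 r v0; set X := bumpavg v r in X0 h2 *.
have U0 := bumpavg_ge0 r u0; set U := bumpavg u r in U0 H *.
rewrite powRM ?invr_ge0 ?(ltW J0)// -powR_inv1 ?(ltW J0)// -powRrM mulN1r powRN in h2.
have rk : r ^+ (2 * k) = r `^ (2 * k%:R) by rewrite -natrM -powR_mulrn// ltW.
have rD : r `^ (2 * k%:R + alpha + a) = r ^+ (2 * k) * r `^ alpha * r `^ a.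
  by rewrite rk !powRD ?(gt_eqF r0) ?implybT.
have Q0 : 0 < r `^ (2 * k%:R + alpha + a) by exact: powR_gt0.
rewrite powRN mulrAC ler_pdivlMr// rD.
set B := bumpavg (iter k nlap w) r in H h1; set T := bumpavg _ r in h1 h2.
have ra : 0 <= r ^+ (2 * k) * r `^ alpha by rewrite mulr_ge0 ?powR_ge0// exprn_ge0// ltW.
have Jp : 0 < J `^ p by rewrite powR_gt0.
have h3 : X `^ p <= J `^ p / J * T.
  exact: le_of_normalized J0 Jp h2.
have JJ : 0 <= J `^ p / J by rewrite divr_ge0 ?ltW.
apply: (@le_trans _ _ (J `^ p / J * (r ^+ (2 * k) * r `^ alpha) * (r `^ a * T))).
  rewrite [X in X <= _]mulrC.
  have -> : J `^ p / J * (r ^+ (2 * k) * r `^ alpha) * (r `^ a * T) =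
    (r ^+ (2 * k) * r `^ alpha * r `^ a) * (J `^ p / J * T) by ring.
  by apply: ler_wpM2l => //; rewrite mulr_ge0 ?powR_ge0.
apply: (@le_trans _ _ (J `^ p / J * (r ^+ (2 * k) * r `^ alpha) * (kap * B))).
  by apply: ler_wpM2l => //; rewrite mulr_ge0.
have -> : J `^ p / J * (r ^+ (2 * k) * r `^ alpha) * (kap * B) = J `^ p / J * kap * (r ^+ (2 * k) * r `^ alpha * B) by ring.
have -> : J `^ p / J * kap * (C + 1) * U = J `^ p / J * kap * ((C + 1) * U) by ring.
apply: ler_wpM2l; first by rewrite mulr_ge0// ltW.
by apply: (le_trans H); rewrite ler_wpM2r// lerDl.
Qed.

(** Inserting one inequality in the other gives X^(pq) <= B^p A r^(-(s1 + p s2)) X; a factor X is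
    divided out and the root of order pq - 1 > 0 is taken. *)
Lemma power_closure (X Y A B r s1 s2 p q : R) : 0 <= X -> 0 <= Y -> 0 < A -> 0 < B -> 0 < r ->
  0 < p -> 0 < q -> 1 < p * q ->
  Y `^ p <= A * r `^ (- s1) * X -> X `^ q <= B * r `^ (- s2) * Y ->
  X <= (B `^ p * A) `^ (p * q - 1)^-1 * r `^ (- ((s1 + p * s2) / (p * q - 1))).
Proof.
move=> X0 Y0 A0 B0 r0 p0 q0 pq h1 h2.
have D0 : 0 < p * q - 1 by rewrite subr_gt0.
have [->|Xn] := eqVneq X 0; first by rewrite mulr_ge0 ?powR_ge0.
have Xp : 0 < X by rewrite lt_neqAle eq_sym Xn.
have BA : 0 < B `^ p * A by rewrite mulr_gt0 ?powR_gt0.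
have rs := powR_gt0 (- s2) r0; have rs1 := powR_gt0 (- s1) r0.
have h3 : X `^ (p * q) <= B `^ p * A * r `^ (- (s1 + p * s2)) * X.
  rewrite [p * q]mulrC powRrM.
  apply: (@le_trans _ _ ((B * r `^ (- s2) * Y) `^ p)).
    have T : 0 <= B * r `^ (- s2) * Y by apply: mulr_ge0 => //; apply: mulr_ge0; exact: ltW.
    by rewrite ge0_ler_powR ?nnegrE ?powR_ge0 ?(ltW p0).
  rewrite !powRM ?mulr_ge0 ?powR_ge0 ?(ltW B0)//.
  rewrite -powRrM opprD powRD ?(gt_eqF r0) ?implybT//.
  have -> : B `^ p * A * (r `^ (- s1) * r `^ (- (p * s2))) * X =
     B `^ p * r `^ (- (p * s2)) * (A * r `^ (- s1) * X) by ring.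
  rewrite mulNr [s2 * p]mulrC; apply: ler_wpM2l => //.
  by rewrite mulr_ge0 ?powR_ge0.
have h4 : X `^ (p * q - 1) <= B `^ p * A * r `^ (- (s1 + p * s2)).
  rewrite -(ler_pM2r Xp) (le_trans _ h3)// -{2}[X]powRr1// -powRD ?Xn ?implybT//.
  by rewrite subrK.
move: D0 h4; set D := p * q - 1 => D0 h4.
rewrite -[leLHS]powRr1// -(mulfV (lt0r_neq0 D0)) powRrM.
rewrite -mulNr powRrM -powRM ?(ltW BA) ?powR_ge0//.
by rewrite ge0_ler_powR ?nnegrE ?powR_ge0 ?invr_ge0 ?(ltW D0)// mulr_ge0 ?powR_ge0 ?(ltW BA).
Qed.

Lemma nonneg_solution_sym k l (alpha beta a b p q : R) u v :
  nonneg_solution k l alpha beta a b p q u v -> nonneg_solution l k beta alpha b a q p v u.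
Proof. by move=> [H1 H2 H3 H4 H5]; split => // x; have [] := H3 x. Qed.

(** The bound is stated for [weightavg] because both final estimates, exterior and local, are
    controlled by it. *)
Lemma solution_decay k l (alpha beta a b p q : R) :
  0 < alpha -> alpha < 2 -> 0 < beta -> beta < 2 -> 0 <= a -> 0 <= b ->
  1 <= p -> 1 <= q -> 1 < p * q ->
  exists2 M : R, 0 < M & forall u v, nonneg_solution k l alpha beta a b p q u v ->
    exists w, [/\ frac_pair alpha u w, smooth k.*2 w,
      forall i, (i <= k)%N -> forall x, 0 <= iter i nlap w x &
      forall r : R, 0 < r -> weightavg alpha u r <=
        M * r `^ (- ((2 * k%:R + alpha + a + p * (2 * l%:R + beta + b)) / (p * q - 1)))].
Proof.
move=> a0 a2 b0 b2 aa bb p1 q1 pq.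
have [A A0 HA] := energy_step k a0 a2 aa p1.
have [B B0 HB] := energy_step l b0 b2 bb q1.
have [C C0 HC] := @weightavg_le_bumpavg R m alpha a0 a2.
pose T := (B `^ p * A) `^ (p * q - 1)^-1.
have T0 : 0 < T by rewrite powR_gt0// mulr_gt0// powR_gt0.
exists ((C + 1) * T) => [|u v sol]; first by rewrite mulr_gt0// ltr_wpDl.
have [[ru wLu] [rv wLv] uv0 eu ev] := sol.
have u0 x : 0 <= u x by have [] := uv0 x.
have v0 x : 0 <= v x by have [] := uv0 x.
have [w [prw sw Ew]] := regular_frac_pair a0 a2 ru wLu u0.
have [z [prz sz Ez]] := regular_frac_pair b0 b2 rv wLv v0.
have [_ cu _ _] := prw; have [_ cv _ _] := prz.
have eqw x : @frac_laplacian_const R n alpha * iter k nlap w x = enorm x `^ a * v x `^ p by rewrite -Ew eu.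
have eqz x : @frac_laplacian_const R n beta * iter l nlap z x = enorm x `^ b * u x `^ q by rewrite -Ez ev.
have Wk x : 0 <= iter k nlap w x.
  by rewrite -(pmulr_rge0 _ (frac_laplacian_const_gt0 (R := R) (m := m) a0 a2)) eqw mulr_ge0// powR_ge0.
have W0 := superpolyharmonic_pair a0 a2 prw sw Wk.
exists w; split => // r r0.
have h1 := HA u v w prw sw cv v0 eqw r r0.
have h2 := HB v u z prz sz cu u0 eqz r r0.
have p0 : 0 < p := lt_le_trans ltr01 p1.
have q0 : 0 < q := lt_le_trans ltr01 q1.
have h3 := power_closure (bumpavg_ge0 r u0) (bumpavg_ge0 r v0) A0 B0 r0 p0 q0 pq h1 h2.
apply: (le_trans (HC u w prw (W0 0%N (leq0n k)) r r0)).
rewrite -mulrA; apply: (@le_trans _ _ ((C + 1) * bumpavg u r)).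
  by rewrite ler_wpM2r ?bumpavg_ge0// lerDl.
by apply: ler_wpM2l => //; rewrite addr_ge0.
Qed.

End nonlinear_decay.

(** * The barrier and the exterior estimate *)

Section half_line.
Context {R : realType}.
Local Notation leb := (@lebesgue_measure R).
Variable s : R.
Hypotheses (s0 : 0 < s) (s1 : s < 1).
Implicit Types (e t a b x y : R).

Lemma integral_FTC (F f : R -> R) a b : a <= b ->
  (forall t, a <= t <= b -> is_derive t (1 : R) F (f t)) ->
  (forall t, a <= t <= b -> f y @[y --> t] --> f t) ->
  (forall t, a <= t <= b -> 0 <= f t) ->
  (\int[leb]_t ((a <= t <= b)%R%:R * f t)%:E = (F b - F a)%:E)%E.
Proof.
rewrite le_eqVlt => /orP[/eqP<-|ab] dF cf f0.
  rewrite subrr; have Z : leb [set a] = 0%E by exact: lebesgue_measure_set1.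
  rewrite -(ge0_integral_cond leb (fun t => a <= t <= a)).
  apply: (@integral_Sset1 _ _ _ a) => t /= /andP[? ?].
  by apply/eqP; rewrite eq_le; apply/andP.
rewrite -(ge0_integral_cond leb (fun t => a <= t <= b)).
rewrite (_ : [set x | _] = `[a, b]%classic); last first.
  by apply/seteqP; split => x /=; rewrite in_itv/=.
have C t : a <= t <= b -> F y @[y --> t] --> F t.
  by move=> tab; exact: is_derive1_continuous (dF t tab).
have ca : a <= a <= b by rewrite lexx ltW.
have cb : a <= b <= b by rewrite lexx ltW.
rewrite (continuous_FTC2 (F := F))// -?EFinB//.
- apply/continuous_within_itvP => //; split.
  + by move=> x; rewrite in_itv/= => /andP[ax xb]; apply: cf; rewrite !ltW.
  + by apply: cvg_at_right_filter; exact: cf.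
  + by apply: cvg_at_left_filter; exact: cf.
- split.
  + by move=> x; rewrite in_itv/= => /andP[ax xb]; have [] := dF x; rewrite ?ltW.
  + by apply: cvg_at_right_filter; exact: C.
  + by apply: cvg_at_left_filter; exact: C.
- by move=> x; rewrite in_itv/= => /andP[ax xb]; rewrite derive1E; have [|_ ->] := dF x; rewrite ?ltW.
Qed.

Definition pker e t : R := (e <= t)%R%:R * t `^ (- 1 - 2 * s).
Definition pmass e : R := e `^ (- (2 * s)) / (2 * s).

Let s20 : 0 < 2 * s. Proof. by rewrite mulr_gt0. Qed.

Lemma integral_pker e : 0 < e -> (\int[leb]_t (pker e t)%:E = (pmass e)%:E)%E.
Proof. by move=> e0; exact: integral_powR_infty. Qed.

Lemma pker_ge0 e t : 0 <= pker e t. Proof. by rewrite mulr_ge0// powR_ge0. Qed.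

Lemma measurable_pker e : measurable_fun setT (pker e).
Proof. by rewrite /pker; meas. Qed.

Definition half_pow x : R := Num.max x 0 `^ s.

Lemma half_pow_ge0 x : 0 <= half_pow x. Proof. exact: powR_ge0. Qed.

Lemma half_pow_pos x : 0 <= x -> half_pow x = x `^ s.
Proof. by move=> x0; rewrite /half_pow; have -> : Num.max x 0 = x by apply/max_idPl. Qed.

Lemma half_pow_neg x : x <= 0 -> half_pow x = 0.
Proof.
move=> x0; rewrite /half_pow; have -> : Num.max x 0 = 0 by apply/max_idPr.
by rewrite powR0// gt_eqF.
Qed.

Lemma measurable_half_pow (d : measure_display) (T : measurableType d) (f : T -> R) :
  measurable_fun setT f -> measurable_fun setT (fun x : T => half_pow (f x)).
Proof.
move=> mf; apply: (measurableT_comp (measurable_powR s)).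
by apply: measurable_maxr.
Qed.

Let pow1 (c : R) : 1 `^ c = 1. Proof. by rewrite powR1. Qed.

(** Concavity of y^s, read off from the tangent inequality for the convex power 1/s at the point
    1. *)
Lemma powR_bernoulli y : 0 <= y -> y `^ s <= 1 + s * (y - 1).
Proof.
move=> y0; have p1 : 1 <= s^-1 by rewrite invf_ge1// ltW.
have := powR_tangent p1 ler01 (powR_ge0 y s).
rewrite !powR1 -powRrM mulfV ?gt_eqF// powRr1// !mulr1.
rewrite -(ler_pM2l s0) mulrBr mulrA mulfV ?gt_eqF// mul1r mulrBr mulfV ?gt_eqF// mulr1; lra.
Qed.

(** For x_+^s at the point 1, p is the loss on the left of 1 and q the gain on the right. The
    substitution G(t) = t/(1 - t) turns q into p(t) (1 - t)^(s-1), and p(t) (1 - t)^(s-1) - p(t) is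
    the derivative of Phi. Comparing loss and gain thus reduces to boundary values of Phi. *)
Local Notation p := (fun t => (1 - (1 - t) `^ s) * t `^ (- 1 - 2 * s)).
Local Notation q := (fun t => ((1 + t) `^ s - 1) * t `^ (- 1 - 2 * s)).
Local Notation Phi := (fun t => (1 - (1 - t) `^ s) ^+ 2 * t `^ (- (2 * s)) / (2 * s)).
Local Notation G := (fun t => ((1 - t)^-1 - 1 : R)).

Lemma is_derive_oneminus_powR (c t : R) : t < 1 ->
  is_derive t (1 : R) (fun t => (1 - t) `^ c) (- (c * (1 - t) `^ (c - 1))).
Proof.
move=> t1; have t10 : 0 < 1 - t by rewrite subr_gt0.
have D1 : is_derive t (1 : R) (fun t => 1 - t) (- 1).
  by have := is_deriveB (is_derive_cst (1 : R) t 1) (is_derive_id t (1 : R)); rewrite sub0r.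
have := is_derive1_comp (f := fun x => x `^ c) (g := fun t => 1 - t).
move=> /(_ _ _ _ (is_derive1_powR c t10) D1).
by rewrite mulrN1.
Qed.

Lemma is_derive_Phi t : 0 < t -> t < 1 ->
  is_derive t (1 : R) Phi (p t * (1 - t) `^ (s - 1) - p t).
Proof.
move=> t0 t1; have t10 : 0 < 1 - t by rewrite subr_gt0.
have D1 := is_derive_oneminus_powR s t1.
have D2 : is_derive t (1 : R) (fun t => 1 - (1 - t) `^ s) (s * (1 - t) `^ (s - 1)).
  by have := is_deriveB (is_derive_cst (1 : R) t 1) D1; rewrite sub0r opprK.
have D3 := is_deriveM D2 D2.
have D4 := is_deriveM D3 (is_derive1_powR (- (2 * s)) t0).
have := is_deriveZ (2 * s)^-1 D4.
rewrite (_ : _ \*: _ = Phi); last first.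
  apply/funext => x; change ((2 * s)^-1 * ((1 - (1 - x) `^ s) * (1 - (1 - x) `^ s) * x `^ (- (2 * s))) = Phi x).
  by rewrite /= mulrC expr2.
rewrite [X in is_derive _ _ _ X -> _](_ : _ = p t * (1 - t) `^ (s - 1) - p t)//.
rewrite /GRing.scale/= (_ : - (2 * s) - 1 = - 1 - 2 * s); last by ring.
have E1 : t `^ (- (2 * s)) = t * t `^ (- 1 - 2 * s).
  by rewrite -{2}[t]powRr1 ?(ltW t0)// -powRD ?(gt_eqF t0) ?implybT//; congr (_ `^ _); ring.
have E2 : (1 - t) `^ s = (1 - t) * (1 - t) `^ (s - 1).
  by rewrite -{2}[1 - t]powRr1 ?(ltW t10)// -powRD ?(gt_eqF t10) ?implybT//; congr (_ `^ _); ring.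
have -> : ((fun t => 1 - (1 - t) `^ s) * (fun t => 1 - (1 - t) `^ s)) t = (1 - (1 - t) `^ s) * (1 - (1 - t) `^ s) by [].
rewrite E1 E2; set y := (1 - t) `^ (s - 1); set z := t `^ _.
by field; rewrite gt_eqF.
Qed.

Lemma is_derive_G t : t < 1 -> is_derive t (1 : R) G ((1 - t) ^- 2).
Proof.
move=> t1; have t10 : 1 - t != 0 by rewrite gt_eqF// subr_gt0.
have D1 : is_derive t (1 : R) (fun t => 1 - t) (- 1).
  by have := is_deriveB (is_derive_cst (1 : R) t 1) (is_derive_id t (1 : R)); rewrite sub0r.
have := is_deriveB (is_deriveV (f := fun t => 1 - t) t10 D1) (is_derive_cst (1 : R) t 1).
by rewrite subr0 /GRing.scale/= mulrN1 opprK.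
Qed.

Lemma cvg_deriv_G t : t < 1 -> derive1 G y @[y --> t] --> derive1 G t.
Proof.
move=> t1; have E y : y < 1 -> derive1 G y = (1 - y) `^ (- 2).
  move=> y1; rewrite derive1E; have [_ ->] := is_derive_G y1.
  by rewrite powRN powR_mulrn// subr_ge0 ltW.
rewrite (E t t1); apply: (@cvg_trans _ ((fun y => (1 - y) `^ (- 2)) @ t)).
  by apply: near_eq_cvg; near=> y; rewrite E//; near: y; exact: lt_nbhsl.
exact: is_derive1_continuous (is_derive_oneminus_powR (- 2) t1).
Unshelve. all: by end_near.
Qed.

Lemma cvg_powR (c t : R) : 0 < t -> y `^ c @[y --> t] --> t `^ c.
Proof. by move=> t0; exact: is_derive1_continuous (is_derive1_powR c t0). Qed.

Lemma cvg_q t : 0 < t -> q y @[y --> t] --> q t.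
Proof.
move=> t0; apply: cvgM; last exact: cvg_powR.
apply: cvgB; last exact: cvg_cst.
have t10 : 0 < 1 + t by rewrite addr_gt0.
apply: (cvg_comp (fun y => 1 + y) (fun x => x `^ s)); last exact: (cvg_powR (c := s) t10).
by apply: cvgD; [exact: cvg_cst|exact: cvg_id].
Qed.

Lemma substitution_identity t : 0 < t -> t < 1 ->
  p t * (1 - t) `^ (s - 1) = q (G t) * (1 - t) ^- 2.
Proof.
move=> t0 t1; have y0 : 0 < 1 - t by rewrite subr_gt0.
have -> : 1 + ((1 - t)^-1 - 1) = (1 - t)^-1 by rewrite addrC subrK.
have -> : (1 - t)^-1 - 1 = t * (1 - t)^-1 by field; rewrite gt_eqF.
have E1 : (1 - t)^-1 `^ s = ((1 - t) `^ s)^-1.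
  by rewrite -(powR_inv1 (ltW y0)) -powRrM mulN1r powRN.
have E2 : (t * (1 - t)^-1) `^ (- 1 - 2 * s) = t `^ (- 1 - 2 * s) * ((1 - t) `^ (- 1 - 2 * s))^-1.
  rewrite powRM ?invr_ge0 ?(ltW t0) ?(ltW y0)//; congr (_ * _).
  by rewrite -(powR_inv1 (ltW y0)) -powRrM mulN1r powRN.
have E3 : ((1 - t) `^ (- 1 - 2 * s))^-1 * (1 - t) ^- 2 = (1 - t) `^ (s - 1) * (1 - t) `^ s.
  rewrite -powR_mulrn ?(ltW y0)// -!powRN -!powRD ?(gt_eqF y0) ?implybT//.
  by congr (_ `^ _); ring.
rewrite E1 E2 -!mulrA E3; have := powR_gt0 s y0; set b := (1 - t) `^ s => b0.
by field; rewrite gt_eqF.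
Qed.

Lemma integral_substitution_G e b : 0 < e -> e < b -> b < 1 ->
  (\int[leb]_t ((e <= t <= b)%R%:R * (p t * (1 - t) `^ (s - 1)))%:E =
   \int[leb]_t ((G e <= t <= G b)%R%:R * q t)%:E)%E.
Proof.
move=> e0 eb b1; have e1 : e < 1 by exact: lt_trans b1.
have Ge : 0 < G e by rewrite subr_gt0 invf_gt1 ?subr_gt0// ltrBlDr ltrDl.
rewrite -(ge0_integral_cond leb (fun t => G e <= t <= G b)) -(ge0_integral_cond leb (fun t => e <= t <= b)).
rewrite (_ : [set x | e <= x <= b] = `[e, b]%classic); last first.
  by apply/seteqP; split => x /=; rewrite in_itv/=.
rewrite (_ : [set x | G e <= x <= G b] = `[G e, G b]%classic); last first.
  by apply/seteqP; split => x /=; rewrite in_itv/=.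
have homoG : {in `[e, b] &, {homo G : x y / x < y}}.
  move=> x y; rewrite !in_itv/= => /andP[ex xb] /andP[ey yb] xy.
  rewrite ltrD2r ltf_pV2 ?posrE ?subr_gt0; [by rewrite ltrD2l ltrN2|exact: le_lt_trans b1|exact: le_lt_trans b1].
have c1 : {in `]e, b[, continuous (derive1 G)}.
  by move=> x; rewrite in_itv/= => /andP[_ xb]; apply: cvg_deriv_G; exact: lt_trans b1.
have c2 : cvg (derive1 G x @[x --> e^'+]).
  by apply/cvg_ex; exists (derive1 G e); apply: cvg_at_right_filter; exact: cvg_deriv_G.
have c3 : cvg (derive1 G x @[x --> b^'-]).
  by apply/cvg_ex; exists (derive1 G b); apply: cvg_at_left_filter; exact: cvg_deriv_G.
have CG x : x < 1 -> G y @[y --> x] --> G x.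
  by move=> x1; exact: is_derive1_continuous (is_derive_G x1).
have c4 : derivable_oo_LRcontinuous G e b.
  split.
  + move=> x; rewrite in_itv/= => /andP[_ xb].
    by have [] := is_derive_G (lt_trans xb b1).
  + by apply: cvg_at_right_filter; exact: CG.
  + by apply: cvg_at_left_filter; exact: CG.
have Geb : G e < G b by apply: homoG => //; rewrite in_itv/= lexx ltW.
have c5 : {within `[G e, G b], continuous q}.
  apply/continuous_within_itvP => //; split.
  + by move=> x; rewrite in_itv/= => /andP[ax xb]; apply: cvg_q; exact: lt_trans ax.
  + by apply: cvg_at_right_filter; exact: cvg_q.
  + by apply: cvg_at_left_filter; apply: cvg_q; exact: lt_trans Geb.
rewrite (integration_by_substitution_increasing (ltW eb) homoG c1 c2 c3 c4 c5).
apply: eq_integral => t; rewrite inE/= in_itv/= => /andP[et tb].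
have t1 : t < 1 by exact: le_lt_trans b1.
have t0 : 0 < t by exact: lt_le_trans et.
have t10 : 0 < 1 - t by rewrite subr_gt0.
congr EFin; change (p t * (1 - t) `^ (s - 1) = q (G t) * derive1 G t).
rewrite derive1E; have [_ ->] := is_derive_G t1; exact: substitution_identity.
Qed.

Lemma Phi_le e : 0 < e -> e <= 1 -> Phi e <= e `^ (2 - 2 * s) / (2 * s).
Proof.
move=> e0 e1; rewrite ler_pM2r ?invr_gt0//.
have y0 : 0 <= 1 - e by rewrite subr_ge0.
have h : 1 - (1 - e) `^ s <= e.
  rewrite lerBlDr -lerBlDl; move: y0; rewrite le_eqVlt => /orP[/eqP<-|y0]; first exact: powR_ge0.
  by apply: ger1_powR; rewrite ?y0 ?(ltW s1)// lerBlDr lerDl ltW.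
have h0 : 0 <= 1 - (1 - e) `^ s.
  rewrite subr_ge0 -[X in _ <= X](pow1 s); apply: ge0_ler_powR; rewrite ?nnegrE ?(ltW s0)//.
  by rewrite lerBlDr lerDl ltW.
rewrite powRD ?(gt_eqF e0) ?implybT// (powR_mulrn 2 (ltW e0)) ler_wpM2r ?powR_ge0//.
by rewrite lerXn2r// nnegrE// ltW.
Qed.

(** Substitution gives the q-integral over [G e, G b]; since G e >= e and q >= 0, it is at most the
    integral over [e, infinity). The integration stops at b < 1, where (1 - t)^(s-1) blows up. *)
Lemma integral_p_le e b : 0 < e -> e < b -> b < 1 ->
  (\int[leb]_t ((e <= t <= b)%R%:R * p t)%:E + (Phi b)%:E <=
   \int[leb]_t ((e <= t)%R%:R * q t)%:E + (Phi e)%:E)%E.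
Proof.
move=> e0 eb b1; have e1 : e < 1 by exact: lt_trans b1.
have p0 t : 0 < t -> t < 1 -> 0 <= p t.
  move=> t0 t1; rewrite mulr_ge0 ?powR_ge0// subr_ge0 -[X in _ <= X](pow1 s).
  by apply: ge0_ler_powR; rewrite ?nnegrE ?(ltW s0) ?subr_ge0 ?(ltW t1)// lerBlDr lerDl ltW.
have pm t : 0 < t -> t < 1 -> 0 <= p t * (1 - t) `^ (s - 1) - p t.
  move=> t0 t1; rewrite subr_ge0 ler_peMr ?p0//.
  rewrite -[s - 1]opprB powRN invf_ge1 ?powR_gt0 ?subr_gt0// -[X in _ <= X](pow1 (1 - s)).
  by apply: ge0_ler_powR; rewrite ?nnegrE ?subr_ge0 ?(ltW s1) ?(ltW t1)// lerBlDr lerDl ltW.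
have rng t : e <= t <= b -> 0 < t /\ t < 1.
  by move=> /andP[et tb]; split; [exact: lt_le_trans et|exact: le_lt_trans b1].
have mp : measurable_fun setT p by meas.
have mm : measurable_fun setT (fun t => p t * (1 - t) `^ (s - 1)) by meas.
have F1 : (\int[leb]_t ((e <= t <= b)%R%:R * (p t * (1 - t) `^ (s - 1) - p t))%:E = (Phi b - Phi e)%:E)%E.
  apply: (@integral_FTC Phi (fun t => p t * (1 - t) `^ (s - 1) - p t) e b); first exact: ltW.
  - by move=> t /rng[t0 t1]; exact: is_derive_Phi.
  - move=> t /rng[t0 t1].
    have t10 : 0 < 1 - t by rewrite subr_gt0.
    have c1 c : (1 - y) `^ c @[y --> t] --> (1 - t) `^ c.
      exact: is_derive1_continuous (is_derive_oneminus_powR c t1).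
    have cp : p y @[y --> t] --> p t.
      by apply: cvgM; [apply: cvgB; [exact: cvg_cst|exact: c1]|exact: cvg_powR].
    by apply: cvgB => //; apply: cvgM => //; exact: c1.
  - by move=> t /rng[t0 t1]; exact: pm.
have E : (\int[leb]_t ((e <= t <= b)%R%:R * (p t * (1 - t) `^ (s - 1)))%:E =
   \int[leb]_t ((e <= t <= b)%R%:R * p t)%:E + (Phi b - Phi e)%:E)%E.
  rewrite -F1 -ge0_integralD_fin.
  - by apply: eq_integral => t _; congr EFin; ring.
  - by meas.
  - by meas.
  - move=> t; case tb : (e <= t <= b); last by rewrite mul0r.
    by have [t0 t1] := rng t tb; rewrite mul1r p0.
  - move=> t; case tb : (e <= t <= b); last by rewrite mul0r.
    by have [t0 t1] := rng t tb; rewrite mul1r pm.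
have Q0 t : 0 < t -> 0 <= q t.
  move=> t0; rewrite mulr_ge0 ?powR_ge0// subr_ge0 -[X in X <= _](pow1 s).
  by apply: ge0_ler_powR; rewrite ?nnegrE ?(ltW s0) ?addr_ge0 ?(ltW t0)// lerDl ltW.
have eG : e <= G e.
  have -> : G e = e / (1 - e) by field; rewrite subr_eq0 gt_eqF.
  by rewrite ler_peMr ?(ltW e0)// invf_ge1 ?subr_gt0// lerBlDr lerDl ltW.
have L : (\int[leb]_t ((e <= t <= b)%R%:R * (p t * (1 - t) `^ (s - 1)))%:E <=
    \int[leb]_t ((e <= t)%R%:R * q t)%:E)%E.
  rewrite integral_substitution_G//; apply: ge0_le_integral_fin.
  - by meas.
  - by meas.
  - move=> t; case tb : (G e <= t <= G b); last by rewrite mul0r.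
    move: tb => /andP[Gt _]; rewrite mul1r; apply: Q0; exact: lt_le_trans e0 (le_trans eG Gt).
  - move=> t; case tb : (G e <= t <= G b).
      by move: tb => /andP[Gt _]; have -> := le_trans eG Gt.
    rewrite mul0r; case et : (e <= t); last by rewrite mul0r.
    by rewrite mul1r Q0// (lt_le_trans e0).
rewrite E EFinB in L.
move: L; have : (0 <= \int[leb]_t ((e <= t)%R%:R * q t)%:E)%E.
  apply: integral_fin_ge0 => t; case et : (e <= t); last by rewrite mul0r.
  by rewrite mul1r Q0// (lt_le_trans e0).
have : (0 <= \int[leb]_t ((e <= t <= b)%R%:R * p t)%:E)%E.
  apply: integral_fin_ge0 => t; case tb : (e <= t <= b); last by rewrite mul0r.
  by have [t0 t1] := rng t tb; rewrite mul1r p0.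
case: (\int[leb]_t ((e <= t)%R%:R * q t)%:E)%E => [Q| |] //; last by move=> *; rewrite addye// leey.
case: (\int[leb]_t _)%E => [I| |] // _ _.
by rewrite -EFinB -!EFinD !lee_fin; lra.
Qed.

Local Notation hh := (fun t => half_pow (1 - t) + half_pow (1 + t)).

(** As b tends to 1, Phi(b) tends to 1/(2s), which is the kernel mass of [1, infinity): it
    compensates the part of the line where (1 - t)_+ vanishes. Only the boundary term at e is
    left. *)
Lemma half_line_Phi e : 0 < e -> e < 1 ->
  ((2 * pmass e)%:E <= \int[leb]_t (hh t * pker e t)%:E + (Phi e)%:E)%E.
Proof.
move=> e0 e1.
have mk := measurable_pker e; have k0 := pker_ge0 e.
have mh : measurable_fun setT (fun t => half_pow (1 - t)) by apply: measurable_half_pow; exact: measurable_funB.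
have mh' : measurable_fun setT (fun t => half_pow (1 + t)) by apply: measurable_half_pow; exact: measurable_funD.
have h0 := half_pow_ge0.
have Q0 t : 0 < t -> 0 <= q t.
  move=> t0; rewrite mulr_ge0 ?powR_ge0// subr_ge0 -[X in X <= _](pow1 s).
  by apply: ge0_ler_powR; rewrite ?nnegrE ?(ltW s0) ?addr_ge0 ?(ltW t0)// lerDl ltW.
have mq : measurable_fun setT (fun t => (e <= t)%R%:R * q t) by meas.
have q0 t : 0 <= (e <= t)%R%:R * q t.
  case et : (e <= t); last by rewrite mul0r.
  by rewrite mul1r Q0// (lt_le_trans e0).
have E : (\int[leb]_t (half_pow (1 + t) * pker e t)%:E = (pmass e)%:E + \int[leb]_t ((e <= t)%R%:R * q t)%:E)%E.
  rewrite -integral_pker// -ge0_integralD_fin//; apply: eq_integral => t _; congr EFin.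
  rewrite /pker; case: (leP e t) => et; last by rewrite !mul0r mulr0 addr0.
  by rewrite half_pow_pos ?addr_ge0 ?(ltW (lt_le_trans e0 et))// !mul1r; ring.
have -> : (\int[leb]_t (hh t * pker e t)%:E = \int[leb]_t (half_pow (1 - t) * pker e t)%:E +
    \int[leb]_t (half_pow (1 + t) * pker e t)%:E)%E.
  rewrite -ge0_integralD_fin.
  - by apply: eq_integral => t _; rewrite mulrDl.
  - exact: measurable_funM.
  - exact: measurable_funM.
  - by move=> t; apply: mulr_ge0.
  - by move=> t; apply: mulr_ge0.
set H := (\int[leb]_t (half_pow (1 - t) * pker e t)%:E)%E.
rewrite E; set Q := (\int[leb]_t ((e <= t)%R%:R * q t)%:E)%E.
have H0 : (0 <= H)%E by apply: integral_fin_ge0 => t; apply: mulr_ge0.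
have Q00 : (0 <= Q)%E by exact: integral_fin_ge0.
suff L : ((pmass e)%:E <= H + Q + (Phi e)%:E)%E.
  rewrite mulr_natl mulr2n EFinD; apply: (le_trans (leeD2l (pmass e)%:E L)).
  by rewrite le_eqVlt; apply/orP; left; apply/eqP; rewrite [(H + (_ + Q))%E]addeCA !addeA.
apply/lee_addgt0Pr => d d0.
(* With y = 1 - b, the excess of the mass beyond b over Phi(b) is y^s (2 - y^s) b^(-2s) / (2s) <= c
   y^s, because b >= 1/2; y is small enough to make this at most d. *)
pose c := 2 `^ (2 * s) / s; have c0 : 0 < c by rewrite divr_gt0// powR_gt0.
pose y := Num.min ((1 - e) / 2) (Num.min (1 / 2) ((d / c) `^ s^-1)).
have dc : 0 < d / c by rewrite divr_gt0.
have y0 : 0 < y by rewrite !lt_min divr_gt0 ?subr_gt0//= powR_gt0// andbT; lra.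
have ye : y <= (1 - e) / 2 by rewrite /y ge_min lexx.
have y2 : y <= 1 / 2 by rewrite /y !ge_min lexx orbT.
have yd : y `^ s <= d / c.
  have yy : y <= (d / c) `^ s^-1 by rewrite /y !ge_min lexx !orbT.
  rewrite -[leRHS]powRr1 ?(ltW dc)// -(mulVf (lt0r_neq0 s0)) powRrM.
  by rewrite ge0_ler_powR ?nnegrE ?powR_ge0 ?(ltW s0) ?(ltW y0).
pose b := 1 - y.
have eb : e < b by rewrite /b; lra.
have b1 : b < 1 by rewrite /b; lra.
have b0 : 0 < b by exact: lt_trans eb.
have L := integral_p_le e0 eb b1.
have mp : measurable_fun setT (fun t => (e <= t <= b)%R%:R * p t) by meas.
have p0 t : 0 <= (e <= t <= b)%R%:R * p t.
  case tb : (e <= t <= b); last by rewrite mul0r.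
  move: tb => /andP[et tb]; rewrite mul1r mulr_ge0 ?powR_ge0// subr_ge0 -[X in _ <= X](pow1 s).
  by apply: ge0_ler_powR; rewrite ?nnegrE ?(ltW s0)//; lra.
have S : ((pmass e)%:E <= H + (\int[leb]_t ((e <= t <= b)%R%:R * p t)%:E + (pmass b)%:E))%E.
  rewrite -(integral_pker e0) -(integral_pker b0) -ge0_integralD_fin//; last 2 first.
  - exact: measurable_pker.
  - by move=> t; exact: pker_ge0.
  rewrite -ge0_integralD_fin.
  - apply: ge0_le_integral_fin => //.
      apply: measurable_funD; first exact: measurable_funM.
      by apply: measurable_funD => //; exact: measurable_pker.
    move=> t; rewrite /pker; have z0 := powR_ge0 t (- 1 - 2 * s); have ht := h0 (1 - t).
    case: (leP e t) => et; last first.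
      have -> : (b <= t) = false by apply/negbTE; rewrite -ltNge (lt_trans et).
      by rewrite !mul0r mulr0 !addr0.
    rewrite !mul1r; have [bt|tb] := leP b t.
      rewrite addrA; apply: (@le_trans _ _ (0 + 1 * t `^ (- 1 - 2 * s))); first by rewrite mul1r add0r.
      by apply: lerD => //; apply: addr_ge0; [exact: mulr_ge0|have := p0 t; rewrite et].
    rewrite (ltW tb) half_pow_pos; last by rewrite subr_ge0 ltW// (lt_trans tb).
    rewrite le_eqVlt; apply/orP; left; apply/eqP => /=.
    by move: (_ `^ s) (_ `^ (- 1 - _)) => x z; ring.
  - exact: measurable_funM.
  - by apply: measurable_funD => //; exact: measurable_pker.
  - by move=> t; apply: mulr_ge0.
  - by move=> t; apply: addr_ge0 => //; exact: pker_ge0.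
have R0 : pmass b - Phi b <= d.
  have bb : 0 <= b `^ (- (2 * s)) <= 2 `^ (2 * s).
    have bV : b^-1 <= 2 by rewrite -div1r ler_pdivrMr// /b; lra.
    rewrite powR_ge0/=; have -> : b `^ (- (2 * s)) = b^-1 `^ (2 * s).
      by rewrite -(powR_inv1 (ltW b0)) -powRrM mulN1r.
    by apply: ge0_ler_powR; rewrite ?nnegrE ?(ltW s20) ?invr_ge0 ?(ltW b0).
  rewrite /pmass -mulrBl -{1}[b `^ _]mul1r -mulrBl (_ : 1 - b = y); last by rewrite /b; ring.
  have ys := powR_ge0 y s; have ys1 : y `^ s <= 1.
    by rewrite -[X in _ <= X](pow1 s); apply: ge0_ler_powR; rewrite ?nnegrE ?(ltW s0) ?(ltW y0)//; lra.
  have -> : 1 - (1 - y `^ s) ^+ 2 = y `^ s * (2 - y `^ s) by ring.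
  have : y `^ s * (2 - y `^ s) * b `^ (- (2 * s)) <= 2 * (d / c) * 2 `^ (2 * s).
    move: bb => /andP[b2 b3]; apply: ler_pM => //; first by rewrite mulr_ge0//; lra.
    by rewrite mulrC; apply: ler_pM => //; lra.
  have -> : 2 * (d / c) * 2 `^ (2 * s) = d * (2 * s).
    rewrite /c; have := powR_gt0 (2 * s) (ltr0Sn R 1); set z := _ `^ _ => z0; field.
    by rewrite !gt_eqF.
  by rewrite -ler_pdivrMr.
move: S L H0 Q00; rewrite -/Q.
have : (0 <= \int[leb]_t ((e <= t <= b)%R%:R * p t)%:E)%E by exact: integral_fin_ge0.
case: (H) => [x| |] //; case: (Q) => [z| |] //; case: (\int[leb]_t _)%E => [I| |] // _.
  by rewrite -!EFinD !lee_fin; move: R0; lra.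
all: by move=> *; rewrite ?addye ?addey ?leey.
Qed.

End half_line.

Section chord.
Context {R : realType}.
Local Notation leb := (@lebesgue_measure R).
Variable s : R.
Hypotheses (s0 : 0 < s) (s1 : s < 1).
Implicit Types (e t A B : R).
Local Notation half_pow := (half_pow s).
Local Notation pker := (pker s).
Local Notation pmass := (pmass s).

Let pow1 (c : R) : 1 `^ c = 1. Proof. by rewrite powR1. Qed.

Let s20 : 0 < 2 * s. Proof. by rewrite mulr_gt0. Qed.

Let h0 x : 0 <= half_pow x. Proof. exact: half_pow_ge0. Qed.

Lemma half_pow_sum_le t : 0 <= t -> t <= 1 -> half_pow (1 - t) + half_pow (1 + t) <= 2.
Proof.
move=> t0 t1; have a0 : 0 <= 1 - t by rewrite subr_ge0.
have b0 : 0 <= 1 + t by rewrite addr_ge0.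
rewrite !half_pow_pos//; move: (powR_bernoulli s0 s1 a0) (powR_bernoulli s0 s1 b0).
have -> : 1 - t - 1 = - t by ring.
have -> : 1 + t - 1 = t by ring.
by move: (_ `^ s) ((1 + t) `^ s) => x y; lra.
Qed.

(** The term Phi(e) is removed by starting from a smaller truncation e', for which Phi(e') <= d.
    Going back to e costs nothing: on [e', e) the symmetric sum is at most 2 by concavity, so the
    mass lost on the left outweighs the integral lost on the right. *)
Lemma half_line1 e : 0 < e -> e <= 1 ->
  ((2 * pmass e)%:E <= \int[leb]_t ((half_pow (1 - t) + half_pow (1 + t)) * pker e t)%:E)%E.
Proof.
move=> e0 e1; apply/lee_addgt0Pr => d d0.
pose e' := Num.min (e / 2) ((d * (2 * s)) `^ (2 - 2 * s)^-1).
have c0 : 0 < 2 - 2 * s by rewrite subr_gt0 gtr_pMr.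
have ds0 : 0 < d * (2 * s) by exact: mulr_gt0.
have f0 : 0 < e' by rewrite lt_min divr_gt0//= powR_gt0.
have fe : e' < e by rewrite gt_min ltr_pdivrMr// ltr_pMr// ltrDl ltr01.
have f1 : e' < 1 by exact: lt_le_trans e1.
have L := half_line_Phi s0 s1 f0 f1.
have P : (1 - (1 - e') `^ s) ^+ 2 * e' `^ (- (2 * s)) / (2 * s) <= d.
  apply: (le_trans (Phi_le s0 s1 f0 (ltW f1))); rewrite ler_pdivrMr//.
  have fc : e' <= (d * (2 * s)) `^ (2 - 2 * s)^-1 by rewrite ge_min lexx orbT.
  have -> : d * (2 * s) = (d * (2 * s)) `^ (2 - 2 * s)^-1 `^ (2 - 2 * s).
    by rewrite -powRrM mulVf ?gt_eqF// powRr1// ltW.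
  by apply: ge0_ler_powR; rewrite ?nnegrE ?powR_ge0 ?(ltW c0) ?(ltW f0).
have mk e'' := measurable_pker s e''.
pose D t := (e' <= t < e)%R%:R * t `^ (- 1 - 2 * s).
have D0 t : 0 <= D t by rewrite mulr_ge0// powR_ge0.
have mD : measurable_fun setT D by rewrite /D; meas.
have ED t : pker e' t = pker e t + D t.
  rewrite /pker /D; case: (leP e t) => et.
    by rewrite (le_trans (ltW fe) et) andbF mul0r addr0.
  by rewrite andbT mul0r add0r.
pose hh t := half_pow (1 - t) + half_pow (1 + t).
have mh : measurable_fun setT hh.
  by apply: measurable_funD; apply: measurable_half_pow; [exact: measurable_funB|exact: measurable_funD].
have hh0 t : 0 <= hh t by rewrite addr_ge0.
have I0 : (0 <= \int[leb]_t (D t)%:E)%E by exact: integral_fin_ge0.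
have Em : (\int[leb]_t (pker e t)%:E + \int[leb]_t (D t)%:E = (pmass e')%:E)%E.
  rewrite -(integral_pker s0 f0) -ge0_integralD_fin//; [|exact: mk|by move=> t; exact: pker_ge0].
  by apply: eq_integral => t _; rewrite ED.
rewrite (integral_pker s0 e0) in Em.
have H : (\int[leb]_t (hh t * pker e' t)%:E <=
   \int[leb]_t (hh t * pker e t)%:E + 2%:E * \int[leb]_t (D t)%:E)%E.
  rewrite -(ge0_integralZ_fin leb (c := 2))// -ge0_integralD_fin.
  - apply: ge0_le_integral_fin.
    + by apply: measurable_funM => //; exact: mk.
    + by apply: measurable_funD; apply: measurable_funM => //; exact: mk.
    + by move=> t; rewrite mulr_ge0// pker_ge0.
    + move=> t; rewrite ED mulrDr lerD2l /D.
      case te : (e' <= t < e); last by rewrite mul0r !mulr0.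
      move: te => /andP[t1 t2]; rewrite ler_wpM2r ?mul1r ?powR_ge0//.
      by apply: half_pow_sum_le; [exact: ltW (lt_le_trans f0 t1)|exact: ltW (lt_le_trans t2 e1)].
  - by apply: measurable_funM => //; exact: mk.
  - exact: measurable_funM.
  - by move=> t; rewrite mulr_ge0// pker_ge0.
  - by move=> t; rewrite mulr_ge0.
have K0 : (0 <= \int[leb]_t (hh t * pker e t)%:E)%E.
  by apply: integral_fin_ge0 => t; rewrite mulr_ge0// pker_ge0.
move: L H Em I0 K0.
have -> : (\int[leb]_t ((half_pow (1 - t) + half_pow (1 + t)) * pker e' t)%:E = \int[leb]_t (hh t * pker e' t)%:E)%E by [].
have -> : (\int[leb]_t ((half_pow (1 - t) + half_pow (1 + t)) * pker e t)%:E = \int[leb]_t (hh t * pker e t)%:E)%E by [].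
case: (\int[leb]_t (D t)%:E)%E => [I| |] //.
case: (\int[leb]_t (hh t * pker e t)%:E)%E => [K| |] //; last by move=> *; rewrite addye// leey.
case: (\int[leb]_t (hh t * pker e' t)%:E)%E => [L| |] //.
rewrite -!EFinM -!EFinD !lee_fin => L1 L2 [L3] _ _.
by move: P L1 L2 L3; lra.
Qed.

Lemma half_powM A t : 0 < A -> half_pow (A * t) = A `^ s * half_pow t.
Proof.
move=> A0; have [t0|t0] := leP 0 t.
  by rewrite !half_pow_pos ?mulr_ge0 ?(ltW A0)// powRM// ltW.
by rewrite !half_pow_neg ?mulr0 ?(ltW t0)// mulr_ge0_le0 ?ltW.
Qed.

(* Scaled to A = 1 this says that the half-line power x_+^s is subharmonic for
   the operator with kernel |t|^(-1-2s), truncated at any e. *)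
Lemma half_line A e : 0 < e -> e <= A ->
  ((2 * A `^ s * pmass e)%:E <=
   \int[leb]_t ((half_pow (A - t) + half_pow (A + t)) * pker e t)%:E)%E.
Proof.
move=> e0 eA; have A0 : 0 < A by exact: lt_le_trans eA.
have e1 : e / A <= 1 by rewrite ler_pdivrMr// mul1r.
have eA0 : 0 < e / A by exact: divr_gt0.
pose F t := (half_pow (A - t) + half_pow (A + t)) * pker e t.
have mF : measurable_fun setT (fun t => (F t)%:E).
  apply/measurable_EFinP; apply: measurable_funM; last exact: measurable_pker.
  by apply: measurable_funD; apply: measurable_half_pow; [exact: measurable_funB|exact: measurable_funD].
have F0 t : (0 <= (F t)%:E)%E by rewrite lee_fin mulr_ge0 ?addr_ge0// pker_ge0.
have := lebesgue_ge0_scale A0 mF F0.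
have mh : measurable_fun setT (fun t => (half_pow (1 - t) + half_pow (1 + t)) * pker (e / A) t).
  apply: measurable_funM; last exact: measurable_pker.
  by apply: measurable_funD; apply: measurable_half_pow; [exact: measurable_funB|exact: measurable_funD].
have c0 : 0 <= A `^ s * A `^ (- 1 - 2 * s) by rewrite mulr_ge0 ?powR_ge0.
have -> : (\int[leb]_t (F (A * t))%:E = (A `^ s * A `^ (- 1 - 2 * s))%:E *
    \int[leb]_t ((half_pow (1 - t) + half_pow (1 + t)) * pker (e / A) t)%:E)%E.
  rewrite -ge0_integralZ_fin//; last by move=> t; rewrite mulr_ge0 ?addr_ge0// pker_ge0.
  apply: eq_integral => t _; congr EFin; rewrite /F /pker.
  have -> : A - A * t = A * (1 - t) by ring.
  have -> : A + A * t = A * (1 + t) by ring.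
  have -> : (e <= A * t) = (e / A <= t) by rewrite ler_pdivrMr// mulrC.
  rewrite !half_powM//; case: (leP (e / A) t) => et; last by rewrite !mul0r !mulr0.
  by rewrite powRM ?(ltW A0) ?(ltW (lt_le_trans eA0 et))// !mul1r; ring.
have := half_line1 eA0 e1.
have Ep : 2 * A `^ s * pmass e = A * (A `^ s * A `^ (- 1 - 2 * s)) * (2 * pmass (e / A)).
  rewrite /pmass powRM ?(ltW e0) ?invr_ge0 ?(ltW A0)//.
  have -> : A^-1 `^ (- (2 * s)) = A `^ (2 * s).
    by rewrite -(powR_inv1 (ltW A0)) -powRrM mulN1r opprK.
  have -> : A `^ (- 1 - 2 * s) = A^-1 * (A `^ (2 * s))^-1.
    by rewrite powRD ?(gt_eqF A0) ?implybT// (powR_inv1 (ltW A0)) powRN.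
  have := powR_gt0 (2 * s) A0; move: (A `^ (2 * s)) => z z0; field.
  by rewrite !gt_eqF.
have c1 : (0 <= A%:E)%E by rewrite lee_fin ltW.
move=> L EK; have -> : (\int[leb]_t (F t)%:E = A%:E * ((A^-1)%:E * \int[leb]_t (F t)%:E))%E.
  by rewrite muleA -EFinM mulfV ?gt_eqF// mul1e.
rewrite -EK Ep -mulrA EFinM [(_ * (2 * _))%:E]EFinM.
by apply: lee_wpmul2l => //; apply: lee_wpmul2l => //; rewrite lee_fin.
Qed.

Lemma powR_subadd A t : 0 <= A -> 0 <= t -> (A + t) `^ s <= A `^ s + t `^ s.
Proof.
move=> A0 t0; have [->|At] := eqVneq (A + t) 0.
  by rewrite powR0 ?gt_eqF// addr_ge0 ?powR_ge0.
have At0 : 0 < A + t by rewrite lt_neqAle eq_sym At addr_ge0.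
have L y : 0 <= y -> y <= A + t -> y / (A + t) * (A + t) `^ s <= y `^ s.
  move=> y0 yA; have [->|yn] := eqVneq y 0; first by rewrite !mul0r powR_ge0.
  have y1 : 0 < y / (A + t) <= 1.
    by rewrite divr_gt0//= ?ler_pdivrMr ?mul1r// lt_neqAle eq_sym yn.
  have -> : y `^ s = (y / (A + t)) `^ s * (A + t) `^ s.
    by rewrite -powRM ?divr_ge0 ?(ltW At0)// divfK.
  by apply: ler_wpM2r; [exact: powR_ge0|exact: ger1_powR (ltW s1)].
have := lerD (L A A0 _) (L t t0 _); rewrite lerDl lerDr => /(_ t0 A0).
by rewrite -mulrDl -mulrDl divff// mul1r.
Qed.

Lemma powR_sub_half_pow A t : 0 < A -> 0 <= t ->
  0 <= A `^ s - half_pow (A - t) /\ A `^ s - half_pow (A - t) <= A `^ (s - 1) * t.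
Proof.
move=> A0 t0; have EA : A `^ s = A `^ (s - 1) * A.
  by rewrite mulrC mulr_powRB1 ?ltW.
have [tA|At] := leP t A.
  have a0 : 0 <= A - t by rewrite subr_ge0.
  rewrite half_pow_pos// subr_ge0; split.
    by apply: ge0_ler_powR; rewrite ?nnegrE ?(ltW s0) ?(ltW A0)// lerBlDr lerDl.
  rewrite lerBlDl -lerBlDr EA -mulrBr.
  move: a0; rewrite le_eqVlt => /orP[/eqP<-|a0]; first by rewrite mulr0 powR_ge0.
  have := @ger1_powR R ((A - t) / A) s.
  rewrite divr_gt0//= ler_pdivrMr// mul1r lerBlDr lerDl => /(_ t0 (ltW s1)) L.
  have -> : (A - t) `^ s = ((A - t) / A) `^ s * A `^ s.
    by rewrite -powRM ?divr_ge0 ?(ltW a0) ?(ltW A0)// divfK ?gt_eqF.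
  have := ler_wpM2r (powR_ge0 A s) L; congr (_ <= _); rewrite EA; field.
  by rewrite gt_eqF.
rewrite half_pow_neg ?subr_le0 ?(ltW At)// subr0 powR_ge0; split=> //.
by rewrite EA ler_wpM2l ?powR_ge0// ltW.
Qed.

(** Majorant of one cross term of [chord_le]: near 0 it uses the Lipschitz bound on (A - t)^s,
    beyond A the trivial bound A^s. Its integral is bounded independently of A. *)
Definition chord_bound A t : R :=
  A `^ (s - 1) * ((0 < t <= A)%R%:R * t `^ ((1 - s) - 1)) + A `^ s * ((A <= t)%R%:R * t `^ (- 1 - s)).

Lemma chord_bound_ge0 A t : 0 <= chord_bound A t.
Proof. by rewrite addr_ge0// !mulr_ge0// powR_ge0. Qed.

Lemma measurable_chord_bound A : measurable_fun setT (chord_bound A).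
Proof. by rewrite /chord_bound; meas. Qed.

Lemma integral_chord_bound A : 0 < A ->
  (\int[leb]_t (chord_bound A t)%:E <= ((1 - s)^-1 + s^-1)%:E)%E.
Proof.
move=> A0; have s10 : 0 < 1 - s by rewrite subr_gt0.
rewrite ge0_integralD_fin; [|by meas|by meas|by move=> t; rewrite !mulr_ge0 ?powR_ge0|by move=> t; rewrite !mulr_ge0 ?powR_ge0].
rewrite EFinD; apply: leeD.
  rewrite ge0_integralZ_fin ?powR_ge0//; [|by meas|by move=> t; rewrite !mulr_ge0 ?powR_ge0].
  have := integral_powR_0 A s10 => L.
  apply: (le_trans (lee_wpmul2l _ L)); first by rewrite lee_fin powR_ge0.
  rewrite -EFinM lee_fin mulrA -powRD ?(gt_eqF A0) ?implybT//.
  by rewrite (_ : s - 1 + (1 - s) = 0) ?powRr0 ?mul1r//; ring.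
rewrite ge0_integralZ_fin ?powR_ge0//; [|by meas|by move=> t; rewrite !mulr_ge0 ?powR_ge0].
rewrite integral_powR_infty// -EFinM lee_fin mulrA -powRD ?(gt_eqF A0) ?implybT//.
by rewrite subrr powRr0 mul1r.
Qed.

Lemma chord_boundP A B e t : 0 < A -> 0 < B -> 0 < e ->
  (A `^ s - half_pow (A - t)) * (half_pow (B + t) - B `^ s) * pker e t <= chord_bound A t.
Proof.
move=> A0 B0 e0; rewrite /pker; case: (leP e t) => et; last by rewrite mul0r mulr0 chord_bound_ge0.
have t0 : 0 < t by exact: lt_le_trans et.
have [x0 x1] := powR_sub_half_pow A0 (ltW t0).
have hB : half_pow (B + t) = (B + t) `^ s by rewrite half_pow_pos// addr_ge0 ?ltW.
rewrite mul1r hB.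
have y1 : (B + t) `^ s - B `^ s <= t `^ s by rewrite lerBlDl powR_subadd ?ltW.
have xA : A `^ s - half_pow (A - t) <= A `^ s by rewrite lerBlDr lerDl.
have z0 := powR_ge0 t (- 1 - 2 * s).
have y0 := powR_ge0 t s.
apply: (@le_trans _ _ ((A `^ s - half_pow (A - t)) * t `^ s * t `^ (- 1 - 2 * s))).
  by rewrite ler_wpM2r// ler_wpM2l.
have Ez : t `^ s * t `^ (- 1 - 2 * s) = t `^ (- 1 - s).
  by rewrite -powRD ?(gt_eqF t0) ?implybT//; congr (_ `^ _); ring.
rewrite -mulrA Ez /chord_bound t0 /=; have w0 := powR_ge0 t (- 1 - s).
have [tA|At] := leP t A.
  apply: (@le_trans _ _ (A `^ (s - 1) * (1 * t `^ (1 - s - 1)))).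
    apply: (le_trans (ler_wpM2r w0 x1)); rewrite mul1r -mulrA.
    rewrite (_ : t * _ = t `^ (1 - s - 1))//.
    by rewrite -{1}[t]powRr1 ?(ltW t0)// -powRD ?(gt_eqF t0) ?implybT//; congr (_ `^ _); ring.
  by rewrite lerDl !mulr_ge0 ?powR_ge0.
rewrite (ltW At) mul0r mulr0 add0r mul1r.
exact: ler_wpM2r.
Qed.

(** A product rule. With a = A^s and b = B^s, b times the symmetric sum for A plus a times that for
    B equals the symmetrised product plus 2ab plus the two cross terms of [chord_boundP]. Two
    applications of [half_line] bound the weighted sums from below by 4ab times the mass, and the
    cross terms integrate to a constant. *)
Lemma chord_le A B e : 0 < e -> e <= A -> e <= B ->
  ((2 * (A `^ s * B `^ s) * pmass e)%:E <=
   \int[leb]_t ((half_pow (A - t) * half_pow (B + t) + half_pow (A + t) * half_pow (B - t)) * pker e t)%:E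
   + (2 * ((1 - s)^-1 + s^-1))%:E)%E.
Proof.
move=> e0 eA eB.
have A0 : 0 < A by exact: lt_le_trans eA.
have B0 : 0 < B by exact: lt_le_trans eB.
have LA := half_line e0 eA; have LB := half_line e0 eB.
have mk := measurable_pker s e; have k0 := pker_ge0 s e.
pose g t := half_pow (A - t) + half_pow (A + t).
pose h t := half_pow (B - t) + half_pow (B + t).
pose S t := half_pow (A - t) * half_pow (B + t) + half_pow (A + t) * half_pow (B - t).
have mm c : measurable_fun setT (fun t => half_pow (c - t)) by apply: measurable_half_pow; exact: measurable_funB.
have mp c : measurable_fun setT (fun t => half_pow (c + t)) by apply: measurable_half_pow; exact: measurable_funD.
have mg : measurable_fun setT g by exact: measurable_funD.
have mh : measurable_fun setT h by exact: measurable_funD.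
have mS : measurable_fun setT S by apply: measurable_funD; exact: measurable_funM.
have g0 t : 0 <= g t by rewrite addr_ge0.
have hh0 t : 0 <= h t by rewrite addr_ge0.
have S0 t : 0 <= S t by rewrite addr_ge0 ?mulr_ge0.
have a0 := powR_ge0 A s; have b0 := powR_ge0 B s.
pose I (f : R -> R) := (\int[leb]_t (f t * pker e t)%:E)%E.
have If0 (f : R -> R) : (forall t, 0 <= f t) -> (0 <= I f)%E.
  by move=> f0; apply: integral_fin_ge0 => t; rewrite mulr_ge0.
have L1 : ((B `^ s)%:E * I g + (A `^ s)%:E * I h <=
    I S + (2 * (A `^ s * B `^ s) * pmass e)%:E + (2 * ((1 - s)^-1 + s^-1))%:E)%E.
  rewrite /I -!ge0_integralZ_fin//; last 4 first.
  - exact: measurable_funM.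
  - by move=> t; rewrite mulr_ge0.
  - exact: measurable_funM.
  - by move=> t; rewrite mulr_ge0.
  rewrite EFinM -(integral_pker s0 e0) -ge0_integralZ_fin ?mulr_ge0//.
  apply: (@le_trans _ _ (\int[leb]_t (S t * pker e t + 2 * (A `^ s * B `^ s) * pker e t + (chord_bound A t + chord_bound B t))%:E)%E); last first.
    rewrite [X in (X <= _)%E]ge0_integralD_fin; last 4 first.
    - by apply: measurable_funD; exact: measurable_funM.
    - by apply: measurable_funD; exact: measurable_chord_bound.
    - by move=> t; apply: addr_ge0; apply: mulr_ge0 => //; rewrite !mulr_ge0.
    - by move=> t; rewrite addr_ge0 ?chord_bound_ge0.
    apply: leeD.
      rewrite ge0_integralD_fin//; first exact: measurable_funM.
      - exact: measurable_funM.
      - by move=> t; rewrite mulr_ge0.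
      - by move=> t; apply: mulr_ge0 => //; rewrite !mulr_ge0.
    rewrite ge0_integralD_fin; [|exact: measurable_chord_bound|exact: measurable_chord_bound|exact: chord_bound_ge0|exact: chord_bound_ge0].
    by rewrite mulr_natl mulr2n EFinD; apply: leeD; exact: integral_chord_bound.
  rewrite -ge0_integralD_fin; last 4 first.
  - by apply: measurable_funM => //; exact: measurable_funM.
  - by apply: measurable_funM => //; exact: measurable_funM.
  - by move=> t; apply: mulr_ge0 => //; exact: mulr_ge0.
  - by move=> t; apply: mulr_ge0 => //; exact: mulr_ge0.
  apply: ge0_le_integral_fin.
  - by apply: measurable_funD; apply: measurable_funM => //; exact: measurable_funM.
  - apply: measurable_funD; first by apply: measurable_funD; exact: measurable_funM.
    by apply: measurable_funD; exact: measurable_chord_bound.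
  - by move=> t; apply: addr_ge0; apply: mulr_ge0 => //; exact: mulr_ge0.
  - move=> t; have := chord_boundP t A0 B0 e0; have := chord_boundP t B0 A0 e0.
    by rewrite /S /g /h; lra.
have L2 : ((2 * (2 * (A `^ s * B `^ s) * pmass e))%:E <= (B `^ s)%:E * I g + (A `^ s)%:E * I h)%E.
  have -> : 2 * (2 * (A `^ s * B `^ s) * pmass e) = B `^ s * (2 * A `^ s * pmass e) + A `^ s * (2 * B `^ s * pmass e) by ring.
  rewrite EFinD; apply: leeD; rewrite EFinM.
    by apply: (lee_wpmul2l _ LA); rewrite lee_fin.
  by apply: (lee_wpmul2l _ LB); rewrite lee_fin.
have := le_trans L2 L1; have := If0 S S0; rewrite -/(I S).
case: (I S) => [x| |] //; last by move=> *; rewrite addye// leey.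
by rewrite -!EFinD !lee_fin => _; lra.
Qed.

End chord.

(** * The barrier (1 - |x|^2)_+^(alpha/2) *)

Section barrier.
Context {R : realType} {m : nat}.
Local Notation n := m.+1.
Local Notation mu := (lebesgue_rV R n).
Local Notation leb := (@lebesgue_measure R).
Variable alpha : R.
Hypotheses (alpha0 : 0 < alpha) (alpha2 : alpha < 2).
Implicit Types (x y z : 'rV[R]_n) (u w : 'rV[R]_n -> R).
Local Notation s := (alpha / 2).

Let s0 : 0 < s. Proof. by rewrite divr_gt0. Qed.
Let s1 : s < 1. Proof. by rewrite ltr_pdivrMr// mul1r. Qed.
Let sE : 2 * s = alpha. Proof. by rewrite mulrC divfK. Qed.

(** Up to a constant, the torsion function of the unit ball for the fractional Laplacian; here only
    one-sided bounds on its truncated operators are proved. *)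
Definition barrier x : R := half_pow s (1 - enorm x ^+ 2).

Lemma barrier_ge0 x : 0 <= barrier x. Proof. exact: half_pow_ge0. Qed.

Lemma measurable_barrier : measurable_fun setT barrier.
Proof. by apply: measurable_half_pow; meas. Qed.

Lemma barrier_out x : 1 <= enorm x -> barrier x = 0.
Proof. by move=> x1; rewrite /barrier half_pow_neg// subr_le0 exprn_ege1. Qed.

Lemma barrier_in x : enorm x <= 1 -> barrier x = (1 - enorm x ^+ 2) `^ s.
Proof. by move=> x1; rewrite /barrier half_pow_pos// subr_ge0 exprn_ile1 ?enorm_ge0. Qed.

Lemma barrier_le1 x : barrier x <= 1.
Proof.
have [x1|/ltW/barrier_out->//] := leP (enorm x) 1; rewrite barrier_in//.
have e1 : 0 <= 1 - enorm x ^+ 2 by rewrite subr_ge0 exprn_ile1 ?enorm_ge0.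
have E1 : (1 : R) `^ s = 1 by rewrite powR1.
rewrite -[X in _ <= X]E1; apply: ge0_ler_powR; rewrite ?nnegrE ?(ltW s0)//; move: e1 (sqr_ge0 (enorm x)); lra.
Qed.

Lemma test_fun_barrier : test_fun 1 barrier.
Proof.
split; [exact: measurable_barrier|exact: barrier_ge0|by move=> x /ltW; exact: barrier_out|].
by exists 1; exact: barrier_le1.
Qed.

Let wT : weighted_fin alpha barrier.
Proof. exact: test_fun_weighted (ltW alpha0) test_fun_barrier. Qed.

Lemma tconv_symmetrize (eps : R) u x : 0 < eps -> weighted_fin alpha u ->
  (\int[mu]_z (tker alpha eps z * (u (x + z) + u (x - z)))%:E = (2 * tconv alpha eps u x)%:E)%E.
Proof.
move=> e0 wu; have [mu' u0 _] := wu; have E := tconvE x (ltW alpha0) e0 wu.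
have m1 := measurable_tconv_int alpha eps x mu'.
have m2 : measurable_fun setT (fun z => tker alpha eps z * u (x - z)).
  by apply: measurable_funM; [exact: measurable_tker|exact: measurable_shiftN].
have p1 z : 0 <= tker alpha eps z * u (x + z) by rewrite mulr_ge0// tker_ge0.
have p2 z : 0 <= tker alpha eps z * u (x - z) by rewrite mulr_ge0// tker_ge0.
rewrite mulr_natl mulr2n EFinD -E -{2}tconv_opp//.
by rewrite -ge0_integralD_fin//; apply: eq_integral => z _; rewrite mulrDr.
Qed.

(* The two distances from x to the unit sphere along a line through x. *)
Lemma chord_lengths x y : enorm x < 1 -> enorm y = 1 -> exists A B : R,
  [/\ 1 - enorm x <= A, 1 - enorm x <= B, A * B = 1 - enorm x ^+ 2,
     forall t : R, 1 - enorm (x + t *: y) ^+ 2 = (A - t) * (B + t) &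
     forall t : R, 1 - enorm (x - t *: y) ^+ 2 = (A + t) * (B - t)].
Proof.
move=> x1 y1; pose b := edot x y; pose r := enorm x.
have r0 : 0 <= r := enorm_ge0 x.
have br : `|b| <= r by have := edot_abs_le x y; rewrite y1 mulr1.
have r2 : 0 <= 1 - r ^+ 2 by rewrite subr_ge0 exprn_ile1// ltW.
have [D D0 D2] : exists2 D : R, 0 <= D & D ^+ 2 = b ^+ 2 + (1 - r ^+ 2).
  by exists (Num.sqrt (b ^+ 2 + (1 - r ^+ 2))); rewrite ?sqrtr_ge0// sqr_sqrtr// addr_ge0// sqr_ge0.
have AB : (D - b) * (D + b) = 1 - r ^+ 2.
  have -> : (D - b) * (D + b) = D ^+ 2 - b ^+ 2 by ring.
  by rewrite D2; ring.
have DB : 1 - r + `|b| <= D.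
  have r1 : 0 <= 1 - r by rewrite subr_ge0 ltW.
  rewrite -(@ler_pXn2r _ 2)// ?nnegrE ?(addr_ge0 r1 (normr_ge0 b))//.
  rewrite D2 -(real_normK (num_real b)).
  have br' : 0 <= r - `|b| by rewrite subr_ge0.
  by have := mulr_ge0 r1 br'; move: (`|b|) => c; rewrite !expr2; lra.
have := ler_norm b; have := ler_norm (- b); rewrite normrN => b1 b2.
exists (D - b), (D + b); split => //.
- by rewrite -/r; move: DB b1 b2; lra.
- by rewrite -/r; move: DB b1 b2; lra.
- move=> t; rewrite enorm_sqrD edotZr enormZ y1 mulr1 -/b -/r real_normK ?num_real//.
  have -> : (D - b - t) * (D + b + t) = (D - b) * (D + b) - 2 * (t * b) - t ^+ 2 by ring.
  by rewrite AB; ring.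
- move=> t; rewrite enorm_sqrD edotNr edotZr enormN enormZ y1 mulr1 -/b -/r real_normK ?num_real//.
  have -> : (D - b + t) * (D + b - t) = (D - b) * (D + b) + 2 * (t * b) - t ^+ 2 by ring.
  by rewrite AB; ring.
Qed.

Lemma half_pow_prod (A B : R) : 0 <= B -> half_pow s (A * B) = half_pow s A * half_pow s B.
Proof.
move=> B0; rewrite (half_pow_pos s B0); have [A0|/ltW A0] := leP 0 A.
  by rewrite !half_pow_pos// ?mulr_ge0// powRM.
by rewrite !half_pow_neg ?mul0r// mulr_le0_ge0.
Qed.

Definition barrier_const : R := n%:R * ball_vol R m * ((1 - s)^-1 + s^-1).

(** Along a chord through x the barrier is the product (A - t)_+^s (B + t)_+^s, with A B = 1 -
    |x|^2. Polar coordinates about x reduce the claim to [chord_le] on each line; |x| <= 1 - eps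
    ensures eps <= A and eps <= B. *)
Lemma barrier_inside (eps : R) x : 0 < eps -> enorm x <= 1 - eps ->
  tmass m alpha eps * barrier x <= tconv alpha eps barrier x + barrier_const.
Proof.
move=> e0 xe.
have x1 : enorm x < 1 by apply: (le_lt_trans xe); rewrite gtrBl.
have p0 : 0 < pmass s eps by rewrite divr_gt0 ?powR_gt0// sE.
pose K := 2 * ((1 - s)^-1 + s^-1).
have K0 : 0 < K by rewrite mulr_gt0// addr_gt0// invr_gt0// subr_gt0.
pose S z := barrier (x + z) + barrier (x - z).
have mS : measurable_fun setT S.
  by apply: measurable_funD; [exact: measurable_shift measurable_barrier|exact: measurable_shiftN measurable_barrier].
have S0 z : 0 <= S z by rewrite addr_ge0// barrier_ge0.
(* The additive constant K of the chords is written as the kernel mass times K / [pmass], so that it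
   sits under the integral and the one-dimensional inequality can be integrated over directions. *)
pose F z := tker alpha eps z * (S z + K / pmass s eps).
have F0 z : 0 <= F z by rewrite mulr_ge0 ?tker_ge0// addr_ge0// divr_ge0 ?ltW.
have mF : measurable_fun setT F.
  by apply: measurable_funM; [exact: measurable_tker|exact: measurable_funD].
have nb0 : 0 < n%:R * ball_vol R m by rewrite mulr_gt0// ball_vol_gt0.
have tm : tmass m alpha eps = n%:R * ball_vol R m * pmass s eps by rewrite /tmass /pmass sE.
have IF : (\int[mu]_z (F z)%:E = (2 * tconv alpha eps barrier x + K / pmass s eps * tmass m alpha eps)%:E)%E.
  rewrite EFinD -(tconv_symmetrize x e0 wT) EFinM -(integral_tker alpha0 e0).
  rewrite -ge0_integralZ_fin; [|by rewrite divr_ge0 ?ltW|exact: measurable_tker|exact: tker_ge0].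
  rewrite -ge0_integralD_fin.
  - by apply: eq_integral => z _; rewrite /F mulrDr [_ / _ * _]mulrC.
  - by apply: measurable_funM => //; exact: measurable_tker.
  - by apply: measurable_funM => //; exact: measurable_tker.
  - by move=> z; rewrite mulr_ge0 ?tker_ge0// S0.
  - by move=> z; rewrite mulr_ge0 ?tker_ge0// divr_ge0 ?ltW.
have L : ((n%:R * (2 * barrier x * pmass s eps * ball_vol R m))%:E <= \int[mu]_z (F z)%:E)%E.
  rewrite (ge0_integral_polar mF F0) EFinM; apply: lee_wpmul2l; first by rewrite lee_fin.
  have c0 : 0 <= 2 * barrier x * pmass s eps by exact: mulr_ge0 (mulr_ge0 (ler0n R 2) (barrier_ge0 x)) (ltW p0).
  have mi : measurable_fun setT (fun y : 'rV[R]_n => (0 < enorm y <= 1)%R%:R : R) by meas.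
  rewrite EFinM -integral_punctured_ball -ge0_integralZ_fin//.
  pose k y (t : R) := (0 < enorm y <= 1)%R%:R * ((0 < t)%R%:R * (t ^+ m * F ((t / enorm y) *: y))).
  have mk : measurable_fun setT (fun p : 'rV[R]_n * R => k p.1 p.2).
    rewrite /k; apply: measurable_funM; first by meas.
    apply: measurable_funM; first by meas.
    by apply: measurable_funM; [meas|apply: (measurableT_comp mF); meas].
  have k0 y t : 0 <= k y t.
    rewrite /k; case: (ltP 0 t) => [t0|]; last by rewrite mul0r mulr0.
    by apply: mulr_ge0 => //; rewrite mul1r; apply: mulr_ge0 => //; exact: exprn_ge0 (ltW t0).
  apply: ge0_le_integral => //.
  - by move=> y _; rewrite lee_fin mulr_ge0.
  - by apply/measurable_EFinP; exact: measurable_funM.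
  - exact: measurable_integral1.
  - move=> y _; case yP : (0 < enorm y <= 1); last first.
      by rewrite mulr0; apply: integral_fin_ge0 => t; have := k0 y t; rewrite /k yP.
    move: yP => /andP[y0 _]; rewrite mulr1.
    have y1 : enorm ((enorm y)^-1 *: y) = 1.
      by rewrite enormZ ger0_norm ?invr_ge0 ?enorm_ge0// mulVf ?gt_eqF.
    have [A [B [A1 B1 AB E1 E2]]] := chord_lengths x1 y1.
    have A0 : 0 < A by apply: lt_le_trans A1; rewrite subr_gt0.
    have B0 : 0 < B by apply: lt_le_trans B1; rewrite subr_gt0.
    have eA : eps <= A by move: xe A1; lra.
    have eB : eps <= B by move: xe B1; lra.
    pose C t := half_pow s (A - t) * half_pow s (B + t) + half_pow s (A + t) * half_pow s (B - t).
    have mC : measurable_fun setT C.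
      by apply: measurable_funD; apply: measurable_funM; apply: measurable_half_pow; first
        [exact: measurable_funB|exact: measurable_funD].
    have C0 t : 0 <= C t by rewrite addr_ge0// mulr_ge0 ?half_pow_ge0.
    have := chord_le s0 s1 e0 eA eB; rewrite -/K.
    have -> : A `^ s * B `^ s = barrier x.
      by rewrite -powRM ?(ltW A0) ?(ltW B0)// AB barrier_in// ltW.
    move=> /le_trans; apply; rewrite le_eqVlt; apply/orP; left; apply/eqP.
    have -> : K = K / pmass s eps * pmass s eps by rewrite divfK// gt_eqF.
    rewrite [(_ * pmass _ _)%:E]EFinM -(integral_pker s0 e0) -ge0_integralZ_fin; last 3 first.
    - by rewrite divr_ge0 ?ltW.
    - exact: measurable_pker.
    - by move=> t; exact: pker_ge0.
    rewrite -ge0_integralD_fin; last 4 first.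
    - by apply: measurable_funM => //; exact: measurable_pker.
    - by apply: measurable_funM => //; exact: measurable_pker.
    - by move=> t; rewrite mulr_ge0 ?C0// pker_ge0.
    - by move=> t; rewrite mulr_ge0 ?pker_ge0// divr_ge0 ?ltW.
    apply: eq_integral => t _; congr EFin; rewrite mul1r /F /tker /rker enormZ.
    have [t0|t0] := ltP 0 t; last first.
      by rewrite mul0r /pker leNgt (le_lt_trans t0 e0)/= !mul0r !mulr0 addr0.
    have -> : `|t / enorm y| * enorm y = t.
      by rewrite ger0_norm ?divr_ge0 ?enorm_ge0 ?(ltW t0)// divfK ?gt_eqF.
    rewrite /pker; case: (leP eps t) => et; last by rewrite !mul0r !mulr0 addr0.
    rewrite !mul1r /S -scalerA /barrier E1 E2.
    rewrite half_pow_prod ?addr_ge0 ?(ltW B0) ?(ltW t0)//.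
    rewrite [half_pow s ((A + t) * _)](_ : _ = half_pow s (A + t) * half_pow s (B - t)); last first.
      by rewrite [(A + t) * _]mulrC half_pow_prod ?addr_ge0 ?(ltW A0) ?(ltW t0)// mulrC.
    have E : t ^+ m * t `^ (- (n%:R + alpha)) = t `^ (- 1 - 2 * s).
      rewrite -powR_mulrn ?(ltW t0)// -powRD ?(gt_eqF t0) ?implybT//.
      by congr (_ `^ _); rewrite sE -natr1; ring.
    rewrite [t ^+ m * _]mulrA E /C.
    by move: (t `^ _) (half_pow s (A - t)) (half_pow s (B + t)) (half_pow s (A + t)) (half_pow s (B - t)) (K / _) => v0 v1 v2 v3 v4 v5; ring.
move: L; rewrite IF lee_fin tm /barrier_const -/K.
have -> : K / pmass s eps * (n%:R * ball_vol R m * pmass s eps) = K * (n%:R * ball_vol R m).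
  by field; rewrite gt_eqF.
have -> : n%:R * (2 * barrier x * pmass s eps * ball_vol R m) = 2 * (n%:R * ball_vol R m * pmass s eps * barrier x) by ring.
by rewrite /K; move: (n%:R * ball_vol R m) => N; lra.
Qed.

(** Only the ball of radius rho/2 about the point at distance 1 - rho from 0 on the ray of x is
    kept. With d = |x| - 1 it lies at distance between d and 2d from x, and the barrier is at least
    (rho/2)^s on it. *)
Lemma barrier_far (eps rho : R) x : 0 < eps -> eps <= enorm x - 1 -> 0 < rho -> rho <= 1 ->
  3 * rho <= 2 * (enorm x - 1) ->
  ball_vol R m * ((2 * (enorm x - 1)) `^ (- (n%:R + alpha)) * (rho / 2) `^ (n%:R + s)) <=
  tconv alpha eps barrier x.
Proof.
set d := enorm x - 1 => e0 ed r0 r1 rd.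
have d0 : 0 < d by exact: lt_le_trans ed.
have x0 : 0 < enorm x by move: d0; rewrite /d; lra.
pose p := ((1 - rho) / enorm x) *: x.
have pE : enorm p = 1 - rho.
  by rewrite enormZ ger0_norm ?divfK ?gt_eqF// divr_ge0 ?subr_ge0// ltW.
have xpE : enorm (x - p) = d + rho.
  have -> : x - p = ((enorm x - (1 - rho)) / enorm x) *: x.
    by rewrite /p -{1}[x]scale1r -scalerBl; congr (_ *: _); field; rewrite gt_eqF.
  rewrite enormZ ger0_norm ?divfK ?gt_eqF//; first by rewrite /d; ring.
  by rewrite divr_ge0 ?(ltW x0)//; move: d0; rewrite /d; lra.
pose K := (2 * d) `^ (- (n%:R + alpha)) * (rho / 2) `^ s.
have K0 : 0 <= K by rewrite mulr_ge0 ?powR_ge0.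
have mi : measurable_fun setT (fun z : 'rV[R]_n => (enorm z <= rho / 2)%R%:R : R) by meas.
have I : (\int[mu]_z ((enorm (z + (x - p))%R <= rho / 2)%R%:R)%:E = ((rho / 2) ^+ n * ball_vol R m)%:E)%E.
  by rewrite (ge0_integral_shift_fin (x - p) mi)// integral_eball lebesgue_eball// divr_gt0.
have mi' : measurable_fun setT (fun z : 'rV[R]_n => (enorm (z + (x - p)) <= rho / 2)%R%:R : R) by meas.
rewrite -lee_fin -(tconvE x (ltW alpha0) e0 wT).
have -> : ball_vol R m * ((2 * d) `^ (- (n%:R + alpha)) * (rho / 2) `^ (n%:R + s)) =
    K * ((rho / 2) ^+ n * ball_vol R m).
  have r20 : 0 < rho / 2 by rewrite divr_gt0.
  by rewrite powRD ?(gt_eqF r20) ?implybT// (powR_mulrn n (ltW r20)) /K; ring.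
rewrite EFinM -I -ge0_integralZ_fin//; apply: ge0_le_integral_fin.
- exact: measurable_funM.
- exact: measurable_tconv_int measurable_barrier.
- by move=> z; rewrite mulr_ge0.
- move=> z; case: (leP (enorm (z + (x - p))) (rho / 2)) => zr; last first.
    by rewrite mulr0 mulr_ge0 ?tker_ge0 ?barrier_ge0.
  have z1 : enorm z <= 2 * d.
    have := enormB (z + (x - p)) (x - p); rewrite addrK xpE => /le_trans; apply.
    by move: zr rd; rewrite -/d; lra.
  have z2 : d <= enorm z.
    have := enorm_leD (x - p) z; rewrite xpE addrC; have := enormB (x - p) (x - p + z).
    rewrite opprD addrA subrr sub0r enormN xpE [x - p + z]addrC => L _.
    have := enormB (z + (x - p)) z; rewrite addrAC subrr add0r xpE => L'.
    by move: L' zr r0; lra.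
  have y1 : enorm (x + z) <= 1 - rho / 2.
    have := enormD p (z + (x - p)).
    have -> : p + (z + (x - p)) = x + z by rewrite addrCA [p + _]addrC subrK addrC.
    by rewrite pE; move: zr; lra.
  rewrite mulr1 /tker (le_trans ed z2) mul1r; apply: ler_pM; rewrite ?powR_ge0//.
    by apply: powRN_le => //; [exact: lt_le_trans z2|rewrite addr_ge0// ltW].
  rewrite barrier_in; last by move: y1 r0; lra.
  have y0 := enorm_ge0 (x + z).
  have y2 : enorm (x + z) ^+ 2 <= enorm (x + z).
    by rewrite expr2 ler_piMr//; move: y1 r0; lra.
  apply: ge0_ler_powR; rewrite ?nnegrE ?(ltW s0)//.
  - by rewrite divr_ge0// ltW.
  - by move: y1 y2 r0; lra.
  - by move: y1 y2 r0; lra.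
Qed.

Definition exterior_kernel x : R := enorm x `^ (- n%:R) * (enorm x ^+ 2 - 1) `^ (- s).

Lemma exterior_kernel_ge0 x : 0 <= exterior_kernel x.
Proof. by rewrite mulr_ge0 ?powR_ge0. Qed.

Lemma measurable_exterior_kernel : measurable_fun setT exterior_kernel.
Proof. by rewrite /exterior_kernel; meas. Qed.

Definition exterior_const : R := ball_vol R m * (2 `^ (- (n%:R + alpha)) * 4^-1 `^ (n%:R + s)).

Lemma exterior_const_gt0 : 0 < exterior_const.
Proof. by rewrite mulr_gt0 ?ball_vol_gt0// mulr_gt0 ?powR_gt0. Qed.

(** [barrier_far] with rho = (|x| - 1)/2 close to the sphere and rho = 1/2 far from it; the two
    regimes give the factors of [exterior_kernel] that dominate there. *)
Lemma barrier_outside (eps : R) x : 0 < eps -> eps <= enorm x - 1 ->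
  exterior_const * exterior_kernel x <= tconv alpha eps barrier x.
Proof.
move=> e0 ed; have d0 : 0 < enorm x - 1 by exact: lt_le_trans ed.
have N0 : 0 <= n%:R :> R by [].
have xd : enorm x ^+ 2 - 1 = (enorm x - 1) * (enorm x + 1) by ring.
have [d1|d1] := leP (enorm x - 1) 1.
  apply: (le_trans _ (@barrier_far eps ((enorm x - 1) / 2) x e0 ed _ _ _)); [|lra|lra|lra].
  rewrite /exterior_const -[X in X <= _]mulrA ler_pM2l ?ball_vol_gt0//.
  rewrite (_ : (enorm x - 1) / 2 / 2 = (enorm x - 1) * 4^-1); last by field.
  rewrite !powRM ?(ltW d0)//.
  rewrite [X in _ <= X](_ : _ = 2 `^ (- (n%:R + alpha)) * 4^-1 `^ (n%:R + s) *
     ((enorm x - 1) `^ (- (n%:R + alpha)) * (enorm x - 1) `^ (n%:R + s))); last by ring.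
  rewrite ler_wpM2l ?mulr_ge0 ?powR_ge0// -powRD ?(gt_eqF d0) ?implybT//.
  rewrite (_ : - (n%:R + alpha) + (n%:R + s) = - s); last by field.
  rewrite /exterior_kernel -[X in _ <= X]mul1r; apply: ler_pM; rewrite ?powR_ge0//.
    have x1 : 1 <= enorm x by move: d0; lra.
    by have := powRN_le ltr01 x1 N0; rewrite powR1.
  apply: powRN_le; rewrite ?(ltW s0)// xd ler_peMr ?(ltW d0)//; move: d0; lra.
apply: (le_trans _ (@barrier_far eps 2^-1 x e0 ed _ _ _)); [|lra|lra|lra].
rewrite /exterior_const -[X in X <= _]mulrA ler_pM2l ?ball_vol_gt0//.
rewrite (_ : 2^-1 / 2 = 4^-1); last by field.
rewrite powRM ?(ltW d0)// -!mulrA ler_pM2l ?powR_gt0// [X in _ <= X]mulrC ler_pM2l ?powR_gt0//.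
rewrite (_ : - (n%:R + alpha) = - n%:R + (- s + - s)); last by field.
rewrite !powRD ?(gt_eqF d0) ?implybT//; apply: ler_pM; rewrite ?powR_ge0//.
  by apply: powRN_le => //; rewrite lerBlDr lerDl.
rewrite -powRM ?(ltW d0)//; apply: powRN_le; rewrite ?(ltW s0) ?mulr_gt0// xd.
by rewrite ler_pM2l//; move: d0; lra.
Qed.

(** In the shell that [barrier_inside] leaves out, the barrier is at most (2 eps)^s, against a mass
    of order eps^(-2s). *)
Lemma tmass_barrier_shell (eps : R) x : 0 < eps -> 1 - eps < enorm x -> enorm x <= 1 ->
  tmass m alpha eps * barrier x <= n%:R * ball_vol R m * (2 `^ s / alpha) * eps `^ (- s).
Proof.
move=> e0 ex x1; have x0 := enorm_ge0 x; rewrite /tmass barrier_in//.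
rewrite -!mulrA ler_pM2l// ler_pM2l ?ball_vol_gt0//.
have L : (1 - enorm x ^+ 2) `^ s <= 2 `^ s * eps `^ s.
  rewrite -powRM ?(ltW e0)//; apply: ge0_ler_powR; rewrite ?nnegrE ?(ltW s0)//.
  - by rewrite subr_ge0 exprn_ile1.
  - by rewrite mulr_ge0// ltW.
  - have : (1 - enorm x) * (1 + enorm x) <= eps * 2.
      by apply: ler_pM; [lra|lra|lra|lra].
    by rewrite expr2; lra.
rewrite mulrCA [X in _ <= X]mulrCA ler_wpM2l ?invr_ge0 ?(ltW alpha0)//.
have -> : eps `^ (- s) = eps `^ (- alpha) * eps `^ s.
  by rewrite -powRD ?(gt_eqF e0) ?implybT//; congr (_ `^ _); field.
by rewrite mulrCA ler_wpM2l ?powR_ge0.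
Qed.

End barrier.

(** * The exterior estimate at unit scale *)

Section exterior.
Context {R : realType} {m : nat}.
Local Notation n := m.+1.
Local Notation mu := (lebesgue_rV R n).
Variable alpha : R.
Hypotheses (alpha0 : 0 < alpha) (alpha2 : alpha < 2).
Implicit Types (x y z : 'rV[R]_n) (u w : 'rV[R]_n -> R).
Local Notation s := (alpha / 2).
Local Notation K := (@barrier_const R m alpha).
Local Notation c := (@exterior_const R m alpha).
Local Notation h := (exterior_kernel alpha).

Let s0 : 0 < s. Proof. by rewrite divr_gt0. Qed.
Let s1 : s < 1. Proof. by rewrite ltr_pdivrMr// mul1r. Qed.

Let K0 : 0 <= K.
Proof.
apply: mulr_ge0; first exact: mulr_ge0 (ler0n _ _) (ltW ball_vol_gt0).
by apply: addr_ge0; rewrite invr_ge0 ?subr_ge0 ltW.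
Qed.

Lemma integral_shell_le (eps : R) : 0 < eps -> eps < 1 ->
  (\int[mu]_x ((1 - eps < enorm x <= 1)%R%:R)%:E <= (n%:R * ball_vol R m * eps)%:E)%E.
Proof.
move=> e0 e1; have e10 : 0 < 1 - eps by rewrite subr_gt0.
have mi r : measurable_fun setT (fun x : 'rV[R]_n => (enorm x <= r)%R%:R : R) by meas.
have ms : measurable_fun setT (fun x : 'rV[R]_n => (1 - eps < enorm x <= 1)%R%:R : R) by meas.
have E : (\int[mu]_x ((enorm x <= 1 - eps)%R%:R)%:E + \int[mu]_x ((1 - eps < enorm x <= 1)%R%:R)%:E =
    \int[mu]_x ((enorm x <= 1)%R%:R)%:E)%E.
  rewrite -ge0_integralD_fin//; apply: eq_integral => x _; congr EFin.
  have [xe|xe] := leP (enorm x) (1 - eps); last by rewrite add0r.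
  by rewrite addr0 (le_trans xe)// gerBl ltW.
move: E; rewrite !integral_eball !lebesgue_eball//.
have : (0 <= \int[mu]_x ((1 - eps < enorm x <= 1)%R%:R)%:E)%E by exact: integral_fin_ge0.
case: (\int[mu]_x _)%E => [I| |] // _ [E]; rewrite lee_fin.
have B : forall k, 1 - k%:R * eps <= (1 - eps) ^+ k.
  elim=> [|k IH]; first by rewrite mul0r subr0 expr0.
  rewrite exprS -natr1; have := ler_wpM2l (ltW e10) IH.
  have := mulr_ge0 (ler0n R k) (mulr_ge0 (ltW e0) (ltW e0)).
  by move: (_ ^+ k) => y; lra.
have := ler_wpM2r (ltW (@ball_vol_gt0 R m)) (B n).
rewrite expr1n mul1r in E.
by move: E; move: (_ ^+ n) => y; lra.
Qed.

(** The barrier is only Hoelder continuous at the sphere, so its truncated operator is of order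
    eps^(-s) in a shell of width eps. The shell has volume of order eps and u is bounded there, so
    it contributes eps^(1-s), which vanishes as s < 1. *)
Lemma exterior_estimate_trunc u w (eps0 : R) : 0 < eps0 -> frac_pair alpha u w ->
  (forall x, enorm x <= 1 -> 0 <= w x) ->
  (\int[mu]_x ((1 + eps0 <= enorm x)%R%:R * (c * (h x * u x)))%:E <=
   K%:E * \int[mu]_x ((enorm x <= 1)%R%:R * u x)%:E)%E.
Proof.
move=> e00 [wu cu cw Luw] w0; have [mu' u0 _] := wu.
have mw := continuous_measurable_rV cw.
have [Mu Mu0 HMu] := continuous_bounded_eball 1 cu.
have tT := test_fun_barrier (m := m) alpha0; have [mT T0 _ _] := tT.
have Tfin := test_fun_integral_fin tT.
apply/lee_addgt0Pr => d d0.
pose J := fine (\int[mu]_x (barrier alpha x)%:E).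
have IT0 : (0 <= \int[mu]_x (barrier alpha x)%:E)%E by exact: integral_fin_ge0.
have JE : (\int[mu]_x (barrier alpha x)%:E = J%:E)%E by rewrite fineK// ge0_fin_numE.
have J0 : 0 <= J by rewrite -lee_fin -JE.
have e0' : 0 < d / 2 / (J + 1) by rewrite !divr_gt0// ltr_wpDl.
have [d1 [d10 Hd]] := Luw _ _ ltr01 e0'.
pose C := n%:R * ball_vol R m * (2 `^ s / alpha).
have C0 : 0 <= C by rewrite !mulr_ge0 ?powR_ge0 ?invr_ge0 ?ltW// ball_vol_gt0.
pose C2 := C * Mu * (n%:R * ball_vol R m).
have C20 : 0 <= C2 by exact: mulr_ge0 (mulr_ge0 C0 Mu0) (mulr_ge0 (ler0n _ _) (ltW ball_vol_gt0)).
have s10 : 0 < 1 - s by rewrite subr_gt0.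
have q0 : 0 < d / 2 / (C2 + 1) by rewrite !divr_gt0// ltr_wpDl.
pose q := (d / 2 / (C2 + 1)) `^ (1 - s)^-1.
(* Below d1 for the convergence of L_eps u, below eps0 for the exterior region, below 1 for the
   shell volume, and below q so that the shell contributes at most d/2. *)
pose eps := Num.min (Num.min d1 eps0) (Num.min 1 q) / 2.
have mn0 : 0 < Num.min (Num.min d1 eps0) (Num.min 1 q) by rewrite !lt_min d10 e00 ltr01 powR_gt0.
have eps_gt0 : 0 < eps by rewrite divr_gt0.
have : eps < Num.min (Num.min d1 eps0) (Num.min 1 q) by rewrite ltr_pdivrMr// ltr_pMr// ltrDl ltr01.
rewrite !lt_min => /andP[/andP[ed1 ee0] /andP[e1 eq]].
have epsq : C2 * eps `^ (1 - s) <= d / 2.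
  have : eps `^ (1 - s) <= d / 2 / (C2 + 1).
    have -> : d / 2 / (C2 + 1) = q `^ (1 - s).
      by rewrite -powRrM mulVf ?gt_eqF// powRr1// ltW.
    by apply: ge0_ler_powR; rewrite ?nnegrE ?powR_ge0 ?(ltW s10) ?(ltW eps_gt0) ?(ltW eq).
  move=> /(ler_wpM2l C20)/le_trans; apply.
  rewrite mulrA ler_pdivrMr ?ltr_wpDl// mulrC ler_wpM2l ?divr_ge0 ?(ltW d0)//.
  by rewrite lerDl.
(* The upper bound on L_eps of the barrier: a constant in the ball and the excess of order eps^(-s)
   in the shell; b is the gain outside. *)
pose a x := K * (enorm x <= 1)%R%:R + C * eps `^ (- s) * (1 - eps < enorm x <= 1)%R%:R.
pose b x := (1 + eps <= enorm x)%R%:R * (c * h x).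
have c0 := ltW (exterior_const_gt0 (m := m) alpha).
have mh := @measurable_exterior_kernel R m alpha.
have ma : measurable_fun setT a by rewrite /a; meas.
have mb : measurable_fun setT b.
  by apply: measurable_funM; [meas|exact: measurable_funM].
have Ce0 : 0 <= C * eps `^ (- s) by rewrite mulr_ge0 ?powR_ge0.
have pa x : 0 <= a x by apply: addr_ge0; exact: mulr_ge0.
have pb x : 0 <= b x.
  by apply: mulr_ge0 => //; apply: mulr_ge0 => //; exact: exterior_kernel_ge0.
have main : forall x, tmass m alpha eps * barrier alpha x + b x <= tconv alpha eps (barrier alpha) x + a x.
  move=> x; have Tc0 := tconv_ge0 alpha eps x (barrier_ge0 (m := m) alpha).
  have [x1|x1] := leP (enorm x) 1; last first.
    rewrite barrier_out ?(ltW x1)// mulr0 add0r.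
    apply: (@le_trans _ _ (tconv alpha eps (barrier alpha) x)); last by rewrite lerDl; exact: pa.
    rewrite /b; case: (leP (1 + eps) (enorm x)) => xe; last by rewrite mul0r.
    by rewrite mul1r; apply: barrier_outside => //; rewrite lerBrDl.
  have -> : b x = 0.
    rewrite /b; case: (leP (1 + eps) (enorm x)) => xe; last by rewrite mul0r.
    by have := le_trans xe x1; rewrite gerDl leNgt eps_gt0.
  rewrite addr0 /a x1 mulr1 andbT; have [xe|xe] := leP (enorm x) (1 - eps).
    by rewrite mulr0 addr0; exact: barrier_inside.
  have := tmass_barrier_shell alpha0 eps_gt0 xe x1; rewrite -/C.
  by rewrite mulr1 => /le_trans; apply; rewrite addrA lerDr addr_ge0.
have := @trunc_test_le R m alpha eps 1 (d / 2 / (J + 1)) u (barrier alpha) w a b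
  alpha0 eps_gt0 (ltW e0') wu tT mw w0 ma pa mb pb.
move=> /(_ _ _ main) T.
have {}T : (\int[mu]_x (barrier alpha x * w x)%:E + \int[mu]_x (u x * b x)%:E <=
    \int[mu]_x (u x * a x)%:E + (d / 2 / (J + 1))%:E * J%:E)%E.
  rewrite -JE; apply: T.
  - by exists Mu => x xr; rewrite (le_trans (ler_norm _))// HMu.
  - by move=> x xr; have := Hd eps x eps_gt0 ed1 xr; rewrite ler_norml => /andP[]; lra.
have Tw0 : (0 <= \int[mu]_x (barrier alpha x * w x)%:E)%E.
  apply: integral_fin_ge0 => x; have [x1|x1] := leP (enorm x) 1; first by rewrite mulr_ge0// w0.
  by rewrite barrier_out ?mul0r// ltW.
have Ib : (\int[mu]_x ((1 + eps0 <= enorm x)%R%:R * (c * (h x * u x)))%:E <= \int[mu]_x (u x * b x)%:E)%E.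
  have hu0 x : 0 <= c * (h x * u x).
    by apply: mulr_ge0 => //; apply: mulr_ge0 => //; exact: exterior_kernel_ge0.
  apply: ge0_le_integral_fin.
  - by apply: measurable_funM; [meas|apply: measurable_funM => //; exact: measurable_funM].
  - exact: measurable_funM.
  - by move=> x; apply: mulr_ge0.
  - move=> x; rewrite /b; case: (leP (1 + eps0) (enorm x)) => xe; last first.
      by rewrite mul0r; apply: mulr_ge0 => //; exact: pb.
    have -> : 1 + eps <= enorm x by apply: le_trans xe; rewrite lerD2l ltW.
    by rewrite !mul1r le_eqVlt; apply/orP; left; apply/eqP; ring.
have Ia : (\int[mu]_x (u x * a x)%:E <=
    K%:E * \int[mu]_x ((enorm x <= 1)%R%:R * u x)%:E + (d / 2)%:E)%E.
  have mu1 : measurable_fun setT (fun x => (enorm x <= 1)%R%:R * u x) by apply: measurable_funM => //; meas.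
  have ms : measurable_fun setT (fun x : 'rV[R]_n => (1 - eps < enorm x <= 1)%R%:R : R) by meas.
  rewrite -ge0_integralZ_fin//; last by move=> x; rewrite mulr_ge0.
  apply: (@le_trans _ _ (\int[mu]_x (K * ((enorm x <= 1)%R%:R * u x) +
      C * eps `^ (- s) * Mu * (1 - eps < enorm x <= 1)%R%:R)%:E)%E).
    apply: ge0_le_integral_fin.
    - exact: measurable_funM.
    - by apply: measurable_funD; apply: measurable_funM.
    - by move=> x; apply: mulr_ge0.
    - move=> x; rewrite /a mulrDr; apply: lerD; first by rewrite mulrCA [u x * _]mulrC.
      case x1 : (1 - eps < enorm x <= 1); last by rewrite !mulr0.
      move: x1 => /andP[_ x1]; rewrite !mulr1 mulrC ler_wpM2l//.
      exact: le_trans (ler_norm _) (HMu x x1).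
  rewrite ge0_integralD_fin//; last 4 first.
  - exact: measurable_funM.
  - exact: measurable_funM.
  - by move=> x; apply: mulr_ge0 => //; apply: mulr_ge0.
  - by move=> x; apply: mulr_ge0 => //; apply: mulr_ge0.
  have CM0 : 0 <= C * eps `^ (- s) * Mu := mulr_ge0 Ce0 Mu0.
  apply: leeD => //; rewrite ge0_integralZ_fin//.
  have L := integral_shell_le eps_gt0 e1.
  apply: (le_trans (lee_wpmul2l _ L)); first by rewrite lee_fin.
  rewrite -EFinM lee_fin; apply: le_trans epsq; rewrite le_eqVlt; apply/orP; left; apply/eqP.
  have -> : eps `^ (1 - s) = eps * eps `^ (- s).
    by rewrite -{2}[eps]powRr1 ?(ltW eps_gt0)// -powRD ?(gt_eqF eps_gt0) ?implybT.
  by rewrite /C2; ring.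
have eJ : d / 2 / (J + 1) * J <= d / 2.
  by rewrite mulrAC ler_pdivrMr ?ltr_wpDl// ler_wpM2l ?divr_ge0 ?(ltW d0)// lerDl.
apply: (le_trans Ib); apply: (le_trans (leeDr _ Tw0)); apply: (le_trans T).
rewrite -EFinM; apply: (le_trans (leeD Ia (_ : (_ <= (d / 2)%:E)%E))); first by rewrite lee_fin.
by rewrite -addeA -EFinD -splitr.
Qed.

Lemma exterior_estimate u w : frac_pair alpha u w ->
  (forall x, enorm x <= 1 -> 0 <= w x) ->
  (\int[mu]_x ((1 < enorm x)%R%:R * (c * (h x * u x)))%:E <=
   K%:E * \int[mu]_x ((enorm x <= 1)%R%:R * u x)%:E)%E.
Proof.
move=> uw w0; have [[mu' u0 _] _ _ _] := uw.
have c0 := ltW (exterior_const_gt0 (m := m) alpha).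
have mh := @measurable_exterior_kernel R m alpha.
apply: (@ge0_integral_exhaustion R _ _ mu (fun k x => 1 + k.+1%:R^-1 <= enorm x) (fun x => 1 < enorm x)
   (fun x => c * (h x * u x))).
- by move=> k; meas.
- by apply: measurable_funM => //; exact: measurable_funM.
- by move=> x; apply: mulr_ge0 => //; apply: mulr_ge0 => //; exact: exterior_kernel_ge0.
- move=> k l x kl; apply: le_trans; rewrite lerD2l lef_pV2 ?posrE// ler_nat ltnS//.
- move=> x x1; have x10 : 0 < enorm x - 1 by rewrite subr_gt0.
  have /ltr_add_invr[k Hk] := x1; exists k; exact: ltW.
- by move=> k x; apply: lt_le_trans; rewrite ltrDl invr_gt0.
- by move=> k; apply: exterior_estimate_trunc uw w0; rewrite invr_gt0.
Qed.

End exterior.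

(** * The exterior estimate in terms of spherical averages *)

Section exterior_average.
Context {R : realType} {m : nat}.
Local Notation n := m.+1.
Local Notation mu := (lebesgue_rV R n).
Local Notation leb := (@lebesgue_measure R).
Variable alpha : R.
Hypotheses (alpha0 : 0 < alpha) (alpha2 : alpha < 2).
Implicit Types (x y z : 'rV[R]_n) (u w : 'rV[R]_n -> R).
Local Notation s := (alpha / 2).

Lemma sphere_int_fin u (r : R) : continuous u -> (forall x, 0 <= u x) -> 0 < r ->
  sphere_int u r = (ball_vol R m * spherical_average u r)%:E.
Proof.
move=> cu u0 r0; have mu' := continuous_measurable_rV cu.
rewrite spherical_averageE// mulrA mulfV ?gt_eqF ?ball_vol_gt0// mul1r fineK//.
rewrite ge0_fin_numE ?sphere_int_ge0//.
have [M M0 HM] := continuous_bounded_eball r cu.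
apply: (@le_lt_trans _ _ (\int[mu]_y (M * (0 < enorm y <= 1)%R%:R)%:E)%E).
  apply: ge0_le_integral_fin.
  - by apply: measurable_funM; [meas|apply: (measurableT_comp mu'); meas].
  - by meas.
  - by move=> y; rewrite mulr_ge0.
  - move=> y; case yP : (0 < enorm y <= 1); last by rewrite mul0r mulr0.
    move: yP => /andP[y0 _]; rewrite mul1r mulr1; apply: le_trans (ler_norm _) (HM _ _).
    by rewrite enormZ ger0_norm ?divr_ge0 ?(ltW r0) ?(ltW y0)// divfK ?gt_eqF.
by rewrite ge0_integralZ_fin//; [rewrite integral_punctured_ball -EFinM ltey|meas].
Qed.

(** In shells t^(n-1) t^(-n) (t^2 - 1)^(-alpha/2) dt appears, and r = rho t turns it into the weight
    of the statement. *)
Lemma integral_exterior_average u (c rho : R) : continuous u -> (forall x, 0 <= u x) ->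
  0 <= c -> 0 < rho ->
  (\int[mu]_x ((1 < enorm x)%R%:R * (c * (exterior_kernel alpha x * u (rho *: x))))%:E =
   (n%:R * c * ball_vol R m)%:E * \int[leb]_(r in `]rho, +oo[)
      (rho `^ alpha / (r * (r ^+ 2 - rho ^+ 2) `^ s) * spherical_average u r)%:E)%E.
Proof.
move=> cu u0 c0 rho0; have mu' := continuous_measurable_rV cu.
have bv0 := @ball_vol_gt0 R m.
pose H t := (1 < t)%R%:R * (c * (t `^ (- n%:R) * (t ^+ 2 - 1) `^ (- s))).
have mH : measurable_fun setT H by rewrite /H; meas.
have H0 t : 0 <= H t by rewrite !mulr_ge0 ?powR_ge0.
pose k r := (rho < r)%R%:R * (rho `^ alpha / (r * (r ^+ 2 - rho ^+ 2) `^ s)).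
have mk : measurable_fun setT k by rewrite /k; meas.
have k0 r : 0 <= k r.
  rewrite /k; case: (ltP rho r) => rr; last by rewrite mul0r.
  by rewrite mul1r divr_ge0 ?mulr_ge0 ?powR_ge0// ltW// (lt_trans rho0).
pose J r := fine (sphere_int u r).
have mJ : measurable_fun setT J.
  by apply: (measurableT_comp (fine_measurable _)) => //; exact: measurable_sphere_int.
have J0 r : 0 <= J r by apply: fine_ge0; exact: sphere_int_ge0.
have JE r : 0 < r -> J r = ball_vol R m * spherical_average u r.
  by move=> r0; rewrite /J sphere_int_fin.
rewrite (_ : (\int[leb]_(r in _) _)%E = \int[leb]_r ((ball_vol R m)^-1 * (k r * J r))%:E)%E; last first.
  rewrite (_ : [set` `]rho, +oo[] = [set r | rho < r]); last first.
    by apply/seteqP; split => r /=; rewrite in_itv/= andbT.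
  rewrite (ge0_integral_cond leb (fun r => rho < r)); apply: eq_integral => r _; congr EFin.
  rewrite /k; case: (ltP rho r) => rr; last by rewrite !mul0r mulr0.
  rewrite (JE r (lt_trans rho0 rr)) !mul1r.
  by move: (_ / _) (spherical_average u r) => X Y; field; rewrite gt_eqF.
rewrite ge0_integralZ_fin ?invr_ge0 ?(ltW bv0)//; last 2 first.
- exact: measurable_funM.
- by move=> r; rewrite mulr_ge0.
rewrite muleA -EFinM mulfK ?gt_eqF//.
transitivity (\int[mu]_x (H (enorm x) * u (rho *: x))%:E)%E.
  by apply: eq_integral => x _; congr EFin; rewrite /H /exterior_kernel !mulrA.
rewrite (ge0_integral_shells mH H0); [|exact: measurable_scale_fun|by []].
rewrite [in RHS]EFinM -[in RHS]muleA; apply: congr1.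
pose G r := rho * c * (k r * J r).
transitivity (\int[leb]_t (G (rho * t))%:E)%E.
  apply: eq_integral => t _.
  have [t0|t0] := ltP 0 t; last first.
    rewrite mul0r mul0e /G /k; have -> : (rho < rho * t) = false.
      by apply/negbTE; rewrite -leNgt ler_piMr ?(ltW rho0)// (le_trans t0).
    by rewrite !mul0r mulr0.
  have rt0 : 0 < rho * t by rewrite mulr_gt0.
  have -> : sphere_int (fun x => u (rho *: x)) t = (J (rho * t))%:E.
    rewrite JE// -sphere_int_fin//; apply: eq_integral => y _; congr EFin.
    by rewrite scalerA mulrA.
  rewrite -EFinM; congr EFin; rewrite /G /H /k ltr_pMr//.
  case: (ltP 1 t) => t1; last by rewrite !(mul0r, mulr0).
  rewrite !mul1r [in RHS]mulrA; congr (_ * _).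
  have T0 : 0 < t ^+ 2 - 1 by rewrite subr_gt0 exprn_egt1.
  have -> : (rho * t) ^+ 2 - rho ^+ 2 = rho ^+ 2 * (t ^+ 2 - 1) by ring.
  rewrite powRM ?sqr_ge0 ?(ltW T0)//.
  have -> : (rho ^+ 2) `^ s = rho `^ alpha.
    by rewrite -(powR_mulrn 2 (ltW rho0)) -powRrM mulrC divfK.
  rewrite !powRN (powR_mulrn n (ltW t0)) exprS.
  have := powR_gt0 alpha rho0; have := powR_gt0 s T0.
  move: (_ `^ s) (rho `^ alpha) => X Y X0 Y0.
  by field; rewrite !gt_eqF ?exprn_gt0.
have mG : measurable_fun setT (fun r => (G r)%:E).
  by apply/measurable_EFinP; apply: measurable_funM => //; exact: measurable_funM.
have G0 r : (0 <= (G r)%:E)%E by rewrite lee_fin; exact: mulr_ge0 (mulr_ge0 (ltW rho0) c0) (mulr_ge0 (k0 r) (J0 r)).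
rewrite (lebesgue_ge0_scale rho0 mG G0) ge0_integralZ_fin ?mulr_ge0 ?(ltW rho0)//; last 2 first.
- exact: measurable_funM.
- by move=> r; rewrite mulr_ge0.
by rewrite muleA -EFinM mulrA mulVf ?gt_eqF// mul1r.
Qed.

Lemma exterior_average_le : exists2 C : R, 0 < C & forall u w, frac_pair alpha u w ->
  (forall x, 0 <= w x) -> forall rho : R, 0 < rho ->
  (\int[leb]_(r in `]rho, +oo[)
      (rho `^ alpha / (r * (r ^+ 2 - rho ^+ 2) `^ s) * spherical_average u r)%:E <=
   (C * weightavg alpha u rho)%:E)%E.
Proof.
pose K := @barrier_const R m alpha; pose c := @exterior_const R m alpha.
have s1 : s < 1 by rewrite ltr_pdivrMr// mul1r.
have bv0 := @ball_vol_gt0 R m.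
have K0 : 0 < K.
  apply: mulr_gt0; first exact: mulr_gt0.
  by apply: addr_gt0; rewrite invr_gt0 ?subr_gt0// divr_gt0.
have c0 : 0 < c by exact: exterior_const_gt0.
have D0 : 0 < n%:R * c * ball_vol R m by rewrite !mulr_gt0.
exists ((n%:R * c * ball_vol R m)^-1 * (K * 2 `^ (n%:R + alpha))).
  by rewrite mulr_gt0 ?invr_gt0// mulr_gt0// powR_gt0.
move=> u w pr w0 rho rho0; have [wu cu cw _] := pr; have [mu' u0 _] := wu.
have a0 := ltW alpha0.
have prs := frac_pair_scale a0 rho0 pr.
have := @exterior_estimate R m alpha alpha0 alpha2 _ _ prs.
move=> /(_ _) E; have {}E := E (fun x _ => mulr_ge0 (powR_ge0 _ _) (w0 _)).
rewrite (integral_exterior_average cu u0 (ltW c0) rho0) in E.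
have wi := weightavg_integrable a0 rho0 wu.
have mw := @measurable_weight R m alpha.
have mus : measurable_fun setT (fun x => u (rho *: x)) by exact: measurable_scale_fun.
have L : (\int[mu]_x ((enorm x <= 1)%R%:R * u (rho *: x))%:E <=
    (2 `^ (n%:R + alpha) * weightavg alpha u rho)%:E)%E.
  rewrite EFinM -(EFin_Rintegral wi) -ge0_integralZ_fin ?powR_ge0//; last 2 first.
  - exact: measurable_funM.
  - by move=> x; rewrite mulr_ge0// ltW// weight_gt0.
  apply: ge0_le_integral_fin.
  - by apply: measurable_funM => //; meas.
  - by apply: measurable_funM => //; exact: measurable_funM.
  - by move=> x; rewrite mulr_ge0.
  - move=> x; case: (leP (enorm x) 1) => x1; last first.
      by rewrite mul0r mulr_ge0 ?powR_ge0// mulr_ge0// ltW// weight_gt0.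
    rewrite mul1r mulrCA ler_peMr// /weight powRN ler_pdivlMr ?powR_gt0 ?ltr_wpDr ?enorm_ge0//.
    rewrite mul1r; apply: ge0_ler_powR; rewrite ?nnegrE ?addr_ge0 ?enorm_ge0//.
    by move: x1; lra.
have {}E := le_trans E (lee_wpmul2l (_ : (0 <= K%:E)%E) L).
have {}E := E (ltW K0 : (0 <= K%:E)%E).
set T := (\int[leb]_(r in _) _)%E in E *.
have -> : T = ((n%:R * c * ball_vol R m)^-1%:E * ((n%:R * c * ball_vol R m)%:E * T))%E.
  by rewrite muleA -EFinM mulVf ?gt_eqF// mul1e.
move: E D0; move: (n%:R * c * ball_vol R m) => D E D0.
rewrite -mulrA EFinM; apply: lee_wpmul2l; first by rewrite lee_fin invr_ge0 ltW.
by apply: (le_trans E); rewrite -EFinM lee_fin mulrA.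
Qed.

End exterior_average.

(** * Spherical means and the local estimate *)

Section radial.
Context {R : realType} {m : nat}.
Local Notation n := m.+1.
Local Notation mu := (lebesgue_rV R n).
Local Notation leb := (@lebesgue_measure R).
Implicit Types (x y z : 'rV[R]_n) (u f g w : 'rV[R]_n -> R).

Let bv0 : 0 < ball_vol R m := ball_vol_gt0.

Let sph f x y : R := (0 < enorm y <= 1)%R%:R * f ((enorm x / enorm y) *: y).

Definition radial f x : R := (ball_vol R m)^-1 * \int[mu]_y (sph f x y).

Lemma sph_dominated f : continuous f -> dominated (sph f).
Proof.
move=> cf; split.
  move=> x; apply: measurable_funM; first by meas.
  by apply: (measurableT_comp (continuous_measurable_rV cf)); meas.
move=> rho rho0; have [M M0 HM] := continuous_bounded_eball rho cf.
exists (fun y => M * (0 < enorm y <= 1)%R%:R); split.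
- apply: ge0_integrable_fin; [by meas|by move=> y; rewrite mulr_ge0|].
  by rewrite ge0_integralZ_fin//; [rewrite integral_punctured_ball -EFinM ltey|meas].
- by move=> y; rewrite mulr_ge0.
- move=> x y xr; rewrite /sph; case yP : (0 < enorm y <= 1); last by rewrite mul0r normr0 mulr0.
  move: yP => /andP[y0 _]; rewrite mul1r mulr1; apply: HM.
  by rewrite enormZ ger0_norm ?divr_ge0 ?enorm_ge0// divfK ?gt_eqF.
Qed.

Lemma continuous_radial f : continuous f -> continuous (radial f).
Proof.
move=> cf; apply: continuous_funZ; apply: continuous_dominated; first exact: sph_dominated.
move=> y; apply: continuous_funZ => x.
apply: (continuous_comp (f := fun x => (enorm x / enorm y) *: y) (g := f)); last exact: cf.
have FF : Filter (nbhs x) := nbhs_filter x.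
apply: (@cvgZr_tmp _ _ _ _ FF).
by apply: cvgMl; exact: continuous_enorm.
Qed.

Lemma radial_ge0 f x : (forall x, 0 <= f x) -> 0 <= radial f x.
Proof.
by move=> f0; rewrite mulr_ge0 ?invr_ge0 ?(ltW bv0)//; apply: Rintegral_ge0 => y _; rewrite mulr_ge0.
Qed.

Lemma eq_radial f x y : enorm x = enorm y -> radial f x = radial f y.
Proof. by move=> xy; rewrite /radial /sph xy. Qed.

Lemma sphere_intE f x : continuous f -> sphere_int f (enorm x) = (ball_vol R m * radial f x)%:E.
Proof.
move=> cf; rewrite /radial mulrA mulfV ?gt_eqF// mul1r.
by rewrite -EFin_Rintegral//; exact: dominated_integrable (sph_dominated cf).
Qed.

Lemma spherical_average_radial f x : continuous f -> (forall x, 0 <= f x) -> 0 < enorm x ->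
  spherical_average f (enorm x) = radial f x.
Proof. by move=> cf f0 x0; rewrite spherical_averageE//; exact: continuous_measurable_rV. Qed.

Lemma sphere_int_cst f x (c : R) : 0 <= c -> (forall y, enorm y = enorm x -> f y = c) ->
  sphere_int f (enorm x) = (ball_vol R m * c)%:E.
Proof.
move=> c0 fc; rewrite mulrC EFinM -integral_punctured_ball -ge0_integralZ_fin//; last by meas.
apply: eq_integral => y _; congr EFin.
case yP : (0 < enorm y <= 1); last by rewrite mul0r mulr0.
move: yP => /andP[y0 _]; rewrite mul1r mulr1; apply: fc.
by rewrite enormZ ger0_norm ?divr_ge0 ?enorm_ge0// divfK ?gt_eqF.
Qed.

Lemma sphere_int_radial f x : continuous f -> (forall x, 0 <= f x) ->
  sphere_int (radial f) (enorm x) = sphere_int f (enorm x).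
Proof.
move=> cf f0; rewrite (sphere_intE _ cf); apply: sphere_int_cst; first exact: radial_ge0.
by move=> y; exact: eq_radial.
Qed.

Lemma enorm_delta0 (t : R) : 0 <= t -> enorm (t *: delta_mx ord0 ord0 : 'rV[R]_n) = t.
Proof. by move=> t0; rewrite enormZ enorm_delta mulr1 ger0_norm. Qed.

Lemma integral_radial_weight f (h : R -> R) : continuous f -> (forall x, 0 <= f x) ->
  measurable_fun setT h -> (forall t, 0 <= h t) ->
  (\int[mu]_x (h (enorm x) * radial f x)%:E = \int[mu]_x (h (enorm x) * f x)%:E)%E.
Proof.
move=> cf f0 mh h0; have mf := continuous_measurable_rV cf.
have cr := continuous_radial cf; have mr := continuous_measurable_rV cr.
have r0 x := radial_ge0 x f0.
rewrite (ge0_integral_shells mh h0 mr r0) (ge0_integral_shells mh h0 mf f0).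
apply: congr1; apply: eq_integral => t _; case: (ltP 0 t) => t0; last by rewrite mul0r !mul0e.
by rewrite -(enorm_delta0 (ltW t0)) sphere_int_radial.
Qed.

Lemma reflect_rVZ e (c : R) x : reflect_rV e (c *: x) = c *: reflect_rV e x.
Proof. by rewrite /reflect_rV edotZl scalerBr scalerA -!mulrA mulrCA. Qed.

Lemma reflect_rVB e x y : reflect_rV e (x - y) = reflect_rV e x - reflect_rV e y.
Proof. by rewrite reflect_rVD -scaleN1r reflect_rVZ scaleN1r. Qed.

Lemma integral_radial_weight_fun alpha u : continuous u -> (forall x, 0 <= u x) ->
  (\int[mu]_x (radial u x * weight alpha x)%:E = \int[mu]_x (u x * weight alpha x)%:E)%E.
Proof.
move=> cu u0; pose h (t : R) := (1 + Num.max t 0) `^ (- (n%:R + alpha)).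
have hE x : weight alpha x = h (enorm x).
  by rewrite /h /weight (_ : Num.max _ _ = enorm x)//; apply/max_idPl; exact: enorm_ge0.
have mh : measurable_fun setT h.
  by rewrite /h; apply: measurable_fun_powR_comp; apply: measurable_funD => //; exact: measurable_maxr.
have h0 t : 0 <= h t := powR_ge0 _ _.
have E := integral_radial_weight cu u0 mh h0.
transitivity (\int[mu]_x (h (enorm x) * radial u x)%:E)%E.
  by apply: eq_integral => x _; rewrite hE mulrC.
by rewrite E; apply: eq_integral => x _; rewrite hE mulrC.
Qed.

Lemma weighted_fin_radial alpha u : continuous u -> weighted_fin alpha u -> weighted_fin alpha (radial u).
Proof.
move=> cu [mu' u0 ufin]; split.
- exact: continuous_measurable_rV (continuous_radial cu).
- by move=> x; exact: radial_ge0.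
- by rewrite integral_radial_weight_fun.
Qed.

Lemma weightavg_radial alpha u : continuous u -> (forall x, 0 <= u x) ->
  weightavg alpha (radial u) 1 = weightavg alpha u 1.
Proof.
move=> cu u0; rewrite /weightavg; under eq_Rintegral do rewrite scale1r.
under [RHS]eq_Rintegral do rewrite scale1r.
by rewrite /Rintegral integral_radial_weight_fun.
Qed.

Section convolution.
Variables (alpha eps : R).
Hypotheses (a0 : 0 < alpha) (e0 : 0 < eps).

Let reflect_dir e (r : R) y : (r / enorm (reflect_rV e y)) *: reflect_rV e y =
  reflect_rV e ((r / enorm y) *: y).
Proof. by rewrite enorm_reflect_rV reflect_rVZ. Qed.

(** Apply the reflection that exchanges x and y under the integral: it preserves the measure, the
    kernel and the radial function f. *)
Lemma tconv_radial_ext f x y : weighted_fin alpha f ->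
  (forall x y, enorm x = enorm y -> f x = f y) -> enorm x = enorm y ->
  tconv alpha eps f x = tconv alpha eps f y.
Proof.
move=> wf fr xy; have [mf f0 _] := wf; rewrite /tconv; apply: congr1.
have := reflect_rV_swap xy; move: (x - y) => e S.
rewrite -[RHS](ge0_integral_reflect e).
- apply: eq_integral => z _; apply: (congr1 EFin); rewrite /tker /rker enorm_reflect_rV; congr (_ * _).
  by apply: fr; rewrite -S -reflect_rVD enorm_reflect_rV.
- exact: measurable_tconv_int.
- by move=> z; rewrite mulr_ge0 ?tker_ge0.
Qed.

Let ak (r : R) x y : R := (0 < enorm y <= 1)%R%:R * tker alpha eps (x - (r / enorm y) *: y).

(** The kernel averaged over the sphere of radius r; it depends on |x| only, again by reflection. *)
Let avgker (r : R) x : \bar R := (\int[mu]_y (ak r x y)%:E)%E.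

Let mavg (r : R) : measurable_fun setT (fun p : 'rV[R]_n * 'rV[R]_n => ak r p.1 p.2).
Proof.
apply: measurable_funM; first by meas.
by apply: (measurableT_comp (measurable_tker alpha eps)); meas.
Qed.

Let ak0 r x y : 0 <= ak r x y. Proof. by rewrite mulr_ge0 ?tker_ge0. Qed.

Let mak r x : measurable_fun setT (ak r x).
Proof. exact: (measurable_section1 (f := ak r) (mavg r) x). Qed.

Let avgker_fin r x : avgker r x \is a fin_num.
Proof.
rewrite ge0_fin_numE; last exact: integral_fin_ge0.
apply: (@le_lt_trans _ _ (\int[mu]_y (eps `^ (- (n%:R + alpha)) * (0 < enorm y <= 1)%R%:R)%:E)%E).
  apply: ge0_le_integral_fin.
  - exact: mak.
  - by meas.
  - exact: ak0.
  - move=> y; rewrite /ak mulrC ler_wpM2r// /tker.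
    case: (leP eps (enorm (x - (r / enorm y) *: y))) => ez; last by rewrite mul0r powR_ge0.
    by rewrite mul1r; apply: powRN_le => //; rewrite addr_ge0// ltW.
rewrite ge0_integralZ_fin ?powR_ge0//; last by meas.
by rewrite integral_punctured_ball -EFinM ltey.
Qed.

Let avgker_radial r x y : enorm x = enorm y -> avgker r x = avgker r y.
Proof.
move=> xy; have := reflect_rV_swap xy; move: (x - y) => e S.
rewrite /avgker -[RHS](ge0_integral_reflect e (mak r y) (ak0 r y)).
apply: eq_integral => z _; apply: (congr1 EFin); rewrite /ak.
have -> : y - (r / enorm (reflect_rV e z)) *: reflect_rV e z = reflect_rV e (x - (r / enorm z) *: z).
  by rewrite reflect_dir reflect_rVB S.
by rewrite /tker /rker !enorm_reflect_rV.
Qed.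

Lemma sphere_int_tconv u r : weighted_fin alpha u ->
  (sphere_int (tconv alpha eps u) r = \int[mu]_x (fine (avgker r x) * u x)%:E)%E.
Proof.
move=> wu; have [mu' u0 _] := wu.
pose F y x := u x * ak r x y.
have mF : measurable_fun setT (fun p : 'rV[R]_n * 'rV[R]_n => F p.1 p.2).
  apply: measurable_funM; first by apply: (measurableT_comp mu'); meas.
  rewrite /ak; apply: measurable_funM; first by meas.
  by apply: (measurableT_comp (measurable_tker alpha eps)); meas.
have F0 y x : 0 <= F y x by rewrite mulr_ge0.
transitivity (\int[mu]_y \int[mu]_x (F y x)%:E)%E.
  apply: eq_integral => y _; rewrite EFinM -(tconvE _ (ltW a0) e0 wu).
  set x0 := (r / enorm y) *: y.
  rewrite -ge0_integralZ_fin//; last 2 first.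
  - exact: measurable_tconv_int.
  - by move=> z; rewrite mulr_ge0 ?tker_ge0.
  rewrite -(integral_shift_addl x0 (measurable_section1 (f := F) mF y) (F0 y)).
  apply: eq_integral => z _; congr EFin; rewrite /F /ak -/x0 addrAC subrr add0r.
  by move: (tker _ _ _) (u _) (_%:R) => A B C; ring.
rewrite (integral_swap mu mu mF F0); apply: eq_integral => x _.
by rewrite mulrC EFinM fineK// -ge0_integralZ_fin.
Qed.

(** By Tonelli the sphere integral of the convolution is the integral of u against the radial kernel
    [avgker], and replacing u by its spherical mean does not change such an integral. *)
Lemma sphere_int_tconv_radial u x : continuous u -> weighted_fin alpha u ->
  (sphere_int (tconv alpha eps u) (enorm x) =
    (ball_vol R m * tconv alpha eps (radial u) x)%:E)%E.
Proof.
move=> cu wu; have [mu' u0 _] := wu.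
have wr := weighted_fin_radial cu wu; have [mr r0 _] := wr.
transitivity (sphere_int (tconv alpha eps (radial u)) (enorm x)); last first.
  apply: sphere_int_cst; first exact: tconv_ge0.
  by move=> y yx; apply: tconv_radial_ext yx => // y1 y2; exact: eq_radial.
rewrite !sphere_int_tconv//; set r := enorm x.
pose h (t : R) := fine (avgker r (t *: delta_mx ord0 ord0)).
have hE z : h (enorm z) = fine (avgker r z).
  by rewrite /h (@avgker_radial r _ z)// enorm_delta0 ?enorm_ge0.
have mh : measurable_fun setT h.
  have mA := measurable_integral1 mu (mavg r) (ak0 r).
  apply: (measurableT_comp (fine_measurable _)) => //.
  apply: (measurableT_comp mA); meas.
have h0 t : 0 <= h t by apply: fine_ge0; exact: integral_fin_ge0.
have E := integral_radial_weight cu u0 mh h0.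
transitivity (\int[mu]_x (h (enorm x) * u x)%:E)%E.
  by apply: eq_integral => z _; rewrite hE.
by rewrite -E; apply: eq_integral => z _; rewrite hE.
Qed.

End convolution.

Lemma sphere_int_le f g x : measurable_fun setT f -> measurable_fun setT g ->
  (forall y, 0 <= f y) -> (forall y, enorm y = enorm x -> f y <= g y) ->
  (sphere_int f (enorm x) <= sphere_int g (enorm x))%E.
Proof.
move=> mf mg f0 fg; apply: ge0_le_integral_fin.
- by apply: measurable_funM; [meas|apply: (measurableT_comp mf); meas].
- by apply: measurable_funM; [meas|apply: (measurableT_comp mg); meas].
- by move=> y; rewrite mulr_ge0.
- move=> y; case yP : (0 < enorm y <= 1); last by rewrite !mul0r.
  move: yP => /andP[y0 _]; rewrite !mul1r; apply: fg.
  by rewrite enormZ ger0_norm ?divr_ge0 ?enorm_ge0// divfK ?gt_eqF.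
Qed.

Lemma sphere_intD f g (r : R) : measurable_fun setT f -> measurable_fun setT g ->
  (forall y, 0 <= f y) -> (forall y, 0 <= g y) ->
  (sphere_int (fun y => (f y + g y)%R) r = sphere_int f r + sphere_int g r)%E.
Proof.
move=> mf mg f0 g0; rewrite /sphere_int -ge0_integralD_fin.
- by apply: eq_integral => y _; rewrite mulrDr.
- by apply: measurable_funM; [meas|apply: (measurableT_comp mf); meas].
- by apply: measurable_funM; [meas|apply: (measurableT_comp mg); meas].
- by move=> y; rewrite mulr_ge0.
- by move=> y; rewrite mulr_ge0.
Qed.

Lemma radialZ (c : R) f x : continuous f -> radial (fun y => c * f y) x = c * radial f x.
Proof.
move=> cf; have Df := dominated_integrable x (sph_dominated cf).
rewrite /radial mulrCA; apply: congr1; rewrite -RintegralZl//.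
by apply: eq_Rintegral => y _; rewrite /sph mulrCA.
Qed.

(** The bound on L_eps u - w holds uniformly on spheres, and spherical integration is monotone,
    additive and commutes with the convolution. It is applied to two inequalities between sums of
    non-negative functions, which w >= 0 makes possible. *)
Lemma frac_pair_radial alpha u w : 0 < alpha -> frac_pair alpha u w -> (forall x, 0 <= w x) ->
  frac_pair alpha (radial u) (radial w).
Proof.
move=> a0 [wu cu cw Luw] w0; have [mu' u0 _] := wu; split.
- exact: weighted_fin_radial.
- exact: continuous_radial.
- exact: continuous_radial.
move=> rho e rho0 e0; have [d [d0 Hd]] := Luw rho e rho0 e0; exists d; split => // eps x eps0 epsd xr.
have mw := continuous_measurable_rV cw.
have mT := measurable_tconv alpha eps mu' u0.
have T0 y := tconv_ge0 alpha eps y u0.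
pose k := tmass m alpha eps; have k0 : 0 < k by exact: tmass_gt0.
pose ku y := k * u y.
have mku : measurable_fun setT ku by exact: measurable_funM.
have ku0 y : 0 <= ku y by rewrite mulr_ge0// ltW.
have cku : continuous ku by exact: continuous_funZ.
have me : measurable_fun setT (fun _ : 'rV[R]_n => e) by exact: measurable_cst.
have Ee : sphere_int (fun _ : 'rV[R]_n => e) (enorm x) = (ball_vol R m * e)%:E.
  exact: (@sphere_int_cst (fun=> e) x e (ltW e0) (fun _ _ => erefl)).
have ES : sphere_int (fun y => tconv alpha eps u y + w y) (enorm x) =
    (ball_vol R m * (tconv alpha eps (radial u) x + radial w x))%:E.
  by rewrite sphere_intD// sphere_int_tconv_radial// sphere_intE// -EFinD mulrDr.
have EK : sphere_int ku (enorm x) = (ball_vol R m * (k * radial u x))%:E.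
  by rewrite sphere_intE// radialZ.
have L1 : (sphere_int (fun y => (tconv alpha eps u y + w y)%R) (enorm x) <=
    sphere_int ku (enorm x) + sphere_int (fun _ : 'rV[R]_n => e) (enorm x))%E.
  rewrite -sphere_intD//; last by move=> _; exact: ltW.
  apply: sphere_int_le; [exact: measurable_funD|exact: measurable_funD|by move=> y; rewrite addr_ge0|].
  move=> y yx; have := Hd eps y eps0 epsd; rewrite yx => /(_ xr).
  by rewrite ler_norml -/k /ku => /andP[]; lra.
have L2 : (sphere_int ku (enorm x) <=
    sphere_int (fun y => (tconv alpha eps u y + w y)%R) (enorm x) + sphere_int (fun _ : 'rV[R]_n => e) (enorm x))%E.
  rewrite -sphere_intD//; [|exact: measurable_funD|by move=> y; rewrite addr_ge0|by move=> _; exact: ltW].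
  apply: sphere_int_le; [by []|by apply: measurable_funD => //; exact: measurable_funD|by []|].
  move=> y yx; have := Hd eps y eps0 epsd; rewrite yx => /(_ xr).
  by rewrite ler_norml -/k /ku => /andP[]; lra.
move: L1 L2; rewrite ES EK Ee -!EFinD !lee_fin -!mulrDr !ler_pM2l// -/k ler_norml => L1 L2.
by apply/andP; split; lra.
Qed.

End radial.

(** * Pointwise bounds from a weighted maximum point *)

Section max_principle.
Context {R : realType} {m : nat}.
Local Notation n := m.+1.
Local Notation mu := (lebesgue_rV R n).
Implicit Types (x y z : 'rV[R]_n) (u w : 'rV[R]_n -> R).

(** Second-order expansion of (1 - q)^(-N): only the linear coefficient matters, as it cancels
    between z and - z. *)
Lemma exp_inv_oneminus_le (N : nat) : exists2 C : R, 0 <= C &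
  forall q : R, `|q| <= 1 / 2 -> (1 - q)^-1 ^+ N <= 1 + N%:R * q + C * q ^+ 2.
Proof.
elim: N => [|N [C C0 IH]].
  by exists 0 => // q _; rewrite expr0 !mul0r !addr0.
exists (2 + 2 * N%:R + 2 * C) => [|q hq]; first by rewrite !addr_ge0 ?mulr_ge0.
have := hq; rewrite ler_norml => /andP[q1 q2].
have q10 : 0 < 1 - q by lra.
have L : (1 - q)^-1 <= 1 + q + 2 * q ^+ 2.
  rewrite -div1r ler_pdivrMr//.
  have := mulr_ge0 (sqr_ge0 q) (_ : 0 <= 1 - 2 * q); rewrite subr_ge0 => /(_ _) H.
  have {}H := H (_ : 2 * q <= 1); have {}H : 0 <= q ^+ 2 * (1 - 2 * q) by apply: H; lra.
  by move: H; rewrite !expr2; lra.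
have q20 := sqr_ge0 q; have N0 : 0 <= N%:R :> R by [].
have L0 : 0 <= (1 - q)^-1 by rewrite invr_ge0 ltW.
have IHq := IH q hq.
have X0 : 0 <= 1 + N%:R * q + C * q ^+ 2 by apply: le_trans IHq; exact: exprn_ge0.
rewrite exprS mulrC; apply: (le_trans (ler_pM (exprn_ge0 N L0) L0 IHq L)).
have -> : (1 + N%:R * q + C * q ^+ 2) * (1 + q + 2 * q ^+ 2) =
   1 + N.+1%:R * q + (2 + N%:R + C + (2 * N%:R + C) * q + 2 * C * q ^+ 2) * q ^+ 2.
  by rewrite -natr1; ring.
rewrite lerD2l ler_wpM2r//.
have NC0 : 0 <= 2 * N%:R + C by rewrite addr_ge0 ?mulr_ge0.
have a1 : (2 * N%:R + C) * q <= (2 * N%:R + C) * (1 / 2) by exact: ler_wpM2l.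
have h1 : 0 <= 1 / 2 - q by lra.
have h2 : 0 <= 1 / 2 + q by lra.
have q4 : q ^+ 2 <= 1 / 4 by have := mulr_ge0 h1 h2; rewrite expr2; lra.
have a2 : 2 * C * q ^+ 2 <= 2 * C * (1 / 4) by apply: ler_wpM2l => //; rewrite mulr_ge0.
by move: a1 a2; lra.
Qed.

Section at_maximum.
Variables (alpha : R) (u : 'rV[R]_n -> R) (x0 : 'rV[R]_n).
Hypotheses (a0 : 0 < alpha) (a2 : alpha < 2) (wu : weighted_fin alpha u).
Hypothesis x01 : enorm x0 < 1.
Local Notation P x := (1 - enorm x ^+ 2).
Hypothesis max0 : forall y, enorm y <= 1 -> P y ^+ n * u y <= P x0 ^+ n * u x0.

Let u0 y : 0 <= u y. Proof. by have [] := wu. Qed.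
Let mu' : measurable_fun setT u. Proof. by have [] := wu. Qed.
Let P0 : 0 < P x0.
Proof. by rewrite subr_gt0 exprn_ilt1 ?enorm_ge0. Qed.
Let P1 : P x0 <= 1.
Proof. by rewrite lerBlDr lerDl sqr_ge0. Qed.

Variable C : R.
Hypotheses (C0 : 0 <= C)
  (HC : forall q : R, `|q| <= 1 / 2 -> (1 - q)^-1 ^+ n <= 1 + n%:R * q + C * q ^+ 2).
Local Notation B := (2 * n%:R + 18 * C).

Let B0 : 0 <= B. Proof. by rewrite addr_ge0// mulr_ge0. Qed.

(** Since P(x0 + z) = P(x0) (1 - q), maximality of P^n u at x0 bounds u nearby by u(x0) (1 -
    q)^(-n). *)
Lemma max_point_le (z : 'rV[R]_n) (q : R) : q = (2 * edot x0 z + enorm z ^+ 2) / P x0 -> q < 1 ->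
  u (x0 + z) <= u x0 * (1 - q)^-1 ^+ n.
Proof.
move=> qE q1; have q10 : 0 < 1 - q by rewrite subr_gt0.
have PE : P (x0 + z) = P x0 * (1 - q).
  by rewrite qE enorm_sqrD; field; rewrite gt_eqF.
have Pz : 0 < P (x0 + z) by rewrite PE mulr_gt0.
have y1 : enorm (x0 + z) <= 1.
  rewrite leNgt; apply/negP => y1; move: Pz; rewrite subr_gt0 ltNge => /negP; apply.
  by rewrite exprn_ege1// ltW.
have := max0 y1; rewrite PE exprMn -mulrA ler_pM2l ?exprn_gt0// => L.
by rewrite exprVn ler_pdivlMr ?exprn_gt0// mulrC.
Qed.

Lemma max_second_difference (z : 'rV[R]_n) : enorm z <= P x0 / 8 ->
  u (x0 + z) + u (x0 - z) <= 2 * u x0 + B * u x0 / P x0 ^+ 2 * enorm z ^+ 2.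
Proof.
move=> zP; have z0 := enorm_ge0 z; have xz0 := enorm_ge0 x0.
have z1 : enorm z <= 1 by move: zP P1; lra.
pose q1 := (2 * edot x0 z + enorm z ^+ 2) / P x0.
pose q2 := (2 * edot x0 (- z) + enorm (- z) ^+ 2) / P x0.
have z2 : enorm z ^+ 2 <= enorm z by rewrite expr2 ler_piMr.
have ed : `|edot x0 z| <= enorm z.
  by apply: (le_trans (edot_abs_le x0 z)); rewrite ler_piMl// ltW.
have /andP[e1 e2] : - enorm z <= edot x0 z <= enorm z by rewrite -ler_norml.
have zP3 : 3 * enorm z / P x0 <= 1 / 2 by rewrite ler_pdivrMr//; move: zP; lra.
have sq := sqr_ge0 (enorm z).
have qb (q : R) : `|q * P x0| <= 3 * enorm z -> `|q| <= 3 * enorm z / P x0.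
  by rewrite normrM (gtr0_norm P0) ler_pdivlMr.
have Q1 : `|q1| <= 3 * enorm z / P x0.
  by apply: qb; rewrite /q1 divfK ?gt_eqF// ler_norml; apply/andP; split; lra.
have Q2 : `|q2| <= 3 * enorm z / P x0.
  by apply: qb; rewrite /q2 divfK ?gt_eqF// edotNr enormN ler_norml; apply/andP; split; lra.
have H (q : R) : `|q| <= 3 * enorm z / P x0 -> (1 - q)^-1 ^+ n <= 1 + n%:R * q + C * (3 * enorm z / P x0) ^+ 2.
  move=> hq; apply: (le_trans (HC (le_trans hq zP3))); rewrite lerD2l ler_wpM2l//.
  by rewrite -[q ^+ 2]real_normK ?num_real// lerXn2r ?nnegrE// (le_trans _ hq).
have q11 : q1 < 1 by move: Q1 zP3; rewrite ler_norml => /andP[]; lra.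
have q21 : q2 < 1 by move: Q2 zP3; rewrite ler_norml => /andP[]; lra.
have L1 := le_trans (max_point_le (erefl q1) q11) (ler_wpM2l (u0 x0) (H q1 Q1)).
have L2 := le_trans (max_point_le (erefl q2) q21) (ler_wpM2l (u0 x0) (H q2 Q2)).
apply: (le_trans (lerD L1 L2)).
have -> : u x0 * (1 + n%:R * q1 + C * (3 * enorm z / P x0) ^+ 2) +
   u x0 * (1 + n%:R * q2 + C * (3 * enorm z / P x0) ^+ 2) =
   2 * u x0 + u x0 * (2 * n%:R * (enorm z ^+ 2 / P x0) + 18 * C * (enorm z ^+ 2 / P x0 ^+ 2)).
  by rewrite /q1 /q2 edotNr enormN; field; rewrite gt_eqF.
rewrite lerD2l.
have -> : B * u x0 / P x0 ^+ 2 * enorm z ^+ 2 =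
   u x0 * (2 * n%:R * (enorm z ^+ 2 / P x0 ^+ 2) + 18 * C * (enorm z ^+ 2 / P x0 ^+ 2)) by ring.
rewrite ler_wpM2l// lerD2r ler_wpM2l// ?mulr_ge0// ler_wpM2l//.
rewrite lef_pV2 ?posrE ?exprn_gt0//.
by rewrite expr2 ler_piMl// ltW.
Qed.

(** Equivalently, L_eps u(x0) >= L_eta u(x0) minus a multiple of u(x0) P(x0)^(-2) eta^(2 - alpha),
    uniformly in eps: second differences serve |z| < eta and nothing is changed beyond. *)
Lemma max_tconv_le (eps eta : R) : 0 < eps -> eps <= eta -> eta <= P x0 / 8 ->
  2 * tconv alpha eps u x0 + 2 * u x0 * tmass m alpha eta <=
  2 * u x0 * tmass m alpha eps +
  B * u x0 / P x0 ^+ 2 * (n%:R * ball_vol R m * (eta `^ (2 - alpha) / (2 - alpha))) +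
  2 * tconv alpha eta u x0.
Proof.
move=> e0 ee eP; have eta0 : 0 < eta by exact: lt_le_trans ee.
have al2 : 0 < 2 - alpha by rewrite subr_gt0.
pose S z := u (x0 + z) + u (x0 - z).
have mS : measurable_fun setT S.
  by apply: measurable_funD; [exact: measurable_shift mu'|exact: measurable_shiftN mu'].
have S0 z : 0 <= S z by rewrite addr_ge0.
pose K := B * u x0 / P x0 ^+ 2.
have K0 : 0 <= K by apply: divr_ge0; [exact: mulr_ge0|exact: sqr_ge0].
pose near z : R := (enorm z <= eta)%R%:R * enorm z `^ ((2 - alpha) - n%:R).
have mn : measurable_fun setT near by rewrite /near; meas.
have n0 z : 0 <= near z by rewrite mulr_ge0// powR_ge0.
have c0 : 0 <= 2 * u x0 by rewrite mulr_ge0.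
have mt d := @measurable_tker R m alpha d.
have t0 d z := tker_ge0 alpha d z.
have mtS d : measurable_fun setT (fun z => tker alpha d z * S z) by exact: measurable_funM.
have tS0 d z : 0 <= tker alpha d z * S z by exact: mulr_ge0.
have mct d : measurable_fun setT (fun z => 2 * u x0 * tker alpha d z) by exact: measurable_funM.
have ct0 d z : 0 <= 2 * u x0 * tker alpha d z by exact: mulr_ge0.
have mKn : measurable_fun setT (fun z => K * near z) by exact: measurable_funM.
have Kn0 z : 0 <= K * near z by exact: mulr_ge0.
have L : (\int[mu]_z (tker alpha eps z * S z + 2 * u x0 * tker alpha eta z)%:E <=
    \int[mu]_z ((2 * u x0 * tker alpha eps z + K * near z) + tker alpha eta z * S z)%:E)%E.
  apply: ge0_le_integral_fin.
  - exact: measurable_funD.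
  - by apply: measurable_funD => //; exact: measurable_funD.
  - by move=> z; exact: addr_ge0.
  - move=> z; rewrite /tker /near; have r0 := rker_ge0 alpha z.
    case: (leP eta (enorm z)) => z1.
      have h := Kn0 z; rewrite /near in h; rewrite (le_trans ee z1) !mul1r.
      by move: h; move: (K * _) (rker alpha z) (S z) => k r v; lra.
    rewrite (ltW z1) !mul0r !mulr0 !addr0 mul1r.
    case: (leP eps (enorm z)) => z2; last by rewrite !mul0r mulr0 add0r mulr_ge0 ?powR_ge0.
    have z0 : 0 < enorm z by exact: lt_le_trans z2.
    rewrite mul1r; have := max_second_difference (le_trans (ltW z1) eP); rewrite -/K -/(S z).
    move=> /(ler_wpM2l r0)/le_trans; apply; rewrite le_eqVlt; apply/orP; left; apply/eqP.
    have -> : enorm z `^ (2 - alpha - n%:R) = enorm z ^+ 2 * rker alpha z.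
      rewrite /rker -(powR_mulrn 2 (ltW z0)) -powRD ?(gt_eqF z0) ?implybT//.
      by congr (_ `^ _); ring.
    by ring.
move: L; rewrite (ge0_integralD_fin _ (mtS eps) (mct eta) (tS0 eps) (ct0 eta)).
rewrite (ge0_integralD_fin _ (measurable_funD (mct eps) mKn) (mtS eta) (fun z => addr_ge0 (ct0 eps z) (Kn0 z)) (tS0 eta)).
rewrite (ge0_integralD_fin _ (mct eps) mKn (ct0 eps) Kn0).
rewrite !(ge0_integralZ_fin mu c0 (mt _) (t0 _)) (ge0_integralZ_fin mu K0 mn n0).
rewrite !integral_tker// !(tconv_symmetrize a0 x0 _ wu)//.
have J := @integral_enorm_0 R m eta (2 - alpha) al2.
move=> L; have {}L := le_trans L (leeD2r _ (leeD2l _ (lee_wpmul2l (_ : (0 <= K%:E)%E) J))).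
by have {}L := L K0; move: L; rewrite -!EFinM -!EFinD lee_fin.
Qed.

End at_maximum.

(** At the maximum point take eta = d P(x0). Then the near error is at most half of u(x0) times the
    kernel mass beyond eta, and the far convolution is at most a multiple of eta^(-n-alpha) times
    the weighted integral of u. Multiplying by eta^(n + alpha) leaves eta^n u(x0), that is d^n
    P(x0)^n u(x0) >= d^n u(0): hence the exponent n in the maximised function. *)
Lemma max_principle_ball alpha : 0 < alpha -> alpha < 2 -> exists2 C : R, 0 < C & forall u w (K : R),
  frac_pair alpha u w -> 0 <= K -> (forall x, enorm x <= 1 -> w x <= K) ->
  u 0 <= C * (K + weightavg alpha u 1).
Proof.
move=> a0 a2; have [C C0 HC] := exp_inv_oneminus_le n.
pose B := 2 * n%:R + 18 * C; have B0 : 0 <= B by rewrite addr_ge0// mulr_ge0.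
have al2 : 0 < 2 - alpha by rewrite subr_gt0.
(* 1/8 meets the constraint of [max_second_difference]; the other bound makes the near error at most
   half of the mass term. *)
pose d := Num.min (1 / 8) ((2 - alpha) / (alpha * (B + 1))).
have d0 : 0 < d by rewrite lt_min divr_gt0//= divr_gt0// mulr_gt0// ltr_wpDl.
have d8 : d <= 1 / 8 by rewrite /d ge_min lexx.
have dB : B / 2 * d ^+ 2 / (2 - alpha) <= (2 * alpha)^-1.
  have d2 : d ^+ 2 <= (2 - alpha) / (alpha * (B + 1)).
    apply: (@le_trans _ _ d); last by rewrite /d ge_min lexx orbT.
    by rewrite expr2 ler_piMl ?ltW//; lra.
  rewrite ler_pdivrMr//; apply: (le_trans (ler_wpM2l (_ : 0 <= B / 2) d2)); first exact: divr_ge0.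
  rewrite mulrA ler_pdivrMr ?mulr_gt0 ?ltr_wpDl//.
  have -> : (2 * alpha)^-1 * (2 - alpha) * (alpha * (B + 1)) = (B + 1) / 2 * (2 - alpha).
    by field; rewrite gt_eqF.
  by apply: ler_wpM2r; [exact: ltW|move: B0; lra].
have bv := @ball_vol_gt0 R m.
pose N := n%:R * ball_vol R m; have N0 : 0 < N by rewrite mulr_gt0.
pose A := 3 `^ (n%:R + alpha); have A0 : 1 <= A.
  have <- : (1 : R) `^ (n%:R + alpha) = 1 by rewrite powR1.
  by apply: ge0_ler_powR; rewrite ?nnegrE ?addr_ge0 ?(ltW a0)//; lra.
exists (2 * alpha / (N * d ^+ n) * A).
  by rewrite mulr_gt0 ?divr_gt0 ?mulr_gt0 ?exprn_gt0// (lt_le_trans ltr01).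
move=> u w K pr K0 wK; have [wu cu cw Luw] := pr; have [mu' u0 ufin] := wu.
pose P x : R := 1 - enorm x ^+ 2.
have cP : continuous P.
  move=> x; have FF : Filter (nbhs x) := nbhs_filter x.
  apply: (@cvgB _ _ _ (nbhs x) FF); first exact: cvg_cst.
  have ce := @continuous_enorm R n x.
  by rewrite expr2; apply: (cvg_trans _ (cvgM ce ce)).
have cPu : continuous (fun x => P x ^+ n * u x).
  apply: continuous_funM => //.
  suff H k : continuous (fun x => P x ^+ k) by exact: H.
  elim: k => [|k IH]; first by move=> x; exact: cst_continuous.
  by under eq_fun do rewrite exprS; exact: continuous_funM.
have [x0 xb xmax] : exists2 x0, enorm x0 <= 1 & forall y, enorm y <= 1 -> P y ^+ n * u y <= P x0 ^+ n * u x0.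
  have ne : @eball R n 1 !=set0 by exists 0; rewrite /eball/= enorm0.
  have [c cA cm] := @compact_EVT_max _ R _ _ ne (@compact_eball R m 1) (continuous_subspaceT cPu).
  by exists c; [exact: set_mem cA|move=> y y1; apply: cm; exact: mem_set].
have W0 := weightavg_ge0 alpha 1 u0.
have u00 : u 0 <= P x0 ^+ n * u x0.
  by have := xmax 0; rewrite /P enorm0 expr0n/= subr0 expr1n mul1r; apply.
have [x01|x01] := ltP (enorm x0) 1; last first.
  apply: (le_trans u00); have -> : P x0 = 0.
    by rewrite /P (_ : enorm x0 = 1) ?expr1n ?subrr//; apply/eqP; rewrite eq_le xb.
  rewrite expr0n/= mul0r !mulr_ge0 ?addr_ge0 ?invr_ge0 ?mulr_ge0 ?exprn_ge0 ?(ltW a0) ?(ltW d0) ?(ltW bv)//.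
  exact: le_trans A0.
have P0 : 0 < P x0 by rewrite subr_gt0 exprn_ilt1 ?enorm_ge0.
have P1 : P x0 <= 1 by rewrite lerBlDr lerDl sqr_ge0.
apply: (le_trans u00).
pose eta := d * P x0; have eta0 : 0 < eta by rewrite mulr_gt0.
have etaP : eta <= P x0 / 8 by rewrite /eta mulrC ler_wpM2l ?(ltW P0)//; lra.
have eta1 : eta <= 1 by move: etaP P1; lra.
have I1 : fine (\int[mu]_x (u x * weight alpha x)%:E) = weightavg alpha u 1.
  by rewrite /weightavg /Rintegral; apply: congr1; apply: eq_integral => x _; rewrite scale1r.
have key e : 0 < e -> N * eta ^+ n / (2 * alpha) * u x0 <= A * (K + weightavg alpha u 1) + A * e.
  move=> e0; have [d1 [d10 Hd]] := Luw 1 e ltr01 e0.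
  pose eps := Num.min (d1 / 2) eta.
  have eps0 : 0 < eps by rewrite lt_min eta0 divr_gt0.
  have eps_eta : eps <= eta by rewrite /eps ge_min lexx orbT.
  have eps_d : eps < d1 by rewrite gt_min; apply/orP; left; rewrite ltr_pdivrMr//; lra.
  have H1 := Hd eps x0 eps0 eps_d xb; have H2 := wK x0 xb.
  have H3 := max_tconv_le a0 a2 wu x01 xmax C0 HC eps0 eps_eta etaP.
  have H4 := tconv_bound (ltW a0) eta0 wu xb.
  rewrite I1 in H4.
  have E1 : B * u x0 / P x0 ^+ 2 * (N * (eta `^ (2 - alpha) / (2 - alpha))) =
     2 * (u x0 * (N * eta `^ (- alpha)) * (B / 2 * d ^+ 2 / (2 - alpha))).
    rewrite powRD ?(gt_eqF eta0) ?implybT// (powR_mulrn 2 (ltW eta0)) /eta.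
    move: (_ `^ _) => Y; field.
    by rewrite !gt_eqF.
  have E2 : tmass m alpha eta = N * eta `^ (- alpha) / alpha by rewrite /tmass mulrA.
  have Y0 := powR_ge0 eta (- alpha).
  have H5 : u x0 * (N * eta `^ (- alpha)) * (B / 2 * d ^+ 2 / (2 - alpha)) <=
      u x0 * (N * eta `^ (- alpha)) * (2 * alpha)^-1.
    by apply: ler_wpM2l => //; rewrite !mulr_ge0// ltW.
  have H6 : u x0 * (N * eta `^ (- alpha)) * (2 * alpha)^-1 <= K + e +
      (1 + (1 + 1) / eta) `^ (n%:R + alpha) * weightavg alpha u 1.
    move: H3; rewrite -/B -/(P x0) -/N E1 E2.
    have -> : 2 * u x0 * (N * eta `^ (- alpha) / alpha) = 4 * (u x0 * (N * eta `^ (- alpha)) * (2 * alpha)^-1).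
      by field; rewrite gt_eqF.
    move: H1 H2 H4 H5; rewrite ler_norml => /andP[_].
    by move: (u x0 * _ * _^-1) (u x0 * _ * (_ / _)) (tconv alpha eta u x0) (tconv alpha eps u x0)
      (_ `^ _ * _) (tmass m alpha eps) => X1 X2 X3 X4 X5 X6; lra.
  have eta_p : 0 < eta `^ (n%:R + alpha) by exact: powR_gt0.
  have H7 := ler_wpM2l (ltW eta_p) H6.
  have E3 : eta `^ (n%:R + alpha) * (u x0 * (N * eta `^ (- alpha)) * (2 * alpha)^-1) =
      N * eta ^+ n / (2 * alpha) * u x0.
    have -> : eta ^+ n = eta `^ (n%:R + alpha) * eta `^ (- alpha).
      by rewrite -powRD ?(gt_eqF eta0) ?implybT// -(powR_mulrn n (ltW eta0)); congr (_ `^ _); ring.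
    by ring.
  rewrite E3 mulrDr mulrA -powRM ?(ltW eta0)// in H7; last by rewrite addr_ge0// divr_ge0// ltW.
  have E4 : eta * (1 + (1 + 1) / eta) = eta + 2 by field; rewrite gt_eqF.
  rewrite E4 in H7; apply: (le_trans H7).
  have g0 : 0 <= n%:R + alpha by rewrite addr_ge0// ltW.
  have L1 : eta `^ (n%:R + alpha) * (K + e) <= A * (K + e).
    apply: ler_wpM2r; first by rewrite addr_ge0// ltW.
    by apply: ge0_ler_powR; rewrite ?nnegrE ?(ltW eta0)//; lra.
  have L2 : (eta + 2) `^ (n%:R + alpha) * weightavg alpha u 1 <= A * weightavg alpha u 1.
    apply: ler_wpM2r => //; have eta2 : 0 <= eta + 2 by rewrite addr_ge0// ltW.
    have eta3 : eta + 2 <= 3 by move: eta1; lra.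
    by apply: ge0_ler_powR => //; rewrite nnegrE.
  by move: L1 L2; lra.
have {}key : N * eta ^+ n / (2 * alpha) * u x0 <= A * (K + weightavg alpha u 1).
  apply/ler_addgt0Pr => e e0; have A1 : 0 < A by exact: lt_le_trans A0.
  have := key (e / A); rewrite divr_gt0// => /(_ isT).
  by rewrite mulrC [A * (e / A)]mulrC divfK ?gt_eqF// [u x0 * _]mulrC.
have D0 : 0 < N * d ^+ n / (2 * alpha) by rewrite divr_gt0 ?mulr_gt0 ?exprn_gt0.
rewrite -(ler_pM2l D0).
have -> : N * d ^+ n / (2 * alpha) * (P x0 ^+ n * u x0) = N * eta ^+ n / (2 * alpha) * u x0.
  by rewrite /eta exprMn; ring.
apply: (le_trans key); rewrite le_eqVlt; apply/orP; left; apply/eqP.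
have dn0 : 0 < d ^+ n by exact: exprn_gt0.
by field; rewrite !gt_eqF.
Qed.

End max_principle.

(** * Weights that concentrate on a sphere *)

Section spherical_means.
Context {R : realType} {m : nat}.
Local Notation n := m.+1.
Local Notation mu := (lebesgue_rV R n).
Local Notation pos y := (Num.max y 0).
Implicit Types (x y z : 'rV[R]_n) (u f w : 'rV[R]_n -> R).

Lemma radial_scale f (c : R) x : 0 <= c -> radial (fun y => f (c *: y)) x = radial f (c *: x).
Proof.
move=> c0; rewrite /radial; apply: congr1; apply: eq_Rintegral => y _.
by rewrite scalerA enormZ (ger0_norm c0) mulrA.
Qed.

(** A dilate of [ballavg] with the radius of the support as a parameter, so that differences in a
    can be formed. *)
Definition capavg (N : nat) (a : R) f (r : R) : R :=
  \int[mu]_x (pos (a - enorm x ^+ 2) ^+ N * f (r *: x)).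

Lemma pos_ge0 (y : R) : 0 <= pos y. Proof. by rewrite le_max lexx orbT. Qed.

Lemma measurable_cap (N : nat) (a : R) :
  measurable_fun setT (fun x : 'rV[R]_n => pos (a - enorm x ^+ 2) ^+ N).
Proof. by apply: measurable_funX; apply: measurable_maxr => //; meas. Qed.

Lemma cap_test (N : nat) (a : R) : 0 < a -> a <= 4 ->
  test_fun 2 (fun x : 'rV[R]_n => pos (a - enorm x ^+ 2) ^+ N.+1).
Proof.
move=> a0 a4; split.
- exact: measurable_cap.
- by move=> x; rewrite exprn_ge0// pos_ge0.
- move=> x x2; have : 4 <= enorm x ^+ 2.
    by have := ler_pM (ler0n R 2) (ler0n R 2) (ltW x2) (ltW x2); rewrite expr2; lra.
  move=> x4; rewrite (_ : pos _ = 0) ?expr0n//; apply/max_idPr; lra.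
- exists (a ^+ N.+1) => x; rewrite lerXn2r ?nnegrE ?pos_ge0 ?(ltW a0)//.
  by rewrite ge_max (ltW a0) andbT lerBlDr lerDl sqr_ge0.
Qed.

Lemma cap_integrable (N : nat) (a : R) f (r : R) : 0 < a -> a <= 4 -> continuous f ->
  mu.-integrable setT (EFin \o (fun x => pos (a - enorm x ^+ 2) ^+ N.+1 * f (r *: x))).
Proof.
by move=> a0 a4 cf; apply: test_fun_integrable (cap_test N a0 a4) _; exact: continuous_scale_rV.
Qed.

Lemma capavgE (N : nat) (a : R) f (r : R) : 0 < a -> measurable_fun setT f -> (forall x, 0 <= f x) ->
  capavg N a f r = a ^+ N * Num.sqrt a ^+ n * ballavg N f (Num.sqrt a * r).
Proof.
move=> a0 mf f0; have s0 : 0 < Num.sqrt a by rewrite sqrtr_gt0.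
have := @Rintegral_scale R m (fun x => pos (a - enorm x ^+ 2) ^+ N * f (r *: x)) _ s0.
move=> /(_ _ _) E; rewrite /capavg.
have {}E : \int[mu]_x (pos (a - enorm (Num.sqrt a *: x) ^+ 2) ^+ N * f (r *: (Num.sqrt a *: x))) =
   (Num.sqrt a ^+ n)^-1 * \int[mu]_x (pos (a - enorm x ^+ 2) ^+ N * f (r *: x)).
  apply: E.
  - apply: measurable_funM; first exact: measurable_cap.
    by apply: (measurableT_comp mf); meas.
  - by move=> x; rewrite mulr_ge0// exprn_ge0// pos_ge0.
have -> : \int[mu]_x (pos (a - enorm x ^+ 2) ^+ N * f (r *: x)) = Num.sqrt a ^+ n *
   \int[mu]_x (pos (a - enorm (Num.sqrt a *: x) ^+ 2) ^+ N * f (r *: (Num.sqrt a *: x))).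
  by rewrite E mulrA mulfV ?mul1r// expf_neq0// gt_eqF.
rewrite [a ^+ N * _]mulrC -mulrA; apply: congr1.
have -> : ballavg N f (Num.sqrt a * r) = (a ^+ N)^-1 *
    \int[mu]_x (pos (a - enorm (Num.sqrt a *: x) ^+ 2) ^+ N * f (r *: (Num.sqrt a *: x))); last first.
  by rewrite mulrA mulfV ?mul1r// expf_neq0// gt_eqF.
rewrite /ballavg /Rintegral.
have aN : 0 < (a ^+ N)^-1 by rewrite invr_gt0 exprn_gt0.
have EE x : (ppart N x * f ((Num.sqrt a * r) *: x))%R =
    (a ^+ N)^-1 * (pos (a - enorm (Num.sqrt a *: x) ^+ 2) ^+ N * f (r *: (Num.sqrt a *: x))).
  rewrite scalerA [r * _]mulrC mulrA; congr (_ * _).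
  rewrite enormZ (gtr0_norm s0) exprMn sqr_sqrtr ?(ltW a0)//.
  have -> : a - a * enorm x ^+ 2 = a * (1 - enorm x ^+ 2) by ring.
  have -> : pos (a * (1 - enorm x ^+ 2)) = a * pos (1 - enorm x ^+ 2).
    by rewrite -{2}(mulr0 a) maxr_pMr ?mulr0// ltW.
  by rewrite exprMn mulrA mulVf ?mul1r// expf_neq0// gt_eqF.
under eq_integral do rewrite EE.
rewrite ge0_integralZ_fin ?(ltW aN)//.
- set I := (\int[mu]_x _)%E.
  have : (0 <= I)%E by apply: integral_fin_ge0 => x; rewrite mulr_ge0// exprn_ge0// pos_ge0.
  by case: I => [v| |] //= _; rewrite gt0_muley ?lte_fin//= mulr0.
- apply: measurable_funM.
    apply: measurable_funX; apply: measurable_maxr => //; meas.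
  by apply: (measurableT_comp mf); meas.
- by move=> x; rewrite mulr_ge0// exprn_ge0// pos_ge0.
Qed.

Section superharmonic.
Variable w : 'rV[R]_n -> R.
Hypotheses (sw : smooth 2 w) (w0 : forall x, 0 <= w x) (Lw0 : forall x, 0 <= nlap w x).
Local Notation g := (nlap w).

Let cw : continuous w. Proof. exact: smooth_continuous sw. Qed.
Let cg : continuous g. Proof. by apply: (@smooth_continuous _ _ 0); exact: smooth_nlap. Qed.
Let mw := continuous_measurable_rV cw.
Let mg := continuous_measurable_rV cg.

Lemma is_derive_capavg (a r : R) : 0 < a ->
  is_derive r (1 : R) (capavg 1 a w) (- (r / 4) * capavg 2 a g r).
Proof.
move=> a0; have s0 : 0 <= Num.sqrt a := sqrtr_ge0 a.
rewrite (_ : capavg 1 a w = fun r => a ^+ 1 * Num.sqrt a ^+ n * ballavg 1 w (Num.sqrt a * r)); last first.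
  by apply/funext => t; exact: capavgE.
have D1 : is_derive r (1 : R) (fun t : R => Num.sqrt a * t) (Num.sqrt a).
  by have := is_deriveZ (Num.sqrt a) (is_derive_id r (1 : R)); rewrite /GRing.scale/= mulr1.
have D2 := is_derive1_comp (is_derive_ballavg 0 (Num.sqrt a * r) sw) D1.
have := is_deriveZ (a ^+ 1 * Num.sqrt a ^+ n) D2.
rewrite [X in is_derive _ _ _ X -> _](_ : _ = - (r / 4) * capavg 2 a g r)//.
rewrite (capavgE 2 r a0 mg Lw0) /GRing.scale/=.
have E : Num.sqrt a * Num.sqrt a = a by rewrite -expr2 sqr_sqrtr// ltW.
transitivity (- (r / 4) * (a ^+ 1 * (Num.sqrt a * Num.sqrt a) * Num.sqrt a ^+ n * ballavg 2 g (Num.sqrt a * r))).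
  by move: (_ ^+ n) (ballavg _ _ _) => X Y; field.
by rewrite E -exprSr.
Qed.

(** A second difference in a of (a - |x|^2)_+ at a = 1: a tent in the variable |x|^2, supported
    where it differs from 1 by at most h, yet a combination of weights whose radial derivatives are
    known. *)
Definition hat (h : R) x : R :=
  pos (1 + h - enorm x ^+ 2) - 2 * pos (1 - enorm x ^+ 2) + pos (1 - h - enorm x ^+ 2).

(** Differentiation in r replaces (a - t)_+ by (a - t)_+^2, w by - Laplacian w >= 0, and brings a
    factor - r/4. The function (a - t)_+^2 is convex in a, so its second difference is non-negative
    and the derivative is at most 0. *)
Lemma hat_integral_nonincreasing (h r1 r2 : R) : 0 < h -> h < 1 -> 0 <= r1 -> r1 <= r2 ->
  \int[mu]_x (hat h x * w (r2 *: x)) <= \int[mu]_x (hat h x * w (r1 *: x)).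
Proof.
move=> h0 h1.
have a1 : 0 < 1 + h by lra.
have a3 : 0 < 1 - h by lra.
have b1 : 1 + h <= 4 by lra.
have b2 : 1 <= 4 :> R by lra.
have b3 : 1 - h <= 4 by lra.
have E r : \int[mu]_x (hat h x * w (r *: x)) =
    capavg 1 (1 + h) w r - 2 * capavg 1 1 w r + capavg 1 (1 - h) w r.
  have i1 := cap_integrable 0 r a1 b1 cw.
  have i2 := cap_integrable 0 r ltr01 b2 cw.
  have i3 := cap_integrable 0 r a3 b3 cw.
  have i2' := integrableZl measurableT 2 i2.
  have i12 := integrableB measurableT i1 i2'.
  rewrite /capavg -(RintegralZl 2 measurableT i2) -(RintegralB measurableT i1 i2') -(RintegralD measurableT i12 i3).
  by apply: eq_Rintegral => x _; rewrite /hat !expr1; ring.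
have D r : is_derive r (1 : R) (fun r => \int[mu]_x (hat h x * w (r *: x)))
    (- (r / 4) * capavg 2 (1 + h) g r - 2 * (- (r / 4) * capavg 2 1 g r) + - (r / 4) * capavg 2 (1 - h) g r).
  rewrite (_ : (fun r => _) = (fun r => capavg 1 (1 + h) w r - 2 * capavg 1 1 w r + capavg 1 (1 - h) w r)); last first.
    by apply/funext => t; exact: E.
  have := is_deriveD (is_deriveB (is_derive_capavg r a1) (is_deriveZ 2 (is_derive_capavg r ltr01))) (is_derive_capavg r a3).
  by [].
apply: (derive_le_nonincreasing (a := 0) (fun r _ => D r)) => r r0.
have i1 := cap_integrable 1 r a1 b1 cg.
have i2 := cap_integrable 1 r ltr01 b2 cg.
have i3 := cap_integrable 1 r a3 b3 cg.
have i2' := integrableZl measurableT 2 i2.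
have i13 := integrableD measurableT i1 i3.
have L : 2 * capavg 2 1 g r <= capavg 2 (1 + h) g r + capavg 2 (1 - h) g r.
  rewrite /capavg -(RintegralZl 2 measurableT i2) -(RintegralD measurableT i1 i3).
  apply: le_Rintegral => //.
  move=> x _; rewrite mulrA -mulrDl ler_wpM2r//.
  move: (enorm x ^+ 2) => s; rewrite !expr2.
  have c1 := pos_ge0 (1 + h - s); have c3 := pos_ge0 (1 - h - s).
  have d1 : 1 + h - s <= pos (1 + h - s) by rewrite le_max lexx.
  have d3 : 1 - h - s <= pos (1 - h - s) by rewrite le_max lexx.
  have [s1|s1] := leP (1 - s) 0.
    by rewrite mulr0 mulr0 addr_ge0// mulr_ge0.
  have e1 : (1 + h - s) * (1 + h - s) <= pos (1 + h - s) * pos (1 + h - s) by apply: ler_pM => //; lra.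
  have [s3|s3] := leP 0 (1 - h - s).
    have e3 : (1 - h - s) * (1 - h - s) <= pos (1 - h - s) * pos (1 - h - s) by apply: ler_pM.
    by have := sqr_ge0 h; rewrite expr2; move: e1 e3; lra.
  have e3 : 0 <= pos (1 - h - s) * pos (1 - h - s) by rewrite mulr_ge0.
  have e4 : (1 - s) * (1 - s) <= (1 - s) * h by apply: ler_wpM2l; lra.
  have e5 : 0 <= (1 - s) * (1 - s) by rewrite mulr_ge0// ltW.
  by have := sqr_ge0 h; rewrite expr2; move: e1 e4 e5; lra.
have r4 : 0 <= r / 4 by rewrite divr_ge0.
have := ler_wpM2l r4 L; lra.
Qed.

End superharmonic.
End spherical_means.

Section local_average.
Context {R : realType} {m : nat}.
Local Notation n := m.+1.
Local Notation mu := (lebesgue_rV R n).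
Local Notation pos y := (Num.max y 0).
Local Notation e0 := (delta_mx ord0 ord0 : 'rV[R]_n).
Implicit Types (x y z : 'rV[R]_n) (u f w : 'rV[R]_n -> R).

Lemma hat_ge0 (h : R) x : 0 < h -> 0 <= hat h x.
Proof.
move=> h0; rewrite /hat; move: (enorm x ^+ 2) => s.
have c1 := pos_ge0 (1 + h - s); have c3 := pos_ge0 (1 - h - s).
have d1 : 1 + h - s <= pos (1 + h - s) by rewrite le_max lexx.
have d3 : 1 - h - s <= pos (1 - h - s) by rewrite le_max lexx.
by have [s1|s1] := leP (1 - s) 0; lra.
Qed.

Lemma hat_out (h : R) x : 0 < h -> h < `|enorm x ^+ 2 - 1| -> hat h x = 0.
Proof.
move=> h0; rewrite /hat; move: (enorm x ^+ 2) => s.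
have [s1|s1] := leP 0 (s - 1); rewrite ?(ger0_norm s1) ?(ltr0_norm s1) => hs.
  have -> : pos (1 + h - s) = 0 by apply/max_idPr; lra.
  have -> : pos (1 - s) = 0 by apply/max_idPr; lra.
  have -> : pos (1 - h - s) = 0 by apply/max_idPr; lra.
  by rewrite mulr0 subr0 addr0.
have -> : pos (1 + h - s) = 1 + h - s by apply/max_idPl; lra.
have -> : pos (1 - s) = 1 - s by apply/max_idPl; lra.
have -> : pos (1 - h - s) = 1 - h - s by apply/max_idPl; lra.
by ring.
Qed.

Lemma hat_near (h : R) x : 0 < h -> `|enorm x ^+ 2 - 1| <= h / 2 -> h / 2 <= hat h x.
Proof.
move=> h0; rewrite /hat; move: (enorm x ^+ 2) => s; rewrite ler_norml => /andP[h1 h2].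
have -> : pos (1 + h - s) = 1 + h - s by apply/max_idPl; lra.
have c3 := pos_ge0 (1 - h - s).
by have [s1|s1] := leP (1 - s) 0; lra.
Qed.

Lemma measurable_hat (h : R) : measurable_fun setT (fun x : 'rV[R]_n => hat h x).
Proof.
have mc a := @measurable_cap R m 1 a.
under eq_fun do rewrite /hat -[pos (1 + h - _)]expr1 -[pos (1 - enorm _ ^+ 2)]expr1 -[pos (1 - h - _)]expr1.
apply: measurable_funD => //; apply: measurable_funB => //.
exact: measurable_funM.
Qed.

Lemma hat_test (h : R) : 0 < h -> h <= 1 -> test_fun 2 (fun x : 'rV[R]_n => hat h x).
Proof.
move=> h0 h1; split.
- exact: measurable_hat.
- by move=> x; exact: hat_ge0.
- move=> x x2; apply: hat_out => //.
  have x4 : 4 <= enorm x ^+ 2.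
    by have := ler_pM (ler0n R 2) (ler0n R 2) (ltW x2) (ltW x2); rewrite expr2; lra.
  by rewrite ger0_norm; lra.
- exists 4 => x; rewrite /hat; have s0 := sqr_ge0 (enorm x); move: (enorm x ^+ 2) s0 => s s0.
  have c2 := pos_ge0 (1 - s).
  have d1 : pos (1 + h - s) <= 2 by rewrite ge_max; apply/andP; split; lra.
  have d3 : pos (1 - h - s) <= 1 by rewrite ge_max; apply/andP; split; lra.
  by lra.
Qed.

Lemma integral_hat_gt0 (h : R) : 0 < h -> h < 1 ->
  (0 < \int[mu]_x (hat h x)%:E)%E.
Proof.
move=> h0 h1; have h80 : 0 < h / 8 by rewrite divr_gt0.
have mi : measurable_fun setT (fun x : 'rV[R]_n => (enorm x <= h / 8)%R%:R : R) by meas.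
have mi' : measurable_fun setT (fun x : 'rV[R]_n => (enorm (x - e0) <= h / 8)%R%:R : R).
  have : measurable_fun setT (fun x : 'rV[R]_n => (enorm (x + (- e0)) <= h / 8)%R%:R : R) by meas.
  by [].
have I : (\int[mu]_x ((enorm (x - e0)%R <= h / 8)%R%:R)%:E = ((h / 8) ^+ n * ball_vol R m)%:E)%E.
  by rewrite (ge0_integral_shift_fin (- e0) mi)// integral_eball lebesgue_eball.
apply: (@lt_le_trans _ _ (\int[mu]_x (h / 2 * (enorm (x - e0)%R <= h / 8)%R%:R)%:E)%E).
  rewrite ge0_integralZ_fin//; last by rewrite divr_ge0// ltW.
  by rewrite I -EFinM lte_fin !mulr_gt0 ?exprn_gt0 ?divr_gt0 ?ball_vol_gt0.
apply: ge0_le_integral_fin.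
- exact: measurable_funM.
- exact: measurable_hat.
- by move=> x; rewrite mulr_ge0// divr_ge0// ltW.
- move=> x; case: (leP (enorm (x - e0)) (h / 8)) => xh; last by rewrite mulr0; exact: hat_ge0.
  rewrite mulr1; apply: hat_near => //.
  have e1 : enorm e0 = 1 by exact: enorm_delta.
  have := enorm_dist_le x e0; rewrite e1 => /le_trans/(_ xh); rewrite ler_norml => /andP[l1 l2].
  have -> : enorm x ^+ 2 - 1 = (enorm x - 1) * (enorm x + 1) by ring.
  rewrite normrM; have b1 : `|enorm x - 1| <= h / 8 by rewrite ler_norml; apply/andP; split.
  have b2 : `|enorm x + 1| <= 3 by rewrite ler_norml; apply/andP; split; lra.
  by apply: (le_trans (ler_pM (normr_ge0 _) (normr_ge0 _) b1 b2)); lra.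
Qed.

Lemma hat_integral_radial f (h r : R) : 0 < h -> 0 <= r -> continuous f -> (forall x, 0 <= f x) ->
  \int[mu]_x (hat h x * f (r *: x)) = \int[mu]_x (hat h x * radial f (r *: x)).
Proof.
move=> h0 r0 cf f0.
pose k (t : R) := Num.max (pos (1 + h - t ^+ 2) - 2 * pos (1 - t ^+ 2) + pos (1 - h - t ^+ 2)) 0.
have kE x : k (enorm x) = hat h x by apply/max_idPl; exact: hat_ge0.
have mk : measurable_fun setT k.
  apply: measurable_maxr => //; apply: measurable_funD; last by apply: measurable_maxr => //; meas.
  apply: measurable_funB; first by apply: measurable_maxr => //; meas.
  by apply: measurable_funM => //; apply: measurable_maxr => //; meas.
have k0 t : 0 <= k t by rewrite le_max lexx orbT.
have cfr : continuous (fun x => f (r *: x)) by exact: continuous_scale_rV.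
have E := integral_radial_weight cfr (fun x => f0 (r *: x)) mk k0.
rewrite /Rintegral; apply: congr1.
transitivity (\int[mu]_x (k (enorm x) * f (r *: x))%:E)%E.
  by apply: eq_integral => x _; rewrite kE.
by rewrite -E; apply: eq_integral => x _; rewrite kE radial_scale.
Qed.

(** The integrals of w and of its spherical mean against [hat] agree. If the mean were larger on the
    outer sphere, by continuity a thin enough hat would keep the two integrals at least a third of
    the gap apart, against [hat_integral_nonincreasing]. *)
Lemma radial_nonincreasing w : smooth 2 w -> (forall x, 0 <= w x) -> (forall x, 0 <= nlap w x) ->
  forall x y, enorm x <= enorm y -> radial w y <= radial w x.
Proof.
move=> sw w0 Lw0 x y xy; have cw : continuous w := smooth_continuous sw.
rewrite leNgt; apply/negP => lt.
pose r1 := enorm x; pose r2 := enorm y.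
have r10 : 0 <= r1 := enorm_ge0 x.
have r20 : 0 <= r2 := enorm_ge0 y.
pose v := radial w; have cv : continuous v := continuous_radial cw.
have v0 z : 0 <= v z by exact: radial_ge0.
have vW : v = radial w by [].
pose gap := (v y - v x) / 3.
have gap0 : 0 < gap by rewrite divr_gt0// subr_gt0.
have E r z : 0 <= r -> v (r *: z) = v ((r * enorm z) *: e0).
  by move=> r0; apply: eq_radial; rewrite !enormZ enorm_delta mulr1 !ger0_norm ?mulr_ge0 ?enorm_ge0.
have cr r : continuous (fun t : R => v ((r * t) *: e0)).
  move=> t; apply: (continuous_comp (f := fun t : R => (r * t) *: e0) (g := v)); last exact: cv.
  have FF : Filter (nbhs t) := nbhs_filter t.
  by apply: (@cvgZr_tmp _ _ _ _ FF); exact: (@mulrl_continuous R r t).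
have vr z z' : enorm z = enorm z' -> v z = v z' by exact: eq_radial.
rewrite -vW in lt; clearbody v.
have vx : v ((r1 * 1) *: e0) = v x by apply: vr; rewrite mulr1 enorm_delta0.
have vy : v ((r2 * 1) *: e0) = v y by apply: vr; rewrite mulr1 enorm_delta0.
have [d d0 Hd] : exists2 d : R, 0 < d & forall t : R, `|t - 1| <= d ->
    v ((r1 * t) *: e0) <= v x + gap /\ v y - gap <= v ((r2 * t) *: e0).
  have FF : Filter (nbhs (1 : R)) := nbhs_filter (1 : R).
  have /(@cvgrPdist_le _ _ _ _ FF)/(_ gap gap0) N1 := cr r1 1.
  have /(@cvgrPdist_le _ _ _ _ FF)/(_ gap gap0) N2 := cr r2 1.
  move: N1 N2; rewrite vx vy => N1 N2.
  pose A t := `|v x - v ((r1 * t) *: e0)| <= gap /\ `|v y - v ((r2 * t) *: e0)| <= gap.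
  have NN : nbhs (1 : R) A by exact: (filterI N1 N2).
  have [e /= ee H] := (iffLR (nbhs_ballP (1 : R) A)) NN.
  exists (e / 2) => [|t te]; first exact: divr_gt0.
  have tb : ball (1 : R) e t.
    by rewrite /ball/= distrC (le_lt_trans te)// ltr_pdivrMr// ltr_pMr// ltrDl ltr01.
  have [B1 B2] := H t tb.
  move: B1 B2; move: (v ((r1 * t) *: e0)) (v ((r2 * t) *: e0)) => v1 v2.
  by rewrite !ler_norml => /andP[B1 B2] /andP[B3 B4]; split; lra.
pose h := Num.min d (1 / 2).
have h0 : 0 < h by rewrite lt_min d0 divr_gt0.
have h1 : h < 1 by rewrite gt_min; apply/orP; right; lra.
have hd : h <= d by rewrite /h ge_min lexx.
have tp := hat_test h0 (ltW h1).
have J0 := integral_hat_gt0 h0 h1.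
have Jfin := test_fun_integral_fin tp.
have cc (c : R) : continuous (fun _ : 'rV[R]_n => c) by move=> z; exact: cst_continuous.
have ic (c : R) := test_fun_integrable tp (cc c).
pose J := \int[mu]_z hat h z.
have JE : (\int[mu]_z (hat h z)%:E = J%:E)%E.
  by rewrite fineK// ge0_fin_numE// ltW.
have JR : 0 < J by rewrite -lte_fin -JE.
have Jc (c : R) : \int[mu]_z (hat h z * c) = c * J.
  have ij : mu.-integrable setT (EFin \o (fun z : 'rV[R]_n => hat h z)).
    by have := ic 1; under eq_fun do rewrite mulr1.
  by rewrite /J -(RintegralZl c measurableT ij); apply: eq_Rintegral => z _; rewrite mulrC.
have iv r := test_fun_integrable tp (continuous_scale_rV (c := r) cv).
have shell z : hat h z != 0 -> `|enorm z - 1| <= d.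
  move=> hz; apply: (le_trans _ hd); rewrite leNgt; apply/negP => lz; move/eqP: hz; apply.
  apply: hat_out => //; apply: (lt_le_trans lz).
  have -> : enorm z ^+ 2 - 1 = (enorm z - 1) * (enorm z + 1) by ring.
  by rewrite normrM ler_peMr//; apply: le_trans (ler_norm _); rewrite lerDr enorm_ge0.
have L1 : \int[mu]_z (hat h z * v (r1 *: z)) <= (v x + gap) * J.
  rewrite -Jc; apply: le_Rintegral => // z _.
  have [->|hz] := eqVneq (hat h z) 0; first by rewrite !mul0r.
  by apply: ler_wpM2l; [exact: hat_ge0|rewrite E//; have [] := Hd _ (shell z hz)].
have L2 : (v y - gap) * J <= \int[mu]_z (hat h z * v (r2 *: z)).
  rewrite -Jc; apply: le_Rintegral => // z _.
  have [->|hz] := eqVneq (hat h z) 0; first by rewrite !mul0r.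
  by apply: ler_wpM2l; [exact: hat_ge0|rewrite E//; have [] := Hd _ (shell z hz)].
have := hat_integral_nonincreasing sw w0 Lw0 h0 h1 r10 xy.
rewrite (hat_integral_radial h0 r20 cw w0) (hat_integral_radial h0 r10 cw w0) -vW => L3.
have := le_trans L2 (le_trans L3 L1); rewrite ler_pM2r// leNgt => /negP; apply.
by move: gap0; rewrite /gap; lra.
Qed.

(** On |y| <= 1/2 the spherical mean of w is at least its value at any |x| >= 1, so that value is
    controlled by the ball mean of w, hence by duality by the weighted integral of u. *)
Lemma radial_le_weightavg alpha : 0 < alpha -> alpha < 2 -> exists2 C : R, 0 <= C & forall u w,
  frac_pair alpha u w -> smooth 2 w -> (forall x, 0 <= w x) -> (forall x, 0 <= nlap w x) ->
  forall (c : R) x, 0 < c -> 1 <= enorm x -> c `^ alpha * radial w (c *: x) <= C * weightavg alpha u c.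
Proof.
move=> a0 a2; have [A A0 HA] := @ballavg2_le_weightavg R m alpha a0 a2.
(* The weight [ppart 2] is at least (1 - 1/4)^2 on the ball of radius 1/2. *)
pose k : R := 9 / 16 * ((1 / 2) ^+ n * ball_vol R m).
have bv := @ball_vol_gt0 R m.
have k0 : 0 < k by rewrite !mulr_gt0 ?exprn_gt0// divr_gt0.
exists (A / k) => [|u w pr sw w0 Lw0 c x c0 x1]; first by rewrite divr_ge0// ltW.
have cw : continuous w := smooth_continuous sw.
have := HA u w pr c c0.
rewrite mulrAC ler_pdivlMr//; apply: le_trans; rewrite -mulrA ler_wpM2l ?powR_ge0//.
have cwc : continuous (fun y => w (c *: y)) by exact: continuous_scale_rV.
have wc0 y : 0 <= w (c *: y) by [].
pose h (t : R) := pos (1 - t ^+ 2) ^+ 2.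
have mh : measurable_fun setT h by apply: measurable_funX; apply: measurable_maxr => //; meas.
have h0 t : 0 <= h t by rewrite exprn_ge0// pos_ge0.
have E := integral_radial_weight cwc wc0 mh h0.
have ip : mu.-integrable setT (EFin \o (fun y => ppart 2 y * w (c *: y))) by exact: ppart_integrable.
rewrite -lee_fin /ballavg -(EFin_Rintegral ip) -E.
have mi : measurable_fun setT (fun y : 'rV[R]_n => (enorm y <= 1 / 2)%R%:R : R) by meas.
have r0 : 0 <= radial w (c *: x) by exact: radial_ge0.
have h20 : 0 < 1 / 2 :> R by rewrite divr_gt0.
have c9 : 0 <= radial w (c *: x) * (9 / 16) by rewrite mulr_ge0// divr_ge0.
rewrite /k [_ * (9 / 16 * _)]mulrA EFinM -lebesgue_eball// -integral_eball -ge0_integralZ_fin//.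
apply: ge0_le_integral_fin.
- exact: measurable_funM.
- apply: measurable_funM.
    by apply: (measurableT_comp mh); meas.
  exact: continuous_measurable_rV (continuous_radial cwc).
- by move=> y; rewrite mulr_ge0.
- move=> y; case: (leP (enorm y) (1 / 2)) => y1; last first.
    by rewrite mulr0 mulr_ge0// radial_ge0.
  rewrite mulr1 mulrC (radial_scale w y (ltW c0)); apply: ler_pM => //.
    have y2 : enorm y ^+ 2 <= 1 / 4.
      by have := ler_pM (enorm_ge0 y) (enorm_ge0 y) y1 y1; rewrite expr2; lra.
    have p3 : 3 / 4 <= pos (1 - enorm y ^+ 2) by rewrite le_max; apply/orP; left; lra.
    have q0 : 0 <= 3 / 4 :> R by rewrite divr_ge0.
    by have := ler_pM q0 q0 p3 p3; rewrite /h expr2; lra.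
  apply: radial_nonincreasing => //; rewrite !enormZ ler_wpM2l//.
  by apply: (le_trans y1); apply: le_trans x1; lra.
Qed.

(** The weight at y is compared with that at 2 x0 + y, where |2 x0| <= 4 gives the 5, then with that
    at x0 + y/2, where 1 + 1/2 gives the 3/2; 2^n is the Jacobian. *)
Lemma weightavg_affine alpha u x0 : 0 <= alpha -> weighted_fin alpha u -> enorm x0 <= 2 ->
  weightavg alpha (fun y => u (x0 + 2^-1 *: y)) 1 <=
  5 `^ (n%:R + alpha) * (3 / 2) `^ (n%:R + alpha) * 2 ^+ n * weightavg alpha u 1.
Proof.
move=> a0 wu x02; have [mu' u0 ufin] := wu; have mw := @measurable_weight R m alpha.
have w0 y := ltW (weight_gt0 alpha y).
have h20 : 0 < 2^-1 :> R by rewrite invr_gt0.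
have wi := weightavg_integrable a0 ltr01 wu.
pose F y := u y * weight alpha y.
have mF : measurable_fun setT F by exact: measurable_funM.
have F0 y : 0 <= F y by exact: mulr_ge0.
pose F2 y := F (2^-1 *: y + x0).
have IF : (\int[mu]_y (F2 y)%:E = (2 ^+ n * weightavg alpha u 1)%:E)%E.
  pose F1 y := F (y + x0).
  have mF1 : measurable_fun setT F1 by apply: (measurableT_comp mF); meas.
  rewrite (_ : (\int[mu]_y _)%E = \int[mu]_y (F1 (2^-1 *: y))%:E)%E//.
  have S1 := ge0_integral_scale_fin h20 mF1 (fun y => F0 (y + x0)).
  have S2 : (\int[mu]_y (F1 y)%:E = \int[mu]_y (F y)%:E)%E := ge0_integral_shift_fin x0 mF F0.
  rewrite S1 S2.
  rewrite EFinM -(EFin_Rintegral wi) exprVn invrK; congr (_ * _)%E.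
  by apply: eq_integral => y _; rewrite scale1r.
pose p := n%:R + alpha; have p0 : 0 <= p by rewrite addr_ge0.
have c50 : 0 <= 5 `^ p * (3 / 2) `^ p by rewrite mulr_ge0 ?powR_ge0.
have mF2 : measurable_fun setT F2 by apply: (measurableT_comp mF); meas.
have F20 y : 0 <= F2 y by exact: F0.
have IF2 : (\int[mu]_y (5 `^ p * (3 / 2) `^ p * F2 y)%:E =
    (5 `^ p * (3 / 2) `^ p * 2 ^+ n * weightavg alpha u 1)%:E)%E.
  by rewrite (ge0_integralZ_fin mu c50 mF2 F20) IF -EFinM mulrA.
have L : (\int[mu]_y (u (x0 + 2^-1 *: y) * weight alpha y)%:E <=
    \int[mu]_y (5 `^ p * (3 / 2) `^ p * F2 y)%:E)%E.
  apply: ge0_le_integral_fin.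
  - by apply: measurable_funM => //; apply: (measurableT_comp mu'); meas.
  - exact: measurable_funM.
  - by move=> y; rewrite mulr_ge0.
  - move=> y; rewrite /F2 /F [2^-1 *: y + x0]addrC mulrCA ler_wpM2l//.
    apply: (le_trans (weight_shift_le (2 *: x0) y a0)).
    have L1 : (1 + enorm (2 *: x0)) `^ p <= 5 `^ p.
      apply: ge0_ler_powR; rewrite ?nnegrE ?addr_ge0 ?enorm_ge0// enormZ ger0_norm//.
      by move: x02; lra.
    have L2 := weight_scale_le (2 *: x0 + y) a0 h20.
    have E2 : 2^-1 *: (2 *: x0 + y) = x0 + 2^-1 *: y.
      by rewrite scalerDr scalerA mulVf// scale1r.
    rewrite E2 (_ : 1 + 2^-1 = 3 / 2) in L2; last by field.
    by rewrite -mulrA; apply: ler_pM => //; exact: powR_ge0.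
rewrite IF2 in L; rewrite -lee_fin; apply: le_trans L; rewrite /weightavg /Rintegral.
have -> : (\int[mu]_y (u (x0 + 2^-1 *: (1 *: y)) * weight alpha y)%:E = \int[mu]_y (u (x0 + 2^-1 *: y) * weight alpha y)%:E)%E.
  by apply: eq_integral => y _; rewrite scale1r.
have : (0 <= \int[mu]_y (u (x0 + 2^-1 *: y) * weight alpha y)%:E)%E.
  by apply: integral_fin_ge0 => y; rewrite mulr_ge0.
by case: (\int[mu]_y _)%E.
Qed.

(** The spherical means of u and w form a pair. Recentred at x0 and contracted by 1/2, the unit ball
    becomes the ball of radius 1/2 about x0, which stays in |x| >= 1, where the mean of w is
    controlled; [max_principle_ball] then bounds the mean of u at x0. *)
Lemma spherical_average_le alpha : 0 < alpha -> alpha < 2 -> exists2 C : R, 0 < C & forall u w,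
  frac_pair alpha u w -> smooth 2 w -> (forall x, 0 <= w x) -> (forall x, 0 <= nlap w x) ->
  forall rho : R, 0 < rho -> spherical_average u rho <= C * weightavg alpha u rho.
Proof.
move=> a0 a2; have [A A0 HA] := @max_principle_ball R m alpha a0 a2.
have [B B0 HB] := radial_le_weightavg a0 a2.
pose D := 5 `^ (n%:R + alpha) * (3 / 2) `^ (n%:R + alpha) * 2 ^+ n.
have D0 : 0 <= D by rewrite !mulr_ge0 ?powR_ge0// exprn_ge0.
(* Chosen so that c0 |x0| = 1 with |x0| = 3/2: then x0 dilated by c lies on the sphere of radius
   rho. *)
pose c0 : R := 2 / 3; have c00 : 0 < c0 by rewrite divr_gt0.
pose S := (1 + c0) `^ (n%:R + alpha) * (c0 ^+ n)^-1.
have S0 : 0 < S by rewrite mulr_gt0 ?powR_gt0 ?invr_gt0 ?exprn_gt0// addr_gt0.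
exists (A * (B + D + 1) * S).
  by apply: mulr_gt0 => //; apply: mulr_gt0 => //; rewrite ltr_wpDl// addr_ge0.
move=> u w pr sw w0 Lw0 rho rho0; have [wu cu cw _] := pr; have [mu' u0 _] := wu.
pose c := c0 * rho; have c_gt0 : 0 < c by rewrite mulr_gt0.
have prs := frac_pair_scale (ltW a0) c_gt0 pr; have [wus cus cws _] := prs.
have [_ us0 _] := wus.
have ws0 x : 0 <= c `^ alpha * w (c *: x) by rewrite mulr_ge0 ?powR_ge0.
have prr := frac_pair_radial a0 prs ws0.
pose x0 : 'rV[R]_n := (3 / 2) *: e0.
have x0E : enorm x0 = 3 / 2 by rewrite enorm_delta0// divr_ge0.
have prt := frac_pair_shift x0 (ltW a0) prr.
have h20 : 0 < 2^-1 :> R by rewrite invr_gt0.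
have pr2 := frac_pair_scale (ltW a0) h20 prt.
have W0 : 0 <= weightavg alpha u c by exact: weightavg_ge0.
have wr := weighted_fin_radial cus wus.
have E1 : weightavg alpha (fun x => u (c *: x)) 1 = weightavg alpha u c.
  by rewrite /weightavg; apply: eq_Rintegral => x _; rewrite scale1r.
have cwc : continuous (fun x => w (c *: x)) by exact: continuous_scale_rV.
have := HA _ _ (B * weightavg alpha u c) pr2; rewrite mulr_ge0// => /(_ isT) H.
have {}H : radial (fun x => u (c *: x)) (x0 + 2^-1 *: 0) <=
    A * (B * weightavg alpha u c + weightavg alpha (fun x => radial (fun y => u (c *: y)) (x0 + 2^-1 *: x)) 1).
  apply: H => y y1.
  have L : 1 <= enorm (x0 + 2^-1 *: y).
    have := enorm_leD x0 (2^-1 *: y); rewrite x0E enormZ ger0_norm ?(ltW h20)//.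
    by move: y1; lra.
  have EQ : radial (fun x => c `^ alpha * w (c *: x)) (x0 + 2^-1 *: y) =
      c `^ alpha * radial w (c *: (x0 + 2^-1 *: y)).
    by rewrite (radialZ _ _ cwc) (radial_scale w _ (ltW c_gt0)).
  rewrite EQ; apply: (le_trans _ (HB u w pr sw w0 Lw0 c (x0 + 2^-1 *: y) c_gt0 L)).
  apply: ler_piMl; first by rewrite mulr_ge0 ?powR_ge0// radial_ge0.
  have p1 : (1 : R) `^ alpha = 1 by rewrite powR1.
  rewrite -[X in _ <= X]p1.
  have i21 : 2^-1 <= 1 :> R by lra.
  by apply: ge0_ler_powR => //; rewrite ?nnegrE ltW.
have x02 : enorm x0 <= 2 by rewrite x0E; lra.
have LD := weightavg_affine (ltW a0) wr x02.
rewrite (weightavg_radial alpha cus us0) E1 -/D in LD.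
have E3 : spherical_average u rho = radial (fun x => u (c *: x)) (x0 + 2^-1 *: 0).
  rewrite scaler0 addr0 radial_scale ?(ltW c_gt0)//.
  have E : enorm (c *: x0) = rho.
    by rewrite enormZ x0E (gtr0_norm c_gt0) /c /c0; field.
  by rewrite -{1}E spherical_average_radial// E.
have LS := weightavg_dilate (ltW a0) rho0 c00 wu; rewrite -/c -/S in LS.
rewrite E3; apply: (le_trans H); clearbody S; rewrite -!mulrA ler_pM2l//.
apply: (@le_trans _ _ ((B + D + 1) * weightavg alpha u c)).
  by move: LD W0; move: (weightavg alpha (fun x => radial _ _) 1) (weightavg alpha u c) => X Y; lra.
by apply: ler_wpM2l => //; rewrite !addr_ge0.
Qed.

End local_average.

(** The half of the theorem that concerns u. For the local bound, k >= 1 makes the first iterate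
    available, so that w is superharmonic. *)
Lemma solution_bounds (R : realType) (m k l : nat) (alpha beta a b p q : R) :
  0 < alpha -> alpha < 2 -> 0 < beta -> beta < 2 -> 0 <= a -> 0 <= b ->
  1 <= p -> 1 <= q -> 1 < p * q ->
  let gamma := (2 * k%:R + alpha + a + p * (2 * l%:R + beta + b)) / (p * q - 1) in
  exists2 M : R, 0 < M & forall u v : 'rV[R]_m.+1 -> R,
    nonneg_solution k l alpha beta a b p q u v ->
    (forall rho : R, 0 < rho ->
       (\int[@lebesgue_measure R]_(r in `]rho, +oo[)
          (rho `^ alpha / (r * (r ^+ 2 - rho ^+ 2) `^ (alpha / 2))
             * spherical_average u r)%:E <= (M * rho `^ (- gamma))%:E)%E) /\
    ((1 <= k)%N -> forall rho : R, 0 < rho -> spherical_average u rho <= M * rho `^ (- gamma)).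
Proof.
move=> a0 a2 b0 b2 aa bb p1 q1 pq gamma.
have [M M0 HM] := @solution_decay R m k l alpha beta a b p q a0 a2 b0 b2 aa bb p1 q1 pq.
have [C C0 HC] := @exterior_average_le R m alpha a0 a2.
have [D D0 HD] := @spherical_average_le R m alpha a0 a2.
exists ((C + D) * M) => [|u v sol]; first by rewrite mulr_gt0// addr_gt0.
have [w [pr sw iw W]] := HM u v sol.
have w0 x : 0 <= w x by exact: (iw 0%N (leq0n k)).
have CD (rho : R) c : 0 < rho -> 0 <= c -> c <= C + D ->
    c * weightavg alpha u rho <= (C + D) * M * rho `^ (- gamma).
  move=> rho0 c0 cCD; apply: (le_trans (ler_wpM2l c0 (W rho rho0))).
  by rewrite -mulrA ler_wpM2r// mulr_ge0 ?powR_ge0// ltW.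
split=> [rho rho0|k1 rho rho0].
  apply: (le_trans (HC u w pr w0 rho rho0)); rewrite lee_fin.
  by apply: CD => //; [exact: ltW|rewrite lerDl ltW].
apply: (le_trans (HD u w pr _ w0 _ rho rho0)).
- by apply: smooth_le sw; rewrite -[2%N]/(1.*2) leq_double.
- by move=> x; exact: (iw 1%N k1).
- by apply: CD => //; [exact: ltW|rewrite lerDr ltW].
Qed.

Theorem theorem1p1 (R : realType) (n : nat) (alpha beta : R) (k l : nat)
    (a b p q : R) :
  (1 <= n)%N ->
  0 < alpha -> alpha < Num.min 2 n%:R ->
  0 < beta -> beta < Num.min 2 n%:R ->
  0 <= a -> 0 <= b -> 0 <= p -> 0 <= q -> 1 <= p -> 1 <= q -> 1 < p * q ->
  exists M : R, 0 < M /\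
    forall u v : 'rV[R]_n -> R,
      nonneg_solution k l alpha beta a b p q u v ->
      (forall rho : R, 0 < rho ->
        (\int[@lebesgue_measure R]_(r in `]rho, +oo[)
            (rho `^ alpha / (r * (r ^+ 2 - rho ^+ 2) `^ (alpha / 2))
               * spherical_average u r)%:E
          <= (M * rho `^ (- ((2 * k%:R + alpha + a
                               + p * (2 * l%:R + beta + b))
                             / (p * q - 1))))%:E)%E /\
        (\int[@lebesgue_measure R]_(r in `]rho, +oo[)
            (rho `^ beta / (r * (r ^+ 2 - rho ^+ 2) `^ (beta / 2))
               * spherical_average v r)%:E
          <= (M * rho `^ (- ((2 * l%:R + beta + b
                               + q * (2 * k%:R + alpha + a))
                             / (p * q - 1))))%:E)%E) /\
      ((1 <= k)%N -> (1 <= l)%N ->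
        forall rho : R, 0 < rho ->
          spherical_average u rho
            <= M * rho `^ (- ((2 * k%:R + alpha + a
                                + p * (2 * l%:R + beta + b))
                              / (p * q - 1))) /\
          spherical_average v rho
            <= M * rho `^ (- ((2 * l%:R + beta + b
                                + q * (2 * k%:R + alpha + a))
                              / (p * q - 1)))).
Proof.
case: n => [//|m] _ a0; rewrite lt_min => /andP[a2 _] b0; rewrite lt_min => /andP[b2 _].
move=> aa bb _ _ p1 q1 pq; have qp : 1 < q * p by rewrite mulrC.
have [A A0 HA] := @solution_bounds R m k l alpha beta a b p q a0 a2 b0 b2 aa bb p1 q1 pq.
(* The system is invariant under exchanging u with v and all parameters accordingly; the common
   constant is the sum of the two. *)
have [B B0 HB] := @solution_bounds R m l k beta alpha b a q p b0 b2 a0 a2 bb aa q1 p1 qp.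
exists (A + B); split=> [|u v sol]; first exact: addr_gt0.
have [u1 u2] := HA u v sol; have [v1 v2] := HB v u (nonneg_solution_sym sol).
rewrite [q * p]mulrC in v1 v2.
have LA (rho c : R) : A * rho `^ c <= (A + B) * rho `^ c.
  by rewrite ler_wpM2r ?powR_ge0// lerDl ltW.
have LB (rho c : R) : B * rho `^ c <= (A + B) * rho `^ c.
  by rewrite ler_wpM2r ?powR_ge0// lerDr ltW.
split=> [rho rho0|k1 l1 rho rho0]; split.
- by apply: (le_trans (u1 rho rho0)); rewrite lee_fin.
- by apply: (le_trans (v1 rho rho0)); rewrite lee_fin.
- exact: le_trans (u2 k1 rho rho0) (LA _ _).
- exact: le_trans (v2 l1 rho rho0) (LB _ _).
Qed.
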